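(* Let $p\ge5$ be a prime and let $X$ be a finite connected 2-complex with Euler characteristic $\chi(X)\ge 1$. Let $b_2$ be the rank of $H_2(X;\mathbb Z)$ and $t_1$ the order of the torsion subgroup of $H_1(X;\mathbb Z)$. Then the class-0 $SL(2)$ Q-invariant $Z_Q(X)\in\mathbb Z/p\mathbb Z$ is $0$ if $b_2>0$ or if $p$ divides $t_1$, and is $t_1^{-2}\in\mathbb Z/p\mathbb Z$ otherwise (the inverse being taken in $\mathbb Z/p\mathbb Z$).
   Context: **Ring.** $\mathbb Z_{(p)}$ is the ring of rationals with denominator prime to $p$; $R=\mathbb Z_{(p)}[v]/(1+v+\dots+v^{p-1})$, so $v$ is a primitive $p$-th root of unity; $\phi_p:R\to\mathbb Z/p\mathbb Z$ is the ring homomorphism which is reduction mod $p$ on $\mathbb Z_{(p)}$ and sends $v\mapsto 1$. **Class-0 $SL(2)$ category.** $\mathcal A$ is the semisimple ribbon (tortile) category over $R$ obtained (Gelfand–Kazhdan) as the subquotient of representations of Lusztig's quantum enveloping algebra of $SL(2)$ specialized at $v$, whose set $S$ of simple objects consists of the simple representations of highest weight $w$ with $w$ even and $0\le w\le p-3$; the product is induced by tensor product. For $w=2z$ the rank (quantum dimension) is $r_w=[2z+1]$ and the twist is the scalar $\theta_w=v^{-2z(z+1)}$, where $[n]=\frac{v^n-v^{-n}}{v-v^{-1}}$. Put $X_0^2=\sum_{w\in S}r_w^2\in R$. **Link evaluation.** Diagrams of framed links (blackboard framing) labeled by objects represent endomorphisms of the unit object, i.e. elements of $R$, in the usual (Reshetikhin–Turaev,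 Shum) way; labels extend linearly to $R$-linear combinations of objects. For a framed link $L$, $Z(L)\in R$ is the value of $L$ with every component labeled by $U=\sum_{w\in S}r_w\,w$. **Q-invariant.** A presentation $P=\langle x_1,\dots,x_n\mid R_1,\dots,R_m\rangle$ is regarded as a 2-complex with one 0-cell, 1-cells $x_k$ and 2-cells attached along the words $R_j$. Let $L_P$ be the framed link which is the closure (blackboard framing) of the braid $\psi_1(R_1)\cdots\psi_m(R_m)\in B_{n+m}$, where $y_j$ ($2\le j\le n+m$) is the braid generator interchanging strings $j-1$ and $j$, $r_{j,k}=y_{j+1}\cdots y_k$ for $j<k$, $r_{j,j}=1$, and $\psi_j:F_n\to B_{n+m}$ is the homomorphism $\psi_j(x_k)=r_{j,m+k-1}\,y_{m+k}^2\,r_{j,m+k-1}^{-1}$. Then $(X_0^2)^{-n}Z(L_P)\in R$ and $Z_Q(P)=\phi_p((X_0^2)^{-n}Z(L_P))\in\mathbb Z/p\mathbb Z$. This is invariant under 2-deformations (deformations through 2-complexes), so for a finite connected 2-complex $Y$ one sets $Z_Q(Y)=Z_Q(P)$ for any presentation $P$ 2-deformation equivalent to $Y$. *)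

(* Defs.v *)
From HB Require Import structures.
From Stdlib Require Import Relation_Operators.
From mathcomp Require Import all_boot all_order all_fingroup all_algebra.
From mathcomp Require Import classical_sets cardinality.
From mathcomp Require Import ring zify.

Set Implicit Arguments.
Unset Strict Implicit.
Unset Printing Implicit Defensive.

Import GRing.Theory Num.Theory.
Local Open Scope ring_scope.

Section LocalRing.
Variable p : nat.

Definition zloc_pred : pred rat := fun x => coprime p `|denq x|.

Lemma zloc_predP (x : rat) :
  reflect (exists2 d : nat, (0 < d)%N && coprime p d & exists n : int, x * d%:R = n%:~R)
          (x \in zloc_pred).
Proof.
apply: (iffP idP) => [hx | [d /andP[d0 cpd] [n]]].
  exists `|denq x|%N; first by rewrite absz_gt0 denq_neq0.
  by exists (numq x); rewrite numqE -{2}absz_denq -pmulrn.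
have d0' : d%:R != 0 :> rat by rewrite pnatr_eq0 -lt0n.
move=> /(canRL (mulfK d0')) ->; rewrite unfold_in /zloc_pred.
have -> : n%:~R / d%:R = fracq (n, d%:Z) by rewrite fracqE.
rewrite den_fracq /= -lt0n d0 /=.
apply: coprime_dvdr cpd.
by apply: dvdn_div; apply: dvdn_gcdr.
Qed.

Fact zloc_subring_closed : subring_closed zloc_pred.
Proof.
split=> [|x y|x y].
- by apply/zloc_predP; exists 1%N; [rewrite coprimen1 | exists 1; rewrite mulr1].
- move=> /zloc_predP[d /andP[d0 cd] [n hn]] /zloc_predP[e /andP[e0 ce] [m hm]].
  apply/zloc_predP; exists (d * e)%N; first by rewrite muln_gt0 d0 e0 coprimeMr cd.
  exists (n * e%:Z - m * d%:Z).
  rewrite natrM mulrBl mulrA hn mulrCA hm.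
  by rewrite rmorphB !rmorphM /= [d%:R * _]mulrC -!pmulrn.
- move=> /zloc_predP[d /andP[d0 cd] [n hn]] /zloc_predP[e /andP[e0 ce] [m hm]].
  apply/zloc_predP; exists (d * e)%N; first by rewrite muln_gt0 d0 e0 coprimeMr cd.
  by exists (n * m); rewrite natrM mulrACA hn hm rmorphM.
Qed.

HB.instance Definition _ :=
  GRing.isSubringClosed.Build rat zloc_pred zloc_subring_closed.

Record zloc := Zloc { zloc_val :> rat; _ : zloc_val \in zloc_pred }.

HB.instance Definition _ := [isSub for zloc_val].
HB.instance Definition _ := [Choice of zloc by <:].
HB.instance Definition _ := [SubChoice_isSubComNzRing of zloc by <:].

Definition Phi : {poly zloc} := \sum_(i < p) 'X^i.

Definition Rp := {poly %/ Phi}.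
HB.instance Definition _ := GRing.ComNzRing.on Rp.

Definition vroot : Rp := in_qpoly Phi 'X.

(** Exponents are reduced mod [p], as [v^p = 1] ([vX_p]). *)
Definition vz (k : int) : Rp := vroot ^+ `|(k %% p%:Z)%Z|.

Definition zloc_red (x : zloc) : 'F_p :=
  (numq (zloc_val x))%:~R / (denq (zloc_val x))%:~R.

(** Evaluation at [v = 1] of the representative of degree < p - 1; it is a ring
    homomorphism ([phi_zmod_morphism], [phi_monoid_morphism]). *)
Definition phi (x : Rp) : 'F_p := (map_poly zloc_red (x : {poly zloc})).[1].

Hypothesis p_pr : prime p.

Lemma size_monic_Phi : size Phi = p /\ Phi \is monic.
Proof.
have -> : Phi = \poly_(i < p) (1 : zloc).
  by rewrite poly_def; apply: eq_bigr => i _; rewrite scale1r.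
have sz : size (\poly_(i < p) (1 : zloc)) = p by rewrite size_poly_eq ?oner_neq0.
by split=> //; rewrite monicE lead_coefE sz coef_poly prednK ?prime_gt0 // leqnn.
Qed.

Lemma mk_monic_Phi : mk_monic Phi = Phi.
Proof. by case: size_monic_Phi => sz mon; rewrite /mk_monic sz mon prime_gt1. Qed.

Lemma in_qpoly_Phi : in_qpoly Phi Phi = 0.
Proof.
apply/val_inj => /=; rewrite mk_monic_Phi.
by rewrite Pdiv.CommonRing.rmodpp //; case: size_monic_Phi => _ /monicP->; exact: commr1.
Qed.

Lemma vX_p : vroot ^+ p = 1.
Proof.
apply/eqP; rewrite -subr_eq0 subrX1.
have -> : \sum_(i < p) vroot ^+ i = in_qpoly Phi Phi.
  by rewrite [in RHS]/Phi rmorph_sum; apply: eq_bigr => i _; rewrite rmorphXn.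
by rewrite in_qpoly_Phi mulr0.
Qed.

Lemma vz_nat (n : nat) : vz n%:Z = vroot ^+ n.
Proof.
by rewrite /vz modz_nat absz_nat [in RHS](divn_eq n p) exprD mulnC exprM vX_p expr1n mul1r.
Qed.

Lemma vzD (a b : int) : vz (a + b) = vz a * vz b.
Proof.
have p0 : p%:Z != 0 by rewrite -lt0n prime_gt0.
have absE (c : int) : `|(c %% p)%Z|%:Z = (c %% p)%Z by rewrite gez0_abs ?modz_ge0.
rewrite [vz a]/vz [vz b]/vz -exprD -vz_nat PoszD !absE /vz.
by rewrite modzDm.
Qed.

Lemma zloc_redP (x : zloc) (n : int) (d : nat) :
  coprime p d -> zloc_val x * d%:R = n%:~R -> zloc_red x = n%:~R / d%:R.
Proof.
move=> cpd h.
have nz (e : nat) : coprime p e -> e%:R != 0 :> 'F_p.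
  by rewrite -(dvdn_pcharf (pchar_Fp p_pr)) -prime_coprime.
have den0 : (denq (zloc_val x))%:~R != 0 :> 'F_p.
  by rewrite -absz_denq -pmulrn; apply: nz; case: x {h}.
apply/eqP; rewrite /zloc_red eqr_div ?nz //; apply/eqP.
have : (numq (zloc_val x))%:~R * (d%:Z)%:~R = n%:~R * (denq (zloc_val x))%:~R :> rat.
  by rewrite numqE mulrAC -pmulrn h.
by rewrite -!rmorphM /= => /intr_inj /(congr1 (fun z : int => z%:~R : 'F_p)); rewrite !rmorphM.
Qed.

Let zloc_valP (x : zloc) :
  exists2 d : nat, (0 < d)%N && coprime p d & exists n : int, zloc_val x * d%:R = n%:~R.
Proof. by apply/zloc_predP; case: x. Qed.

Let Fp_neq0 (e : nat) : coprime p e -> e%:R != 0 :> 'F_p.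
Proof. by rewrite -(dvdn_pcharf (pchar_Fp p_pr)) -prime_coprime. Qed.

Lemma zloc_red_zmod_morphism : zmod_morphism zloc_red.
Proof.
move=> x y.
have [d /andP[_ cd] [n hn]] := zloc_valP x; have [e /andP[_ ce] [m hm]] := zloc_valP y.
rewrite (zloc_redP cd hn) (zloc_redP ce hm).
rewrite (@zloc_redP (x - y) (n * e%:Z - m * d%:Z) (d * e)) ?coprimeMr ?cd //; last first.
  rewrite natrM mulrBl mulrA hn mulrCA hm.
  by rewrite rmorphB !rmorphM /= [d%:R * _]mulrC -!pmulrn.
rewrite -[- (m%:~R / _)]mulNr addf_div ?Fp_neq0 // natrM rmorphB !rmorphM /= -!pmulrn.
by rewrite mulNr.
Qed.

Lemma zloc_red_monoid_morphism : monoid_morphism zloc_red.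
Proof.
split=> [|x y]; first by rewrite (@zloc_redP 1 1 1) ?coprimen1 ?divr1 ?mulr1.
have [d /andP[_ cd] [n hn]] := zloc_valP x; have [e /andP[_ ce] [m hm]] := zloc_valP y.
rewrite (zloc_redP cd hn) (zloc_redP ce hm) mulf_div -natrM -rmorphM /=.
by rewrite (@zloc_redP (x * y) (n * m) (d * e)) ?coprimeMr ?cd // natrM mulrACA hn hm rmorphM.
Qed.

Let red : {rmorphism zloc -> 'F_p} :=
  HB.pack zloc_red (GRing.isZmodMorphism.Build _ _ _ zloc_red_zmod_morphism)
    (GRing.isMonoidMorphism.Build _ _ _ zloc_red_monoid_morphism).

Lemma phi_in_qpoly (q : {poly zloc}) : phi (in_qpoly Phi q) = (map_poly zloc_red q).[1].
Proof.
rewrite /phi /= mk_monic_Phi -[zloc_red]/(red : _ -> _).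
have [_ mon] := size_monic_Phi.
rewrite [in RHS](Pdiv.RingMonic.rdivp_eq mon q) rmorphD rmorphM /= hornerD hornerM.
suff -> : (map_poly red Phi).[1] = 0 by rewrite mulr0 add0r.
rewrite rmorph_sum horner_sum (eq_bigr (fun=> 1)) => [|i _].
  by rewrite sumr_const card_ord -[RHS](pchar_Fp_0 p_pr).
by rewrite rmorphXn /= (map_polyX red) hornerXn expr1n.
Qed.

Lemma qpolyK (x : Rp) : in_qpoly Phi (x : {poly zloc}) = x.
Proof. by apply: val_inj; apply: Pdiv.CommonRing.rmodp_small; apply: size_mk_monic. Qed.

Lemma phi_zmod_morphism : zmod_morphism phi.
Proof.
move=> x y; rewrite -[x]qpolyK -[y]qpolyK -rmorphB !phi_in_qpoly -[zloc_red]/(red : _ -> _).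
by rewrite rmorphB hornerD hornerN.
Qed.

Lemma phi_monoid_morphism : monoid_morphism phi.
Proof.
split=> [|x y].
  by rewrite -(rmorph1 (in_qpoly Phi)) phi_in_qpoly -[zloc_red]/(red : _ -> _) rmorph1 hornerC.
rewrite -[x]qpolyK -[y]qpolyK -rmorphM !phi_in_qpoly -[zloc_red]/(red : _ -> _).
by rewrite rmorphM hornerM.
Qed.

Lemma phiC (a : zloc) : phi (qpolyC Phi a) = zloc_red a.
Proof. by rewrite /phi /= -[zloc_red]/(red : _ -> _) map_polyC hornerC. Qed.

Lemma phi_v : phi vroot = 1.
Proof. by rewrite phi_in_qpoly -[zloc_red]/(red : _ -> _) map_polyX hornerX. Qed.

(** [n] = (v^n - v^-n)/(v - v^-1) in the form that makes sense in the ring ([qintE]). *)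
Definition qint (n : nat) : Rp := \sum_(i < n) vz (n%:Z - 1 - (2 * i)%:Z).

Definition qfact (n : nat) : Rp := \prod_(i < n) qint i.+1.

(** q-Pascal recursion; [qbin_fact] identifies it with [n]!/([k]![n-k]!). *)
Fixpoint qbin (n k : nat) : Rp :=
  match n, k with
  | _, 0 => 1
  | 0, _.+1 => 0
  | n'.+1, k'.+1 => vz (- k%:Z) * qbin n' k + vz (n%:Z - k%:Z) * qbin n' k'
  end.

Lemma vz0 : vz 0 = 1. Proof. by rewrite -[0 : int]/(0%:Z) vz_nat expr0. Qed.

Lemma qintD (a b : nat) : qint (a + b) = vz (- b%:Z) * qint a + vz a%:Z * qint b.
Proof.
rewrite addnC addrC /qint big_split_ord /= !big_distrr /=.
by congr (_ + _); apply: eq_bigr => i _; rewrite -vzD; congr vz; rewrite !PoszD; ring.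
Qed.

Lemma qint1 : qint 1 = 1. Proof. by rewrite /qint big_ord1; exact: vz0. Qed.

Lemma qintE (n : nat) : (vz 1 - vz (-1)) * qint n = vz n%:Z - vz (- n%:Z).
Proof.
elim: n => [|n IHn]; first by rewrite /qint big_ord0 mulr0 oppr0 subrr.
rewrite -addn1 qintD qint1 mulr1 mulrDr mulrCA IHn mulrBr mulrBl -!vzD.
by rewrite addrC subrKA PoszD opprD [in vz (1 + _)]addrC [in vz (-1 - _)]addrC.
Qed.

Lemma qbin_fact (n k : nat) : (k <= n)%N -> qbin n k * (qfact k * qfact (n - k)) = qfact n.
Proof.
have qfactS m : qfact m.+1 = qfact m * qint m.+1 by rewrite /qfact big_ord_recr.
have qfact0 : qfact 0 = 1 by rewrite /qfact big_ord0.
have qbin_gt m : forall l, (m < l)%N -> qbin m l = 0.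
  by elim: m => [|m IHm] [|l] //= lml; rewrite !IHm ?mulr0 ?addr0 // ltnW.
elim: n k => [|n IHn] [|k] lekn; rewrite ?subn0 ?qfact0 ?mulr1 //.
  by rewrite /= !mul1r.
rewrite subSS /= mulrDl [X in _ = X]qfactS.
have /(congr1 qint) : (n.+1 = (n - k) + k.+1)%N by rewrite addnS subnK.
rewrite qintD => ->; rewrite mulrDr; congr (_ + _).
  move: lekn; rewrite ltnS leq_eqVlt => /orP[/eqP->|ltkn].
    by rewrite qbin_gt // subnn /qint big_ord0 !(mulr0, mul0r).
  by rewrite -(IHn k.+1 ltkn) -(subnSK ltkn) !qfactS; ring.
rewrite -(IHn k lekn) qfactS; have -> : n.+1%:Z - k.+1%:Z = (n - k)%:Z by rewrite -subzn //; lia.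
ring.
Qed.

End LocalRing.

Section Braiding.
Variable p : nat.
Local Notation R := (Rp p).

(** [z : simple] stands for the simple module of highest weight [w = 2z], [w <= p - 3]. *)
Definition simple := 'I_(p.-1)./2.

Definition qdim (z : simple) : R := qint p (2 * z).+1.

Definition X02 : R := \sum_(z : simple) qdim z ^+ 2.

(** The basis x_0, ..., x_(2z) of the module [z], for all [z] at once:
    x_i has weight 2z - 2i, F^(k) x_i = [i+k; k] x_(i+k) and
    E^(k) x_i = [2z-i+k; k] x_(i-k). *)
Definition bvec := {z : simple & 'I_(2 * z).+1}.

Definition hwt (x : bvec) : int := (tag x)%:Z - (tagged x)%:Z.

Definition Fdiv (k : nat) (x y : bvec) : R :=
  if (tag y == tag x) && (tagged y == tagged x + k :> nat)%N
  then qbin p (tagged y) k else 0.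

Definition Ediv (k : nat) (x y : bvec) : R :=
  if (tag y == tag x) && (tagged x == tagged y + k :> nat)%N
  then qbin p (2 * tag x - tagged y) k else 0.

Definition vfact (k : nat) : R := \prod_(i < k) (vz p i.+1%:Z - vz p (- i.+1%:Z)).

(** Lusztig's braiding x (x) y |-> Theta (f (y (x) x)), where f is v^(-wt wt'/2) and
    Theta = sum_k (-1)^k v^(-k(k-1)/2) (v-v^-1)^k [k]! F^(k) (x) E^(k), for the coproduct
    E |-> E (x) 1 + K (x) E, F |-> F (x) K^-1 + 1 (x) F.
    [braiding x y y' x'] is the coefficient of y' (x) x' in the image of x (x) y.
    With the quantum trace given by K^-1 the twist on [z] is v^(-2z(z+1)). *)
Definition braiding (x y y' x' : bvec) : R :=
  vz p (- (2 * hwt x * hwt y)) *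
  \sum_(k < p) (-1) ^+ k * vz p (- 'C(k, 2)%:Z) * vfact k * (Fdiv k y y' * Ediv k x x').

(** The inverse: Theta^-1 is the image of Theta under the bar involution. *)
Definition braidingV (x y y' x' : bvec) : R :=
  vz p (2 * hwt x' * hwt y') *
  \sum_(k < p) vz p 'C(k, 2)%:Z * vfact k * (Fdiv k x x' * Ediv k y y').

End Braiding.

Section Braids.
Variable N : nat.

(** Strings are numbered from 0. The letter [(i, b)], [0 < i], is the generator
    interchanging the strings [i - 1] and [i], inverted when [b]. *)
Definition braid := seq ('I_N * bool).

Definition winv (T : Type) (w : seq (T * bool)) : seq (T * bool) :=
  rev [seq (l.1, ~~ l.2) | l <- w].

Definition pstr (i : 'I_N) : 'I_N := Ordinal (leq_ltn_trans (leq_pred i) (ltn_ord i)).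

Definition braid_perm (w : braid) : {perm 'I_N} :=
  (\prod_(l <- w) tperm (pstr l.1) l.1)%g.

Variable p : nat.
Local Notation R := (Rp p).

Definition state := {ffun 'I_N -> bvec p}.

Definition letter_coef (l : 'I_N * bool) (s t : state) : R :=
  let i := l.1 in
  if [forall j, (j != i) && (j != pstr i) ==> (t j == s j)]
  then (if l.2 then @braidingV p else @braiding p) (s (pstr i)) (s i) (t (pstr i)) (t i)
  else 0.

(** matrix coefficients of the operator of a braid, the first letter acting first *)
Fixpoint braid_coef (w : braid) (s t : state) : R :=
  if w is l :: w' then \sum_(u : state) letter_coef l s u * braid_coef w' u t
  else (s == t)%:R.

(** the closure of [w], its strings labelled by the simple objects [c] *)
Definition closure_value (w : braid) (c : {ffun 'I_N -> simple p}) : R :=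
  \sum_(s : state | [forall i, tag (s i) == c i])
    (\prod_i vz p (- (2 * hwt (s i)))) * braid_coef w s s.

(** The components of the closure are the cycles of [braid_perm w], so its labellings by
    simple objects are the [c] constant on cycles; labelling every component by
    U = sum_z r_z z weights [c] by the product of the r's over the components. *)
Definition Zlink (w : braid) : R :=
  \sum_(c : {ffun 'I_N -> simple p} | [forall i, c (braid_perm w i) == c i])
    (\prod_(i | froots (braid_perm w) i) qdim (c i)) * closure_value w c.

End Braids.

Record presentation := Presentation {
  pgen : nat;
  prel : nat;
  relator : 'I_prel -> seq ('I_pgen * bool)  (* [true] marks an inverse *)
}.

Section QInvariant.
Variable P : presentation.
Local Notation n := (pgen P).
Local Notation m := (prel P).

Definition ramp (a b : nat) : braid (m + n) :=
  [seq (i, false) | i : 'I_(m + n) <- enum 'I_(m + n) & (a < i <= b)%N].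

Definition psi_gen (j : 'I_m) (k : 'I_n) : braid (m + n) :=
  let r := ramp j (m + k).-1 in
  let y := (rshift m k, false) in
  r ++ [:: y; y] ++ winv r.

Definition psi (j : 'I_m) (w : seq ('I_n * bool)) : braid (m + n) :=
  flatten [seq if l.2 then winv (psi_gen j l.1) else psi_gen j l.1 | l <- w].

(** L_P as the word psi_1(R_1) ... psi_m(R_m); the relators use the strings [j < m] and the
    generators the strings [m + k], so that r_(j,b) = y_(j+1) ... y_b is [ramp j b]. *)
Definition link : braid (m + n) := flatten [seq psi j (relator j) | j <- enum 'I_m].

(** (X_0^2)^(-n) Z(L_P) lies in R and reduces to [a]; R is a domain and X_0^2 is not 0, so
    [x] is unique. *)
Definition pres_ZQ (p : nat) (a : 'F_p) :=
  exists2 x : Rp p, X02 p ^+ n * x = Zlink p link & phi x = a.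

End QInvariant.

Definition letter_src (V E : Type) (src tgt : E -> V) (l : E * bool) :=
  if l.2 then tgt l.1 else src l.1.
Definition letter_tgt (V E : Type) (src tgt : E -> V) (l : E * bool) :=
  if l.2 then src l.1 else tgt l.1.

Fixpoint walk (V : eqType) (E : Type) (src tgt : E -> V)
    (u : V) (w : seq (E * bool)) (u' : V) : bool :=
  if w is l :: w' then
    (letter_src src tgt l == u) && walk src tgt (letter_tgt src tgt l) w' u'
  else u == u'.

(** The attaching map of a 2-cell is an edge loop, given with its base point. *)
Record complex2 := Complex2 {
  vert : finType;
  edge : finType;
  face : finType;
  src : edge -> vert;
  tgt : edge -> vert;
  attach : face -> vert * seq (edge * bool);
  attachP : forall f, walk src tgt (attach f).1 (attach f).2 (attach f).1
}.

Definition is_loop (X : complex2) (l : vert X * seq (edge X * bool)) : bool :=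
  walk (@src X) (@tgt X) l.1 l.2 l.1.

Definition connected2 (X : complex2) :=
  (exists u : vert X, True) /\
  (forall u u' : vert X, exists w, walk (@src X) (@tgt X) u w u').

Definition euler_char (X : complex2) : int :=
  #|vert X|%:Z - #|edge X|%:Z + #|face X|%:Z.

Section Homology.
Variable X : complex2.

Definition d1 (c : {ffun edge X -> int}) : {ffun vert X -> int} :=
  [ffun u => \sum_e c e * ((tgt e == u)%:R - (src e == u)%:R)].

Definition d2 (c : {ffun face X -> int}) : {ffun edge X -> int} :=
  [ffun e => \sum_f c f * \sum_(l <- (attach f).2 | l.1 == e) (-1) ^+ l.2].

Local Open Scope classical_set_scope.

(** There are no 3-cells, so H_2 is the group of 2-cycles. *)
Definition H2 : set {ffun face X -> int} := [set c | d2 c = 0].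

Definition H1_class (c : {ffun edge X -> int}) : set {ffun edge X -> int} :=
  [set c' | range d2 (c' - c)].

(** The elements of H_1 are represented by their cosets of boundaries. *)
Definition H1_torsion : set (set {ffun edge X -> int}) :=
  [set H1_class c | c in
    [set c | d1 c = 0 /\ exists k : nat, (0 < k)%N /\ range d2 (c *+ k)]].

End Homology.
Arguments H2 X : clear implicits.
Arguments H1_torsion X : clear implicits.

Definition Zfree (V : zmodType) (r : nat) (c : 'I_r -> V) :=
  forall a : 'I_r -> int, \sum_i c i *~ a i = 0 -> forall i, a i = 0.

Definition has_rank (V : zmodType) (G : set V) (r : nat) :=
  (exists c : 'I_r -> V, (forall i, G (c i)) /\ Zfree c) /\
  (forall s (c : 'I_s -> V), (forall i, G (c i)) -> Zfree c -> (s <= r)%N).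

Definition map_word (E E' : Type) (f : E -> E') (w : seq (E * bool)) : seq (E' * bool) :=
  [seq (f l.1, l.2) | l <- w].

(** [oe] and [fo] record which cells have their orientation reversed *)
Definition cell_iso (X Y : complex2) :=
  exists (fv : vert X -> vert Y) (fe : edge X -> edge Y) (ff : face X -> face Y)
         (oe : edge X -> bool) (fo : face X -> bool),
    [/\ bijective fv /\ bijective fe /\ bijective ff,
        (forall e, src (fe e) = fv (if oe e then tgt e else src e)),
        (forall e, tgt (fe e) = fv (if oe e then src e else tgt e)) &
        (forall f, attach (ff f) =
           (fv (attach f).1,
            let w := [seq (fe l.1, l.2 (+) oe l.1) | l <- (attach f).2] in
            if fo f then winv w else w))].

(** [Y] is [X] with a new vertex joined to [u] by a new edge *)
Definition expansion1 (X Y : complex2) :=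
  exists (fv : option (vert X) -> vert Y) (fe : option (edge X) -> edge Y)
         (ff : face X -> face Y) (u : vert X),
    [/\ bijective fv /\ bijective fe /\ bijective ff,
        (forall e, src (fe (Some e)) = fv (Some (src e)) /\
                   tgt (fe (Some e)) = fv (Some (tgt e))),
        (src (fe None) = fv (Some u) /\ tgt (fe None) = fv None) &
        (forall f, attach (ff f) =
           (fv (Some (attach f).1), map_word (fe \o Some) (attach f).2))].

(** [Y] is [X] with a new edge parallel to the walk [w] and a 2-cell filling the bigon *)
Definition expansion2 (X Y : complex2) :=
  exists (fv : vert X -> vert Y) (fe : option (edge X) -> edge Y)
         (ff : option (face X) -> face Y) (u u' : vert X) (w : seq (edge X * bool)),
    [/\ bijective fv /\ bijective fe /\ bijective ff,
        (forall e, src (fe (Some e)) = fv (src e) /\ tgt (fe (Some e)) = fv (tgt e)),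
        [/\ walk (@src X) (@tgt X) u w u', src (fe None) = fv u & tgt (fe None) = fv u'],
        (forall f, attach (ff (Some f)) =
           (fv (attach f).1, map_word (fe \o Some) (attach f).2)) &
        attach (ff None) =
           (fv u, (fe None, false) :: winv (map_word (fe \o Some) w))].

(** elementary free homotopies of loops in [X] minus the open 2-cell [f] *)
Inductive loop_step (X : complex2) (f : face X) :
    vert X * seq (edge X * bool) -> vert X * seq (edge X * bool) -> Prop :=
| LoopRotate u l w :
    loop_step f (u, l :: w) (letter_tgt (@src X) (@tgt X) l, rcons w l)
| LoopCancel u w1 l w2 :
    loop_step f (u, w1 ++ [:: l; (l.1, ~~ l.2)] ++ w2) (u, w1 ++ w2)
| LoopFace u w1 g w2 :
    g != f -> loop_step f (u, w1 ++ (attach g).2 ++ w2) (u, w1 ++ w2).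

Definition loop_homotopic (X : complex2) (f : face X) :=
  clos_refl_sym_trans _
    (fun l l' => [/\ is_loop l, is_loop l' & loop_step f l l']).

(** [Y] is [X] with the attaching map of [f] changed by a homotopy *)
Definition slide (X Y : complex2) :=
  exists (fv : vert X -> vert Y) (fe : edge X -> edge Y) (ff : face X -> face Y) (f : face X)
         (l : vert X * seq (edge X * bool)),
    [/\ bijective fv /\ bijective fe /\ bijective ff,
        (forall e, src (fe e) = fv (src e) /\ tgt (fe e) = fv (tgt e)),
        loop_homotopic f (attach f) l &
        (forall g, attach (ff g) =
           let l' := if g == f then l else attach g in (fv l'.1, map_word fe l'.2))].

Definition deformation : complex2 -> complex2 -> Prop :=
  clos_refl_sym_trans _ (fun X Y =>
    cell_iso X Y \/ expansion1 X Y \/ expansion2 X Y \/ slide X Y).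

Lemma pres_attachP (P : presentation) (j : 'I_(prel P)) :
  walk (fun _ : 'I_(pgen P) => tt) (fun=> tt) tt (relator j) tt.
Proof.
suff walkT w (u : unit) : walk (fun _ : 'I_(pgen P) => tt) (fun=> tt) u w tt by exact: walkT.
elim: w u => [|l w IHw] u; first by case: u.
apply/andP; split; last exact: IHw.
by case: u; case: (letter_src _ _ l).
Qed.

Definition pres_complex (P : presentation) : complex2 :=
  Complex2 (attach := fun j => (tt, relator j)) (@pres_attachP P).

(** Z_Q(X) is Z_Q(P) for any presentation [P] that is 2-deformation equivalent to [X]. *)
Definition is_ZQ (p : nat) (X : complex2) (a : 'F_p) :=
  forall P : presentation, deformation X (pres_complex P) -> pres_ZQ P a.

(* Main.v *)
Require Import Defs.
From HB Require Import structures.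
From mathcomp Require Import all_boot all_order all_fingroup all_algebra.
From mathcomp Require Import boolp classical_sets cardinality.
From mathcomp Require Import mpoly finfield.
From mathcomp Require Import ring zify.

(** Put h = v - 1, so that X_0^2 is a unit times h^(p-3). In the state sum of L_P each relator
strand travels through the generator strands, and summing over its label and its states gives an
operator on the states of the generator strands. In a suitable basis its matrix coefficients are
sums over all weights of Laurent polynomials in v^(2z+1) and v^mu, and such weight sums are
divisible by h^(p-3). Hence, up to one more power of h, a relator strand may be replaced by its
classical limit, a product of symmetric powers of 2x2 matrices congruent to 1 modulo h.
The sum over the states of a generator strand is then the sum of (2z+1) tr Sym^(2z), which mod p
is -2 (t^2 - 4)^((p-3)/2) in terms of the trace t; to lowest order it is h^(p-3) times a power of
the quadratic form of sl_2 at sum_j A_jk Y_j, with A the matrix of exponent sums and Y_j a formal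
element of sl_2 for each relator. If there are more relators than generators, a power of h is left
after division by (X_0^2)^n. If their numbers agree, the weight sums act on the polynomials in the
Y_j like a Gaussian functional in characteristic p; by Wick's formula it vanishes when some Y_j
occurs p - 1 times, so the result is invariant under row operations on A and is det(A)^(p-3).
Finally |det A| = t_1 by the Smith normal form, and Euler characteristic, b_2 and the torsion of
H_1 are invariant under 2-deformations. *)

Set Implicit Arguments.
Unset Strict Implicit.
Unset Printing Implicit Defensive.

Import GRing.Theory Num.Theory.
Local Open Scope ring_scope.

(** * The ring at the root of unity *)

(** The reduction [phi] may be applied only after the division by (X_0^2)^n, that is by h^((p-3)n)
    up to a unit, while a single state contributes no such power: all divisibility comes from sums
    over labels. The formal variables Y_j allow the sums over the generator strands to be carried
    out with the weight sums of the relators still to be taken. The basis that produces Laurent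
    polynomials is that of a Verma module: there the finite dimension of the simple modules imposes
    no condition on the summation, since the raising coefficient vanishes at the ends. Contracting a
    relator strand needs the quantum trace given by K, while the closure is taken with K^-1; both
    agree on operators that commute with E. Invariance of Z_Q is not assumed: the value is computed
    for every presentation equivalent to X and is seen to depend on homology only. The constants
    cancel: with s = (p-3)/2, each generator brings 4 from the unit part of X_0^2, -2 times 4^s from
    the trace sum and the discriminant, and -1/2 from the value at A = 1, in all 4^(s+1) = 2^(p-1) =
    1 mod p. *)

Section Units.
Variable R : comNzRingType.
Implicit Types x y : R.

(** [Rp p] is only given the structure of a commutative ring, so units are expressed by an explicit
    inverse. *)
Definition isunit x := exists y, x * y = 1.

Lemma isunit1 : isunit 1. Proof. by exists 1; rewrite mulr1. Qed.

Lemma isunitM x y : isunit x -> isunit y -> isunit (x * y).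
Proof. by move=> [a ha] [b hb]; exists (a * b); rewrite mulrACA ha hb mulr1. Qed.

Lemma isunitX x n : isunit x -> isunit (x ^+ n).
Proof. by move=> ux; elim: n => [|n IHn]; [exact: isunit1 | rewrite exprS; exact: isunitM]. Qed.

Lemma isunit_prod (I : Type) (r : seq I) (P : pred I) (F : I -> R) :
  (forall i, P i -> isunit (F i)) -> isunit (\prod_(i <- r | P i) F i).
Proof. by move=> h; elim/big_ind: _ => //; [exact: isunit1 | exact: isunitM]. Qed.

Lemma unit_mulI u x y : isunit u -> u * x = u * y -> x = y.
Proof.
by move=> [w uw] e; rewrite -[x]mul1r -[y]mul1r -uw -!(mulrC w) -!mulrA e.
Qed.

End Units.

Section RootOfUnity.
Variable p : nat.
Hypothesis p_pr : prime p.
Local Notation R := (Rp p).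
Local Notation v := (vroot p).
Local Notation vz := (vz p).

Lemma phi_rmorphism : {f : {rmorphism R -> 'F_p} | f =1 @phi p}.
Proof.
pose f : {rmorphism R -> 'F_p} :=
  HB.pack (@phi p) (GRing.isZmodMorphism.Build _ _ _ (phi_zmod_morphism p_pr))
    (GRing.isMonoidMorphism.Build _ _ _ (phi_monoid_morphism p_pr)).
by exists f.
Qed.

Definition phim : {rmorphism R -> 'F_p} := sval phi_rmorphism.

Lemma phimE : phim =1 @phi p. Proof. exact: svalP phi_rmorphism. Qed.

Definition hv : R := v - 1.

Lemma phim_v : phim v = 1. Proof. by rewrite phimE phi_v. Qed.

Lemma phim_hv : phim hv = 0. Proof. by rewrite rmorphB rmorph1 phim_v subrr. Qed.

Lemma phim_vz k : phim (vz k) = 1.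
Proof. by rewrite /Defs.vz rmorphXn phim_v expr1n. Qed.

Lemma vz0E : vz 0 = 1. Proof. exact: vz0. Qed.

Lemma vzN a : vz a * vz (- a) = 1.
Proof. by rewrite -vzD // subrr vz0E. Qed.

Lemma vzX a n : vz a ^+ n = vz (a * n%:Z).
Proof.
elim: n => [|n IHn]; first by rewrite mulr0 vz0E expr0.
by rewrite exprS IHn -vzD //; congr vz; rewrite -addn1 PoszD mulrDr mulr1 addrC.
Qed.

Lemma vz_p a : vz (a * p%:Z) = 1.
Proof. by rewrite -vzX /Defs.vz -exprM mulnC exprM vX_p // expr1n. Qed.

Lemma vz_modp a b : (a = b %[mod p%:Z])%Z -> vz a = vz b.
Proof. by rewrite /Defs.vz => ->. Qed.

Lemma sum_v : \sum_(i < p) v ^+ i = 0.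
Proof.
have -> : \sum_(i < p) v ^+ i = in_qpoly (Phi p) (Phi p).
  by rewrite [in RHS]/Phi rmorph_sum; apply: eq_bigr => i _; rewrite rmorphXn.
exact: in_qpoly_Phi.
Qed.

Lemma natr_regular n (x : R) : (0 < n)%N -> x *+ n = 0 -> x = 0.
Proof.
move=> n_gt0 xn0; apply: val_inj => /=; apply/polyP => i; rewrite coef0.
have /(congr1 (fun y : R => (y : {poly zloc p})`_i)) := xn0.
rewrite raddfMn /= coefMn coef0 => /(congr1 (val : zloc p -> rat)).
rewrite (raddfMn (val : zloc p -> rat)) /= => /eqP; rewrite mulrn_eq0 -implyNb -lt0n n_gt0 /= => /eqP h.
exact: val_inj.
Qed.

(** The cyclotomic relation 0 = sum_i v^i turns [p] into minus the sum of the v^i - 1. *)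
Lemma hv_dvd_p : exists w, p%:R = hv * w.
Proof.
have e : p%:R = - (\sum_(i < p) (v ^+ i - 1)) :> R.
  by rewrite sumrB sum_v sumr_const card_ord sub0r opprK.
have /fin_all_exists[w hw] : forall i : 'I_p, exists w, v ^+ i - 1 = hv * w.
  by move=> i; exists (\sum_(j < i) v ^+ j); rewrite subrX1.
exists (- \sum_i w i); rewrite e mulrN mulr_sumr.
by congr (- _); apply: eq_bigr => i _; rewrite hw.
Qed.

(** [h] divides [p], which is regular because the ring has no additive torsion. Cancelling powers of
    [h] rests on this alone; the ring need not be known to be a domain. *)
Lemma hv_regular (x : R) : hv * x = 0 -> x = 0.
Proof.
move=> hx0; have [w hw] := hv_dvd_p.
by apply: (@natr_regular p); rewrite ?prime_gt0 // -mulr_natl hw mulrAC hx0 mul0r.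
Qed.

Lemma hvX_regular k (x : R) : hv ^+ k * x = 0 -> x = 0.
Proof. by elim: k => [|k IHk]; rewrite ?expr0 ?mul1r // exprS -mulrA => /hv_regular. Qed.

Lemma hvX_inj k : injective ( *%R (hv ^+ k)).
Proof.
by move=> x y /eqP; rewrite -subr_eq0 -mulrBr => /eqP/hvX_regular/subr0_eq.
Qed.

Lemma isunit_vz a : isunit (vz a). Proof. by exists (vz (- a)); exact: vzN. Qed.

Definition cyc (i : nat) : R := \sum_(t < i) v ^+ t.

Lemma cycE i : v ^+ i - 1 = hv * cyc i. Proof. by rewrite subrX1. Qed.

Lemma phim_cyc i : phim (cyc i) = i%:R.
Proof.
rewrite rmorph_sum (eq_bigr (fun=> 1)) ?sumr_const ?card_ord // => t _.
by rewrite rmorphXn phim_v expr1n.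
Qed.

(** If i j = 1 mod p, then v = (v^i)^j, so v - 1 is in turn a multiple of v^i - 1, and the two
    quotients are inverse to each other. *)
Lemma cyc_unit i : coprime p i -> isunit (cyc i).
Proof.
move=> cpi.
have [j hj] : exists j, (i * j = 1 %[mod p])%N.
  have i0 : (0 < i)%N by case: i cpi => //; rewrite /coprime gcdn0 => /eqP p1; move: p_pr; rewrite p1.
  case: (egcdnP p i0) => a b e _; exists a; rewrite mulnC e.
  by rewrite gcdnC (eqP cpi) modnMDl.
exists (\sum_(t < j) v ^+ (i * t)).
apply: (hvX_inj (k := 1)); rewrite expr1 mulr1 mulrA -cycE.
have -> : \sum_(t < j) v ^+ (i * t) = \sum_(t < j) (v ^+ i) ^+ t.
  by apply: eq_bigr => t _; rewrite exprM.
rewrite -subrX1 -exprM (divn_eq (i * j) p) hj modn_small ?prime_gt1 //.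
by rewrite exprD mulnC exprM vX_p // expr1n mul1r.
Qed.

Lemma cyc_unit_ord i : (0 < i < p)%N -> isunit (cyc i).
Proof.
move=> /andP[i0 ip]; apply: cyc_unit; rewrite prime_coprime //.
by apply/negP => /(dvdn_leq i0); rewrite leqNgt ip.
Qed.

Lemma vX_sub_regular (i j : nat) (x : R) : (i < p)%N -> (j < p)%N -> i != j ->
  (v ^+ i - v ^+ j) * x = 0 -> x = 0.
Proof.
wlog ltij : i j x / (i < j)%N => [wl|] ip jp nij.
  move: (nij); rewrite neq_ltn => /orP[lt|lt]; first exact: wl.
  move=> e; apply: (wl j i x lt) => //; first by rewrite eq_sym.
  by rewrite -opprB mulNr e oppr0.
rewrite -(subnKC (ltnW ltij)) exprD -[X in (X - _) * x]mulr1 -mulrBr -opprB cycE => e.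
rewrite mulrN mulNr mulrCA -mulrA in e.
apply: hv_regular; apply: (@unit_mulI _ (v ^+ i * cyc (j - i))).
  apply: isunitM; first by rewrite -vz_nat //; exact: isunit_vz.
  by apply: cyc_unit_ord; rewrite subn_gt0 ltij (leq_ltn_trans (leq_subr _ _)).
by rewrite mulrCA -[hv * _]opprK e oppr0 mulr0.
Qed.

(** The factor theorem applied to one root after the other; regularity of the pairwise differences
    replaces the absence of zero divisors. *)
Lemma regular_roots_prod (rs : seq R) (q : {poly R}) :
  pairwise (fun a b => `[< forall x, (a - b) * x = 0 -> x = 0 >]) rs ->
  (forall a, a \in rs -> root q a) ->
  exists q', q = q' * \prod_(a <- rs) ('X - a%:P).
Proof.
elim: rs q => [|a rs IH] q /=; first by exists q; rewrite big_nil mulr1.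
case/andP => /allP ha hp hr.
have /factor_theorem[q1 q1E] : root q a by apply: hr; rewrite mem_head.
have [b hb|q' q'E] := IH q1 hp.
  have /asboolP reg := ha _ hb; have := hr b; rewrite in_cons hb orbT => /(_ isT).
  rewrite q1E rootE hornerM hornerXsubC => /eqP e.
  by apply/eqP; apply: reg; rewrite -opprB mulNr mulrC e oppr0.
by exists q'; rewrite big_cons mulrCA mulrC -q'E q1E.
Qed.

Lemma Phi_prod : \sum_(i < p) 'X^i = \prod_(1 <= i < p) ('X - (v ^+ i)%:P) :> {poly R}.
Proof.
set q := (X in X = _).
have qE : q = \poly_(i < p) 1 by rewrite poly_def; apply: eq_bigr => i _; rewrite scale1r.
have sq : size q = p by rewrite qE size_poly_eq ?oner_neq0.
have mq : q \is monic by rewrite monicE lead_coefE sq qE coef_poly prednK ?prime_gt0 // leqnn.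
have [||q' q'E] := @regular_roots_prod [seq v ^+ i | i <- index_iota 1 p] q.
- rewrite pairwise_map; apply/(pairwiseP 0) => i j; rewrite !inE size_iota => hi hj ij /=.
  apply/asboolP => x; apply: vX_sub_regular; rewrite ?nth_iota //; lia.
- move=> a /mapP[i]; rewrite mem_index_iota => /andP[i1 ip] {a}->.
  rewrite rootE qE poly_def horner_sum; apply/eqP.
  under eq_bigr => t _ do rewrite scale1r hornerXn.
  apply: (@vX_sub_regular i 0); rewrite ?prime_gt0 ?expr0 //; first by rewrite -lt0n.
  by rewrite -subrX1 -exprM mulnC exprM vX_p // expr1n subrr.
rewrite big_map in q'E.
have mp : \prod_(1 <= i < p) ('X - (v ^+ i)%:P) \is monic by exact: monic_prod_XsubC.
have sp : size (\prod_(1 <= i < p) ('X - (v ^+ i)%:P)) = p.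
  by rewrite size_prod_XsubC size_iota subn1 prednK ?prime_gt0.
have mq' : q' \is monic by move: mq; rewrite q'E monicMr.
have sq' : size q' = 1.
  have := sq; rewrite q'E size_Mmonic ?monic_neq0 // sp => e.
  by move: (size q') e (prime_gt0 p_pr) => k; lia.
have q1 : q' = 1.
  by move: mq'; rewrite (size1_polyC (eq_leq sq')) monicE lead_coefC => /eqP ->.
by rewrite q'E q1 mul1r.
Qed.

(** The unit by which [p] and h^(p-1) differ ([natr_p_hv]); mod p it is (p-1)!, hence -1 by
    Wilson. *)
Definition pu : R := \prod_(1 <= i < p) cyc i.

Lemma pu_unit : isunit pu.
Proof. by rewrite /pu big_seq; apply: isunit_prod => i; rewrite mem_index_iota; exact: cyc_unit_ord. Qed.

Lemma phim_pu : phim pu = -1.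
Proof.
rewrite rmorph_prod /= (eq_bigr (fun i => i%:R)) => [|i _]; last exact: phim_cyc.
rewrite -natr_prod -[p in index_iota _ p](prednK (prime_gt0 p_pr)) -fact_prod.
have := Wilson (prime_gt1 p_pr); rewrite p_pr => /esym/idP.
rewrite (dvdn_pcharf (pchar_Fp p_pr)) -natr1 => /eqP e.
by apply/eqP; rewrite -addr_eq0 e.
Qed.

Hypothesis p_ge5 : (5 <= p)%N.

Lemma odd_p : odd p.
Proof. by case/even_prime: p_pr p_ge5 => [->|]. Qed.

(** Evaluation of [Phi_prod] at 1; the sign (-1)^(p-1) disappears because [p] is odd. *)
Lemma natr_p_hv : p%:R = hv ^+ p.-1 * pu.
Proof.
have /(congr1 (fun q => q.[1])) := Phi_prod.
have -> : (\sum_(i < p) 'X^i : {poly R}).[1] = p%:R.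
  rewrite horner_sum (_ : p%:R = \sum_(i < p) 1 :> R); last by rewrite sumr_const card_ord.
  by apply: eq_bigr => i _; rewrite hornerXn expr1n.
move=> ->; rewrite horner_prod.
rewrite (eq_bigr (fun i => - hv * cyc i)) => [|i _].
  rewrite big_split /= prodr_const_nat subn1 exprNn -signr_odd.
  by rewrite -[odd _]negbK -oddS prednK ?prime_gt0 // odd_p mul1r.
by rewrite hornerXsubC -opprB cycE mulNr.
Qed.

Definition vdif (k : int) : R := vz k - vz (- k).

Lemma vdif_nat (n : nat) : vdif n%:Z = hv * (vz (- n%:Z) * cyc (2 * n)).
Proof.
rewrite mulrCA -cycE -[v ^+ _](vz_nat p_pr) mulrBr mulr1 -vzD //.
by rewrite /vdif; congr (vz _ - _); rewrite mulnC PoszM; lia.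
Qed.

Lemma qint_vdif n : vdif 1 * qint p n = vdif n%:Z.
Proof. exact: qintE. Qed.

Lemma phim_qint n : phim (qint p n) = n%:R.
Proof.
rewrite rmorph_sum (eq_bigr (fun=> 1)) ?sumr_const ?card_ord // => i _.
exact: phim_vz.
Qed.

Lemma sum_all_v (d : int) : \sum_(i < p) vz (d * i%:Z) = if (p%:Z %| d)%Z then p%:R else 0.
Proof.
have e i : vz (d * i%:Z) = vz d ^+ i by rewrite vzX.
under eq_bigr => i _ do rewrite e.
case: ifP => [/dvdzP[q ->]|/negbT nd].
  by rewrite vz_p (eq_bigr (fun=> 1)) ?sumr_const ?card_ord // => i _; rewrite expr1n.
rewrite /Defs.vz.
set k := `|(d %% p)%Z|%N.
have p0 : p%:Z != 0 by case: (p) p_ge5.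
have kp : (0 < k < p)%N.
  have k0 : k%:Z = (d %% p)%Z by rewrite gez0_abs ?modz_ge0.
  rewrite lt0n -!ltz_nat k0 ltz_pmod // ?andbT; last by rewrite ltz_nat; lia.
  by apply: contra nd => /eqP kz; apply/dvdz_mod0P; rewrite -k0 kz.
apply: (@vX_sub_regular k 0); rewrite ?prime_gt0 ?expr0 //; [lia|lia|].
by rewrite -subrX1 -exprM mulnC exprM vX_p // expr1n subrr.
Qed.

(* The odd numbers [x < p] and their opposites represent all nonzero residues mod [p]. *)
Lemma sum_odd (V : zmodType) (F : int -> V) :
  (forall a b, (a = b %[mod p%:Z])%Z -> F a = F b) ->
  \sum_(z < (p.-1)./2) (F (2 * z).+1%:Z + F (- (2 * z).+1%:Z)) = \sum_(i < p) F i%:Z - F 0.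
Proof.
move=> hF; pose s := (p.-1)./2.
have ps : p = (2 * s).+1.
  by have := odd_p; rewrite -[X in odd X](prednK (prime_gt0 p_pr)) /= => h; rewrite /s; lia.
rewrite -/s -(big_mkord xpredT (fun i => F i%:Z)) big_ltn ?prime_gt0 // [F 0 + _]addrC addrK.
have -> : \sum_(1 <= i < p) F i%:Z = \sum_(0 <= z < s) (F (2 * z).+1%:Z + F (2 * z).+2%:Z).
  rewrite {1}ps; elim: {ps}s => [|t IH]; first by rewrite !big_geq.
  rewrite [RHS]big_nat_recr //= -IH mulnS !addSn add0n.
  by rewrite big_nat_recr //= big_nat_recr //= addrA.
rewrite -(big_mkord xpredT (fun z => F (2 * z).+1%:Z + F (- (2 * z).+1%:Z))).
rewrite !big_split /=; congr (_ + _).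
rewrite [RHS]big_nat_rev /=; apply: eq_big_nat => z /andP[_ zs].
apply: hF; rewrite add0n subnS.
have -> : (2 * (s - z).-1).+2%:Z = - (2 * z).+1%:Z + p%:Z by lia.
by rewrite modzDr.
Qed.

(** The simple objects are z = 0, ..., [sp], and [2 * sp] = p - 3 is the exponent of [h] in
    X_0^2. *)
Definition sp := (p - 3)./2.

Lemma spE : p = (2 * sp).+3.
Proof. by have := odd_p; move: p_ge5; rewrite /sp; lia. Qed.

Lemma card_simple : (p.-1)./2 = sp.+1. Proof. by have := spE; lia. Qed.

Definition xunit : R := vz (-1) * (1 + v).

Lemma vdif1 : vdif 1 = hv * xunit.
Proof. by rewrite (vdif_nat 1) /cyc muln1 big_ord_recl big_ord1 expr0 expr1. Qed.

Lemma xunit_unit : isunit xunit.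
Proof.
apply: isunitM; first exact: isunit_vz.
by have := @cyc_unit_ord 2; rewrite /cyc big_ord_recl big_ord1 expr0 expr1; apply; lia.
Qed.

Lemma phim_xunit : phim xunit = 2%:R.
Proof. by rewrite rmorphM phim_vz mul1r rmorphD rmorph1 phim_v. Qed.

Lemma vdif_unit i : (0 < i < p)%N ->
  exists2 u, vdif i%:Z = hv * u & isunit u.
Proof.
move=> /andP[i0 ip]; exists (vz (- i%:Z) * cyc (2 * i)); first exact: vdif_nat.
apply: isunitM; first exact: isunit_vz.
apply: cyc_unit => //; rewrite coprimeMr !prime_coprime //.
by apply/andP; split; apply/negP => /dvdn_leq; move: p_ge5; lia.
Qed.

Lemma vdif1_inj (x y : R) : vdif 1 * x = vdif 1 * y -> x = y.
Proof.
rewrite vdif1 => e; apply: (unit_mulI xunit_unit); apply: (hvX_inj (k := 1)).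
by rewrite expr1 [LHS]mulrA [RHS]mulrA.
Qed.

Lemma qint_unit i : (0 < i < p)%N -> isunit (qint p i).
Proof.
move=> hi; have [u hu [w uw]] := vdif_unit hi.
have e : xunit * qint p i = u.
  by apply: (hvX_inj (k := 1)); rewrite expr1 mulrA -vdif1 qint_vdif hu.
by exists (xunit * w); rewrite mulrA [qint p i * _]mulrC e.
Qed.

(** Multiplied by (v - v^-1)^2, the sum runs over the squares of v^x - v^-x for odd x < p, which by
    [sum_odd] is the sum of v^(2x) - 1 over the nonzero residues, that is -p. Both [p] and v - v^-1
    are known up to units; the value 1/4 comes from [phim_xunit] and [phim_pu]. *)
Lemma X02_hv : exists e, [/\ X02 p = hv ^+ (2 * sp) * e, isunit e & 4%:R * phim e = 1].
Proof.
have e1 : vdif 1 ^+ 2 * X02 p = - p%:R.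
  rewrite /X02 mulr_sumr (eq_bigr (fun z : simple p => vdif (2 * z).+1%:Z ^+ 2)); last first.
    by move=> z _; rewrite -exprMn qint_vdif.
  rewrite (eq_bigr (fun z : simple p => (vz (2 * (2 * z).+1%:Z) - 1) + (vz (2 * - (2 * z).+1%:Z) - 1))).
    rewrite (@sum_odd _ (fun x => vz (2 * x) - 1)) => [|a b ab]; last first.
      by congr (_ - _); apply: vz_modp; rewrite -modzMmr ab modzMmr.
    rewrite sumrB sum_all_v // ifF ?sumr_const ?card_ord ?mulr0 ?vz0E ?subrr ?subr0 ?sub0r //.
    by rewrite dvdzE /= gtnNdvd //; move: p_ge5; lia.
  move=> z _; set x := (2 * z).+1%:Z; rewrite /vdif sqrrB !vzX -vzD // subrr vz0E.
  have -> : vz (2 * x) = vz (x * 2%:Z) by congr (vz _); rewrite mulrC.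
  have -> : vz (2 * - x) = vz (- x * 2%:Z) by congr (vz _); rewrite mulrC.
  set a := vz _; set b := vz _; ring.
have [y hy] := isunitX 2 xunit_unit; have [w hw] := pu_unit.
exists (- (pu * y)); split; last first.
  have := congr1 phim hy; rewrite rmorphM rmorph1 rmorphXn phim_xunit => hy2.
  by rewrite rmorphN rmorphM phim_pu mulN1r opprK -[RHS]hy2; congr (_ * _); rewrite expr2 -natrM.
- exists (- (w * xunit ^+ 2)); rewrite mulrNN mulrACA hw mul1r mulrC; exact: hy.
apply: (@unit_mulI _ (xunit ^+ 2)); first exact: isunitX xunit_unit.
apply: (hvX_inj (k := 2)).
have -> : hv ^+ 2 * (xunit ^+ 2 * X02 p) = vdif 1 ^+ 2 * X02 p by rewrite vdif1; ring.
rewrite e1 natr_p_hv.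
have -> : hv ^+ 2 * (xunit ^+ 2 * (hv ^+ (2 * sp) * - (pu * y))) =
  - (hv ^+ 2 * hv ^+ (2 * sp) * pu * (xunit ^+ 2 * y)) by ring.
rewrite hy mulr1 -exprD; congr (- (_ ^+ _ * _)).
by have := spE; lia.
Qed.

End RootOfUnity.

(** * q-binomial identities and the braiding *)

Section QuantumIdentities.
Variables (R : comNzRingType) (p : nat) (vz : int -> R) (qint qfact vfact : nat -> R).
Variable qbin : nat -> nat -> R.
Hypothesis vz0 : vz 0 = 1.
Hypothesis vzD : forall a b, vz (a + b) = vz a * vz b.
Hypothesis qint0 : qint 0 = 0.
Hypothesis qint_unit : forall i, (0 < i < p)%N -> isunit (qint i).
Hypothesis qfact0 : qfact 0 = 1.
Hypothesis qfactS : forall m, qfact m.+1 = qfact m * qint m.+1.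
Hypothesis qbin0 : forall n, qbin n 0 = 1.
Hypothesis qbin0S : forall k, qbin 0 k.+1 = 0.
Hypothesis qbinE : forall n k,
  qbin n.+1 k.+1 = vz (- k.+1%:Z) * qbin n k.+1 + vz (n.+1%:Z - k.+1%:Z) * qbin n k.
Hypothesis qbin_fact : forall n k, (k <= n)%N -> qbin n k * (qfact k * qfact (n - k)) = qfact n.
Definition qdif k := vz k - vz (- k).
Hypothesis vfact0 : vfact 0 = 1.
Hypothesis vfactS : forall k, vfact k.+1 = vfact k * qdif k.+1%:Z.
Hypothesis qint_dif : forall n, qdif 1 * qint n = qdif n%:Z.
Hypothesis qdif1_inj : forall x y, qdif 1 * x = qdif 1 * y -> x = y.
Local Notation vdif := qdif.

Lemma vdifM m n : vdif m * vdif n = vz (m + n) + vz (- (m + n)) - vz (m - n) - vz (n - m).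
Proof.
rewrite /qdif mulrBl !mulrBr -!vzD.
by rewrite opprB -opprD [- m + n]addrC; ring.
Qed.

Lemma qfact_unit n : (n < p)%N -> isunit (qfact n).
Proof.
elim: n => [|n IH] np; first by rewrite qfact0; exact: isunit1.
by rewrite qfactS; apply: isunitM; [apply: IH | apply: qint_unit]; lia.
Qed.

Lemma vfactE k : vfact k = vdif 1 ^+ k * qfact k.
Proof.
elim: k => [|k IH]; first by rewrite vfact0 qfact0 mulr1.
by rewrite vfactS IH -qint_dif // exprS qfactS; ring.
Qed.

Lemma qbin_gt n k : (n < k)%N -> qbin n k = 0.
Proof.
elim: n k => [|n IHn] [|k] //= lt; rewrite ?qbin0S // qbinE !IHn ?mulr0 ?addr0 //; lia.
Qed.

Lemma qbin_mul n k l : (k + l <= n)%N -> (n < p)%N ->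
  qbin n k * qbin (n - k) l = qbin n (k + l) * qbin (k + l) k.
Proof.
move=> kln np.
apply: (@unit_mulI _ (qfact k * qfact l * qfact (n - (k + l)))).
  by apply: isunitM; [apply: isunitM|]; apply: qfact_unit; lia.
have e1 := @qbin_fact n k ltac:(lia).
have e2 := @qbin_fact (n - k) l ltac:(lia).
have e3 := @qbin_fact n (k + l) ltac:(lia).
have e4 := @qbin_fact (k + l) k ltac:(lia).
rewrite -subnDA in e2; rewrite addKn in e4.
transitivity (qfact n).
  by rewrite -e1 -e2; ring.
by rewrite -e3 -e4; ring.
Qed.

Lemma qbin_sym n k : (k <= n < p)%N -> qbin n (n - k) = qbin n k.
Proof.
move=> /andP[kn np].
have e1 := @qbin_fact n k kn.
have e2 := @qbin_fact n (n - k) (leq_subr _ _).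
rewrite subKn // in e2.
apply: (@unit_mulI _ (qfact k * qfact (n - k))); first by apply: isunitM; apply: qfact_unit; lia.
by rewrite [LHS]mulrC [RHS]mulrC e1 -e2; congr (_ * _); rewrite mulrC.
Qed.

Lemma vfact_qbin K k : (k <= K < p)%N -> vfact k * vfact (K - k) * qbin K k = vfact K.
Proof.
move=> /andP[kK Kp]; rewrite !vfactE -(qbin_fact kK).
have -> : vdif 1 ^+ K = vdif 1 ^+ k * vdif 1 ^+ (K - k) by rewrite -exprD subnKC.
by ring.
Qed.

Lemma qbinSr n k : (k <= n)%N -> (n.+1 < p)%N ->
  qbin n.+1 k * qint (n.+1 - k) = qbin n k * qint n.+1.
Proof.
move=> kn np; apply: (@unit_mulI _ (qfact k * qfact (n - k))).
  by apply: isunitM; apply: qfact_unit; lia.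
have e1 := @qbin_fact n.+1 k ltac:(lia).
have e2 := @qbin_fact n k kn.
rewrite subSn // qfactS in e1 *.
transitivity (qfact n.+1); first by rewrite -e1; ring.
by rewrite qfactS -e2; ring.
Qed.

Lemma qbinSS n k : (k <= n)%N -> (n.+1 < p)%N ->
  qbin n.+1 k.+1 * qint k.+1 = qbin n k * qint n.+1.
Proof.
move=> kn np; apply: (@unit_mulI _ (qfact k * qfact (n - k))).
  by apply: isunitM; apply: qfact_unit; lia.
have e1 := @qbin_fact n.+1 k.+1 ltac:(lia).
have e2 := @qbin_fact n k kn.
rewrite subSS qfactS in e1.
transitivity (qfact n.+1); first by rewrite -e1; ring.
by rewrite qfactS -e2; ring.
Qed.

Lemma qbinS n k : (k <= n)%N -> (n < p)%N ->
  qbin n k.+1 * qint k.+1 = qbin n k * qint (n - k).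
Proof.
move=> kn np; case: (ltnP k n) => kltn; last first.
  have -> : n = k by lia.
  by rewrite qbin_gt // subnn qint0 mulr0 mul0r.
apply: (@unit_mulI _ (qfact k * qfact (n - k.+1))).
  by apply: isunitM; apply: qfact_unit; lia.
have e1 := @qbin_fact n k.+1 ltac:(lia).
have e2 := @qbin_fact n k kn.
rewrite qfactS in e1; rewrite -subnSK // qfactS in e2 *.
transitivity (qfact n); first by rewrite -e1; ring.
by rewrite -e2; ring.
Qed.

(** Gauss's q-binomial theorem. At [c = 0] the factor [t = 0] vanishes, and this is the cancellation
    behind Theta Theta^-1 = 1. *)
Lemma sum_qbin K (c : int) :
  \sum_(k < K.+1) (-1) ^+ k * vz (k%:Z * (K%:Z - 1) + c * k%:Z) * qbin K k =
  \prod_(t < K) (1 - vz ((2 * t)%:Z + c)).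
Proof.
elim: K => [|K IH].
  by rewrite big_ord_recl !big_ord0 addr0 mul0r mulr0 addr0 vz0 qbin0 expr0 !mulr1.
rewrite [RHS]big_ord_recr -IH.
rewrite big_ord_recl mul0r mulr0 addr0 vz0 expr0 qbin0 !mul1r.
under [in LHS]eq_bigr => k _ do rewrite /= /bump /= add1n qbinE mulrDr.
rewrite big_split /= mulrBr mulr1 addrA; congr (_ + _).
  rewrite [RHS]big_ord_recl mul0r mulr0 addr0 vz0 expr0 qbin0 !mul1r; congr (_ + _).
  rewrite big_ord_recr /= qbin_gt // !mulr0 addr0.
  apply: eq_bigr => k _; rewrite /= /bump /= add1n.
  rewrite -!mulrA; congr (_ * _); rewrite mulrA -vzD; congr (vz _ * _).
  by lia.
rewrite mulr_suml -sumrN; apply: eq_bigr => k _.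
rewrite exprS mulN1r !mulNr; congr (- _).
rewrite -!mulrA; congr (_ * _); rewrite [qbin _ _ * _]mulrC !mulrA -!vzD; congr (vz _ * _).
by lia.
Qed.

Lemma sum_qbin0 K : (0 < K)%N ->
  \sum_(k < K.+1) (-1) ^+ k * vz (k%:Z * (K%:Z - 1)) * qbin K k = 0.
Proof.
case: K => // K _; have := sum_qbin K.+1 0.
rewrite [X in _ = X]big_ord_recl (_ : 1 - _ = 0) ?mul0r => [e|]; last first.
  by rewrite addr0 -[X in vz X]/(0 : int) vz0 subrr.
rewrite -[RHS]e.
by apply: eq_bigr => k _; rewrite mul0r addr0.
Qed.

Lemma sum_qbinV0 K : (0 < K < p)%N ->
  \sum_(k < K.+1) (-1) ^+ k * vz (- (k%:Z * (K%:Z - 1))) * qbin K k = 0.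
Proof.
move=> /andP[K0 Kp]; rewrite (reindex_inj rev_ord_inj) /=.
rewrite -[RHS](mulr0 ((-1) ^+ K * vz (- (K%:Z * (K%:Z - 1))))) -[in RHS](sum_qbin0 K0) mulr_sumr.
apply: eq_bigr => k _; rewrite subSS; have kK : (k <= K)%N by rewrite -ltnS.
rewrite qbin_sym ?kK // -[(-1) ^+ (K - k)]signr_odd oddB // signr_addb !signr_odd.
rewrite [RHS]mulrA; congr (_ * _).
rewrite [RHS]mulrACA -vzD //; congr (_ * vz _).
by rewrite -subzn //; ring.
Qed.

Lemma bin2_sub K k : (k <= K)%N ->
  'C(K - k, 2)%:Z - 'C(k, 2)%:Z = 'C(K, 2)%:Z - k%:Z * (K%:Z - 1).
Proof.
move=> kK; rewrite -{2}(subnK kK); set m := (K - k)%N.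
have -> : K%:Z = m%:Z + k%:Z by rewrite -PoszD subnK.
elim: k m {kK} => [|k IH] m; first by rewrite addn0 bin0n; lia.
have := IH m; rewrite addnS !binS !bin1; nia.
Qed.

(* Index form of the crossing of a strand of weight [2a], at x_i, passing over a strand of
   weight [2b], at x_j; [cCi] is the inverse crossing. *)
Definition cC (a b i j i' j' : nat) : R :=
  if (j <= j')%N && (i' + j' == i + j)%N then
    vz (- (2 * (a%:Z - i%:Z) * (b%:Z - j%:Z))) *
    ((-1) ^+ (j' - j) * vz (- 'C(j' - j, 2)%:Z) * vfact (j' - j) *
     (qbin j' (j' - j) * qbin (2 * a - i') (j' - j)))
  else 0.

Definition cCi (a b i j i' j' : nat) : R :=
  if (j <= j')%N && (i' + j' == i + j)%N then
    vz (2 * (a%:Z - i'%:Z) * (b%:Z - j'%:Z)) *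
    (vz 'C(j' - j, 2)%:Z * vfact (j' - j) *
     (qbin j' (j' - j) * qbin (2 * a - i') (j' - j)))
  else 0.

(** Conservation of weight confines the double sums below to a line, on which they become single
    sums. *)
Lemma sum_support (V : nmodType) (G : nat -> nat -> V) N M (f g : nat -> nat) K :
  (forall i j, (i < N)%N -> (j < M)%N -> G i j != 0 -> exists2 k, (k <= K)%N & i = f k /\ j = g k) ->
  (forall k, (k <= K)%N -> (f k < N)%N && (g k < M)%N) ->
  {in [pred k | (k <= K)%N] &, injective g} ->
  \sum_(i < N) \sum_(j < M) G i j = \sum_(k < K.+1) G (f k) (g k).
Proof.
move=> supp rng ginj; rewrite pair_bigA /=.
pose fg (k : 'I_K.+1) : 'I_N * 'I_M :=
  let h := rng k (ltn_ord k) in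
  (Ordinal (proj1 (andP h)), Ordinal (proj2 (andP h))).
have fg_inj : injective fg.
  move=> k l /(congr1 (fun x => val x.2)) /= e.
  by apply: val_inj; apply: (ginj _ _ _ _ e); rewrite inE -ltnS; apply: ltn_ord.
rewrite (bigID [pred ij | ij \in [set fg k | k : 'I_K.+1]]) /= [X in _ + X]big1 ?addr0 => [|ij nij].
  by rewrite big_imset /=; [apply: eq_bigl => k; rewrite inE | move=> k l _ _; exact: fg_inj].
apply/eqP; apply: contraNT nij => /(supp _ _ (ltn_ord _) (ltn_ord _))[k kK [e1 e2]].
apply/imsetP; exists (Ordinal (kK : (k < K.+1)%N)) => //.
by case: ij e1 e2 => i j /= e1 e2; congr (_, _); apply: val_inj.
Qed.

Lemma qbin_split n k l : (k + l <= n < p)%N ->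
  qbin n l * qbin (n - l) k = qbin n (k + l) * qbin (k + l) l.
Proof. by move=> /andP[h np]; rewrite qbin_mul 1?[(k + l)%N]addnC //; lia. Qed.

Lemma crossFE a b i j k l : (j + (k + l) <= 2 * b)%N -> (i + (k + l) <= 2 * a)%N ->
  ((2 * a).+2 < p)%N -> ((2 * b).+2 < p)%N ->
  vfact k * vfact l * (qbin (j + k) k * qbin (2 * a - (i + l)) k) *
   (qbin (j + (k + l)) l * qbin (2 * a - i) l) =
  vfact (k + l) * (qbin (j + (k + l)) (k + l) * qbin (2 * a - i) (k + l)) * qbin (k + l) l.
Proof.
move=> h1 h2 h3 h4.
have e1 := @qbin_split (j + (k + l)) k l ltac:(lia).
have e2 := @qbin_split (2 * a - i) k l ltac:(lia).
have e3 := @vfact_qbin (k + l) l ltac:(lia).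
rewrite addnK in e3; rewrite -subnDA in e2.
have ee1 : (j + (k + l) - l = j + k)%N by lia.
rewrite ee1 in e1; rewrite -e3.
transitivity (vfact k * vfact l * ((qbin (j + (k + l)) l * qbin (j + k) k) *
  (qbin (2 * a - i) l * qbin (2 * a - (i + l)) k))); first by ring.
by rewrite e1 e2; ring.
Qed.

Lemma crossFE' a b i j k l : (j + (k + l) <= 2 * b)%N -> (i + (k + l) <= 2 * a)%N ->
  ((2 * a).+2 < p)%N -> ((2 * b).+2 < p)%N ->
  vfact k * vfact l * (qbin (j + k) k * qbin (2 * a - i) k) *
   (qbin (j + (k + l)) l * qbin (2 * a - (i + k)) l) =
  vfact (k + l) * (qbin (j + (k + l)) (k + l) * qbin (2 * a - i) (k + l)) * qbin (k + l) k.
Proof.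
move=> h1 h2 h3 h4.
have e1 := @qbin_split (j + (k + l)) k l ltac:(lia).
have e2 := @qbin_split (2 * a - i) l k ltac:(lia).
have e3 := @vfact_qbin (k + l) l ltac:(lia).
rewrite addnK in e3; rewrite -subnDA [(l + k)%N]addnC in e2.
have ee1 : (j + (k + l) - l = j + k)%N by lia.
rewrite ee1 in e1; rewrite -e3.
transitivity (vfact k * vfact l * ((qbin (j + (k + l)) l * qbin (j + k) k) *
  (qbin (2 * a - i) k * qbin (2 * a - (i + k)) l))); first by ring.
by rewrite e1 e2; ring.
Qed.

Lemma crossS a b i j k : cC a b (i + k) j i (j + k) =
  vz (- (2 * (a%:Z - (i + k)%:Z) * (b%:Z - j%:Z))) *
    ((-1) ^+ k * vz (- 'C(k, 2)%:Z) * vfact k *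
     (qbin (j + k) k * qbin (2 * a - i) k)).
Proof. by rewrite /cC leq_addr addKn addnAC -addnA eqxx. Qed.

Lemma crossSi a b i j k : cCi a b (i + k) j i (j + k) =
  vz (2 * (a%:Z - i%:Z) * (b%:Z - (j + k)%:Z)) *
    (vz 'C(k, 2)%:Z * vfact k * (qbin (j + k) k * qbin (2 * a - i) k)).
Proof. by rewrite /cCi leq_addr addKn addnAC -addnA eqxx. Qed.

Lemma cross_supp a b i j i' j' : cC a b i j i' j' != 0 -> (j <= j')%N /\ (i' + j' = i + j)%N.
Proof. by rewrite /cC; case: ifP => [/andP[h /eqP e] _ //|]; rewrite eqxx. Qed.

Lemma crossi_supp a b i j i' j' : cCi a b i j i' j' != 0 -> (j <= j')%N /\ (i' + j' = i + j)%N.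
Proof. by rewrite /cCi; case: ifP => [/andP[h /eqP e] _ //|]; rewrite eqxx. Qed.

Lemma mulf_neq0P (x y : R) : x * y != 0 -> x != 0 /\ y != 0.
Proof.
by move=> h; split; apply: contraNneq h => ->; rewrite ?mul0r ?mulr0.
Qed.

(** The common scheme of [cross_invL] and [cross_invR]: when [K] units are moved in total, split
    between the two crossings, the terms are a common factor times a q-binomial row with signs,
    whose sum vanishes unless K = 0. *)
Lemma sum_cross (G : nat -> nat -> R) a b i j K (f : nat -> R) c :
  ((2 * a).+2 < p)%N -> (i + K <= 2 * a)%N -> (j + K <= 2 * b)%N -> (K = 0%N -> f 0%N = 1) ->
  (forall i1 j1, G i1 j1 != 0 -> exists2 k, (k <= K)%N & i1 = (i + k)%N /\ j1 = (j + (K - k))%N) ->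
  (forall k, (k <= K)%N -> G (i + k)%N (j + (K - k))%N = c * (f k * qbin K k)) ->
  ((0 < K < p)%N -> \sum_(k < K.+1) f k * qbin K k = 0) ->
  \sum_(i1 < (2 * a).+1) \sum_(j1 < (2 * b).+1) G i1 j1 = c * (K == 0%N)%:R.
Proof.
move=> ha hi hj f0 supp Gf sf.
rewrite (@sum_support _ G _ _ (fun k => i + k)%N (fun k => j + (K - k))%N K); first last.
- by move=> k l; rewrite !inE => kK lK /addnI; lia.
- by move=> k kK; apply/andP; split; lia.
- by move=> i1 j1 _ _; exact: supp.
rewrite (eq_bigr (fun k : 'I_K.+1 => c * (f k * qbin K k))); last first.
  by move=> k _; apply: Gf; rewrite -ltnS.
rewrite -mulr_sumr; congr (_ * _); have [K0|K0] := posnP K.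
  by rewrite K0 big_ord1 /= f0 // qbin0 mulr1.
by rewrite sf ?(gtn_eqF K0) //; lia.
Qed.

Lemma cross_cond a b i j i1 j1 i' j' : cCi a b i j i1 j1 * cC a b i1 j1 i' j' != 0 ->
  [/\ (j <= j1 <= j')%N, (i1 + j1 = i + j)%N & (i' + j' = i + j)%N].
Proof.
by move=> /mulf_neq0P[/crossi_supp[h1 h2] /cross_supp[h3 h4]]; split; rewrite ?h1 ?h3 //; lia.
Qed.

Lemma cross_cond' a b i j i1 j1 i' j' : cC a b i j i1 j1 * cCi a b i1 j1 i' j' != 0 ->
  [/\ (j <= j1 <= j')%N, (i1 + j1 = i + j)%N & (i' + j' = i + j)%N].
Proof.
by move=> /mulf_neq0P[/cross_supp[h1 h2] /crossi_supp[h3 h4]]; split; rewrite ?h1 ?h3 //; lia.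
Qed.

Lemma cross_delta (G : nat -> nat -> R) N M i j i' j' :
  (forall i1 j1, G i1 j1 != 0 -> (j <= j')%N && (i' + j' == i + j)%N) ->
  ((j <= j')%N && (i' + j' == i + j)%N ->
    \sum_(i1 < N) \sum_(j1 < M) G i1 j1 = ((i == i') && (j == j'))%:R) ->
  \sum_(i1 < N) \sum_(j1 < M) G i1 j1 = ((i == i') && (j == j'))%:R.
Proof.
move=> h1 h2.
have [c|nc] := boolP ((j <= j')%N && (i' + j' == i + j)%N); first exact: h2.
rewrite [RHS](_ : _ = 0); last first.
  by case: eqP => // e; case: eqP => // e'; move: nc; rewrite e e' leqnn eqxx.
rewrite big1 // => i1 _; rewrite big1 // => j1 _; apply/eqP; apply: contraNT nc; exact: h1.
Qed.

Lemma cross_invL a b i j i' j' : (i <= 2 * a)%N -> (j' <= 2 * b)%N ->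
  ((2 * a).+2 < p)%N -> ((2 * b).+2 < p)%N ->
  \sum_(i1 < (2 * a).+1) \sum_(j1 < (2 * b).+1) cCi a b i j i1 j1 * cC a b i1 j1 i' j' =
  ((i == i') && (j == j'))%:R.
Proof.
move=> hi hj' ha hb.
apply: (@cross_delta (fun i1 j1 => cCi a b i j i1 j1 * cC a b i1 j1 i' j')).
  by move=> i1 j1 /cross_cond[? ? ?]; apply/andP; split; [|apply/eqP]; lia.
move=> /andP[lj /eqP e]; set K := (j' - j)%N; have ej : j' = (j + K)%N by rewrite subnKC.
have ei : i = (i' + K)%N by lia.
rewrite ej ei in hi hj' *.
have -> : (i' + K == i')%N && (j == j + K)%N = (K == 0)%N by apply/andP/eqP; lia.
rewrite (@sum_cross (fun i1 j1 => cCi a b (i' + K) j i1 j1 * cC a b i1 j1 i' (j + K)) a b i' j K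
  (fun k => (-1) ^+ k * vz (- (k%:Z * (K%:Z - 1))))
  (vfact K * (qbin (j + K) K * qbin (2 * a - i') K) * vz ('C(K, 2)%:Z))) //.
- by case: eqP => [K0|_]; rewrite ?mulr0 // K0 vfact0 !qbin0 bin0n vz0 !mulr1.
- by move=> ->; rewrite mul0r oppr0 vz0 expr0 mulr1.
- by move=> i1 j1 /cross_cond[? ? ?]; exists (i1 - i')%N; [|split]; lia.
- move=> l lK; set k := (K - l)%N; have eK : K = (k + l)%N by rewrite /k; lia.
  have h1 : (i' + l + k = i' + K)%N by lia.
  have h2 : (j + k + l = j + K)%N by lia.
  have E1 := crossSi a b (i' + l) j k; rewrite h1 in E1.
  have E2 := crossS a b i' (j + k) l; rewrite h2 in E2.
  rewrite E1 E2.
  have eF := @crossFE a b i' j k l; rewrite -eK in eF; have {}eF := eF hj' hi ha hb.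
  have eC := bin2_sub lK; rewrite -/k in eC.
  set X := vz (2 * _ * _); set Y := vz (- _); have XY : X * Y = 1 by rewrite -vzD subrr vz0.
  transitivity ((X * Y) * (-1) ^+ l * vz ('C(k, 2)%:Z - 'C(l, 2)%:Z) *
     (vfact k * vfact l * (qbin (j + k) k * qbin (2 * a - (i' + l)) k) *
     (qbin (j + K) l * qbin (2 * a - i') l))); first by rewrite vzD; ring.
  by rewrite eF XY eC vzD; ring.
- exact: sum_qbinV0.
Qed.

Lemma cross_invR a b i j i' j' : (i <= 2 * a)%N -> (j' <= 2 * b)%N ->
  ((2 * a).+2 < p)%N -> ((2 * b).+2 < p)%N ->
  \sum_(i1 < (2 * a).+1) \sum_(j1 < (2 * b).+1) cC a b i j i1 j1 * cCi a b i1 j1 i' j' =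
  ((i == i') && (j == j'))%:R.
Proof.
move=> hi hj' ha hb.
apply: (@cross_delta (fun i1 j1 => cC a b i j i1 j1 * cCi a b i1 j1 i' j')).
  by move=> i1 j1 /cross_cond'[? ? ?]; apply/andP; split; [|apply/eqP]; lia.
move=> /andP[lj /eqP e]; set K := (j' - j)%N; have ej : j' = (j + K)%N by rewrite subnKC.
have ei : i = (i' + K)%N by lia.
rewrite ej ei in hi hj' *.
have -> : (i' + K == i')%N && (j == j + K)%N = (K == 0)%N by apply/andP/eqP; lia.
rewrite (@sum_cross (fun i1 j1 => cC a b (i' + K) j i1 j1 * cCi a b i1 j1 i' (j + K)) a b i' j K
  (fun k => (-1) ^+ (K - k) * vz (k%:Z * (K%:Z - 1)))
  (vfact K * (qbin (j + K) K * qbin (2 * a - i') K) *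
   vz (2 * (a%:Z - i'%:Z) * (b%:Z - (j + K)%:Z) - 2 * (a%:Z - (i' + K)%:Z) * (b%:Z - j%:Z)
       - 'C(K, 2)%:Z))) //.
- case: eqP => [K0|_]; rewrite ?mulr0 // K0 vfact0 !qbin0 bin0n !mulr1 !mul1r !addn0.
  by rewrite subrr -[RHS]vz0.
- by move=> ->; rewrite mul0r vz0 expr0 mulr1.
- by move=> i1 j1 /cross_cond'[? ? ?]; exists (i1 - i')%N; [|split]; lia.
- move=> l lK; set k := (K - l)%N; have eK : K = (k + l)%N by rewrite /k; lia.
  have h1 : (i' + l + k = i' + K)%N by lia.
  have h2 : (j + k + l = j + K)%N by lia.
  have E1 := crossS a b (i' + l) j k; rewrite h1 in E1.
  have E2 := crossSi a b i' (j + k) l; rewrite h2 in E2.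
  rewrite E1 E2.
  have eF := @crossFE a b i' j k l; rewrite -eK in eF; have {}eF := eF hj' hi ha hb.
  have eC := bin2_sub lK; rewrite -/k in eC.
  have -> : 2 * (a%:Z - i'%:Z) * (b%:Z - (j + K)%:Z) - 2 * (a%:Z - (i' + K)%:Z) * (b%:Z - j%:Z)
       - 'C(K, 2)%:Z = (- (2 * (a%:Z - (i' + K)%:Z) * (b%:Z - j%:Z))) +
        (2 * (a%:Z - i'%:Z) * (b%:Z - (j + K)%:Z)) + (- 'C(k, 2)%:Z + 'C(l, 2)%:Z - l%:Z * (K%:Z - 1)).
    by move: eC; lia.
  rewrite !vzD; set X := vz (2 * _ * _); set Y := vz (- (2 * _ * _)); set Z := vz (- (l%:Z * _)).
  set W := vz (l%:Z * _); have ZW : Z * W = 1 by rewrite -vzD addNr vz0.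
  transitivity (X * Y * (-1) ^+ k * vz (- 'C(k, 2)%:Z) * vz ('C(l, 2)%:Z) * (Z * W) *
     (vfact k * vfact l * (qbin (j + k) k * qbin (2 * a - (i' + l)) k) *
     (qbin (j + K) l * qbin (2 * a - i') l))); first by rewrite ZW; ring.
  by rewrite eF; ring.
- move=> /andP[K0 Kp].
  transitivity ((-1) ^+ K * \sum_(k < K.+1) (-1) ^+ k * vz (k%:Z * (K%:Z - 1)) * qbin K k).
    rewrite mulr_sumr; apply: eq_bigr => k _.
    have kK : (k <= K)%N by rewrite -ltnS.
    by rewrite -[(-1) ^+ (K - k)]signr_odd oddB // signr_addb !signr_odd !mulrA.
  by rewrite sum_qbin0 // mulr0.
Qed.

(** Here the strand of weight [2a] is closed up between the two crossings. The weight of the closure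
    combines with the exponents of the crossings to those of [sum_qbin0], so the closed strand slips
    off the other one. *)
Lemma cross_trace a b i j i' j' : (i <= 2 * a)%N -> (j' <= 2 * b)%N ->
  ((2 * a).+2 < p)%N -> ((2 * b).+2 < p)%N ->
  \sum_(i1 < (2 * a).+1) \sum_(j1 < (2 * b).+1)
     vz (2 * (a%:Z - i1%:Z)) * cC a b i1 j i' j1 * cCi a b i j1 i1 j' =
  vz (2 * (a%:Z - i%:Z)) * ((i == i') && (j == j'))%:R.
Proof.
move=> hi hj' ha hb.
pose G i1 j1 := vz (2 * (a%:Z - i1%:Z)) * cC a b i1 j i' j1 * cCi a b i j1 i1 j'.
have supp i1 j1 : G i1 j1 != 0 ->
  [/\ (j <= j1 <= j')%N, (i1 + j = i' + j1)%N & (i' + j' = i + j)%N].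
  move=> /mulf_neq0P[/mulf_neq0P[_ /cross_supp[h1 h2]] /crossi_supp[h3 h4]].
  by split; rewrite ?h1 ?h3 //; lia.
have [c|nc] := boolP ((j <= j')%N && (i' + j' == i + j)%N); last first.
  rewrite [RHS](_ : _ = 0); last first.
    by case: eqP => [e|_]; rewrite ?mulr0 //; case: eqP => e'; rewrite ?mulr0 //; move: nc; rewrite e e' leqnn eqxx.
  rewrite big1 // => i1 _; rewrite big1 // => j1 _; apply/eqP; apply: contraNT nc.
  by move=> /supp[? ? ?]; apply/andP; split; [|apply/eqP]; lia.
move: c => /andP[lj /eqP e]; set K := (j' - j)%N; have ej : j' = (j + K)%N by rewrite subnKC.
have ei : i = (i' + K)%N by lia.
rewrite ej ei in hi hj' supp *.
have -> : (i' + K == i')%N && (j == j + K)%N = (K == 0)%N by apply/andP/eqP; lia.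
have -> : \sum_(i1 < (2 * a).+1) \sum_(j1 < (2 * b).+1)
     vz (2 * (a%:Z - i1%:Z)) * cC a b i1 j i' j1 * cCi a b (i' + K) j1 i1 (j + K) =
  \sum_(i1 < (2 * a).+1) \sum_(j1 < (2 * b).+1) G i1 j1.
  by rewrite /G -ej -ei.
rewrite (@sum_support _ G _ _ (fun k => i' + k)%N (fun k => j + k)%N K); first last.
- by move=> k l; rewrite !inE => kK lK /addnI; lia.
- by move=> k kK; apply/andP; split; lia.
- by move=> i1 j1 _ _ /supp[? ? ?]; exists (j1 - j)%N; [|split]; lia.
pose c := vfact K * (qbin (j + K) K * qbin (2 * a - i') K) *
   vz (2 * (a%:Z - i'%:Z) * (1 - K%:Z) + 'C(K, 2)%:Z).
rewrite (eq_bigr (fun k : 'I_K.+1 => c * ((-1) ^+ k * vz (k%:Z * (K%:Z - 1)) * qbin K k))).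
  rewrite -mulr_sumr; have [K0|K0] := posnP K.
    rewrite K0 big_ord1 /= /c K0 vfact0 !qbin0 bin0n !mulr1 mul0r vz0 expr0 addn0 !mul1r !mulr1.
    by rewrite addr0.
  by rewrite sum_qbin0 // !mulr0.
move=> k _; have kK : (k <= K)%N by rewrite -ltnS.
set l := (K - k)%N; have eK : K = (k + l)%N by rewrite /l; lia.
have h1 : (i' + k + l = i' + K)%N by lia.
have h2 : (j + k + l = j + K)%N by lia.
have E2 := crossSi a b (i' + k) (j + k) l; rewrite h1 h2 in E2.
rewrite /G ei ej E2 crossS.
have eF := @crossFE' a b i' j k l; rewrite -eK in eF; have {}eF := eF hj' hi ha hb.
have eC := bin2_sub kK; rewrite -/l in eC.
rewrite /c; set X := vz (2 * _); set Y := vz (- (2 * _ * _)); set Z := vz (2 * _ * _).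
transitivity ((-1) ^+ k * (X * Y * Z * vz (- 'C(k, 2)%:Z) * vz 'C(l, 2)%:Z) *
   (vfact k * vfact l * (qbin (j + k) k * qbin (2 * a - i') k) *
     (qbin (j + K) l * qbin (2 * a - (i' + k)) l))); first by ring.
have -> : X * Y * Z * vz (- 'C(k, 2)%:Z) * vz 'C(l, 2)%:Z =
  vz (2 * (a%:Z - i'%:Z) * (1 - K%:Z) + 'C(K, 2)%:Z) * vz (k%:Z * (K%:Z - 1)).
  rewrite -!vzD; congr vz; move: eC; rewrite !PoszD; nia.
by rewrite eF; ring.
Qed.

Lemma qint_exchange j k c :
  vdif 1 * (qint (j + k.+1) * qint c - qint j * qint (c + k.+1)) = qint k.+1 * vdif (c%:Z - j%:Z).
Proof.
apply: qdif1_inj.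
transitivity ((vdif 1 * qint (j + k.+1)) * (vdif 1 * qint c) -
  (vdif 1 * qint j) * (vdif 1 * qint (c + k.+1))); first by ring.
rewrite [RHS]mulrA !qint_dif !vdifM !PoszD.
set A := j%:Z; set B := k.+1%:Z; set C := c%:Z.
have -> : - (A + B + C) = - (A + (C + B)) by ring.
have -> : A + B + C = A + (C + B) by ring.
have -> : A + B - C = B - (C - A) by ring.
have -> : C + B - A = B + (C - A) by ring.
have -> : C - (A + B) = C - A - B by ring.
have -> : A - (C + B) = - (B + (C - A)) by ring.
set x := vz _; set y := vz _; set z := vz _; set t := vz _; set u := vz _; set w := vz _; ring.
Qed.

(* The first strand of weight [2a] and the second of weight [2b] exchange places; both
   sides are the matrix coefficients of the crossing composed with [E (x) 1 + K (x) E]. *)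
Lemma cross_intertwine a b i j i' j' : (i <= 2 * a)%N -> (j <= 2 * b)%N ->
  (i' <= 2 * a)%N -> (j' <= 2 * b)%N -> ((2 * a).+2 < p)%N -> ((2 * b).+2 < p)%N ->
  cC a b i j i' j'.+1 * qint (2 * b - j') +
  cC a b i j i'.+1 j' * (vz (2 * (b%:Z - j'%:Z)) * qint (2 * a - i')) =
  (if (0 < i)%N then qint (2 * a - i.-1) * cC a b i.-1 j i' j' else 0) +
  (if (0 < j)%N then vz (2 * (a%:Z - i%:Z)) * qint (2 * b - j.-1) * cC a b i j.-1 i' j' else 0).
Proof.
move=> hi hj hi' hj' ha hb.
have zero i1 j1 i2 j2 : ~~ ((j1 <= j2) && (i2 + j2 == i1 + j1))%N -> cC a b i1 j1 i2 j2 = 0.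
  by rewrite /cC => /negbTE ->.
have [e|ne] := eqVneq (i + j)%N (i' + j').+1; last first.
  rewrite (zero i j i' j'.+1); last by apply/nandP; right; lia.
  rewrite (zero i j i'.+1 j'); last by apply/nandP; right; lia.
  rewrite !mul0r addr0; case: ifP => i0; case: ifP => j0;
    rewrite ?(zero i.-1 j i' j') ?(zero i j.-1 i' j') ?mulr0 ?addr0 //;
    by apply/nandP; right; lia.
case: (ltnP j'.+1 j) => [lt|le].
  rewrite (zero i j i' j'.+1); last by apply/nandP; left; lia.
  rewrite (zero i j i'.+1 j'); last by apply/nandP; left; lia.
  rewrite (zero i.-1 j i' j'); last by apply/nandP; left; lia.
  rewrite (zero i j.-1 i' j'); last by apply/nandP; left; lia.
  by rewrite !mul0r !mulr0 !if_same.
(* The extreme case: only the leading terms of the crossing occur, one on each side. *)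
have [ej|nej] := eqVneq j j'.+1.
  have ei : i = i' by lia.
  have h0 : (0 < j)%N by lia.
  rewrite (zero i j i'.+1 j') ?mul0r ?addr0; last by apply/nandP; left; lia.
  rewrite (zero i.-1 j i' j') ?mulr0 ?if_same ?add0r; last by apply/nandP; left; lia.
  rewrite h0 ej ei /=.
  have := crossS a b i' j'.+1 0; rewrite !addn0 => ->.
  have := crossS a b i' j' 0; rewrite !addn0 => ->.
  rewrite !qbin0 vfact0 bin0n oppr0 !vz0 expr0 !mulr1 [RHS]mulrAC -vzD [LHS]mulrC [RHS]mulrC.
  by congr (_ * vz _); rewrite intS; ring.
(* In the generic case all four coefficients are multiples of one product of binomials, and what
   remains is [qint_exchange]. *)
set k := (j' - j)%N; have ej : j' = (j + k)%N by rewrite /k; lia.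
have ei : i = (i' + k.+1)%N by lia.
have i0 : (0 < i)%N by lia.
have [n en] : exists n, (2 * a - i' = n.+1)%N by exists (2 * a - i').-1; lia.
set alpha : int := a%:Z - i%:Z; set beta : int := b%:Z - j%:Z.
have E1 : cC a b i j i' j'.+1 = vz (- (2 * alpha * beta)) * ((-1) ^+ k.+1 *
    vz (- 'C(k.+1, 2)%:Z) * vfact k.+1 * (qbin (j + k).+1 k.+1 * qbin n.+1 k.+1)).
  by have := crossS a b i' j k.+1; rewrite -ei addnS -ej en.
have E2 : cC a b i j i'.+1 j' = vz (- (2 * alpha * beta)) * ((-1) ^+ k *
    vz (- 'C(k, 2)%:Z) * vfact k * (qbin (j + k) k * qbin n k)).
  have := crossS a b i'.+1 j k; rewrite addSnnS -ei -ej.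
  by have -> : (2 * a - i'.+1)%N = n by lia.
have E3 : cC a b i.-1 j i' j' = vz (- (2 * (alpha + 1) * beta)) * ((-1) ^+ k *
    vz (- 'C(k, 2)%:Z) * vfact k * (qbin (j + k) k * qbin n.+1 k)).
  have := crossS a b i' j k; rewrite -ej en.
  have -> : (i' + k = i.-1)%N by lia.
  have -> : (i.-1)%:Z = i%:Z - 1 by lia.
  by move=> ->; congr (vz _ * _); rewrite /alpha /beta; ring.
have E4 : (if (0 < j)%N then vz (2 * alpha) * qint (2 * b - j.-1) * cC a b i j.-1 i' j' else 0) =
  vz (- (2 * alpha * beta)) * qint ((2 * b - (j + k)) + k.+1) * ((-1) ^+ k.+1 *
    vz (- 'C(k.+1, 2)%:Z) * vfact k.+1 * (qbin (j + k) k.+1 * qbin n.+1 k.+1)).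
  case: (posnP j) => [j0|j0].
    by rewrite [in X in qbin X]j0 add0n qbin_gt // mul0r !mulr0.
  have := crossS a b i' j.-1 k.+1; rewrite -ei addnS -addSn prednK // -ej en => ->.
  have -> : (2 * b - j.-1 = 2 * b - (j + k) + k.+1)%N by lia.
  rewrite mulrA [vz _ * _ * vz _]mulrAC -vzD -ej; congr (vz _ * _ * _).
  have -> : (j.-1)%:Z = j%:Z - 1 by lia.
  by rewrite /alpha /beta; ring.
rewrite i0 E1 E2 E3 E4.
have b1 := @qbinSS (j + k) k ltac:(lia) ltac:(lia).
have b2 := @qbinSS n k ltac:(lia) ltac:(lia).
have b3 := @qbinS (j + k) k ltac:(lia) ltac:(lia); rewrite addnK in b3.
have b4 := @qbinSr n k ltac:(lia) ltac:(lia).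
have -> : (2 * a - i.-1 = n.+1 - k)%N by lia.
rewrite ej en -addnS.
have e1 := qint_exchange j k (2 * b - (j + k)).
have bS : 'C(k.+1, 2)%:Z = 'C(k, 2)%:Z + k%:Z by rewrite binS bin1 PoszD.
have -> : vz (- 'C(k.+1, 2)%:Z) = vz (- 'C(k, 2)%:Z) * vz (- k%:Z) by rewrite bS opprD vzD.
have -> : vz (- (2 * (alpha + 1) * beta)) = vz (- (2 * alpha * beta)) * vz (- (2 * beta)).
  by rewrite -vzD; congr vz; ring.
have eX : vz (- k%:Z) * vdif ((2 * b - (j + k))%N%:Z - j%:Z) =
   vz (2 * (b%:Z - (j + k)%:Z)) - vz (- (2 * beta)).
  by rewrite /qdif mulrBr -!vzD; congr (vz _ - vz _); rewrite /beta; lia.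
(* Multiplying by [k+1] makes the recursions [b1] to [b4] between neighbouring binomials applicable
   without quotients. *)
apply: (@unit_mulI _ (qint k.+1)); first by apply: qint_unit; lia.
rewrite vfactS -qint_dif exprS addnS.
set q := qint k.+1 in b1 b2 b3 b4 e1 eX *.
set X := vz (- (2 * alpha * beta)); set V1 := vz (- k%:Z) in eX *.
set V2 := vz (2 * _) in eX *; set V3 := vz (- (2 * beta)) in eX *.
set U := vz (- 'C(k, 2)%:Z); set s := (-1) ^+ k; set f := vfact k; set d := vdif 1 in e1 *.
set q1 := qint (n.+1 - k) in b4 *; set q2 := qint (2 * b - (j + k)) in e1 *.
set q3 := qint (2 * b - (j + k) + k.+1) in e1 *; set q4 := qint (j + k).+1 in b1.
rewrite addnS -/q4 in e1.
set M := qbin (j + k) k in b1 b3 *; set N := qbin n k in b2 b4 *.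
set T := qint n.+1 in b2 b4 *; set Y := vdif _ in e1 eX.
transitivity (X * s * U * f * (- (V1 * d * (qbin (j + k).+1 k.+1 * q) * (qbin n.+1 k.+1 * q) * q2)
   + V2 * q * M * (N * T))); first by ring.
transitivity (X * s * U * f * ( V3 * q * M * (qbin n.+1 k * q1) -
    V1 * d * (qbin (j + k) k.+1 * q) * (qbin n.+1 k.+1 * q) * q3)); last by ring.
rewrite b1 b2 b3 b4; congr (_ * _).
apply/eqP; rewrite -subr_eq0; apply/eqP.
transitivity (M * N * T * ((V2 - V3) * q - V1 * (d * (q4 * q2 - qint j * q3)))); first by ring.
by rewrite e1 -eX; ring.
Qed.

End QuantumIdentities.

(** * The braiding in the bases of the simple modules *)

Section Crossings.
Variable p : nat.
Hypothesis p_pr : prime p.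
Hypothesis p_ge5 : (5 <= p)%N.
Local Notation R := (Rp p).
Local Notation vz := (vz p).
Local Notation cC := (@cC R vz (vfact p) (qbin p)).
Local Notation cCi := (@cCi R vz (vfact p) (qbin p)).
Implicit Types x y : bvec p.

(** The arguments are ordered by strand rather than by position: [x] becomes [x'] and [y] becomes
    [y']. *)
Definition over x y x' y' : R := braiding x y y' x'.
Definition overV x y x' y' : R := braidingV y x x' y'.

(* [tagged x] has a type depending on [tag x]; [bidx] hides this. *)
Definition bidx x : nat := tagged x.

Lemma hwtE x : hwt x = (tag x)%:Z - (bidx x)%:Z. Proof. by []. Qed.

Lemma simple_lt (z : simple p) : ((2 * z).+2 < p)%N.
Proof.
move: (ltn_ord z); move: (nat_of_ord z) => k.
by rewrite card_simple // => h; have := spE p_pr p_ge5; lia.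
Qed.

Lemma bidx_le x : (bidx x <= 2 * tag x)%N.
Proof. by rewrite -ltnS ltn_ord. Qed.

Lemma bvec_eq x y : (x == y) = (tag x == tag y) && (bidx x == bidx y).
Proof.
apply/eqP/andP => [-> //|[/eqP]].
rewrite /bidx; case: x y => [z i] [z' i'] /= e; subst z'; move=> /eqP /val_inj -> //.
Qed.

Lemma sum_bvec (V : nmodType) (z : simple p) (G : bvec p -> V) (f : nat -> V) :
  (forall x, tag x = z -> G x = f (bidx x)) -> (forall x, tag x != z -> G x = 0) ->
  \sum_x G x = \sum_(i < (2 * z).+1) f i.
Proof.
move=> h1 h2.
pose F (z' : simple p) (i : 'I_(2 * z').+1) := G (Tagged (fun z : simple p => 'I_(2 * z).+1) i).
rewrite (eq_bigr (fun x => F (tag x) (tagged x))); last by move=> [].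
rewrite -(@sig_big_dep _ _ _ _ (fun z : simple p => 'I_(2 * z).+1) xpredT (fun _ _ => true) F) /=.
rewrite (bigD1 z) //= [X in _ + X]big1 ?addr0 => [|z' nz].
  by apply: eq_bigr => i _; rewrite /F h1.
by apply: big1 => i _; rewrite /F h2.
Qed.

Lemma sum_pick (V : nmodType) (I : finType) (P : pred I) (F : I -> V) (i : I) :
  P i -> (forall j, P j -> j != i -> F j = 0) -> \sum_(j | P j) F j = F i.
Proof. by move=> Pi h; rewrite (bigD1 i) //= big1 ?addr0 // => j /andP[]; exact: h. Qed.

Lemma FdivE k x y :
  Fdiv k x y = if (tag y == tag x) && (bidx y == bidx x + k)%N then qbin p (bidx y) k else 0.
Proof. by []. Qed.

Lemma EdivE k x y : Ediv k x y =
  if (tag y == tag x) && (bidx x == bidx y + k)%N then qbin p (2 * tag x - bidx y) k else 0.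
Proof. by []. Qed.

(** Weights leave only [k = k0] in the sum over the powers of F and E, and the range k < p contains
    it because 2z + 2 < p. *)
Lemma FE_pick (c : nat -> R) x y x' y' (k0 := (bidx y' - bidx y)%N) :
  \sum_(k < p) c k * (Fdiv k y y' * Ediv k x x') =
  if [&& tag x' == tag x, tag y' == tag y, (bidx y <= bidx y')%N &
     (bidx x' + bidx y' == bidx x + bidx y)%N]
  then c k0 * (qbin p (bidx y') k0 * qbin p (2 * tag x - bidx x') k0) else 0.
Proof.
have k0p : (k0 < p)%N.
  have := bidx_le y'; have := simple_lt (tag y'); rewrite /k0; lia.
case: ifP => [/and4P[tx ty le /eqP e]|h].
  rewrite (@sum_pick _ _ _ _ (Ordinal k0p)) //=.
    rewrite FdivE EdivE tx ty /=.
    by rewrite !ifT //; apply/eqP; rewrite /k0; lia.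
  move=> k _ nk; rewrite FdivE; case: ifP => [/andP[_ /eqP ek]|_]; last by rewrite mul0r mulr0.
  by case/negP: nk; apply/eqP/val_inj; rewrite /= /k0 ek addKn.
apply: big1 => k _; rewrite FdivE EdivE.
case: ifP => [/andP[ty /eqP ek]|_]; last by rewrite mul0r mulr0.
case: ifP => [/andP[tx /eqP ek']|_]; last by rewrite !mulr0.
by move: h; rewrite tx ty ek ek' /= leq_addr /= addnA addnAC eqxx.
Qed.

Lemma overE x y x' y' : over x y x' y' =
  if (tag x' == tag x) && (tag y' == tag y)
  then cC (tag x) (tag y) (bidx x) (bidx y) (bidx x') (bidx y') else 0.
Proof.
rewrite /over /braiding (FE_pick (fun k => (-1) ^+ k * vz (- 'C(k, 2)%:Z) * vfact p k)) /cC.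
case: eqP => //= [_|]; last by rewrite mulr0.
case: eqP => //= [_|]; last by rewrite mulr0.
by case: ifP => _; rewrite ?mulr0.
Qed.

Lemma overVE x y x' y' : overV x y x' y' =
  if (tag x' == tag x) && (tag y' == tag y)
  then cCi (tag x) (tag y) (bidx x) (bidx y) (bidx x') (bidx y') else 0.
Proof.
rewrite /overV /braidingV (FE_pick (fun k => vz ('C(k, 2)%:Z) * vfact p k)) /cCi.
case: eqP => //= [ex|]; last by rewrite mulr0.
case: eqP => //= [ey|]; last by rewrite mulr0.
case: ifP => _; rewrite ?mulr0 //; congr (vz _ * _).
by rewrite !hwtE ex ey; ring.
Qed.

Lemma qint0E : qint p 0 = 0. Proof. by rewrite /qint big_ord0. Qed.
Lemma qfact0E : qfact p 0 = 1. Proof. by rewrite /qfact big_ord0. Qed.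
Lemma qfactSE m : qfact p m.+1 = qfact p m * qint p m.+1.
Proof. by rewrite /qfact big_ord_recr. Qed.
Lemma vfact0E : vfact p 0 = 1. Proof. by rewrite /vfact big_ord0. Qed.
Lemma vfactSE m : vfact p m.+1 = vfact p m * qdif vz m.+1%:Z.
Proof. by rewrite /vfact big_ord_recr. Qed.
Lemma qbin0E n : qbin p n 0 = 1. Proof. by case: n. Qed.
Lemma qbin0SE k : qbin p 0 k.+1 = 0. Proof. by []. Qed.
Lemma qbinSSE n k :
  qbin p n.+1 k.+1 = vz (- k.+1%:Z) * qbin p n k.+1 + vz (n.+1%:Z - k.+1%:Z) * qbin p n k.
Proof. by []. Qed.
Lemma vzDE a b : vz (a + b) = vz a * vz b. Proof. exact: vzD. Qed.
Lemma qint_difE n : qdif vz 1 * qint p n = qdif vz n%:Z. Proof. exact: qintE. Qed.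
Lemma qdif1_injE (x y : R) : qdif vz 1 * x = qdif vz 1 * y -> x = y.
Proof. exact: vdif1_inj. Qed.

Lemma sum2_bvec (a b : simple p) (G : bvec p -> bvec p -> R) (f : nat -> nat -> R) :
  (forall x y, G x y = if (tag x == a) && (tag y == b) then f (bidx x) (bidx y) else 0) ->
  \sum_x \sum_y G x y = \sum_(i < (2 * a).+1) \sum_(j < (2 * b).+1) f i j.
Proof.
move=> h; apply: (@sum_bvec _ a _ (fun i => \sum_(j < (2 * b).+1) f i j)) => x tx.
  apply: (@sum_bvec _ b _ (f (bidx x))) => y ty; rewrite h tx eqxx; first by rewrite ty eqxx.
  by rewrite (negbTE ty).
by apply: big1 => y _; rewrite h (negbTE tx).
Qed.

Lemma sum2_over (G : bvec p -> bvec p -> R) (f : nat -> nat -> R) (c : R) x y x' y' :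
  (forall x1 y1, G x1 y1 = if [&& tag x1 == tag x, tag y1 == tag y, tag x' == tag x & tag y' == tag y]
     then f (bidx x1) (bidx y1) else 0) ->
  (tag x' = tag x -> tag y' = tag y ->
    \sum_(i < (2 * tag x).+1) \sum_(j < (2 * tag y).+1) f i j =
    c * ((bidx x == bidx x') && (bidx y == bidx y'))%:R) ->
  \sum_x1 \sum_y1 G x1 y1 = c * ((x == x') && (y == y'))%:R.
Proof.
move=> hG hf.
have [/andP[/eqP tx /eqP ty]|ntt] := boolP ((tag x' == tag x) && (tag y' == tag y)); last first.
  have /negbTE -> : ~~ ((x == x') && (y == y')).
    by apply/negP => /andP[/eqP e1 /eqP e2]; move: ntt; rewrite e1 e2 !eqxx.
  rewrite mulr0.
  rewrite big1 // => x1 _; rewrite big1 // => y1 _; rewrite hG.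
  by rewrite (negbTE ntt) !andbF.
rewrite (@sum2_bvec (tag x) (tag y) _ f) ?hf //.
  by rewrite !bvec_eq tx ty !eqxx.
by move=> x1 y1; rewrite hG tx ty !eqxx !andbT.
Qed.

Lemma over_invL x y x' y' :
  \sum_x1 \sum_y1 overV x y x1 y1 * over x1 y1 x' y' = ((x == x') && (y == y'))%:R.
Proof.
rewrite -[RHS]mul1r; apply: (@sum2_over _ (fun i1 j1 =>
   cCi (tag x) (tag y) (bidx x) (bidx y) i1 j1 * cC (tag x) (tag y) i1 j1 (bidx x') (bidx y'))).
  move=> x1 y1; rewrite overE overVE.
  case: eqP => [->|_]; rewrite ?mul0r //=; case: eqP => [->|_]; rewrite ?mul0r //=.
  by case: ifP => _; rewrite ?mulr0.
move=> tx ty; rewrite mul1r; apply: (@cross_invL R p vz (qint p) (qfact p) (vfact p) (qbin p)) => //;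
  solve [exact: vz0E | exact: vzDE | exact: qint0E | exact: qint_unit | exact: qfact0E
    | exact: qfactSE | exact: qbin0E | exact: qbin_fact | exact: vfact0E | exact: vfactSE
    | exact: qint_difE | exact: qdif1_injE | exact: bidx_le | rewrite -ty; exact: bidx_le
    | exact: simple_lt ].
Qed.

Lemma over_invR x y x' y' :
  \sum_x1 \sum_y1 over x y x1 y1 * overV x1 y1 x' y' = ((x == x') && (y == y'))%:R.
Proof.
rewrite -[RHS]mul1r; apply: (@sum2_over _ (fun i1 j1 =>
   cC (tag x) (tag y) (bidx x) (bidx y) i1 j1 * cCi (tag x) (tag y) i1 j1 (bidx x') (bidx y'))).
  move=> x1 y1; rewrite overE overVE.
  case: eqP => [->|_]; rewrite ?mul0r //=; case: eqP => [->|_]; rewrite ?mul0r //=.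
  by case: ifP => _; rewrite ?mulr0.
move=> tx ty; rewrite mul1r; apply: (@cross_invR R p vz (qint p) (qfact p) (vfact p) (qbin p)) => //;
  solve [exact: vz0E | exact: vzDE | exact: qint0E | exact: qint_unit | exact: qfact0E
    | exact: qfactSE | exact: qbin0E | exact: qbin_fact | exact: vfact0E | exact: vfactSE
    | exact: qint_difE | exact: qdif1_injE | exact: bidx_le | rewrite -ty; exact: bidx_le
    | exact: simple_lt ].
Qed.

(* Weight of a strand closed up on its left; the closure in [closure_value] uses the inverse
   power of [v]. *)
Definition wgt x : R := qdim (tag x) * vz (2 * hwt x).

Lemma over_trace x y x' y' :
  \sum_x1 \sum_y1 wgt x1 * over x1 y x' y1 * overV x y1 x1 y' = wgt x * ((x == x') && (y == y'))%:R.
Proof.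
rewrite /wgt; apply: (@sum2_over _ (fun i1 j1 => qdim (tag x) * (vz (2 * ((tag x)%:Z - i1%:Z)) *
   cC (tag x) (tag y) i1 (bidx y) (bidx x') j1 * cCi (tag x) (tag y) (bidx x) j1 i1 (bidx y')))).
  move=> x1 y1; rewrite overE overVE hwtE.
  case: (eqVneq (tag x1) (tag x)) => [->|_] /=; last by rewrite mulr0.
  case: (eqVneq (tag y1) (tag y)) => [->|_] /=; last by rewrite andbF mulr0 mul0r.
  rewrite andbT; case: eqP => _; case: eqP => _; rewrite ?mulr0 ?mul0r //.
  by rewrite !mulrA.
move=> tx ty; under eq_bigr => i _ do rewrite -mulr_sumr.
rewrite -mulr_sumr -mulrA; congr (_ * _).
apply: (@cross_trace R p vz (qint p) (qfact p) (vfact p) (qbin p)) => //;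
  solve [exact: vz0E | exact: vzDE | exact: qint0E | exact: qint_unit | exact: qfact0E
    | exact: qfactSE | exact: qbin0E | exact: qbinSSE | exact: qbin_fact | exact: vfact0E | exact: vfactSE
    | exact: qint_difE | exact: qdif1_injE | exact: bidx_le | rewrite -ty; exact: bidx_le
    | exact: simple_lt ].
Qed.

Lemma qbin1 n : (n < p)%N -> qbin p n 1 = qint p n.
Proof.
move=> np; have := @qbinS R p vz (qint p) (qfact p) (qbin p) qint0E (@qint_unit p p_pr p_ge5)
  qfact0E qfactSE qbin0SE qbinSSE (@qbin_fact p p_pr) n 0%N (leq0n n) np.
by rewrite qbin0E mul1r subn0 qint1 // mulr1.
Qed.

Lemma sum_Ediv1r (F : bvec p -> R) y (f : nat -> R) :
  (forall u, tag u = tag y -> F u = f (bidx u)) ->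
  \sum_u F u * Ediv 1 u y = f (bidx y).+1 * qint p (2 * tag y - bidx y).
Proof.
move=> hF; have hy := bidx_le y; have hz := simple_lt (tag y).
rewrite (@sum_bvec _ (tag y) _ (fun i => if i == (bidx y).+1 then f i * qint p (2 * tag y - bidx y) else 0)).
- rewrite -big_mkcond /=; case: (ltnP (bidx y) (2 * tag y)) => lt.
    by rewrite (@sum_pick _ _ _ _ (Ordinal (lt : ((bidx y).+1 < (2 * tag y).+1)%N))) //= => j /eqP e /eqP[]; apply: val_inj.
  rewrite big1 => [|i /eqP e]; last by have := ltn_ord i; rewrite e; lia.
  by rewrite (eqP (_ : 2 * tag y - bidx y == 0)%N) ?qint0E ?mulr0 //; lia.
- move=> u tu; rewrite EdivE tu eqxx addn1 /=; case: ifP => e; last by rewrite mulr0.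
  by rewrite hF // qbin1 //; lia.
- by move=> u tu; rewrite EdivE eq_sym (negbTE tu) mulr0.
Qed.

Lemma sum_Ediv1l (F : bvec p -> R) x (f : nat -> R) :
  (forall u, tag u = tag x -> F u = f (bidx u)) ->
  \sum_u Ediv 1 x u * F u =
  if (0 < bidx x)%N then qint p (2 * tag x - (bidx x).-1) * f (bidx x).-1 else 0.
Proof.
move=> hF; have hx := bidx_le x; have hz := simple_lt (tag x).
rewrite (@sum_bvec _ (tag x) _ (fun i => if i.+1 == bidx x then qint p (2 * tag x - i) * f i else 0)).
- rewrite -big_mkcond /=; case: (posnP (bidx x)) => x0.
    by rewrite big1 // => i; rewrite x0.
  have lt : ((bidx x).-1 < (2 * tag x).+1)%N by lia.
  rewrite (@sum_pick _ _ _ _ (Ordinal lt)) //= => [|j /eqP e /eqP[]]; first by rewrite prednK.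
  by apply: val_inj; rewrite /= -e.
- move=> u tu; rewrite EdivE tu eqxx addn1 eq_sym /=; case: ifP => e; last by rewrite mul0r.
  by rewrite hF // qbin1 //; lia.
- by move=> u tu; rewrite EdivE (negbTE tu) mul0r.
Qed.

(** The braiding commutes with the coproduct E (x) 1 + K (x) E. *)
Lemma over_intertwine x y x' y' :
  \sum_u over x y x' u * Ediv 1 u y' + \sum_w over x y w y' * (vz (2 * hwt y') * Ediv 1 w x') =
  \sum_u Ediv 1 x u * over u y x' y' + \sum_w vz (2 * hwt x) * Ediv 1 y w * over x w x' y'.
Proof.
have [/andP[/eqP tx /eqP ty]|ntt] := boolP ((tag x' == tag x) && (tag y' == tag y)); last first.
  rewrite !big1 // => u _; rewrite overE.
  - rewrite EdivE; case: (eqVneq (tag u) (tag y)) => e; last by rewrite mulr0 mul0r.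
    by rewrite e (negbTE ntt) mulr0.
  - rewrite EdivE; case: (eqVneq (tag u) (tag x)) => e; last by rewrite mul0r.
    by rewrite e (negbTE ntt) mulr0.
  - rewrite EdivE; case: (eqVneq (tag x') (tag u)) => e; last by rewrite !mulr0.
    by rewrite -e (negbTE ntt) mul0r.
  - rewrite EdivE; case: (eqVneq (tag y') (tag u)) => e; last by rewrite !mulr0.
    by rewrite -e (negbTE ntt) mul0r.
rewrite (@sum_Ediv1r _ y' (fun i => cC (tag x) (tag y) (bidx x) (bidx y) (bidx x') i)); last first.
  by move=> u tu; rewrite overE tu tx ty !eqxx.
under [X in _ + X = _]eq_bigr => w _ do rewrite mulrA.
rewrite (@sum_Ediv1r _ x' (fun i => cC (tag x) (tag y) (bidx x) (bidx y) i (bidx y') * vz (2 * hwt y'))); last first.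
  by move=> u tu; rewrite overE tu tx ty !eqxx.
rewrite (@sum_Ediv1l _ x (fun i => cC (tag x) (tag y) i (bidx y) (bidx x') (bidx y'))); last first.
  by move=> u tu; rewrite overE tu tx ty !eqxx.
under [X in _ = _ + X]eq_bigr => w _ do rewrite [vz _ * _]mulrC -mulrA.
rewrite (@sum_Ediv1l _ y (fun i => vz (2 * hwt x) * cC (tag x) (tag y) (bidx x) i (bidx x') (bidx y'))); last first.
  by move=> u tu; rewrite overE tu tx ty !eqxx.
rewrite tx ty !hwtE ty.
have := @cross_intertwine R p vz (qint p) (qfact p) (vfact p) (qbin p) (vz0E p_pr) vzDE qint0E
  (@qint_unit p p_pr p_ge5) qfact0E qfactSE qbin0E qbin0SE qbinSSE (@qbin_fact p p_pr) vfact0E vfactSE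
  qint_difE qdif1_injE (tag x) (tag y) (bidx x) (bidx y) (bidx x') (bidx y') (bidx_le x) (bidx_le y).
rewrite -{1}tx -{1}ty => /(_ (bidx_le x') (bidx_le y') (simple_lt _) (simple_lt _)) e.
rewrite -[X in _ + X = _]mulrA e; congr (_ + _); case: ifP => // _.
by rewrite mulrCA mulrA.
Qed.

End Crossings.

(** * Operators on states and partial traces *)

Section Operators.
Variables (R : comNzRingType) (B I : finType).
Local Notation st := {ffun I -> B}.
Local Notation fn := (st -> R).
Local Notation op := (fn -> fn).
Implicit Types (s t : st) (F : fn) (O : op).

Definition upd s i x : st := [ffun j => if j == i then x else s j].

Lemma updE s i x j : upd s i x j = if j == i then x else s j. Proof. by rewrite ffunE. Qed.

Lemma upd_same s i x : upd s i x i = x. Proof. by rewrite updE eqxx. Qed.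

Lemma upd_neq s i x j : j != i -> upd s i x j = s j. Proof. by rewrite updE => /negbTE ->. Qed.

Lemma upd_id s i : upd s i (s i) = s.
Proof. by apply/ffunP => j; rewrite updE; case: eqP => [->|]. Qed.

Lemma upd_upd s i x y : upd (upd s i x) i y = upd s i y.
Proof. by apply/ffunP => j; rewrite !updE; case: eqP. Qed.

Lemma updC s i j x y : i != j -> upd (upd s i x) j y = upd (upd s j y) i x.
Proof.
move=> nij; apply/ffunP => k; rewrite !updE.
by case: eqP => [->|//]; rewrite eq_sym (negbTE nij).
Qed.

Definition lin O := forall (J : finType) (c : J -> R) (F : J -> fn),
  O (fun t => \sum_j c j * F j t) = (fun s => \sum_j c j * O (F j) s).

Definition gop (K : finType) (c : st -> K -> R) (phi : st -> K -> st) : op :=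
  fun F s => \sum_k c s k * F (phi s k).

Lemma lin_gop K c phi : lin (@gop K c phi).
Proof.
move=> J d F; apply: funext => s; rewrite /gop.
under eq_bigr => k _ do rewrite mulr_sumr.
rewrite exchange_big /=; apply: eq_bigr => j _; rewrite mulr_sumr.
by apply: eq_bigr => k _; rewrite mulrCA.
Qed.

Lemma lin_comp O1 O2 : lin O1 -> lin O2 -> lin (O1 \o O2).
Proof. by move=> h1 h2 J c F; rewrite /= h2 h1. Qed.

Lemma lin_id : lin id. Proof. by []. Qed.

Lemma linZ O (c : R) F : lin O -> O (fun t => c * F t) = (fun s => c * O F s).
Proof.
move=> h; have := h unit (fun=> c) (fun=> F).
under [X in O X]funext => t do rewrite big_const card_unit /= addr0.
by move=> ->; apply: funext => s; rewrite big_const card_unit /= addr0.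
Qed.

Lemma lin_sum O (J : finType) (F : J -> fn) : lin O ->
  O (fun t => \sum_j F j t) = (fun s => \sum_j O (F j) s).
Proof.
move=> h; have := h J (fun=> 1) F.
under [X in O X]funext => t do under eq_bigr => j _ do rewrite mul1r.
by move=> ->; apply: funext => s; apply: eq_bigr => j _; rewrite mul1r.
Qed.

Lemma linB O F G : lin O -> O (fun t => F t - G t) = (fun s => O F s - O G s).
Proof.
move=> h; have := h bool (fun b => if b then 1 else -1) (fun b => if b then F else G).
under [X in O X]funext => t do rewrite big_bool /= mul1r mulN1r.
by move=> ->; apply: funext => s; rewrite big_bool /= mul1r mulN1r.
Qed.

Definition delta s : fn := fun t => (t == s)%:R.

Lemma fn_delta F : F = (fun t => \sum_s F s * delta s t).
Proof.
apply: funext => t; rewrite (bigD1 t) //= big1 ?addr0 /delta ?eqxx ?mulr1 //.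
by move=> s nst; rewrite eq_sym (negbTE nst) mulr0.
Qed.

Lemma lin_delta O F : lin O -> O F = (fun t => \sum_s F s * O (delta s) t).
Proof. by move=> h; rewrite {1}(fn_delta F) h. Qed.

Variable q : st -> R.

Definition tr O : R := \sum_s q s * O (delta s) s.

Lemma tr_cyc (A E : op) : lin A -> lin E ->
  (forall s t, E (delta s) t != 0 -> q s = q t) -> tr (A \o E) = tr (E \o A).
Proof.
move=> hA hE hq; rewrite /tr /=.
under eq_bigr => s _ do rewrite (lin_delta (E _) hA) mulr_sumr.
under [RHS]eq_bigr => t _ do rewrite (lin_delta (A _) hE) mulr_sumr.
rewrite exchange_big /=; apply: eq_bigr => t _; apply: eq_bigr => s _.
have [->|ne] := eqVneq (E (delta s) t) 0; first by rewrite mul0r !mulr0.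
by rewrite (hq s t ne); ring.
Qed.

Lemma tr_comm O E G : lin O -> lin E -> lin G ->
  (forall s t, E (delta s) t != 0 -> q s = q t) -> O \o E = E \o O ->
  tr (O \o E \o G) = tr (O \o G \o E).
Proof.
move=> hO hE hG hq e.
by rewrite e [RHS](tr_cyc (lin_comp hO hG) hE hq).
Qed.

End Operators.
Arguments upd {B I}.

(** * Agreement of the quantum traces given by K and by K^-1 *)

Section TraceSymmetry.
Variables (R : comNzRingType) (B : finType) (N : nat).
Local Notation st := {ffun 'I_N -> B}.
Local Notation fn := (st -> R).
Variables (vz : int -> R) (wt : B -> int) (q : B -> R).
Variables (Bk BV : B -> B -> B -> B -> R) (Ek Fk : B -> B -> R).
Hypothesis vz0 : vz 0 = 1.
Hypothesis vzD : forall a b, vz (a + b) = vz a * vz b.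
Hypothesis Bwt : forall x y u w, Bk x y u w != 0 -> wt u + wt w = wt x + wt y.
Hypothesis Ewt : forall x y, Ek x y != 0 -> wt y = wt x + 1 /\ q x = q y.
Hypothesis Fwt : forall x y, Fk x y != 0 -> wt y = wt x - 1.
Hypothesis BVB : forall x y x' y', \sum_u \sum_w BV x y u w * Bk u w x' y' = ((x == x') && (y == y'))%:R.
Hypothesis BBV : forall x y x' y', \sum_u \sum_w Bk x y u w * BV u w x' y' = ((x == x') && (y == y'))%:R.
Hypothesis BE : forall x y x' y',
  \sum_u Bk x y u x' * Ek u y' + \sum_w Bk x y y' w * (vz (2 * wt y') * Ek w x') =
  \sum_u Ek x u * Bk u y y' x' + \sum_w vz (2 * wt x) * Ek y w * Bk x w y' x'.
Variable d1 : R.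
Hypothesis EFE : forall x z, d1 * (\sum_y Fk x y * Ek y z - \sum_y Ek x y * Fk y z) =
  (x == z)%:R * (vz (2 * wt x) - vz (- (2 * wt x))).

Definition letter_op (K : B -> B -> B -> B -> R) (a b : 'I_N) : fn -> fn :=
  gop (fun s (k : B * B) => K (s a) (s b) k.1 k.2) (fun s k => upd (upd s a k.1) b k.2).

Lemma letter_opE K a b F s :
  letter_op K a b F s = \sum_u \sum_w K (s a) (s b) u w * F (upd (upd s a u) b w).
Proof. by rewrite /letter_op /gop pair_bigA. Qed.

Lemma letter_op_comp K K' a b F s : a != b ->
  letter_op K a b (letter_op K' a b F) s =
  \sum_u' \sum_w' (\sum_u \sum_w K (s a) (s b) u w * K' u w u' w') * F (upd (upd s a u') b w').
Proof.
move=> nab; rewrite letter_opE.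
under eq_bigr => u _ do under eq_bigr => w _ do rewrite letter_opE upd_same upd_neq // upd_same mulr_sumr.
under [RHS]eq_bigr => u' _ do under eq_bigr => w' _ do rewrite mulr_suml.
rewrite [RHS]exchange_big /=.
under [RHS]eq_bigr => w' _ do rewrite exchange_big /=.
rewrite [RHS]exchange_big /=; apply: eq_bigr => u _.
under [RHS]eq_bigr => w' _ do under eq_bigr => u' _ do rewrite mulr_suml.
under [RHS]eq_bigr => w' _ do rewrite exchange_big /=.
rewrite [RHS]exchange_big /=; apply: eq_bigr => w _.
rewrite [RHS]exchange_big /=; apply: eq_bigr => u' _; rewrite mulr_sumr.
apply: eq_bigr => w' _; rewrite mulrA; congr (_ * F _).
by apply/ffunP => k; rewrite !updE; case: eqP => // _; case: eqP.
Qed.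

Lemma letter_op_inv K K' a b : a != b ->
  (forall x y x' y', \sum_u \sum_w K x y u w * K' u w x' y' = ((x == x') && (y == y'))%:R) ->
  letter_op K a b \o letter_op K' a b = id.
Proof.
move=> nab h; apply: funext => F; apply: funext => s; rewrite /= letter_op_comp //.
rewrite (bigD1 (s a)) //= (bigD1 (s b)) //= h !eqxx mul1r !upd_id.
rewrite !big1 ?addr0 // => [u nu|w nw].
  by apply: big1 => w _; rewrite h eq_sym (negbTE nu) mul0r.
by rewrite h eqxx eq_sym (negbTE nw) mul0r.
Qed.

(** The iterated coproduct puts K on the strands to the left of the one on which E acts, and K^-1 on
    those to the right of the one on which F acts. *)
Definition kapl (s : st) (j : 'I_N) : R := vz (2 * \sum_(l : 'I_N | (l < j)%N) wt (s l)).
Definition kapr (s : st) (j : 'I_N) : R := vz (- (2 * \sum_(l : 'I_N | (j < l)%N) wt (s l))).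

Definition Eop : fn -> fn :=
  gop (fun s (k : 'I_N * B) => kapl s k.1 * Ek (s k.1) k.2) (fun s k => upd s k.1 k.2).
Definition Fop : fn -> fn :=
  gop (fun s (k : 'I_N * B) => kapr s k.1 * Fk (s k.1) k.2) (fun s k => upd s k.1 k.2).

Lemma EopE F s : Eop F s = \sum_j kapl s j * \sum_y Ek (s j) y * F (upd s j y).
Proof.
rewrite /Eop /gop -(pair_bigA _ (fun j y => kapl s j * Ek (s j) y * F (upd s j y))) /=.
by apply: eq_bigr => j _; rewrite mulr_sumr; apply: eq_bigr => y _; rewrite mulrA.
Qed.

Lemma FopE F s : Fop F s = \sum_j kapr s j * \sum_y Fk (s j) y * F (upd s j y).
Proof.
rewrite /Fop /gop -(pair_bigA _ (fun j y => kapr s j * Fk (s j) y * F (upd s j y))) /=.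
by apply: eq_bigr => j _; rewrite mulr_sumr; apply: eq_bigr => y _; rewrite mulrA.
Qed.

Lemma kapl_upd s i x j : kapl (upd s i x) j =
  if (i < j)%N then kapl s j * vz (2 * (wt x - wt (s i))) else kapl s j.
Proof.
rewrite /kapl; case: ifP => ij.
  rewrite -vzD; congr vz; rewrite -mulrDr; congr (_ * _).
  rewrite (bigD1 i) //= [in RHS](bigD1 i) //= upd_same.
  rewrite (eq_bigr (fun l => wt (s l))); first by ring.
  by move=> l /andP[_ nl]; rewrite upd_neq.
congr (vz (_ * _)); apply: eq_bigr => l lj; rewrite upd_neq //.
by apply: contraFneq ij => <-.
Qed.

Lemma kapr_upd s i x j : kapr (upd s i x) j =
  if (j < i)%N then kapr s j * vz (- (2 * (wt x - wt (s i)))) else kapr s j.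
Proof.
rewrite /kapr; case: ifP => ij.
  rewrite -vzD; congr vz; rewrite -opprD; congr (- _); rewrite -mulrDr; congr (_ * _).
  rewrite (bigD1 i) //= [in RHS](bigD1 i) //= upd_same.
  rewrite (eq_bigr (fun l => wt (s l))); first by ring.
  by move=> l /andP[_ nl]; rewrite upd_neq.
congr (vz (- (_ * _))); apply: eq_bigr => l lj; rewrite upd_neq //.
by apply: contraFneq ij => <-.
Qed.

(** Where E acts on a third strand, the crossing preserves the weight of the pair and thus the
    factor K; where it acts on the pair itself, [BE] applies. *)
Lemma letter_E (a b : 'I_N) : b = a.+1 :> nat -> letter_op Bk a b \o Eop = Eop \o letter_op Bk a b.
Proof.
move=> ab; apply: funext => F; apply: funext => s /=.
have nab : a != b by apply/eqP => /(congr1 val) /=; rewrite ab => /eqP; rewrite ltn_eqF.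
rewrite letter_opE EopE.
under eq_bigr => u _ do under eq_bigr => w _ do rewrite EopE mulr_sumr.
transitivity (\sum_j \sum_u \sum_w Bk (s a) (s b) u w *
  (kapl (upd (upd s a u) b w) j * \sum_y Ek (upd (upd s a u) b w j) y * F (upd (upd (upd s a u) b w) j y))).
  by rewrite [RHS]exchange_big /=; apply: eq_bigr => u _; rewrite [RHS]exchange_big.
rewrite (bigD1 b) //= (bigD1 a) //= [RHS](bigD1 b) //= [in RHS](bigD1 a) //= !addrA.
congr (_ + _); last first.
  apply: eq_bigr => j /andP[jb ja].
  under [in RHS]eq_bigr => y _ do rewrite letter_opE !upd_neq 1?eq_sym // mulr_sumr.
  rewrite [in RHS]exchange_big /= mulr_sumr; apply: eq_bigr => u _.
  under [in RHS]eq_bigr => y _ do rewrite mulr_sumr.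
  rewrite [in RHS]exchange_big /= mulr_sumr; apply: eq_bigr => w _.
  have [->|ne] := eqVneq (Bk (s a) (s b) u w) 0.
    by rewrite mul0r big1 ?mulr0 // => y _; rewrite mul0r mulr0.
  have -> : kapl (upd (upd s a u) b w) j = kapl s j.
    rewrite !kapl_upd upd_neq 1?eq_sym //.
    have -> : (b < j)%N = (a < j)%N.
      rewrite ab; apply/idP/idP => [/ltnW //|aj]; rewrite ltn_neqAle aj andbT -ab.
      by rewrite eq_sym -[_ == _]/(j == b).
    case: (a < j)%N => //; rewrite -mulrA -vzD -mulrDr.
    have -> : wt u - wt (s a) + (wt w - wt (s b)) = 0 by rewrite addrACA (Bwt ne) -opprD subrr.
    by rewrite mulr0 vz0 mulr1.
  rewrite mulrCA; congr (_ * _); rewrite mulr_sumr; apply: eq_bigr => y _.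
  rewrite !upd_neq // mulrCA; congr (_ * (_ * F _)).
  by rewrite [LHS]updC 1?eq_sym // [upd (upd s a u) j y]updC 1?eq_sym.
have kb : kapl s b = kapl s a * vz (2 * wt (s a)).
  rewrite /kapl -vzD -mulrDr; congr (vz (_ * _)); rewrite (bigD1 a) ?ab //= addrC; congr (_ + _).
  by apply: eq_bigl => l; rewrite ltnS ltn_neqAle andbC.
transitivity (\sum_y' \sum_x' kapl s a * (\sum_u Bk (s a) (s b) u x' * Ek u y' +
   \sum_w Bk (s a) (s b) y' w * (vz (2 * wt y') * Ek w x')) * F (upd (upd s a y') b x')).
  under [RHS]eq_bigr => y' _ do under eq_bigr => x' _ do rewrite mulrDr mulrDl addrC.
  under [RHS]eq_bigr => y' _ do rewrite big_split /=.
  rewrite big_split /=; congr (_ + _).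
    apply: eq_bigr => u _.
    under [RHS]eq_bigr => x' _ do rewrite mulr_sumr mulr_suml.
    rewrite [RHS]exchange_big /=; apply: eq_bigr => w _.
    rewrite kapl_upd ltnn kapl_upd ab ltnSn kb upd_same !mulr_sumr.
    apply: eq_bigr => x' _; rewrite upd_upd.
    have -> : kapl s a * vz (2 * wt (s a)) * vz (2 * (wt u - wt (s a))) = kapl s a * vz (2 * wt u).
      by rewrite -mulrA -vzD -mulrDr addrC subrK.
    by ring.
  under [RHS]eq_bigr => y' _ do under eq_bigr => x' _ do rewrite mulr_sumr mulr_suml.
  under [RHS]eq_bigr => y' _ do rewrite exchange_big /=.
  rewrite [RHS]exchange_big /=; apply: eq_bigr => u _.
  rewrite [RHS]exchange_big /=; apply: eq_bigr => w _.
  rewrite !kapl_upd ltnn ab ltnNge leqnSn /= !mulr_sumr.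
  apply: eq_bigr => y' _; rewrite upd_neq // upd_same [upd (upd _ b w) a _]updC 1?eq_sym // upd_upd.
  by ring.
transitivity (\sum_y' \sum_x' kapl s a * (\sum_u Ek (s a) u * Bk u (s b) y' x' +
   \sum_w vz (2 * wt (s a)) * Ek (s b) w * Bk (s a) w y' x') * F (upd (upd s a y') b x')).
  by apply: eq_bigr => y' _; apply: eq_bigr => x' _; rewrite BE.
under [LHS]eq_bigr => y' _ do under eq_bigr => x' _ do rewrite mulrDr mulrDl addrC.
under [LHS]eq_bigr => y' _ do rewrite big_split /=.
rewrite big_split /=; congr (_ + _).
  rewrite kb; under [in RHS]eq_bigr => w _ do rewrite letter_opE upd_same upd_neq // mulr_sumr.
  rewrite [in RHS]exchange_big /= mulr_sumr; apply: eq_bigr => y' _.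
  under [in RHS]eq_bigr => w _ do rewrite mulr_sumr.
  rewrite [in RHS]exchange_big /= mulr_sumr; apply: eq_bigr => x' _.
  rewrite mulr_sumr mulr_suml mulr_sumr; apply: eq_bigr => w _.
  by rewrite [upd (upd s b w) a y']updC 1?eq_sym // upd_upd; ring.
under [in RHS]eq_bigr => w _ do rewrite letter_opE upd_same upd_neq 1?eq_sym // mulr_sumr.
rewrite [in RHS]exchange_big /= mulr_sumr; apply: eq_bigr => y' _.
under [in RHS]eq_bigr => w _ do rewrite mulr_sumr.
rewrite [in RHS]exchange_big /= mulr_sumr; apply: eq_bigr => x' _.
rewrite mulr_sumr mulr_suml mulr_sumr; apply: eq_bigr => w _.
by rewrite upd_upd; ring.
Qed.

Lemma letter_EV (a b : 'I_N) : b = a.+1 :> nat -> letter_op BV a b \o Eop = Eop \o letter_op BV a b.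
Proof.
move=> ab; have nab : a != b by apply/eqP => /(congr1 val) /=; rewrite ab => /eqP; rewrite ltn_eqF.
have e := letter_E ab.
have i1 := letter_op_inv nab BVB; have i2 := letter_op_inv nab BBV.
transitivity (letter_op BV a b \o Eop \o (letter_op Bk a b \o letter_op BV a b)); first by rewrite i2.
rewrite -[LHS]/(letter_op BV a b \o (Eop \o letter_op Bk a b) \o letter_op BV a b) -e.
by rewrite -[LHS]/((letter_op BV a b \o letter_op Bk a b) \o (Eop \o letter_op BV a b)) i1.
Qed.

(** Contributions of E and F on different strands commute. The commutators on single strands, with
    the factors K to their left and K^-1 to their right, telescope. *)
Lemma EF_comm F s : d1 * (Fop (Eop F) s - Eop (Fop F) s) =
  (vz (2 * \sum_l wt (s l)) - vz (- (2 * \sum_l wt (s l)))) * F s.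
Proof.
rewrite EopE FopE.
under eq_bigr => j _ do under eq_bigr => y _ do rewrite EopE mulr_sumr.
under [X in _ - X]eq_bigr => j _ do under eq_bigr => y _ do rewrite FopE mulr_sumr.
pose A i j := kapr s j * \sum_y Fk (s j) y * (kapl (upd s j y) i *
  \sum_z Ek (upd s j y i) z * F (upd (upd s j y) i z)).
pose C i j := kapl s i * \sum_z Ek (s i) z * (kapr (upd s i z) j *
  \sum_y Fk (upd s i z j) y * F (upd (upd s i z) j y)).
have -> : \sum_j kapr s j * (\sum_y \sum_i Fk (s j) y * (kapl (upd s j y) i *
  \sum_z Ek (upd s j y i) z * F (upd (upd s j y) i z))) = \sum_i \sum_j A i j.
  by rewrite [RHS]exchange_big; apply: eq_bigr => j _; rewrite exchange_big /= mulr_sumr.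
have -> : \sum_i kapl s i * (\sum_z \sum_j Ek (s i) z * (kapr (upd s i z) j *
  \sum_y Fk (upd s i z j) y * F (upd (upd s i z) j y))) = \sum_i \sum_j C i j.
  by apply: eq_bigr => i _; rewrite exchange_big /= mulr_sumr.
have AC i j : i != j -> A i j = C i j.
  move=> nij; rewrite /A /C; under eq_bigr => y _ do rewrite upd_neq // !mulr_sumr.
  under [in RHS]eq_bigr => z _ do rewrite upd_neq 1?eq_sym // !mulr_sumr.
  rewrite [in RHS]exchange_big /= !mulr_sumr; apply: eq_bigr => y _.
  rewrite !mulr_sumr; apply: eq_bigr => z _; rewrite [upd (upd s j y) i z]updC 1?eq_sym //.
  have [->|nF] := eqVneq (Fk (s j) y) 0; first by rewrite !(mul0r, mulr0).
  have [->|nE] := eqVneq (Ek (s i) z) 0; first by rewrite !(mul0r, mulr0).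
  rewrite kapl_upd kapr_upd; have [-> _] := Ewt nE; rewrite (Fwt nF).
  case: ifP => _; last by ring.
  have -> : wt (s j) - 1 - wt (s j) = - (wt (s i) + 1 - wt (s i)) by ring.
  by rewrite mulrN; ring.
rewrite -sumrB mulr_sumr.
(* K on the strands before [k] and K^-1 on those from [k] on, so that the commutator on strand i is
   T (i+1) - T i. *)
pose T k := vz (2 * (\sum_(l : 'I_N | (l < k)%N) wt (s l) - \sum_(l : 'I_N | (k <= l)%N) wt (s l))).
transitivity (\sum_(i < N) (T i.+1 - T i) * F s); last first.
  rewrite -mulr_suml -(big_mkord xpredT (fun i => T i.+1 - T i)) telescope_sumr // /T.
  congr ((vz _ - vz _) * _).
    rewrite [X in _ - X]big1 ?subr0 => [|l]; last by rewrite leqNgt ltn_ord.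
    by congr (_ * _); apply: eq_bigl => l; rewrite ltn_ord.
  rewrite big_pred0 ?sub0r ?mulrN //.
apply: eq_bigr => i _; rewrite -sumrB (bigD1 i) //= big1 ?addr0 => [|j nj]; last first.
  by rewrite AC ?subrr // eq_sym.
have Ai : A i i = kapl s i * kapr s i * \sum_z (\sum_y Fk (s i) y * Ek y z) * F (upd s i z).
  rewrite /A; under eq_bigr => y _ do rewrite kapl_upd ltnn upd_same !mulr_sumr.
  rewrite exchange_big /= mulr_sumr [RHS]mulr_sumr; apply: eq_bigr => z _.
  by rewrite mulr_suml !mulr_sumr; apply: eq_bigr => y _; rewrite upd_upd; ring.
have Ci : C i i = kapl s i * kapr s i * \sum_z (\sum_y Ek (s i) y * Fk y z) * F (upd s i z).
  rewrite /C; under eq_bigr => y _ do rewrite kapr_upd ltnn upd_same !mulr_sumr.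
  rewrite exchange_big /= mulr_sumr [RHS]mulr_sumr; apply: eq_bigr => z _.
  by rewrite mulr_suml !mulr_sumr; apply: eq_bigr => y _; rewrite upd_upd; ring.
rewrite Ai Ci -mulrBr -sumrB mulrCA mulr_sumr.
rewrite (eq_bigr (fun z => (s i == z)%:R * (vz (2 * wt (s i)) - vz (- (2 * wt (s i)))) * F (upd s i z))); last first.
  by move=> z _; rewrite -mulrBl mulrA EFE.
rewrite (bigD1 (s i)) //= big1 ?addr0 => [|z nz]; last by rewrite eq_sym (negbTE nz) !mul0r.
rewrite eqxx mul1r upd_id mulrA; congr (_ * _).
rewrite /kapl /kapr -vzD mulrBr -!vzD /T; congr (vz _ - vz _).
  rewrite [in RHS](bigD1 i) //= [X in wt _ + X](eq_bigl (fun l : 'I_N => (l < i)%N)); first by ring.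
  by move=> l; rewrite ltnS ltn_neqAle andbC.
rewrite [X in _ = 2 * (_ - X)](bigD1 i) //= [X in wt _ + X](eq_bigl (fun l : 'I_N => (i < l)%N)); first by ring.
by move=> l; rewrite [(i < l)%N]ltn_neqAle andbC eq_sym.
Qed.

Definition wtot (s : st) : int := \sum_l wt (s l).

(** By cyclicity, and as [O] commutes with E, the traces of O F E and O E F agree; the commutator of
    E and F is K - K^-1 up to the factor [d1]. Commutation with F is not called for. *)
Lemma tr_weight_sym (O : fn -> fn) : lin O -> O \o Eop = Eop \o O ->
  \sum_(s : st) (\prod_i q (s i)) * vz (2 * wtot s) * O (delta R s) s =
  \sum_(s : st) (\prod_i q (s i)) * vz (- (2 * wtot s)) * O (delta R s) s.
Proof.
move=> hO eO; pose Q (s : st) := \prod_i q (s i).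
have hQ s t : Eop (delta R s) t != 0 -> Q s = Q t.
  move=> ne; rewrite EopE in ne.
  have [j] : exists j, kapl t j * (\sum_y Ek (t j) y * delta R s (upd t j y)) != 0.
    apply/existsP; apply: contraNT ne; rewrite negb_exists => /forallP h.
    by rewrite big1 // => j _; apply/eqP; rewrite -[_ == _]negbK h.
  move=> nej; have [y] : exists y, Ek (t j) y * delta R s (upd t j y) != 0.
    apply/existsP; apply: contraNT nej; rewrite negb_exists => /forallP h.
    by rewrite big1 ?mulr0 // => y _; apply/eqP; rewrite -[_ == _]negbK h.
  move=> ney; have nE : Ek (t j) y != 0 by apply: contraNneq ney => ->; rewrite mul0r.
  have : delta R s (upd t j y) != 0 by apply: contraNneq ney => ->; rewrite mulr0.
  rewrite /delta; case: (eqVneq (upd t j y) s) => [<- _|_]; last by rewrite eqxx.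
  rewrite /Q (bigD1 j) //= [RHS](bigD1 j) //= upd_same; have [_ ->] := Ewt nE; congr (_ * _).
  by apply: eq_bigr => i ni; rewrite upd_neq.
have := tr_comm hO (lin_gop _ _ : lin Eop) (lin_gop _ _ : lin Fop) hQ eO.
rewrite /tr /= => e; apply/eqP; rewrite -subr_eq0 -sumrB; apply/eqP.
transitivity (d1 * (\sum_s Q s * O (Fop (Eop (delta R s))) s - \sum_s Q s * O (Eop (Fop (delta R s))) s)).
  rewrite -sumrB mulr_sumr; apply: eq_bigr => s _.
  rewrite -mulrBl -mulrBr -/(Q s) -mulrA.
  have h1 := linB (Fop (Eop (delta R s))) (Eop (Fop (delta R s))) hO.
  have h2 := linZ d1 (fun t => Fop (Eop (delta R s)) t - Eop (Fop (delta R s)) t) hO.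
  have h3 := linZ (vz (2 * wtot s) - vz (- (2 * wtot s))) (delta R s) hO.
  have e1 : (fun t => d1 * (Fop (Eop (delta R s)) t - Eop (Fop (delta R s)) t)) =
            (fun t => (vz (2 * wtot s) - vz (- (2 * wtot s))) * delta R s t).
    apply: funext => t; rewrite EF_comm /delta.
    by case: eqP => [->|_]; rewrite ?mulr0.
  rewrite e1 h3 h1 in h2; have := congr1 (fun f => f s) h2; rewrite /= => h4.
  by rewrite h4 -mulrBr mulrCA.
by rewrite e subrr mulr0.
Qed.

End TraceSymmetry.

(** * Closing single strands *)

Section PartialTrace.
Variables (R : comNzRingType) (B : finType) (N : nat).
Local Notation st := {ffun 'I_N -> B}.
Local Notation fn := (st -> R).
Local Notation op := (fn -> fn).
Variables (w : B -> R) (d : B).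
Implicit Types (s t u : st) (F H : fn) (O P G : op) (i j a b : 'I_N).

(** [O] acts as the identity on strand [i]: it commutes with fixing the value there. *)
Definition indep i O := forall F s x, O F (upd s i x) = O (fun t => F (upd t i x)) s.

Lemma indep_id i : indep i id. Proof. by []. Qed.

Lemma indep_comp i O P : indep i O -> indep i P -> indep i (O \o P).
Proof.
move=> hO hP F s x; rewrite /= hO; congr (O _ s); apply: funext => t; exact: hP.
Qed.

Lemma indep_letter (K : B -> B -> B -> B -> R) i a b : i != a -> i != b -> indep i (letter_op K a b).
Proof.
move=> ia ib F s x; rewrite !letter_opE !upd_neq 1?eq_sym //.
apply: eq_bigr => x1 _; apply: eq_bigr => x2 _; congr (_ * F _).
by rewrite [upd (upd s i x) a x1]updC // [LHS]updC.
Qed.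

Lemma lin_letter (K : B -> B -> B -> B -> R) a b : lin (@letter_op R B N K a b).
Proof. exact: lin_gop. Qed.

Definition free i F := forall t x, F (upd t i x) = F t.

Lemma free_indep i O F : indep i O -> free i F -> free i (O F).
Proof. by move=> hO hF t x; rewrite hO; congr (O _ t); apply: funext => u; apply: hF. Qed.

Lemma indep_slice i O F x : lin O -> indep i O -> free i F ->
  O (fun u => F u * (u i == x)%:R) = (fun u => O F u * (u i == x)%:R).
Proof.
move=> lO iO fF; apply: funext => u; rewrite -{1}[u](upd_id _ i) iO.
have -> : (fun t => F (upd t i (u i)) * (upd t i (u i) i == x)%:R) =
          (fun t => (u i == x)%:R * F t).
  by apply: funext => t; rewrite upd_same fF mulrC.
by rewrite linZ // mulrC.
Qed.

Definition ptr j O : op := fun H s => \sum_x w x * O (fun u => H u * (u j == x)%:R) (upd s j x).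

Lemma lin_ptr j O : lin O -> lin (ptr j O).
Proof.
move=> lO J c F; apply: funext => s; rewrite /ptr.
under [RHS]eq_bigr => k _ do rewrite mulr_sumr.
rewrite exchange_big /=; apply: eq_bigr => x _.
under [X in _ * O X _]funext => u do (rewrite mulr_suml; under eq_bigr => k _ do rewrite -mulrA).
rewrite lO mulr_sumr; apply: eq_bigr => k _; rewrite mulrCA //.
Qed.

Lemma indep_ptr i j O : i != j -> lin O -> indep i O -> indep i (ptr j O).
Proof.
move=> ij lO iO F s x; rewrite /ptr; apply: eq_bigr => y _; congr (_ * _).
rewrite updC // iO; congr (O _ _); apply: funext => t; rewrite upd_neq // eq_sym //.
Qed.

Definition ind (A : {set 'I_N}) (r : st) : fn := fun u => [forall i, (i \notin A) ==> (u i == r i)]%:R.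

(** The trace over the strands outside [A]; those in [A] are closed up already and frozen at the
    dummy value [d]. *)
Definition FT (A : {set 'I_N}) O : R :=
  \sum_(r : st | [forall i, (i \in A) ==> (r i == d)]) (\prod_(i | i \notin A) w (r i)) * O (ind A r) r.

Lemma ind_free (A : {set 'I_N}) r j : j \in A -> free j (ind A r).
Proof.
move=> jA t x; rewrite /ind; congr (_%:R); congr (nat_of_bool _); apply: eq_forallb => i.
by case: (eqVneq i j) => [->|ne]; rewrite ?jA // upd_neq.
Qed.

(** Of the three factors only [O1] acts on strand [j], so closing that strand amounts to replacing
    [O1] by its partial trace. *)
Lemma FT_step (A : {set 'I_N}) P O1 O j : j \notin A -> lin P -> lin O1 -> lin O ->
  indep j P -> indep j O -> FT A (P \o O1 \o O) = FT (j |: A) (P \o ptr j O1 \o O).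
Proof.
move=> jA lP lO1 lO iP iO; rewrite /FT.
rewrite (partition_big (fun r : st => upd r j d)
   (fun r : st => [forall i, (i \in j |: A) ==> (r i == d)])) /=; last first.
  move=> r /forallP h; apply/forallP => i; rewrite !inE; apply/implyP.
  case: (eqVneq i j) => [-> _|ne /=]; first by rewrite upd_same.
  by move=> iA; rewrite upd_neq //; have := h i; rewrite iA.
apply: eq_bigr => r /forallP hr.
have rj : r j = d by have := hr j; rewrite !inE eqxx => /eqP.
rewrite (reindex (fun x => upd r j x)) /=; last first.
  exists (fun u => u j) => [x _|u]; first by rewrite upd_same.
  by rewrite inE => /andP[_ /eqP <-]; rewrite upd_upd upd_id.
rewrite (eq_bigl xpredT) => [|x]; last first.
  rewrite upd_upd -{2}rj upd_id eqxx andbT; apply/forallP => i; apply/implyP => iA.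
  have ij : i != j by apply: contraNneq jA => <-.
  by rewrite upd_neq //; have := hr i; rewrite !inE iA orbT.
have H0 := ind_free r (setU11 j A); set H := ind _ r in H0 *.
have indE x : ind A (upd r j x) = (fun u => H u * (u j == x)%:R).
  apply: funext => u; rewrite /H /ind -natrM mulnb; congr (_%:R); congr (nat_of_bool _).
  apply/forallP/andP => [h|[/forallP h1 h2] i].
    split; last by have := h j; rewrite jA upd_same.
    apply/forallP => i; apply/implyP; rewrite !inE negb_or => /andP[ij iA].
    by have := h i; rewrite iA upd_neq.
  apply/implyP => iA; case: (eqVneq i j) => [->|ij]; first by rewrite upd_same.
  by rewrite upd_neq //; have := h1 i; rewrite !inE negb_or ij iA.
transitivity (\sum_x (w x * \prod_(i | i \notin j |: A) w (r i)) *
   P (fun t => O1 (fun u => O H u * (u j == x)%:R) (upd t j x)) r).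
  apply: eq_bigr => x _; rewrite indE /= indep_slice // iP; congr (_ * _).
  rewrite (bigD1 j) //= upd_same; congr (_ * _).
  by apply: eq_big => [i|i /andP[_ ij]]; rewrite ?upd_neq // !inE negb_or andbC.
have e := linZ _ _ lP.
transitivity (\prod_(i | i \notin j |: A) w (r i) * \sum_x P (fun t => w x * O1 (fun u => O H u * (u j == x)%:R) (upd t j x)) r).
  by rewrite mulr_sumr; apply: eq_bigr => x _; rewrite e; ring.
congr (_ * _); have := lin_sum (fun x t => w x * O1 (fun u => O H u * (u j == x)%:R) (upd t j x)) lP.
by move=> /(congr1 (fun f => f r)) /= <-.
Qed.

Variables (Kov KovV : B -> B -> B -> B -> R).
Hypothesis ov_tr : forall x y x' y',
  \sum_x1 \sum_y1 w x1 * Kov x1 y x' y1 * KovV x y1 x1 y' = w x * ((x == x') && (y == y'))%:R.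

(* The loop of the strand [a] is shrunk over the strand [b]. *)
Lemma ptr_cross a b G H : a != b -> lin G -> indep b G -> free a H ->
  ptr a (letter_op Kov a b \o G \o letter_op KovV a b) H = ptr a G H.
Proof.
move=> ab lG iG fH; apply: funext => s; rewrite /ptr /=.
have ba : b != a by rewrite eq_sym.
pose M x1 y' : fn := fun t => \sum_b' KovV (t a) y' x1 b' * H (upd t b b').
transitivity (\sum_x' \sum_x1 \sum_y' (w x1 * Kov x1 (s b) x' y') * G (M x1 y') (upd s a x')).
  rewrite exchange_big /=; apply: eq_bigr => x1 _.
  rewrite letter_opE mulr_sumr; apply: eq_bigr => x' _; rewrite mulr_sumr.
  apply: eq_bigr => y' _; rewrite upd_same upd_neq // !mulrA; congr (_ * _).
  rewrite upd_upd iG; congr (G _ _); apply: funext => t; rewrite letter_opE upd_same upd_neq //.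
  rewrite (bigD1 x1) //= [X in _ + X]big1 ?addr0 => [|x2 nx].
    apply: eq_bigr => b' _; rewrite upd_neq // upd_same eqxx mulr1.
    by rewrite [upd (upd t b y') a x1]updC // upd_upd updC // fH.
  by apply: big1 => b' _; rewrite upd_neq // upd_same (negbTE nx) !mulr0.
apply: eq_bigr => x' _.
have -> : (\sum_x1 \sum_y' (w x1 * Kov x1 (s b) x' y') * G (M x1 y') (upd s a x')) =
  G (fun t => \sum_(k : B * B) (w k.1 * Kov k.1 (s b) x' k.2) * M k.1 k.2 t) (upd s a x').
  by rewrite lG pair_bigA.
have := linZ (w x') (fun u => H u * (u a == x')%:R) lG.
move=> /(congr1 (fun f => f (upd s a x'))) /= <-.
have -> : upd s a x' = upd (upd s a x') b (s b) by rewrite -[in LHS](upd_id s b) updC.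
rewrite !iG; congr (G _ _); apply: funext => t.
transitivity (\sum_b' (\sum_x1 \sum_y1 w x1 * Kov x1 (s b) x' y1 * KovV (t a) y1 x1 b') * H (upd t b b')).
  rewrite -(pair_bigA _ (fun x1 y1 => (w x1 * Kov x1 (s b) x' y1) * M x1 y1 (upd t b (s b)))) /=.
  under [RHS]eq_bigr => b' _ do rewrite mulr_suml.
  rewrite [RHS]exchange_big /=; apply: eq_bigr => x1 _.
  under [RHS]eq_bigr => b' _ do rewrite mulr_suml.
  rewrite [RHS]exchange_big /=; apply: eq_bigr => y1 _; rewrite /M mulr_sumr.
  by apply: eq_bigr => b' _; rewrite upd_neq // upd_upd mulrA.
rewrite (bigD1 (s b)) //= ov_tr eqxx andbT big1 ?addr0 => [|b' nb]; last first.
  by rewrite ov_tr [s b == b']eq_sym (negbTE nb) andbF mulr0 mul0r.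
rewrite upd_neq //; case: eqP => [->|_]; first by ring.
by rewrite !(mulr0, mul0r).
Qed.

Definition Cs j (l : seq 'I_N) : op := foldr (fun i O => letter_op Kov j i \o O) id l.
Definition Cis j (l : seq 'I_N) : op := foldr (fun i O => O \o letter_op KovV j i) id l.

Lemma ptr_Cs j l G H : j \notin l -> uniq l -> lin G -> (forall i, i \in l -> indep i G) -> free j H ->
  ptr j (Cs j l \o G \o Cis j l) H = ptr j G H.
Proof.
elim: l => [//|i l IH]; rewrite inE negb_or => /andP[ji jl] /andP[il ul] lG iG fH.
have lC l' : lin (Cs j l') by elim: l' => [|k l' IHl]; [exact: lin_id | apply: lin_comp; [exact: lin_letter|]].
have lCi l' : lin (Cis j l') by elim: l' => [|k l' IHl]; [exact: lin_id | apply: lin_comp; [|exact: lin_letter]].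
rewrite -[LHS]/(ptr j (letter_op Kov j i \o (Cs j l \o G \o Cis j l) \o letter_op KovV j i) H).
rewrite ptr_cross //.
- by apply: IH => // k kl; apply: iG; rewrite inE kl orbT.
- by apply: lin_comp; [apply: lin_comp|].
have ind_l (l' : seq 'I_N) : i \notin l' -> indep i (Cs j l') /\ indep i (Cis j l').
  elim: l' => [|k l' IHl]; first by [].
  rewrite inE negb_or => /andP[ik /IHl[h1 h2]].
  by split; apply: indep_comp => //; apply: indep_letter; rewrite // eq_sym.
have [h1 h2] := ind_l l il; apply: indep_comp => //; apply: indep_comp => //.
by apply: iG; rewrite inE eqxx.
Qed.

Hypothesis ov_inv : forall x y x' y',
  \sum_x1 \sum_y1 KovV x y x1 y1 * Kov x1 y1 x' y' = ((x == x') && (y == y'))%:R.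

Lemma Cis_Cs j l : j \notin l -> Cis j l \o Cs j l = id.
Proof.
elim: l => [//|i l IH]; rewrite inE negb_or => /andP[ji jl].
rewrite -[LHS]/(Cis j l \o (letter_op KovV j i \o letter_op Kov j i) \o Cs j l).
by rewrite letter_op_inv // -[LHS]/(Cis j l \o Cs j l) IH.
Qed.

End PartialTrace.

Section Ranges.
Variable N : nat.

Definition rng (c b : nat) : seq 'I_N := [seq i : 'I_N <- enum 'I_N | (c < i <= b)%N].

Lemma val_rng c b : (b < N)%N -> map val (rng c b) = iota c.+1 (b - c).
Proof.
move=> bN; rewrite /rng (eq_filter (a2 := preim val (fun i : nat => (c < i <= b)%N))) // -filter_map val_enum_ord.
apply: (@irr_sorted_eq _ ltn); first exact: ltn_trans.
- exact: ltnn.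
- by apply: sorted_filter; [exact: ltn_trans | exact: iota_ltn_sorted].
- exact: iota_ltn_sorted.
by move=> i; rewrite mem_filter !mem_iota; apply/idP/idP; lia.
Qed.

Lemma rng_cons c b (i : 'I_N) : i = c.+1 :> nat -> (i <= b < N)%N -> rng c b = i :: rng i b.
Proof.
move=> e /andP[ib bN]; apply: (inj_map val_inj); rewrite /= !val_rng // -e.
by have -> : (b - c = (b - i).+1)%N by lia.
Qed.

Lemma rng_nil c b : (b <= c)%N -> rng c b = [::].
Proof.
move=> bc; rewrite /rng (eq_filter (a2 := pred0)) ?filter_pred0 // => i /=.
by apply/negP => /andP[]; lia.
Qed.

Lemma rng_cat c e b : (c <= e <= b)%N -> (b < N)%N -> rng c b = rng c e ++ rng e b.
Proof.
move=> h bN; have eN : (e < N)%N by lia.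
apply: (inj_map val_inj); rewrite map_cat !val_rng //.
have -> : (b - c = (e - c) + (b - e))%N by lia.
by rewrite iotaD; have -> : (c.+1 + (e - c) = e.+1)%N by lia.
Qed.

Lemma mem_rng c b (i : 'I_N) : (i \in rng c b) = (c < i <= b)%N.
Proof. by rewrite mem_filter mem_enum andbT. Qed.

Lemma uniq_rng c b : uniq (rng c b).
Proof. by rewrite filter_uniq // enum_uniq. Qed.

End Ranges.

(** * Braid words in coordinates indexed by strands *)

Section BraidOperators.
Variables (R : comNzRingType) (B : finType) (N : nat).
Local Notation st := {ffun 'I_N -> B}.
Local Notation fn := (st -> R).
Local Notation op := (fn -> fn).
Variables (Bk BV : B -> B -> B -> B -> R).
Implicit Types (s : st) (F : fn) (i j c b : 'I_N).

Definition bop (w : braid N) : op :=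
  foldr (fun l O => letter_op (if l.2 then BV else Bk) (pstr l.1) l.1 \o O) id w.

Lemma bop_cat w1 w2 : bop (w1 ++ w2) = bop w1 \o bop w2.
Proof. by elim: w1 => [//|l w1 IH] /=; rewrite IH. Qed.

Lemma lin_bop w : lin (bop w).
Proof. by elim: w => [|l w IH]; [exact: lin_id | apply: lin_comp; [exact: lin_gop|]]. Qed.

(* Crossings of a strand (first argument) with another one (second argument), the first
   passing over or under the second. *)
Definition Kov x y x' y' := Bk x y y' x'.
Definition KovV x y x' y' := BV y x x' y'.
Definition Kun x y x' y' := Bk y x x' y'.
Definition KunV x y x' y' := BV x y y' x'.

Definition nx (i : 'I_N) : 'I_N := odflt i (insub i.+1).

Lemma nxE i j : j = i.+1 :> nat -> nx i = j.
Proof. by move=> e; apply: val_inj; rewrite /nx insubT -?e // => h; rewrite /= e. Qed.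

(* The strand [j] has moved to position [c], the strands between moving one step back. *)
Definition rdi j c i := if (j <= i < c)%N then nx i else if i == c then j else i.
Definition rd j c s : st := [ffun i => s (rdi j c i)].

Lemma rd_id j s : rd j j s = s.
Proof.
apply/ffunP => i; rewrite ffunE /rdi; case: ifP => [|_]; last by case: eqP => [->|].
by move=> /andP[h1 h2]; have := leq_ltn_trans h1 h2; rewrite ltnn.
Qed.

Lemma pstrE c i : i = c.+1 :> nat -> pstr i = c.
Proof. by move=> e; apply: val_inj; rewrite /= e. Qed.

Lemma rdi_far j c i k : i = c.+1 :> nat -> (j <= c)%N -> k != c -> k != i ->
  [/\ rdi j c k = rdi j i k, rdi j c k != j & rdi j c k != i].
Proof.
move=> e jc kc ki; have kc' : (k : nat) <> c by move=> h; case/eqP: kc; apply: val_inj.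
have ki' : (k : nat) <> i by move=> h; case/eqP: ki; apply: val_inj.
have hi := ltn_ord i; rewrite /rdi (negbTE kc) (negbTE ki).
have -> : (j <= k < i)%N = (j <= k < c)%N by move: kc'; rewrite /= e; lia.
case: ifP => [h|h]; split=> //.
- have lt : (k.+1 < N)%N by lia.
  by rewrite (@nxE _ (Ordinal lt)) //; apply/eqP => /(congr1 val) /=; lia.
- have lt : (k.+1 < N)%N by lia.
  by rewrite (@nxE _ (Ordinal lt)) //; apply/eqP => /(congr1 val) /=; lia.
by apply/eqP => /(congr1 val) /=; move: kc'; lia.
Qed.

(** After the change of coordinates [rd], the crossing of the traveling strand, at position [c],
    with its right neighbour becomes a crossing of the strands [j] and [i], whose indices no longer
    depend on the position. *)
Lemma step_up K j c i F s : i = c.+1 :> nat -> (j <= c)%N ->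
  letter_op K c i F (rd j c s) = letter_op (fun x y x' y' => K x y y' x') j i (fun s => F (rd j i s)) s.
Proof.
move=> e jc; rewrite !letter_opE [RHS]exchange_big /=.
have ci : (c == i) = false by apply/eqP => /(congr1 val) /=; lia.
have ji : (j == i) = false by apply/eqP => /(congr1 val) /=; lia.
have -> : rd j c s c = s j by rewrite ffunE /rdi ltnn andbF eqxx.
have -> : rd j c s i = s i by rewrite ffunE /rdi eq_sym ci e ltnNge leqnSn andbF.
apply: eq_bigr => u _; apply: eq_bigr => v _; congr (_ * F _).
apply/ffunP => k; rewrite !(ffunE, updE).
case: (eqVneq k i) => [->|ki]; first by rewrite /rdi ltnn andbF eqxx ji eqxx.
case: (eqVneq k c) => [->|kc].
  by rewrite /rdi jc e ltnSn /= (nxE e) eqxx.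
have [e1 n1 n2] := rdi_far e jc kc ki.
by rewrite -e1 (negbTE n1) (negbTE n2).
Qed.

Lemma step_down K j c i F s : i = c.+1 :> nat -> (j <= c)%N ->
  letter_op K c i F (rd j i s) = letter_op (fun x y x' y' => K y x x' y') j i (fun s => F (rd j c s)) s.
Proof.
move=> e jc; rewrite !letter_opE.
have ci : (c == i) = false by apply/eqP => /(congr1 val) /=; lia.
have ji : (j == i) = false by apply/eqP => /(congr1 val) /=; lia.
have -> : rd j i s c = s i by rewrite ffunE /rdi jc e ltnSn /= (nxE e).
have -> : rd j i s i = s j by rewrite ffunE /rdi ltnn andbF eqxx.
apply: eq_bigr => u _; apply: eq_bigr => v _; congr (_ * F _).
apply/ffunP => k; rewrite !(ffunE, updE).
case: (eqVneq k i) => [->|ki].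
  by rewrite /rdi [i == c]eq_sym ci e ltnNge leqnSn andbF eqxx.
case: (eqVneq k c) => [->|kc]; first by rewrite /rdi ltnn andbF eqxx ji eqxx.
have [e1 n1 n2] := rdi_far e jc kc ki.
by rewrite -e1 (negbTE n1) (negbTE n2).
Qed.

Lemma bop_up j c b w F s : (j <= c <= b)%N ->
  bop ([seq (i, false) | i <- rng N c b] ++ w) F (rd j c s) =
  Cs Kov j (rng N c b) (fun s => bop w F (rd j b s)) s.
Proof.
move: {2}(b - c)%N (erefl (b - c)%N) => k; elim: k c s => [|k IH] c s ek /andP[jc cb].
  by rewrite rng_nil; [have -> : c = b by apply: val_inj; rewrite /=; lia | lia].
have hc : (c.+1 < N)%N by have := ltn_ord b; lia.
pose i := Ordinal hc; have ib : (i <= b < N)%N by rewrite ltn_ord andbT /=; lia.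
rewrite (@rng_cons N c b i) //= (@pstrE c i) //= step_up //.
congr (letter_op _ j i _ s); apply: funext => t; apply: IH => /=; lia.
Qed.

Lemma bop_down j c b w F s : (j <= c <= b)%N ->
  bop ([seq (i, true) | i <- rev (rng N c b)] ++ w) F (rd j b s) =
  Cis KovV j (rng N c b) (fun s => bop w F (rd j c s)) s.
Proof.
move: {2}(b - c)%N (erefl (b - c)%N) => k; elim: k c w s => [|k IH] c w s ek /andP[jc cb].
  by rewrite rng_nil; [have -> : c = b by apply: val_inj; rewrite /=; lia | lia].
have hc : (c.+1 < N)%N by have := ltn_ord b; lia.
pose i := Ordinal hc; have ib : (i <= b < N)%N by rewrite ltn_ord andbT /=; lia.
rewrite (@rng_cons N c b i) // rev_cons map_rcons cat_rcons IH /=; [|lia|lia].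
congr (Cis _ _ _ _ s); apply: funext => t; rewrite (@pstrE c i) // step_down //.
Qed.

End BraidOperators.

Section WordInverse.
Variable T : Type.
Implicit Types w : seq (T * bool).

Lemma winv_cat w1 w2 : winv (w1 ++ w2) = winv w2 ++ winv w1.
Proof. by rewrite /winv map_cat rev_cat. Qed.

Lemma winvK w : winv (winv w) = w.
Proof.
rewrite /winv map_rev revK -map_comp -[RHS]map_id; apply: eq_map => -[i b] /=.
by rewrite negbK.
Qed.

Lemma winv_map (I : Type) (f : I -> T) b (l : seq I) :
  winv [seq (f i, b) | i <- l] = [seq (f i, ~~ b) | i <- rev l].
Proof. by rewrite /winv -map_comp -map_rev. Qed.

End WordInverse.

(** * Contraction of the relator strands *)

Section LinkOperators.
Variables (R : comNzRingType) (B : finType) (m n : nat).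
Local Notation N := (m + n)%N.
Local Notation st := {ffun 'I_N -> B}.
Local Notation gst := {ffun 'I_n -> B}.
Local Notation fn := (st -> R).
Local Notation op := (fn -> fn).
Variables (w : B -> R) (d : B) (Bk BV : B -> B -> B -> B -> R).
Local Notation Kov := (Kov Bk).
Local Notation KovV := (KovV BV).
Local Notation Kun := (Kun Bk).
Local Notation KunV := (KunV BV).
Hypothesis ov_tr : forall x y x' y',
  \sum_x1 \sum_y1 w x1 * Kov x1 y x' y1 * KovV x y1 x1 y' = w x * ((x == x') && (y == y'))%:R.
Hypothesis ov_inv : forall x y x' y',
  \sum_x1 \sum_y1 KovV x y x1 y1 * Kov x1 y1 x' y' = ((x == x') && (y == y'))%:R.

Implicit Types (j : 'I_m) (k : 'I_n) (l : 'I_n * bool) (x : B) (g : gst) (f : B -> gst -> R).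
Local Notation lj j := (lshift n j).
Local Notation rk k := (rshift m k).

Definition gw j (k : 'I_n) : braid N :=
  let r := [seq (i, false) | i <- rng N j (m + k).-1] in
  let y := (rk k, false) in r ++ [:: y; y] ++ winv r.
Definition rw j (wd : seq ('I_n * bool)) : braid N :=
  flatten [seq if l.2 then winv (gw j l.1) else gw j l.1 | l <- wd].
Definition lw (rel : 'I_m -> seq ('I_n * bool)) : braid N :=
  flatten [seq rw j (rel j) | j <- enum 'I_m].

Definition loop_op j l : op :=
  if l.2 then letter_op KunV (lj j) (rk l.1) \o letter_op KovV (lj j) (rk l.1)
  else letter_op Kov (lj j) (rk l.1) \o letter_op Kun (lj j) (rk l.1).

(** The relator strand passes over the strands in between, clasps the generator strand, and returns
    over the same strands. *)
Lemma bop_gw j l :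
  bop Bk BV (if l.2 then winv (gw j l.1) else gw j l.1) =
  Cs Kov (lj j) (rng N j (m + l.1).-1) \o loop_op j l \o Cis KovV (lj j) (rng N j (m + l.1).-1).
Proof.
case: l => k b /=; have jm := ltn_ord j; have kn := ltn_ord k.
have hc : ((m + k).-1 < N)%N by lia.
pose c := Ordinal hc; have jc : (lj j <= lj j <= c)%N by rewrite leqnn /=; lia.
have ec : rk k = c.+1 :> nat by rewrite /=; lia.
apply: funext => F; apply: funext => s.
have -> : (if b then winv (gw j k) else gw j k) =
   [seq (i, false) | i <- rng N j c] ++ (rk k, b) :: (rk k, b) :: [seq (i, true) | i <- rev (rng N j c)] ++ [::].
  rewrite cats0 /gw; case: b; last by rewrite winv_map.
  by rewrite winv_cat winv_cat winvK -catA winv_map.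
rewrite -[rng N j c]/(rng N (lj j) c) -[rng N j _]/(rng N (lj j) c).
rewrite -{1}[s](rd_id (lj j)) bop_up //; congr (Cs _ _ _ _ s); apply: funext => t /=.
rewrite (pstrE ec) (step_up _ _ _ ec) //; last by case/andP: jc.
have fin v : bop Bk BV ([seq (i, true) | i <- rev (rng N (lj j) c)] ++ [::]) F (rd (lj j) c v) =
    Cis KovV (lj j) (rng N (lj j) c) F v.
  by rewrite bop_down //; congr (Cis _ _ _ _ v); apply: funext => z; rewrite rd_id.
case: b => /=; congr (letter_op _ _ _ _ t); apply: funext => u.
  rewrite (step_down _ _ _ ec) //; last by case/andP: jc.
  congr (letter_op _ _ _ _ u); apply: funext => v.
  exact: fin.
rewrite (step_down _ _ _ ec) //; last by case/andP: jc.
congr (letter_op _ _ _ _ u); apply: funext => v.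
exact: fin.
Qed.

Lemma Cs_cat (K : B -> B -> B -> B -> R) (j : 'I_N) (l1 l2 : seq 'I_N) : Cs K j (l1 ++ l2) = Cs K j l1 \o Cs K j l2.
Proof. by elim: l1 => [//|i l1 IH] /=; rewrite IH. Qed.

Lemma Cis_cat (K : B -> B -> B -> B -> R) (j : 'I_N) (l1 l2 : seq 'I_N) : Cis K j (l1 ++ l2) = Cis K j l2 \o Cis K j l1.
Proof. by elim: l1 => [//|i l1 IH] /=; rewrite IH. Qed.

Definition low (k : nat) : seq 'I_n := [seq i : 'I_n <- enum 'I_n | (i < k)%N].

Lemma rng_gens k : rng N m.-1 (m + k).-1 = [seq rk i | i <- low k] \/ m = 0%N.
Proof.
case: (posnP m) => [->|m0]; [by right|left].
have kn := ltn_ord k; apply: (inj_map val_inj); rewrite val_rng; last by lia.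
rewrite -map_comp (eq_map (g := (addn m) \o val)) // map_comp.
have -> : map val (low k) = iota 0 k.
  rewrite /low (eq_filter (a2 := preim val (fun i : nat => (i < k)%N))) // -filter_map val_enum_ord.
  apply: (@irr_sorted_eq _ ltn); [exact: ltn_trans|exact: ltnn| |exact: iota_ltn_sorted|].
    by apply: sorted_filter; [exact: ltn_trans | exact: iota_ltn_sorted].
  by move=> i; rewrite mem_filter !mem_iota; apply/idP/idP; lia.
by rewrite -iotaDl addn0; congr iota; lia.
Qed.

Definition Gl j l : op := Cs Kov (lj j) [seq rk i | i <- low l.1] \o loop_op j l \o
  Cis KovV (lj j) [seq rk i | i <- low l.1].
Definition Gop j wd : op := foldr (fun l O => Gl j l \o O) id wd.
Definition rels j : seq 'I_N := rng N j m.-1.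

Lemma rels_notin j : lj j \notin rels j.
Proof. by rewrite mem_rng /= ltnn. Qed.

(** The overcrossings with the later relator strands cancel between consecutive letters and survive
    only at the two ends of the word; for the empty word there are none. *)
Lemma bop_rw j wd :
  bop Bk BV (rw j wd) = id /\ wd = [::] \/
  bop Bk BV (rw j wd) = Cs Kov (lj j) (rels j) \o Gop j wd \o Cis KovV (lj j) (rels j).
Proof.
have one l : bop Bk BV (if l.2 then winv (gw j l.1) else gw j l.1) =
    Cs Kov (lj j) (rels j) \o Gl j l \o Cis KovV (lj j) (rels j).
  have jm := ltn_ord j; have kn := ltn_ord l.1.
  rewrite bop_gw (@rng_cat N j m.-1); [|lia|lia].
  have [->|m0] := rng_gens l.1; last by lia.
  by rewrite Cs_cat Cis_cat.
have step l v : bop Bk BV (rw j (l :: v)) =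
    bop Bk BV (if l.2 then winv (gw j l.1) else gw j l.1) \o bop Bk BV (rw j v).
  by rewrite -bop_cat.
elim: wd => [|l v IH]; [by left|right].
rewrite step one; case: IH => [[-> ->]|->] //.
transitivity (Cs Kov (lj j) (rels j) \o Gl j l \o (Cis KovV (lj j) (rels j) \o
   Cs Kov (lj j) (rels j)) \o Gop j v \o Cis KovV (lj j) (rels j)); first by [].
by rewrite Cis_Cs // rels_notin.
Qed.

Lemma lin_Cs K (j : 'I_N) (l : seq 'I_N) : lin (@Cs R B N K j l).
Proof. by elim: l => [|i l IH]; [exact: lin_id | apply: lin_comp; [exact: lin_letter|]]. Qed.

Lemma lin_Cis K (j : 'I_N) (l : seq 'I_N) : lin (@Cis R B N K j l).
Proof. by elim: l => [|i l IH]; [exact: lin_id | apply: lin_comp; [|exact: lin_letter]]. Qed.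

Lemma indep_Cs K (i j : 'I_N) (l : seq 'I_N) : i != j -> i \notin l -> indep i (@Cs R B N K j l).
Proof.
move=> ij; elim: l => [|k l IH]; first by [].
rewrite inE negb_or => /andP[ik /IH h]; apply: indep_comp => //; exact: indep_letter.
Qed.

Lemma indep_Cis K (i j : 'I_N) (l : seq 'I_N) : i != j -> i \notin l -> indep i (@Cis R B N K j l).
Proof.
move=> ij; elim: l => [|k l IH]; first by [].
rewrite inE negb_or => /andP[ik /IH h]; apply: indep_comp => //; exact: indep_letter.
Qed.

Lemma lin_loop j l : lin (loop_op j l).
Proof. by rewrite /loop_op; case: ifP => _; apply: lin_comp; exact: lin_letter. Qed.

Lemma lj_rk j k : (lj j == rk k) = false.
Proof. by apply/eqP => /(congr1 val) /=; have := ltn_ord j; lia. Qed.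

Lemma rk_lj j k : (rk k == lj j) = false. Proof. by rewrite eq_sym lj_rk. Qed.

Lemma lj_low j k : lj j \notin [seq rk i | i <- low k].
Proof. by apply/mapP => -[i _ /eqP]; rewrite lj_rk. Qed.

Lemma indep_Gop (i j : 'I_m) wd : i != j -> indep (lj i) (Gop j wd).
Proof.
move=> ij; have lij : lj i != lj j by apply: contraNneq ij => /(@lshift_inj _ _) ->.
elim: wd => [|l v IH]; first by [].
apply: indep_comp => //; apply: indep_comp; first apply: indep_comp.
- by apply: indep_Cs => //; exact: lj_low.
- by rewrite /loop_op; case: ifP => _; apply: indep_comp; apply: indep_letter => //; rewrite lj_rk.
- by apply: indep_Cis => //; exact: lj_low.
Qed.

Lemma lin_Gop j wd : lin (Gop j wd).
Proof.
elim: wd => [|l v IH]; first exact: lin_id.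
apply: lin_comp => //; apply: lin_comp; last exact: lin_Cis.
by apply: lin_comp; [exact: lin_Cs | exact: lin_loop].
Qed.

Lemma indep_bop_rw (i j : 'I_m) wd : (i < j)%N -> indep (lj i) (bop Bk BV (rw j wd)).
Proof.
move=> ij; case: (bop_rw j wd) => [[-> _]|->]; first exact: indep_id.
have nij : i != j by rewrite neq_ltn ij.
have lij : lj i != lj j by apply: contraNneq nij => /(@lshift_inj _ _) ->.
have ni : lj i \notin rels j by rewrite mem_rng /=; lia.
apply: indep_comp; [apply: indep_comp|]; [exact: indep_Cs|exact: indep_Gop|exact: indep_Cis].
Qed.

Lemma ptr_rw j wd H : free (lj j) H -> ptr w (lj j) (bop Bk BV (rw j wd)) H = ptr w (lj j) (Gop j wd) H.
Proof.
move=> fH; case: (bop_rw j wd) => [[-> ->]|->] //.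
apply: ptr_Cs => //; [exact: rels_notin|exact: uniq_rng|exact: lin_Gop|].
move=> i; rewrite mem_rng /= => /andP[ji im].
have hi : (i < m)%N by lia.
have -> : i = lj (Ordinal hi) by apply: val_inj.
by apply: indep_Gop; rewrite neq_ltn /= ji orbT.
Qed.

Variable rel : 'I_m -> seq ('I_n * bool).
Let Om j : op := bop Bk BV (rw j (rel j)).
Let Tf j : op := ptr w (lj j) (Gop j (rel j)).
Definition comps (O : 'I_m -> op) (js : seq 'I_m) : op := foldr (fun j Q => O j \o Q) id js.

Lemma bop_lw : bop Bk BV (lw rel) = comps Om (enum 'I_m).
Proof. by rewrite /lw; elim: (enum 'I_m) => [//|j js IH] /=; rewrite bop_cat IH. Qed.

Lemma lin_comps O js : (forall j, lin (O j)) -> lin (comps O js).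
Proof. by move=> h; elim: js => [|j js IH]; [exact: lin_id | apply: lin_comp]. Qed.

(** The strands are closed in increasing order: the words of later relators do not act on strand
    [j], and once it is closed, the crossings of its own word with later relator strands slip off
    ([ptr_rw]). *)
Lemma FT_rels (A : {set 'I_N}) P js : lin P -> sorted ltn (map val js) ->
  (forall j, j \in js -> indep (lj j) P /\ lj j \notin A) ->
  FT w d A (P \o comps Om js) = FT w d ([set lj j | j in js] :|: A) (P \o comps Tf js).
Proof.
elim: js A P => [|j js IH] A P lP srt hP.
  by congr (FT _ _ _ _); apply/setP => i; rewrite !inE; case: imsetP => // -[].
have lOm (k : 'I_m) : lin (Om k) by exact: lin_bop.
have lTf (k : 'I_m) : lin (Tf k) by apply: lin_ptr; exact: lin_Gop.
have [iP jA] := hP j (mem_head _ _).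
have jjs : forall k : 'I_m, k \in js -> (j < k)%N.
  move=> k kjs; have := srt; rewrite /= (path_sortedE ltn_trans) => /andP[/allP h _].
  by apply: h; apply: map_f.
have iOm : indep (lj j) (comps Om js).
  move: jjs {IH srt hP}; elim: js => [|k js IH] h //=.
  apply: indep_comp; first by apply: indep_bop_rw; apply: h; rewrite mem_head.
  by apply: IH => i ijs; apply: h; rewrite inE ijs orbT.
have -> : P \o comps Om (j :: js) = P \o Om j \o comps Om js by [].
rewrite (@FT_step _ _ _ w d A P (Om j) (comps Om js) (lj j)) //; last exact: lin_comps.
have -> : FT w d (lj j |: A) (P \o ptr w (lj j) (Om j) \o comps Om js) =
          FT w d (lj j |: A) ((P \o Tf j) \o comps Om js).
  apply: eq_bigr => r _; congr (_ * P _ _); rewrite /Om ptr_rw //.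
  by apply: free_indep => //; apply: ind_free; rewrite setU11.
rewrite IH.
- congr (FT _ _ _ _); apply/setP => i; rewrite !inE; rewrite orbA; congr (_ || _).
  apply/orP/imsetP => [[/imsetP[k kjs ->]|/eqP ->]|[k]].
  + by exists k; rewrite // inE kjs orbT.
  + by exists j; rewrite // mem_head.
  rewrite inE => /orP[/eqP -> -> |kjs ->]; [by right; rewrite eqxx | by left; apply/imsetP; exists k].
- by apply: lin_comp.
- by move: srt; rewrite /= => /path_sorted.
move=> k kjs; have kj : k != j by rewrite neq_ltn jjs ?orbT.
have ljk : lj k != lj j by apply: contraNneq kj => /(@lshift_inj _ _) ->.
have [iPk kA] := hP k (mem_behead (s := j :: js) kjs).
split; last by rewrite !inE negb_or ljk.
apply: indep_comp => //; apply: indep_ptr => //; [exact: lin_Gop | exact: indep_Gop].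
Qed.

Definition rdg (s : st) : gst := [ffun k => s (rk k)].

Definition gletter (K : B -> B -> B -> B -> R) (k : 'I_n) (f : B -> gst -> R) : B -> gst -> R :=
  fun x g => \sum_x' \sum_y' K x (g k) x' y' * f x' (upd g k y').

Lemma letter_red K j k f : letter_op K (lj j) (rk k) (fun s => f (s (lj j)) (rdg s)) =
  (fun s => gletter K k f (s (lj j)) (rdg s)).
Proof.
apply: funext => s; rewrite letter_opE /gletter; apply: eq_bigr => x' _; apply: eq_bigr => y' _.
rewrite upd_neq ?lj_rk // upd_same ffunE; congr (_ * f _ _).
apply/ffunP => i; rewrite !(ffunE, updE) (inj_eq (@rshift_inj _ _)).
by case: eqP => // _; rewrite rk_lj.
Qed.

Definition gCs K (l : seq 'I_n) (f : B -> gst -> R) := foldr (gletter K) f l.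
Definition gCis K (l : seq 'I_n) (f : B -> gst -> R) := foldl (fun f i => gletter K i f) f l.
Definition gloop l f := if l.2 then gletter KunV l.1 (gletter KovV l.1 f)
  else gletter Kov l.1 (gletter Kun l.1 f).
Definition gword wd f := foldr (fun l f => gCs Kov (low l.1) (gloop l (gCis KovV (low l.1) f))) f wd.

Lemma Gop_red j wd f : Gop j wd (fun s => f (s (lj j)) (rdg s)) =
  (fun s => gword wd f (s (lj j)) (rdg s)).
Proof.
have cs K (l : seq 'I_n) f' : Cs K (lj j) [seq rk i | i <- l] (fun s => f' (s (lj j)) (rdg s)) =
   (fun s => gCs K l f' (s (lj j)) (rdg s)).
  by elim: l => [//|i l IH] /=; rewrite IH letter_red.
have cis K (l : seq 'I_n) f' : Cis K (lj j) [seq rk i | i <- l] (fun s => f' (s (lj j)) (rdg s)) =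
   (fun s => gCis K l f' (s (lj j)) (rdg s)).
  by elim: l f' => [//|i l IH] f' /=; rewrite letter_red IH.
elim: wd => [//|l v IH] /=; rewrite IH /Gl /= cis /loop_op /gloop.
by case: ifP => _; rewrite /= !letter_red cs.
Qed.

(** What a closed relator strand leaves behind: an operator on the states of the generator strands
    alone. *)
Definition relT wd (f : gst -> R) : gst -> R :=
  fun g => \sum_x w x * gword wd (fun x' g' => f g' * (x' == x)%:R) x g.

Lemma ptr_red j wd (f : gst -> R) : ptr w (lj j) (Gop j wd) (fun s => f (rdg s)) = (fun s => relT wd f (rdg s)).
Proof.
apply: funext => s; rewrite /ptr /relT; apply: eq_bigr => x _; congr (_ * _).
rewrite (Gop_red j wd (fun x' g' => f g' * (x' == x)%:R)) upd_same; congr (gword _ _ _ _).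
by apply/ffunP => k; rewrite !(ffunE, updE) rk_lj.
Qed.

Theorem trace_lw :
  \sum_(s : st) (\prod_i w (s i)) * bop Bk BV (lw rel) (delta R s) s =
  \sum_(g : gst) (\prod_k w (g k)) * foldr (fun j (f : gst -> R) => relT (rel j) f) (delta R g) (enum 'I_m) g.
Proof.
have srt : sorted ltn (map val (enum 'I_m)) by rewrite val_enum_ord iota_ltn_sorted.
have e0 : \sum_(s : st) (\prod_i w (s i)) * bop Bk BV (lw rel) (delta R s) s =
   FT w d finset.set0 (id \o comps Om (enum 'I_m)).
  rewrite /FT bop_lw; apply: eq_big => s.
    by apply/esym/forallP => i; rewrite inE.
  move=> _; congr (_ * _); first by apply: eq_bigl => i; rewrite inE.
  congr (comps _ _ _ _); apply: funext => u; rewrite /delta /ind; congr (nat_of_bool _)%:R.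
  apply/eqP/forallP => [-> i|h]; first by rewrite eqxx implybT.
  by apply/ffunP => i; have := h i; rewrite inE => /eqP.
rewrite e0 FT_rels //; last by move=> j _; rewrite inE.
pose A := [set lj j | j in enum 'I_m] :|: finset.set0.
have inA j : lj j \in A by rewrite /A finset.setU0; apply/imsetP; exists j; rewrite // mem_enum.
have ninA k : rk k \notin A.
  by rewrite /A finset.setU0; apply/imsetP => -[j _ /eqP]; rewrite rk_lj.
pose mk (g : gst) : st := [ffun i => match split i with inl _ => d | inr k => g k end].
have mkl g j : mk g (lj j) = d by rewrite ffunE (unsplitK (inl j)).
have mkr g k : mk g (rk k) = g k by rewrite ffunE (unsplitK (inr k)).
have rmk g : rdg (mk g) = g by apply/ffunP => k; rewrite ffunE mkr.
rewrite /FT -/A (reindex mk) /=; last first.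
  exists rdg => [g _|r]; first exact: rmk.
  rewrite inE => /forallP h; apply/ffunP => i; rewrite ffunE.
  case: splitP => [j ij|k ik].
    have -> : i = lj j by apply: val_inj.
    by have := h (lj j); rewrite inA => /eqP.
  by rewrite ffunE; congr (r _); apply: val_inj.
apply: eq_big => g.
  apply/forallP => i; rewrite -(splitK i); case: (split i) => [j|k] /=.
    by rewrite mkl eqxx implybT.
  by rewrite (negbTE (ninA k)).
move=> _; congr (_ * _).
  rewrite big_split_ord /= big1 ?mul1r => [|j]; last by rewrite inA.
  by apply: eq_big => k; rewrite ?ninA // mkr.
have -> : ind R A (mk g) = (fun s => delta R g (rdg s)).
  apply: funext => u; rewrite /ind /delta; congr (nat_of_bool _)%:R.
  apply/forallP/eqP => [h|e i].
    by apply/ffunP => k; have := h (rk k); rewrite ninA mkr ffunE => /eqP.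
  rewrite -(splitK i); case: (split i) => [j|k] /=; first by rewrite inA.
  by rewrite ninA mkr -e ffunE eqxx.
have -> : forall js (f : gst -> R), comps Tf js (fun s => f (rdg s)) =
   (fun s => foldr (fun j (f : gst -> R) => relT (rel j) f) f js (rdg s)).
  by elim=> [//|j js IH] f; rewrite /= IH /Tf ptr_red.
by rewrite rmk.
Qed.

End LinkOperators.

(** * The link value as a trace over the generator strands *)

Section LinkTrace.
Variable p : nat.
Hypothesis p_pr : prime p.
Hypothesis p_ge5 : (5 <= p)%N.
Local Notation R := (Rp p).
Local Notation vz := (vz p).

Lemma vz_sum (I : finType) (F : I -> int) : \prod_i vz (F i) = vz (\sum_i F i).
Proof.
by apply: (big_rec2 (fun x y => x = vz y)) => [|i x y _ ->]; rewrite ?vz0E // vzDE.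
Qed.

Lemma braid_perm_cat N (w1 w2 : braid N) : braid_perm (w1 ++ w2) = (braid_perm w1 * braid_perm w2)%g.
Proof. by rewrite /braid_perm big_cat. Qed.

Lemma braid_perm_winv N (w : braid N) : braid_perm (winv w) = (braid_perm w)^-1%g.
Proof.
elim: w => [|l w IH]; first by rewrite /braid_perm !big_nil invg1.
rewrite -cat1s winv_cat !braid_perm_cat IH invMg; congr (_ * _)%g.
by rewrite /braid_perm !big_seq1 tpermV.
Qed.

Lemma braid_perm_link (P : presentation) : braid_perm (link P) = 1%g.
Proof.
have gen j k : braid_perm (@psi_gen P j k) = 1%g.
  rewrite /psi_gen !braid_perm_cat braid_perm_winv.
  have -> : braid_perm [:: (rshift (prel P) k, false); (rshift (prel P) k, false)] = 1%g.
    by rewrite /braid_perm !big_cons big_nil mulg1 tperm2.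
  by rewrite mul1g mulgV.
have fl (T : Type) (F : T -> braid (prel P + pgen P)) (l : seq T) :
    (forall x, braid_perm (F x) = 1%g) -> braid_perm (flatten (map F l)) = 1%g.
  move=> h; elim: l => [|x l IH]; first by rewrite /braid_perm big_nil.
  by rewrite /= braid_perm_cat h IH mulg1.
apply: (fl) => j; apply: (fl) => l; case: ifP => _; rewrite ?braid_perm_winv gen ?invg1 //.
Qed.

Lemma froots1 N (i : 'I_N) (s : {perm 'I_N}) : s = 1%g -> froots s i.
Proof.
move=> ->; rewrite /fingraph.roots /=; apply/eqP; set r := fingraph.root _ _.
have : fconnect (1%g : {perm 'I_N}) i r by exact: connect_root.
move/iter_findex => e; rewrite -e; elim: (findex _ _ _) => //= k ->; exact: perm1.
Qed.

(** For a pure braid every strand is a component, so the sum over labels and the sum over states of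
    given labels combine to one over all states. *)
Lemma Zlink_pure N (w : braid N) : braid_perm w = 1%g ->
  Zlink p w = \sum_(s : state N p) (\prod_i qdim (tag (s i))) *
     vz (- (2 * \sum_i hwt (s i))) * braid_coef w s s.
Proof.
move=> pw; rewrite /Zlink /closure_value.
rewrite (eq_bigl xpredT) => [|c]; last by apply/forallP => i; rewrite pw perm1.
rewrite [RHS](partition_big (fun s : state N p => [ffun i => tag (s i)]) xpredT) //=.
apply: eq_bigr => c _; rewrite mulr_sumr.
apply: eq_big => s.
  by apply/forallP/eqP => [h|<- i]; [apply/ffunP => i; rewrite ffunE; apply/eqP | rewrite ffunE].
move=> /forallP h; rewrite mulrA; congr (_ * _ * _).
  rewrite (eq_bigl xpredT) => [|i]; last exact: froots1.
  by apply: eq_bigr => i _; rewrite (eqP (h i)).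
by rewrite vz_sum; congr vz; rewrite mulr_sumr sumrN.
Qed.

Lemma letter_coef_op N (l : 'I_N * bool) (s : state N p) (F : state N p -> R) : pstr l.1 != l.1 ->
  \sum_t letter_coef l s t * F t =
  letter_op (if l.2 then @braidingV p else @braiding p) (pstr l.1) l.1 F s.
Proof.
case: l => b e /=; set a := pstr b => nab.
rewrite letter_opE pair_bigA /=.
pose f (k : bvec p * bvec p) : state N p := upd (upd s a k.1) b k.2.
pose P (t : state N p) := [forall j, (j != b) && (j != a) ==> (t j == s j)].
rewrite (bigID P) /= [X in _ + X]big1 ?addr0 => [|t nt]; last first.
  by rewrite /letter_coef /= -/a -/(P t) (negbTE nt) mul0r.
rewrite (reindex f) /=; last first.
  exists (fun t => (t a, t b)) => [[x y] _|t].
    by rewrite /f /= upd_same upd_neq // upd_same.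
  rewrite inE => /forallP h; apply/ffunP => j; rewrite /f !updE.
  case: eqP => [-> //|/eqP jb]; case: eqP => [-> //|/eqP ja].
  by have := h j; rewrite jb ja => /eqP.
apply: eq_big => [k|k Pk].
  by apply/forallP => j; apply/implyP => /andP[jb ja]; rewrite /f !upd_neq.
rewrite /letter_coef /= -/a -/(P (f k)) Pk; congr (_ * _).
by rewrite /f upd_neq // !upd_same; case: e.
Qed.

Lemma braid_coef_op N (w : braid N) (s t : state N p) : all (fun l => pstr l.1 != l.1) w ->
  braid_coef w s t = bop (@braiding p) (@braidingV p) w (delta R t) s.
Proof.
elim: w s => [|l w IH] s //= /andP[hl hw].
by rewrite letter_coef_op //; congr (letter_op _ _ _ _ s); apply: funext => u; exact: IH.
Qed.

Lemma link_pos (P : presentation) : all (fun l : 'I_(prel P + pgen P) * bool => (0 < l.1)%N) (link P).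
Proof.
have wi N (w : braid N) : all (fun l : 'I_N * bool => (0 < l.1)%N) (winv w) = all (fun l : 'I_N * bool => (0 < l.1)%N) w.
  by rewrite /winv all_rev all_map.
have gen j k : all (fun l : 'I_(prel P + pgen P) * bool => (0 < l.1)%N) (@psi_gen P j k).
  have hr b : all (fun l : 'I_(prel P + pgen P) * bool => (0 < l.1)%N) (@ramp P j b).
    by apply/allP => l /mapP[i]; rewrite mem_filter => /andP[/andP[h _] _] {l}-> /=; lia.
  by rewrite /psi_gen !all_cat wi hr /= andbT; have := ltn_ord j; lia.
rewrite /link; elim: (enum 'I_(prel P)) => [//|j js IH] /=; rewrite all_cat IH andbT.
rewrite /psi; elim: (relator j) => [//|l v IHv] /=; rewrite all_cat IHv andbT.
by case: ifP; rewrite ?wi gen.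
Qed.

Lemma over_wt (x y u w : bvec p) : braiding x y u w != 0 -> hwt u + hwt w = hwt x + hwt y.
Proof.
rewrite -[braiding x y u w]/(over x y w u) overE //.
case: ifP => [/andP[/eqP tx /eqP ty] /cross_supp[_ h]|_]; last by rewrite eqxx.
by rewrite !hwtE tx ty; lia.
Qed.

Lemma Ediv_wt (x y : bvec p) : Ediv 1 x y != 0 -> hwt y = hwt x + 1 /\ qdim (tag x) = qdim (tag y).
Proof.
rewrite EdivE; case: ifP => [/andP[/eqP t /eqP e] _|_]; last by rewrite eqxx.
by rewrite !hwtE t e; split=> //; lia.
Qed.

Lemma Fdiv_wt (x y : bvec p) : Fdiv 1 x y != 0 -> hwt y = hwt x - 1.
Proof.
rewrite FdivE; case: ifP => [/andP[/eqP t /eqP e] _|_]; last by rewrite eqxx.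
by rewrite !hwtE t e; lia.
Qed.

Lemma EF_diag (x z : bvec p) :
  qdif vz 1 * (\sum_y Fdiv 1 x y * Ediv 1 y z - \sum_y Ediv 1 x y * Fdiv 1 y z) =
  (x == z)%:R * (vz (2 * hwt x) - vz (- (2 * hwt x))).
Proof.
have hx := bidx_le x; have hz := bidx_le z; have sx := simple_lt p_pr p_ge5 (tag x).
have sz := simple_lt p_pr p_ge5 (tag z).
rewrite (@sum_Ediv1r p p_pr p_ge5 _ z (fun i => if (tag z == tag x) && (i == bidx x + 1)%N then qbin p i 1 else 0)); last first.
  by move=> u tu; rewrite FdivE tu.
rewrite (@sum_Ediv1l p p_pr p_ge5 _ x (fun i => if (tag z == tag x) && (bidx z == i + 1)%N then qbin p (bidx z) 1 else 0)); last first.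
  by move=> u tu; rewrite FdivE tu.
rewrite bvec_eq [tag x == _]eq_sym; case: eqP => [t|_]; rewrite ?andTb; last by rewrite /= !mul0r mulr0 if_same subrr mulr0.
rewrite addn1 eqSS [bidx x == _]eq_sym; case: (eqVneq (bidx z) (bidx x)) => [e|ne]; last first.
  rewrite mul0r sub0r; case: (posnP (bidx x)) => x0; first by rewrite oppr0 mulr0 mul0r.
  by rewrite addn1 prednK // (negbTE ne) mulr0 oppr0 mulr0 mul0r.
rewrite mul1r e t; rewrite !(@qbin1 p p_pr p_ge5); [|lia|lia].
have q0 := @qint_exchange R vz (qint p) (vzDE p_pr) (qint_difE p_pr) (@qdif1_injE p p_pr p_ge5) (bidx x) 0 (2 * tag x - bidx x).
have -> : (if (0 < bidx x)%N then qint p (2 * tag x - (bidx x).-1) * (if bidx x == ((bidx x).-1 + 1)%N then qint p (bidx x) else 0) else 0) =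
   qint p (bidx x) * qint p (2 * tag x - bidx x + 1).
  case: (posnP (bidx x)) => [->|x0]; first by rewrite qint0E mul0r.
  rewrite addn1 prednK // eqxx.
  by rewrite mulrC; congr (_ * qint p _); lia.
rewrite -[(bidx x).+1]addn1 q0 qint1 // mul1r /qdif hwtE.
by congr (vz _ - vz (- _)); rewrite -subzn //; lia.
Qed.

Lemma bop_E N (w : braid N) : all (fun l : 'I_N * bool => (0 < l.1)%N) w ->
  bop (@braiding p) (@braidingV p) w \o Eop vz (@hwt p) (@Ediv p 1) =
  Eop vz (@hwt p) (@Ediv p 1) \o bop (@braiding p) (@braidingV p) w.
Proof.
have inv1 x y x' y' : \sum_u \sum_w braidingV x y u w * braiding u w x' y' = ((x == x') && (y == y'))%:R :> R.
  rewrite andbC; have := over_invL p_pr p_ge5 y x y' x'; by [].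
have inv2 x y x' y' : \sum_u \sum_w braiding x y u w * braidingV u w x' y' = ((x == x') && (y == y'))%:R :> R.
  have := over_invR p_pr p_ge5 x y x' y'; by rewrite exchange_big.
have int x y x' y' : \sum_u braiding x y u x' * Ediv 1 u y' + \sum_w braiding x y y' w * (vz (2 * hwt y') * Ediv 1 w x') =
  \sum_u Ediv 1 x u * braiding u y y' x' + \sum_w vz (2 * hwt x) * Ediv 1 y w * braiding x w y' x' :> R.
  exact: over_intertwine.
elim: w => [//|[b e] w IH] /= /andP[b0 hw].
have eb : b = (pstr b).+1 :> nat by rewrite /= prednK.
have l1 : letter_op (if e then @braidingV p else @braiding p) (pstr b) b \o Eop vz (@hwt p) (@Ediv p 1) =
  Eop vz (@hwt p) (@Ediv p 1) \o letter_op (if e then @braidingV p else @braiding p) (pstr b) b.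
  case: e.
    exact: (@letter_EV R _ N vz (@hwt p) (@braiding p) _ _ (vz0E p_pr) (vzDE p_pr) over_wt inv1 inv2 int).
  exact: (@letter_E R _ N vz (@hwt p) (@braiding p) _ (vz0E p_pr) (vzDE p_pr) over_wt int).
set L := letter_op _ _ _ in l1 *; set E := Eop _ _ _ in l1 IH *.
by rewrite -[LHS]/(L \o (bop _ _ w \o E)) IH // -[LHS]/((L \o E) \o bop _ _ w) l1.
Qed.

Theorem Zlink_trace (P : presentation) :
  Zlink p (link P) = \sum_(g : {ffun 'I_(pgen P) -> bvec p}) (\prod_k wgt (g k)) *
   foldr (fun j (f : {ffun 'I_(pgen P) -> bvec p} -> R) =>
      relT (@wgt p) (@braiding p) (@braidingV p) (relator j) f) (delta R g) (enum 'I_(prel P)) g.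
Proof.
rewrite Zlink_pure ?braid_perm_link //.
pose O := bop (@braiding p) (@braidingV p) (link P).
rewrite (eq_bigr (fun s : state _ p => (\prod_i qdim (tag (s i))) * vz (- (2 * wtot (@hwt p) s)) * O (delta R s) s)); last first.
  move=> s _; rewrite braid_coef_op //; apply: sub_all (link_pos P) => l h.
  by apply/eqP => /(congr1 val) /=; lia.
(* The closure weighs a state by K^-1, whereas [over_trace], which lets a loop slip off, needs K. *)
have := @tr_weight_sym R _ _ vz (@hwt p) (fun x => qdim (tag x)) (@Ediv p 1) (@Fdiv p 1) (vzDE p_pr)
  Ediv_wt Fdiv_wt _ EF_diag O (lin_bop _ _ _) (bop_E (link_pos P)).
move=> <-.
rewrite (eq_bigr (fun s : state _ p => (\prod_i wgt (s i)) * O (delta R s) s)); last first.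
  by move=> s _; rewrite /wgt big_split /= vz_sum -mulr_sumr.
have d : bvec p.
  have h : (0 < (p.-1)./2)%N by move: p_ge5; lia.
  by exists (Ordinal h); exact: ord0.
apply: (@trace_lw R _ _ _ _ d) => x y x' y'.
  exact: over_trace.
exact: over_invL.
Qed.

End LinkTrace.

(** * Weight sums over the simple objects *)

Section Divisibility.
Variables (R : comNzRingType) (h : R).

Definition dvh k (x : R) := exists r, x = h ^+ k * r.

Lemma dvh0 k : dvh k 0. Proof. by exists 0; rewrite mulr0. Qed.

Lemma dvhD k x y : dvh k x -> dvh k y -> dvh k (x + y).
Proof. by move=> [r ->] [s ->]; exists (r + s); rewrite mulrDr. Qed.

Lemma dvhMl k c x : dvh k x -> dvh k (c * x).
Proof. by move=> [r ->]; exists (c * r); rewrite mulrCA. Qed.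

Lemma dvhN k x : dvh k x -> dvh k (- x).
Proof. by rewrite -mulN1r; exact: dvhMl. Qed.

Lemma dvh_sum k (I : Type) (r : seq I) (P : pred I) (F : I -> R) :
  (forall i, P i -> dvh k (F i)) -> dvh k (\sum_(i <- r | P i) F i).
Proof. by move=> hF; elim/big_ind: _ => //; [exact: dvh0 | exact: dvhD]. Qed.

Lemma dvhM k l x y : dvh k x -> dvh l y -> dvh (k + l) (x * y).
Proof. by move=> [r ->] [s ->]; exists (r * s); rewrite exprD; ring. Qed.

Lemma dvh_le k l x : (k <= l)%N -> dvh l x -> dvh k x.
Proof. by move=> /subnKC <- [r ->]; exists (h ^+ (l - k) * r); rewrite exprD mulrA. Qed.

End Divisibility.

Section Integral.
Variables (R : comNzRingType) (h : R) (p : nat) (vz : int -> R).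
Hypothesis p_pr : prime p.
Hypothesis p_ge5 : (5 <= p)%N.
Local Notation s := (sp p).
Hypothesis vz0 : vz 0 = 1.
Hypothesis vzD : forall a b, vz (a + b) = vz a * vz b.
Hypothesis vz_p : forall a, vz (a * p%:Z) = 1.
Hypothesis h_inj : forall k, injective ( *%R (h ^+ k)).
Variable pu : R.
Hypothesis pE : p%:R = h ^+ p.-1 * pu.
Variable d : int -> R.
Hypothesis dE : forall k, d k = vz k - vz (- k).
Hypothesis d_unit : forall i, (0 < i < p)%N -> exists2 u, d i%:Z = h * u & isunit u.
Hypothesis sum_vz : forall c, \sum_(i < p) vz (c * i%:Z) = if (p%:Z %| c)%Z then p%:R else 0.
Variable qint : nat -> R.
Hypothesis qint_d : forall n, d 1 * qint n = d n%:Z.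
Local Notation dvh := (dvh h).

Lemma vz_mod a b : (a = b %[mod p%:Z])%Z -> vz a = vz b.
Proof.
move=> e; rewrite (divz_eq a p%:Z) (divz_eq b p%:Z) e !vzD !vz_p //.
Qed.

Definition Xx (x : int) : R := vz x + vz (- x).

(* The trace over a closed relator strand, with highest weight [2 z] and weights [2 mu]. *)
Definition lam (f : int -> int -> R) : R :=
  \sum_(z < s.+1) qint (2 * z).+1 *
   \sum_(i < (2 * z).+1) vz (2 * (z%:Z - i%:Z)) * f z%:Z (z%:Z - i%:Z).

Lemma dvp x : (exists r, x = p%:R * r) -> dvh (2 * s).+2 x.
Proof.
move=> [r ->]; exists (pu * r); rewrite pE mulrA; congr (_ ^+ _ * _ * _).
by have := spE p_pr p_ge5; lia.
Qed.

(** Orthogonality of characters: a Laurent polynomial in v^i, summed over all residues i, is a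
    multiple of [p]. *)
Lemma sum_XV a (c : int) : exists r, \sum_(i < p) vz (c * i%:Z) * Xx i%:Z ^+ a = p%:R * r.
Proof.
elim: a c => [|a IH] c.
  under eq_bigr => i _ do rewrite expr0 mulr1.
  by rewrite sum_vz; case: ifP => _; [exists 1; rewrite mulr1 | exists 0; rewrite mulr0].
have [r1 h1] := IH (c + 1); have [r2 h2] := IH (c - 1).
exists (r1 + r2); rewrite mulrDr -h1 -h2 -big_split /=; apply: eq_bigr => i _.
rewrite exprS -mulrDl mulrA; congr (_ * _).
by rewrite /Xx mulrDr -!vzD mulrDl mulrBl mul1r.
Qed.

Lemma geom (D : int) (z : nat) :
  d D * \sum_(i < (2 * z).+1) vz (2 * D * (z%:Z - i%:Z)) = d (D * (2 * z).+1%:Z).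
Proof.
pose T (i : nat) := vz (D * ((2 * z).+1%:Z - (2 * i)%:Z)).
rewrite mulr_sumr (eq_bigr (fun i : 'I_(2 * z).+1 => - (T i.+1 - T i))).
  rewrite sumrN -(big_mkord xpredT (fun i => T i.+1 - T i)) telescope_sumr // opprB /T dE subr0.
  by congr (_ - vz _); lia.
move=> i _; rewrite dE mulrBl -!vzD opprB /T; congr (vz _ - vz _); lia.
Qed.

(** The weight sum of the monomial X^a v^(2(D-1)mu); the shift by 1 absorbs the factor v^(2mu) of
    [lam]. *)
Definition Iad a (D : int) : R :=
  \sum_(z < s.+1) qint (2 * z).+1 * (Xx (2 * z).+1%:Z ^+ a *
   \sum_(i < (2 * z).+1) vz (2 * D * (z%:Z - i%:Z))).

Lemma Iad_prod a D : d 1 * d D * Iad a D =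
  \sum_(z < s.+1) d (2 * z).+1%:Z * d (D * (2 * z).+1%:Z) * Xx (2 * z).+1%:Z ^+ a.
Proof.
rewrite mulr_sumr; apply: eq_bigr => z _; rewrite -geom -qint_d; ring.
Qed.

(** Halving without division by 2: if 2S = p r, then S = (p+1)S - pS = p((s+2)r - S), because
    (p+1)/2 = s + 2. *)
Lemma sum_odd_half (F : int -> R) :
  (forall a b, (a = b %[mod p%:Z])%Z -> F a = F b) -> (forall x, F (- x) = F x) -> F 0 = 0 ->
  (exists r, \sum_(i < p) F i%:Z = p%:R * r) ->
  exists r, \sum_(z < s.+1) F (2 * z).+1%:Z = p%:R * r.
Proof.
move=> Fm Fe F0 [r hr]; have := sum_odd p_pr p_ge5 Fm.
rewrite F0 subr0 hr card_simple // big_split /=.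
rewrite [X in _ + X](eq_bigr (fun z : 'I_s.+1 => F (2 * z).+1%:Z)) => [|z _]; last exact: Fe.
set S := \sum_(z < _) _ => e.
exists ((s.+2)%:R * r - S); rewrite mulrBr mulrCA -e.
have p1 : p%:R + 1 = s.+2%:R + s.+2%:R :> R.
  by rewrite -natrD natr1; congr (_%:R); have := spE p_pr p_ge5; lia.
transitivity ((s.+2%:R + s.+2%:R - p%:R) * S); last by ring.
by rewrite -p1 addrC addKr mul1r.
Qed.

Lemma dvh_cancel k (u x : R) : isunit u -> dvh k.+2 (h * h * u * x) -> dvh k x.
Proof.
move=> [w uw] [r hr]; exists (w * r).
have e : u * x = h ^+ k * r.
  by apply: (@h_inj 2); rewrite expr2 mulrA hr !exprS; ring.
by rewrite mulrCA -e mulrA [w * u]mulrC uw mul1r.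
Qed.

(** Multiplication by [d 1 * d D], which is h^2 times a unit, sums the geometric series over the
    weights. The result is an even function summed over odd numbers, a multiple of [p] and hence of
    h^(2s+2). *)
Lemma Iad_dvh_ndiv a D : ~~ (p%:Z %| D)%Z -> dvh (2 * s) (Iad a D).
Proof.
move=> nD.
have [u du uu] : exists2 u, d D = h * u & isunit u.
  have p0 : p%:Z != 0 by case: (p) p_ge5.
  pose k := `|(D %% p%:Z)%Z|%N; have ek : k%:Z = (D %% p%:Z)%Z by rewrite gez0_abs ?modz_ge0.
  have dk : d D = d k%:Z.
    rewrite !dE; congr (_ - _); apply: vz_mod; rewrite ek ?modz_mod //.
    by rewrite -[in RHS]modzNm modz_mod modzNm.
  rewrite dk; apply: d_unit; rewrite lt0n -!ltz_nat ek ltz_pmod // ?andbT; last by move: p_ge5; lia.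
  by apply: contra nD => /eqP k0; apply/dvdz_mod0P; rewrite -ek k0.
have [u1 d1 uu1] := @d_unit 1 ltac:(move: p_ge5; lia).
apply: (@dvh_cancel _ (u1 * u)); first exact: isunitM.
have -> : h * h * (u1 * u) * Iad a D = d 1 * d D * Iad a D by rewrite du d1; ring.
rewrite Iad_prod; apply: dvp.
apply: (@sum_odd_half (fun x => d x * d (D * x) * Xx x ^+ a)).
- move=> x y xy; have xy' : (- x = - y %[mod p%:Z])%Z by rewrite -modzNm xy modzNm.
  have Dxy : (D * x = D * y %[mod p%:Z])%Z by rewrite -modzMmr xy modzMmr.
  have Dxy' : (- (D * x) = - (D * y) %[mod p%:Z])%Z by rewrite -modzNm Dxy modzNm.
  by rewrite !dE /Xx (vz_mod xy) (vz_mod xy') (vz_mod Dxy) (vz_mod Dxy').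
- have dN x : d (- x) = - d x by rewrite !dE opprK opprB.
  by move=> x; rewrite mulrN !dN mulrNN /Xx opprK [vz (- x) + _]addrC.
- by rewrite dE oppr0 subrr !mul0r.
have [r1 e1] := sum_XV a (1 + D); have [r2 e2] := sum_XV a (1 - D).
have [r3 e3] := sum_XV a (- 1 + D); have [r4 e4] := sum_XV a (- 1 - D).
exists (r1 - r2 - r3 + r4); rewrite mulrDr !mulrBr -e1 -e2 -e3 -e4 -!sumrB -big_split /=.
apply: eq_bigr => i _; rewrite -!mulrBl -mulrDl; congr (_ * _).
rewrite !dE mulrBl !mulrBr -!vzD; set x := i%:Z.
have -> : (1 + D) * x = x + D * x by ring.
have -> : (1 - D) * x = x - D * x by ring.
have -> : (-1 + D) * x = - x + D * x by ring.
have -> : (-1 - D) * x = - x - D * x by ring.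
by set q1 := vz _; set q2 := vz _; set q3 := vz _; set q4 := vz _; ring.
Qed.

Lemma Iad_mod a D E : (D = E %[mod p%:Z])%Z -> Iad a D = Iad a E.
Proof.
move=> e; apply: eq_bigr => z _; congr (_ * (_ * _)); apply: eq_bigr => i _.
by apply: vz_mod; rewrite ![2 * _]mulrC -!mulrA -modzMml e modzMml.
Qed.

(** If [p] divides [D], then [d D] is 0 and cannot be cancelled. Instead, the sum of [Iad a E] over
    all residues E is a multiple of [p] by orthogonality, and its other terms are divisible
    already. *)
Lemma Iad_dvh a D : dvh (2 * s) (Iad a D).
Proof.
have [pD|] := boolP (p%:Z %| D)%Z; last exact: Iad_dvh_ndiv.
have -> : Iad a D = Iad a 0 by apply: Iad_mod; rewrite mod0z; apply/dvdz_mod0P.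
have p0 : (0 < p)%N by exact: prime_gt0.
have e : \sum_(E < p) Iad a E%:Z = Iad a 0 + \sum_(1 <= E < p) Iad a E%:Z.
  by rewrite -(big_mkord xpredT (fun E => Iad a E%:Z)) big_ltn.
have -> : Iad a 0 = \sum_(E < p) Iad a E%:Z - \sum_(1 <= E < p) Iad a E%:Z by rewrite e addrK.
apply: dvhD; last first.
  apply: dvhN; rewrite big_seq; apply: dvh_sum => E; rewrite mem_index_iota => /andP[E0 Ep].
  by apply: Iad_dvh_ndiv; rewrite dvdzE /= gtnNdvd.
apply: (@dvh_le _ _ _ (2 * s).+2); first by lia.
apply: dvp.
pose r (z : nat) (i : nat) : R := if (p%:Z %| (2 * (z%:Z - i%:Z))%R)%Z then 1 else 0.
exists (\sum_(z < s.+1) qint (2 * z).+1 * (Xx (2 * z).+1%:Z ^+ a * \sum_(i < (2 * z).+1) r z i)).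
rewrite exchange_big mulr_sumr /=; apply: eq_bigr => z _.
rewrite -mulr_sumr -mulr_sumr exchange_big /=.
rewrite (eq_bigr (fun i : 'I_(2 * z).+1 => p%:R * r z i)) => [|i _]; first by rewrite -mulr_sumr; ring.
rewrite (eq_bigr (fun E : 'I_p => vz ((2 * (z%:Z - i%:Z)) * E%:Z))) => [|E _].
  by rewrite sum_vz /r; case: ifP => _; rewrite ?mulr1 ?mulr0.
by congr vz; ring.
Qed.

(* The Laurent polynomials in [v^(2 mu)] and [v^(2z+1)] that are symmetric in the latter; their
   weight sums [lam] are much more divisible by [h] than the values themselves ([lam_dvh]). *)
Inductive inA : (int -> int -> R) -> Prop :=
| InA0 : inA (fun _ _ => 0)
| InAmon c a e : inA (fun z mu => c * Xx (2 * z + 1) ^+ a * vz (2 * e * mu))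
| InAadd f g : inA f -> inA g -> inA (fun z mu => f z mu + g z mu).

Lemma inA_eq f g : inA f -> (forall z mu, f z mu = g z mu) -> inA g.
Proof. by move=> hf e; have <- : f = g by apply: funext => z; apply: funext => mu; exact: e. Qed.

Lemma lam_dvh f : inA f -> dvh (2 * s) (lam f).
Proof.
elim=> [|c a e|g1 g2 _ h1 _ h2].
- exists 0; rewrite mulr0 /lam big1 // => z _; rewrite big1 ?mulr0 // => i _; exact: mulr0.
- have -> : lam (fun z mu => c * Xx (2 * z + 1) ^+ a * vz (2 * e * mu)) = c * Iad a (1 + e).
    rewrite /lam /Iad mulr_sumr; apply: eq_bigr => z _; rewrite !mulr_sumr; apply: eq_bigr => i _.
    have -> : (2 * z).+1%:Z = 2 * z%:Z + 1 by lia.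
    have -> : 2 * (1 + e) * (z%:Z - i%:Z) = 2 * (z%:Z - i%:Z) + 2 * e * (z%:Z - i%:Z) by ring.
    by rewrite vzD; ring.
  by apply: dvhMl; exact: Iad_dvh.
have -> : lam (fun z mu => g1 z mu + g2 z mu) = lam g1 + lam g2; last exact: dvhD.
rewrite /lam -big_split /=; apply: eq_bigr => z _; rewrite -mulrDr; congr (_ * _).
by rewrite -big_split /=; apply: eq_bigr => i _; rewrite -mulrDr.
Qed.

Lemma inA_cst c : inA (fun _ _ => c).
Proof. by apply: inA_eq (InAmon c 0 0) _ => z mu; rewrite !mulr0 mul0r vz0 expr0 !mulr1. Qed.

Lemma inA_V e : inA (fun _ mu => vz (2 * e * mu)).
Proof. by apply: inA_eq (InAmon 1 0 e) _ => z mu; rewrite expr0 !mul1r. Qed.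

Lemma inA_X : inA (fun z _ => Xx (2 * z + 1)).
Proof. by apply: inA_eq (InAmon 1 1 0) _ => z mu; rewrite mulr0 mul0r vz0 expr1 mul1r mulr1. Qed.

Lemma inA_mul f g : inA f -> inA g -> inA (fun z mu => f z mu * g z mu).
Proof.
move=> hf; elim=> [|c a e|g1 g2 _ h1 _ h2].
- by apply: inA_eq InA0 _ => z mu; rewrite mulr0.
- elim: hf => [|c' a' e'|f1 f2 _ h1 _ h2].
  + by apply: inA_eq InA0 _ => z mu; rewrite mul0r.
  + apply: inA_eq (InAmon (c' * c) (a' + a) (e' + e)) _ => z mu.
    by rewrite mulrDr mulrDl vzD exprD; ring.
  + by have H := InAadd h1 h2; apply: (inA_eq H) => z mu; rewrite [RHS]mulrDl.
by have H := InAadd h1 h2; apply: (inA_eq H) => z mu; rewrite [RHS]mulrDr.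
Qed.

Lemma inA_sum (I : Type) (r : seq I) (P : pred I) (F : I -> int -> int -> R) :
  (forall i, P i -> inA (F i)) -> inA (fun z mu => \sum_(i <- r | P i) F i z mu).
Proof.
move=> hF; elim: r => [|i r IH]; first by apply: inA_eq InA0 _ => z mu; rewrite big_nil.
have [Pi|nPi] := boolP (P i); last first.
  by apply: inA_eq IH _ => z mu; rewrite big_cons (negbTE nPi).
by apply: inA_eq (InAadd (hF i Pi) IH) _ => z mu; rewrite big_cons Pi.
Qed.

Lemma inA_shift j f : inA f -> inA (fun z mu => f z (mu + j)).
Proof.
elim=> [|c a e|f1 f2 _ h1 _ h2]; first exact: InA0.
  apply: inA_eq (InAmon (c * vz (2 * e * j)) a e) _ => z mu.
  by rewrite mulrDr vzD; ring.
exact: InAadd.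
Qed.

(** The quotient by [h] has to lie in [inA] again: only then is the weight sum of the error
    divisible by one power more than h^(2s). *)
Definition congA (f g : int -> int -> R) :=
  exists2 q, inA q & forall z mu, f z mu = g z mu + h * q z mu.

Lemma congA_refl f : congA f f.
Proof. by exists (fun _ _ => 0); [exact: InA0 | move=> z mu; rewrite mulr0 addr0]. Qed.

Lemma congA_trans f g k : congA f g -> congA g k -> congA f k.
Proof.
move=> [q Aq e] [q' Aq' e']; exists (fun z mu => q' z mu + q z mu); first exact: InAadd.
by move=> z mu; rewrite e e' mulrDr addrA.
Qed.

Lemma congA_add f g f' g' : congA f g -> congA f' g' ->
  congA (fun z mu => f z mu + f' z mu) (fun z mu => g z mu + g' z mu).
Proof.
move=> [q Aq e] [q' Aq' e']; exists (fun z mu => q z mu + q' z mu); first exact: InAadd.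
by move=> z mu; rewrite e e' mulrDr addrACA.
Qed.

Lemma congA_mul f g f' g' : inA f' -> inA g -> congA f g -> congA f' g' ->
  congA (fun z mu => f z mu * f' z mu) (fun z mu => g z mu * g' z mu).
Proof.
move=> Af Ag [q Aq e] [q' Aq' e'].
exists (fun z mu => q z mu * f' z mu + g z mu * q' z mu).
  by apply: InAadd; exact: inA_mul.
by move=> z mu; rewrite e mulrDl [in g z mu * f' z mu]e'; ring.
Qed.

Lemma congA_sum (I : Type) (r : seq I) (F G : I -> int -> int -> R) :
  (forall i, congA (F i) (G i)) ->
  congA (fun z mu => \sum_(i <- r) F i z mu) (fun z mu => \sum_(i <- r) G i z mu).
Proof.
move=> hF; have [q hq] := choice (fun i => let: ex_intro2 q a b := hF i in ex_intro _ q (conj a b)).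
exists (fun z mu => \sum_(i <- r) q i z mu); first by apply: inA_sum => i _; case: (hq i).
by move=> z mu; rewrite mulr_sumr -big_split /=; apply: eq_bigr => i _; case: (hq i).
Qed.

Lemma lam_cong f g : congA f g -> exists r, lam f = lam g + h ^+ (2 * s).+1 * r.
Proof.
move=> [q Aq e]; have [r hr] := lam_dvh Aq; exists r.
rewrite exprS -mulrA -hr /lam mulr_sumr -big_split /=; apply: eq_bigr => z _.
rewrite mulrCA -mulrDr; congr (_ * _); rewrite mulr_sumr -big_split /=; apply: eq_bigr => i _.
by rewrite e; ring.
Qed.

End Integral.

(** * Matrix coefficients of the relator strands *)

Section Gauge.
Variables (R : comNzRingType) (p : nat) (vz : int -> R) (qint qfact vfact : nat -> R).
Variable qbin : nat -> nat -> R.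
Hypothesis p_pr : prime p.
Hypothesis p_ge5 : (5 <= p)%N.
Hypothesis qint_unit : forall i, (0 < i < p)%N -> isunit (qint i).
Hypothesis qfact0 : qfact 0 = 1.
Hypothesis qfactS : forall m, qfact m.+1 = qfact m * qint m.+1.
Hypothesis qbin_fact : forall n k, (k <= n)%N -> qbin n k * (qfact k * qfact (n - k)) = qfact n.
Local Notation d := (qdif vz).
Hypothesis vfact0 : vfact 0 = 1.
Hypothesis vfactS : forall k, vfact k.+1 = vfact k * d k.+1%:Z.
Hypothesis qint_dif : forall n, d 1 * qint n = d n%:Z.
Local Notation cC := (@cC R vz vfact qbin).
Local Notation cCi := (@cCi R vz vfact qbin).
Implicit Types x y : bvec p.

(* [(u, i)] stands for a traveling strand which passes under (if [u]) another one, through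
   a crossing which is inverted if [i]. *)
Definition kr (c : bool * bool) x y x' y' : R :=
  if (tag x' == tag x) && (tag y' == tag y) then
    let C := if c.2 then cCi else cC in
    if c.1 then C (tag y) (tag x) (bidx y) (bidx x) (bidx y') (bidx x')
    else C (tag x) (tag y) (bidx x) (bidx y) (bidx x') (bidx y')
  else 0.

(** The coefficient of raising [k] times from weight [mu] when lowering has coefficient 1. It makes
    sense for all integers [z], [mu], and vanishes when the raising passes above [z]. *)
Definition Ehat k (z mu : int) : R :=
  \prod_(j < k) (d (z - mu - j%:Z) * d (z + mu + 1 + j%:Z)).

(* Matrix coefficients in a Verma basis: for the traveling strand at weight [mu] of the
   module [z], the lowering operators have coefficient 1. *)
Definition vco (c : bool * bool) y y' (z mu : int) : R :=
  let e := hwt y - hwt y' in let k := `|e|%N in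
  if (tag y' == tag y) && (if c.1 then e <= 0 else 0 <= e) then
    (if c.2 then vz (2 * (mu + e) * hwt y') * vz 'C(k, 2)%:Z
     else vz (- (2 * mu * hwt y)) * ((-1) ^+ k * vz (- 'C(k, 2)%:Z))) *
    (if c.1 then qbin (2 * tag y - bidx y')%N k else qbin (bidx y') k * Ehat k z mu)
  else 0.

Lemma vfact_prod i k : vfact (i + k) = vfact i * \prod_(j < k) d ((i + k)%:Z - j%:Z).
Proof.
elim: k => [|k IH]; first by rewrite addn0 big_ord0 mulr1.
rewrite addnS vfactS IH big_ord_recl mulrA -[LHS]mulrA [X in _ * X]mulrC [LHS]mulrA subr0 [RHS]mulrAC.
rewrite [LHS]mulrAC; congr (_ * _ * _); apply: eq_bigr => j _; congr d; rewrite lift0; lia.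
Qed.

Lemma vfact_qbin_prod N k : (k <= N < p)%N ->
  vfact k * qbin N k = \prod_(j < k) d ((N - k)%:Z + 1 + j%:Z).
Proof.
move=> /andP[kN Np]; apply: (@unit_mulI _ (qfact (N - k))).
  by apply: (@qfact_unit _ p qint qfact) => //; lia.
have qfp i l : qfact (i + l) = qfact i * \prod_(j < l) qint (i + j).+1.
  by elim: l => [|l IH]; rewrite ?addn0 ?big_ord0 ?mulr1 // addnS qfactS IH big_ord_recr mulrA.
rewrite (@vfactE _ vz qint qfact vfact) // mulrCA.
transitivity (d 1 ^+ k * (qbin N k * (qfact k * qfact (N - k)))); first by ring.
rewrite qbin_fact // -[in LHS](subnK kN) qfp mulrCA; congr (_ * _).
move: (N - k)%N => r; elim: (k) => [|l IH]; first by rewrite !big_ord0 mulr1.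
rewrite !big_ord_recr /= -IH exprSr -!mulrA; congr (_ * _); rewrite mulrCA; congr (_ * _).
by rewrite qint_dif; congr d; lia.
Qed.

Lemma Ehat_vfact (a i k : nat) : (i + k <= 2 * a < p)%N ->
  vfact (i + k) * (vfact k * qbin (2 * a - i) k) = Ehat k a%:Z (a%:Z - (i + k)%:Z) * vfact i.
Proof.
move=> h; rewrite vfact_prod vfact_qbin_prod; last by lia.
rewrite -[LHS]mulrA -big_split /= mulrC; congr (_ * _); apply: eq_bigr => j _.
by congr (d _ * d _); lia.
Qed.

(** Rescaling x_i by [vfact i] is the passage to the Verma basis. There the crossing depends on the
    traveling strand only through its module and its weight. *)
Lemma kr_gauge c x y x' y' : vfact (bidx x) * kr c x y x' y' =
  if (tag x' == tag x) && (hwt x' + hwt y' == hwt x + hwt y)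
  then vco c y y' (tag x)%:Z (hwt x) * vfact (bidx x') else 0.
Proof.
have lx := simple_lt p_pr p_ge5 (tag x); have ly := simple_lt p_pr p_ge5 (tag y).
have bx := bidx_le x; have bx' := bidx_le x'; have by_ := bidx_le y; have by' := bidx_le y'.
rewrite /kr /vco; case: (eqVneq (tag x') (tag x)) => [ex|]; last by rewrite mulr0.
case: (eqVneq (tag y') (tag y)) => [ey|]; last by rewrite /= mulr0; case: ifP => _ //; rewrite mul0r.
rewrite ex in bx'; rewrite ey in by'; rewrite /= !hwtE ex ey.
move: (tag x : nat) (tag y : nat) (bidx x) (bidx y) (bidx x') (bidx y') lx ly bx bx' by_ by'
  => a b i j i' j' la lb ia ia' jb jb' {x y x' y' ex ey}.
have -> : (a%:Z - i'%:Z + (b%:Z - j'%:Z) == a%:Z - i%:Z + (b%:Z - j%:Z)) = (i' + j' == i + j)%N by lia.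
have -> : b%:Z - j%:Z - (b%:Z - j'%:Z) = j'%:Z - j%:Z by lia.
case: c => [u inv] /=.
have cE A B I J I' J' : (if inv then cCi else cC) A B I J I' J' =
  if (J <= J')%N && (I' + J' == I + J)%N then
    (if inv then vz (2 * (A%:Z - I'%:Z) * (B%:Z - J'%:Z)) * vz 'C(J' - J, 2)%:Z
     else vz (- (2 * (A%:Z - I%:Z) * (B%:Z - J%:Z))) * ((-1) ^+ (J' - J) * vz (- 'C(J' - J, 2)%:Z))) *
    (vfact (J' - J) * (qbin J' (J' - J) * qbin (2 * A - I') (J' - J))) else 0.
  by case: (inv); rewrite /cC /cCi; case: ifP => _ //; ring.
rewrite !cE [(j' + i')%N]addnC [(j + i)%N]addnC.
case: (eqVneq (i' + j')%N (i + j)%N) => [e|ne]; last by rewrite !andbF; case: u; rewrite mulr0.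
rewrite !andbT; case: u.
- have -> : (j'%:Z - j%:Z <= 0) = (i <= i')%N by lia.
  case: leqP => h; last by rewrite mulr0 mul0r.
  have -> : `|(j'%:Z - j%:Z)%R|%N = (i' - i)%N by lia.
  have v : vfact i * vfact (i' - i) * qbin i' (i' - i) = vfact i'.
    have := @vfact_qbin R p vz qint qfact vfact qbin qfact0 qfactS qbin_fact vfact0 vfactS qint_dif i' (i' - i).
    rewrite subKn // => <-; [ring|lia].
  have -> : a%:Z - i%:Z + (j'%:Z - j%:Z) = a%:Z - i'%:Z by lia.
  have -> : 2 * (b%:Z - j'%:Z) * (a%:Z - i'%:Z) = 2 * (a%:Z - i'%:Z) * (b%:Z - j'%:Z) by ring.
  have -> : 2 * (b%:Z - j%:Z) * (a%:Z - i%:Z) = 2 * (a%:Z - i%:Z) * (b%:Z - j%:Z) by ring.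
  by rewrite -v; set P := (if inv then _ else _); ring.
have -> : (0 <= j'%:Z - j%:Z) = (j <= j')%N by lia.
case: leqP => h; last by rewrite mulr0 mul0r.
have -> : `|(j'%:Z - j%:Z)%R|%N = (j' - j)%N by lia.
have ek : i = (i' + (j' - j))%N by lia.
have v := @Ehat_vfact a i' (j' - j) ltac:(lia); rewrite -ek in v.
have -> : a%:Z - i%:Z + (j'%:Z - j%:Z) = a%:Z - i'%:Z by lia.
set P := (if inv then _ else _); set q := qbin j' _.
transitivity (P * q * (Ehat (j' - j) a%:Z (a%:Z - i%:Z) * vfact i')); last by ring.
by rewrite -v; ring.
Qed.

End Gauge.

(** * A relator strand as a path of weights *)

Section Traveler.
Variables (R : comNzRingType) (p n : nat) (vz : int -> R) (vfact : nat -> R).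
Variable qbin : nat -> nat -> R.
Hypothesis p_pr : prime p.
Hypothesis p_ge5 : (5 <= p)%N.
Hypothesis vfact_inj : forall i x y, (i < p)%N -> vfact i * x = vfact i * y -> x = y.
Local Notation d := (qdif vz).
Local Notation vco := (vco vz qbin).
Local Notation Ehat := (Ehat vz).
Local Notation gst := {ffun 'I_n -> bvec p}.
Variable K : bool * bool -> bvec p -> bvec p -> bvec p -> bvec p -> R.
Hypothesis K_gauge : forall c x y x' y', vfact (bidx x) * K c x y x' y' =
  if (tag x' == tag x) && (hwt x' + hwt y' == hwt x + hwt y)
  then vco c y y' (tag x)%:Z (hwt x) * vfact (bidx x') else 0.
Implicit Types (g : gst) (cs : seq ((bool * bool) * 'I_n)) (x y : bvec p) (z mu : int).

Definition Wt g : int := \sum_k hwt (g k).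

(** Only the weight of the traveling strand is recorded, and it is free to leave the interval from
    -z to z. *)
Fixpoint Ver cs g g' z mu : R :=
  if cs is c :: cs' then
    \sum_y vco c.1 (g c.2) y z mu * Ver cs' (upd g c.2 y) g' z (mu + (hwt (g c.2) - hwt y))
  else (g == g')%:R.

Definition trav cs (f : bvec p -> gst -> R) := foldr (fun c => gletter (K c.1) c.2) f cs.

Lemma Wt_upd g k y : Wt (upd g k y) = Wt g - hwt (g k) + hwt y.
Proof.
rewrite /Wt (bigD1 k) //= upd_same [in RHS](bigD1 k) //= [X in _ + X](eq_bigr (fun i => hwt (g i))).
  by ring.
by move=> i ik; rewrite upd_neq.
Qed.

Lemma hwt_bound x : - (tag x)%:Z <= hwt x <= (tag x)%:Z.
Proof. by have := bidx_le x; rewrite hwtE; lia. Qed.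

Lemma bvec_ex (z : simple p) mu : - z%:Z <= mu <= z%:Z -> exists2 x : bvec p, tag x = z & hwt x = mu.
Proof.
move=> h; have lt : (`|z%:Z - mu| < (2 * z).+1)%N by lia.
exists (Tagged (fun z : simple p => 'I_(2 * z).+1) (Ordinal lt)) => //.
by rewrite /hwt /=; lia.
Qed.

Lemma bvec_hwt x y : tag x = tag y -> hwt x = hwt y -> x = y.
Proof. by move=> e h; apply/eqP; rewrite bvec_eq e eqxx /=; move: h; rewrite !hwtE e; lia. Qed.

Lemma d0 : d 0 = 0. Proof. by rewrite /qdif oppr0 subrr. Qed.

Lemma Ehat_top k z mu : mu <= z -> z < mu + k%:Z -> Ehat k z mu = 0.
Proof.
move=> h1 h2; have lt : (`|z - mu| < k)%N by lia.
rewrite /Ehat (bigD1 (Ordinal lt)) //=.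
have -> : z - mu - `|z - mu|%N%:Z = 0 by lia.
by rewrite d0 !mul0r.
Qed.

Lemma Ehat_bot k z mu : mu < - z -> - z <= mu + k%:Z -> Ehat k z mu = 0.
Proof.
move=> h1 h2; have lt : (`|(- z - mu - 1)%R| < k)%N by lia.
rewrite /Ehat (bigD1 (Ordinal lt)) //=.
have -> : z + mu + 1 + `|(- z - mu - 1)%R|%N%:Z = 0 by lia.
by rewrite d0 mulr0 mul0r.
Qed.

Lemma vco_up c y y' z mu : 0 < hwt y - hwt y' ->
  Ehat `|(hwt y - hwt y')%R| z mu = 0 -> vco c y y' z mu = 0.
Proof.
move=> h e; rewrite /vco; case: ifP => // /andP[_].
by case: c.1 => h'; [lia | rewrite e !mulr0].
Qed.

Lemma vco_top c y y' z mu : mu <= z -> z < mu + (hwt y - hwt y') -> vco c y y' z mu = 0.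
Proof. by move=> h1 h2; apply: vco_up; [lia | apply: Ehat_top => //; lia]. Qed.

Lemma vco_bot c y y' z mu : mu < - z -> - z <= mu + (hwt y - hwt y') -> vco c y y' z mu = 0.
Proof. by move=> h1 h2; apply: vco_up; [lia | apply: Ehat_bot => //; lia]. Qed.

(** The lowering coefficient 1 lets a path fall below -z, but then it cannot return, because raising
    across -z has coefficient 0. *)
Lemma Ver_low cs g g' z mu mu' : mu < - z -> - z <= mu' -> mu' + Wt g' = mu + Wt g ->
  Ver cs g g' z mu = 0.
Proof.
elim: cs g mu => [|c cs IH] g mu h1 h2 e /=.
  by case: eqP => // ge; move: e; rewrite ge; lia.
apply: big1 => y _; case: (lerP (- z) (mu + (hwt (g c.2) - hwt y))) => h.
  by rewrite vco_bot // mul0r.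
by rewrite (IH _ _ h) ?mulr0 // Wt_upd e; ring.
Qed.

(** The sum without truncation is correct, since paths that leave the module contribute 0 as soon as
    they end inside it. *)
Lemma trav_Ver cs (f : gst -> R) x x0 g :
  vfact (bidx x) * trav cs (fun x' g' => f g' * (x' == x0)%:R) x g =
  \sum_g' if (tag x0 == tag x) && (hwt x0 + Wt g' == hwt x + Wt g)
    then Ver cs g g' (tag x)%:Z (hwt x) * f g' * vfact (bidx x0) else 0.
Proof.
elim: cs x g => [|c cs IH] x g /=.
  rewrite (bigD1 g) //= eqxx big1 => [|g' /negbTE ng]; last first.
    by rewrite [g == g']eq_sym ng !mul0r; case: ifP.
  rewrite addr0 mul1r; case: (eqVneq x x0) => [->|ne].
    by rewrite !eqxx /= mulr1 mulrC.
  rewrite !mulr0; case: ifP => // /andP[/eqP e1 /eqP e2].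
  by case/eqP: ne; apply: bvec_hwt => //; lia.
transitivity (\sum_y \sum_g' if (tag x0 == tag x) && (hwt x0 + Wt g' == hwt x + Wt g) then
   vco c.1 (g c.2) y (tag x)%:Z (hwt x) *
   Ver cs (upd g c.2 y) g' (tag x)%:Z (hwt x + (hwt (g c.2) - hwt y)) * f g' * vfact (bidx x0) else 0); last first.
  rewrite exchange_big /=; apply: eq_bigr => g' _.
  by case: ifP => _; [rewrite !mulr_suml | rewrite big1].
rewrite /gletter exchange_big mulr_sumr /=; apply: eq_bigr => y _.
set mu := hwt x + (hwt (g c.2) - hwt y); set F := trav cs _.
have cond x1 : (hwt x1 + hwt y == hwt x + hwt (g c.2)) = (hwt x1 == mu) by rewrite /mu; lia.
have condW g' : (hwt x0 + Wt g' == hwt x + Wt g) = (hwt x0 + Wt g' == mu + Wt (upd g c.2 y)).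
  by rewrite Wt_upd /mu; congr (_ == _); ring.
have step x1 : vfact (bidx x) * (K c.1 x (g c.2) x1 y * F x1 (upd g c.2 y)) =
   if (tag x1 == tag x) && (hwt x1 == mu) then vco c.1 (g c.2) y (tag x)%:Z (hwt x) *
     (vfact (bidx x1) * F x1 (upd g c.2 y)) else 0.
  by rewrite mulrA K_gauge cond; case: ifP; rewrite ?mul0r // mulrA.
rewrite mulr_sumr (eq_bigr _ (fun x1 _ => step x1)).
have hx := hwt_bound x.
have [h|h] := boolP (- (tag x)%:Z <= mu <= (tag x)%:Z).
  have [x1 t1 e1] := bvec_ex h.
  rewrite (bigD1 x1) //= t1 e1 !eqxx big1 ?addr0 => [|x2 ne]; last first.
    case: ifP => // /andP[/eqP t2 /eqP e2]; case/eqP: ne; apply: bvec_hwt; first by rewrite t1.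
    by rewrite e1.
  rewrite IH mulr_sumr; apply: eq_bigr => g' _; rewrite t1 e1 condW.
  by case: ifP => _; rewrite ?mulr0 // !mulrA.
rewrite big1 => [|x1 _]; last first.
  case: ifP => // /andP[/eqP t1 /eqP e1]; case/negP: h.
  by rewrite -e1 -t1; exact: hwt_bound.
apply/esym; apply: big1 => g' _; case: ifP => // /andP[/eqP t0 /eqP e0].
have h0 := hwt_bound x0; rewrite t0 in h0.
(* Either the step passes above [z], where the raising coefficient vanishes, or the path is below
   [- z] while its final weight is not. *)
case: (lerP (- (tag x)%:Z) mu) => h1.
  by rewrite vco_top ?mul0r //; move: h h1; rewrite /mu; lia.
rewrite (@Ver_low _ _ _ _ _ (hwt x0)) ?mulr0 ?mul0r //; first by move: h0; lia.
by rewrite e0 Wt_upd /mu; ring.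
Qed.

Lemma trav_eq cs (f : gst -> R) x g :
  trav cs (fun x' g' => f g' * (x' == x)%:R) x g =
  \sum_g' if Wt g' == Wt g then Ver cs g g' (tag x)%:Z (hwt x) * f g' else 0.
Proof.
have lx := simple_lt p_pr p_ge5 (tag x); have bx := bidx_le x.
apply: (@vfact_inj (bidx x)); first by lia.
rewrite trav_Ver mulr_sumr; apply: eq_bigr => g' _; rewrite eqxx /=.
have -> : (hwt x + Wt g' == hwt x + Wt g) = (Wt g' == Wt g) by lia.
by case: ifP; rewrite ?mulr0 // mulrC.
Qed.

Lemma sum_bvec2 (G : nat -> nat -> R) :
  \sum_(x : bvec p) G (tag x) (bidx x) = \sum_(z < (sp p).+1) \sum_(i < (2 * z).+1) G z i.
Proof.
pose F (z' : simple p) (i : 'I_(2 * z').+1) := G z' i.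
rewrite (eq_bigr (fun x => F (tag x) (tagged x))) //.
rewrite -(@sig_big_dep _ _ _ _ (fun z : simple p => 'I_(2 * z).+1) xpredT (fun _ _ => true) F) /=.
rewrite /F -(big_mkord xpredT (fun z : nat => \sum_(i < (2 * z).+1) G z i)).
by rewrite -(big_mkord xpredT (fun z : nat => \sum_(i < (2 * z).+1) G z i)) card_simple.
Qed.

Variable qint : nat -> R.
Variable w : bvec p -> R.
Hypothesis wE : forall x, w x = qint (2 * tag x).+1 * vz (2 * hwt x).

Lemma trav_trace cs (f : gst -> R) g :
  \sum_x w x * trav cs (fun x' g' => f g' * (x' == x)%:R) x g =
  \sum_g' (if Wt g' == Wt g then lam p vz qint (Ver cs g g') else 0) * f g'.
Proof.
under eq_bigr => x _ do rewrite trav_eq mulr_sumr.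
rewrite exchange_big /=; apply: eq_bigr => g' _; case: ifP => _; last first.
  by rewrite mul0r big1 // => x _; rewrite mulr0.
rewrite /lam; under eq_bigr => x _ do rewrite wE hwtE.
rewrite (sum_bvec2 (fun z i : nat => qint (2 * z).+1 * vz (2 * (z%:Z - i%:Z)) *
  (Ver cs g g' z%:Z (z%:Z - i%:Z) * f g'))).
rewrite mulr_suml; apply: eq_bigr => z _; rewrite -mulrA mulr_suml mulr_sumr.
by apply: eq_bigr => i _; rewrite !mulrA.
Qed.

(** The crossings of one letter, in the encoding of [kr]: over the lower generator strands, the
    clasp, and back. *)
Definition flat1 (l : 'I_n * bool) : seq ((bool * bool) * 'I_n) :=
  [seq ((false, false), i) | i <- low n l.1] ++
  (if l.2 then [:: ((true, true), l.1); ((false, true), l.1)]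
   else [:: ((false, false), l.1); ((true, false), l.1)]) ++
  [seq ((false, true), i) | i <- rev (low n l.1)].

Definition flat (wd : seq ('I_n * bool)) := flatten (map flat1 wd).

Variables Bk BV : bvec p -> bvec p -> bvec p -> bvec p -> R.
Hypothesis K_Bk : forall c, K c = if c.1 then (if c.2 then KunV BV else Kun Bk)
  else (if c.2 then KovV BV else Kov Bk).

Lemma gword_trav wd f : gword Bk BV wd f = trav (flat wd) f.
Proof.
elim: wd => [//|l wd IH] /=; rewrite IH /trav /flat /= foldr_cat -/(flat wd) -/(trav (flat wd) f).
move: (trav _ f) => f1; rewrite /flat1 !foldr_cat !foldr_map /gCs.
have -> : gCis (KovV BV) (low n l.1) f1 = foldr (gletter (KovV BV)) f1 (rev (low n l.1)).
  by rewrite -[in LHS](revK (low n l.1)) /gCis foldl_rev.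
have e k b (L : seq 'I_n) (f2 : bvec p -> gst -> R) :
    foldr (fun i : 'I_n => gletter (K (k, b, i).1) (k, b, i).2) f2 L = foldr (gletter (K (k, b))) f2 L by [].
rewrite !e !K_Bk /=; move: (foldr _ _ (rev _)) => f2.
by rewrite /gloop; case: (l.2); rewrite /= !K_Bk.
Qed.

Lemma relT_Ver wd f g : relT w Bk BV wd f g =
  \sum_g' (if Wt g' == Wt g then lam p vz qint (Ver (flat wd) g g') else 0) * f g'.
Proof. by rewrite /relT -trav_trace; apply: eq_bigr => x _; rewrite gword_trav. Qed.

End Traveler.

(** * Symmetric powers and Chebyshev polynomials *)

Section SymmetricPowers.
Variable K : comNzRingType.
Implicit Types (A B M : 'M[K]_2) (N : nat) (q : {poly K}).

(** A row of [M] as a linear form, dehomogenized in 'X. *)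
Definition lf M (r : 'I_2) : {poly K} := (M r 0)%:P + (M r 1)%:P * 'X.

(* The matrix of the N-th symmetric power of [M]. *)
Definition sym N M (b i : nat) : K := (lf M 0 ^+ (N - b) * lf M 1 ^+ b)`_i.

Lemma mul2E A B i j : (A *m B) i j = A i 0 * B 0 j + A i 1 * B 1 j.
Proof.
rewrite mxE big_ord_recl big_ord1; congr (_ + A i _ * B _ j); exact: val_inj.
Qed.

Lemma size_lf M r : (size (lf M r) <= 2)%N.
Proof.
apply: leq_trans (size_polyD _ _) _; rewrite geq_max; apply/andP; split.
  by apply: leq_trans (size_polyC_leq1 _) _.
apply: leq_trans (size_polyMleq _ _) _; rewrite size_polyX.
by have := size_polyC_leq1 (M r 1); lia.
Qed.

Lemma size_lfX M a b : (size (lf M 0 ^+ a * lf M 1 ^+ b)%R <= (a + b).+1)%N.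
Proof.
have sz r k : (size (lf M r ^+ k) <= k.+1)%N.
  elim: k => [|k IH]; first by rewrite expr0 size_poly1.
  rewrite exprS; apply: leq_trans (size_polyMleq _ _) _.
  by have := size_lf M r; move: IH; lia.
by apply: leq_trans (size_polyMleq _ _) _; have := sz 0 a; have := sz 1 b; lia.
Qed.

(** The substitution of the two linear forms of [B] into [q], regarded as homogeneous of degree
    [N]. *)
Definition hsub N B q : {poly K} := \sum_(j < N.+1) (q`_j)%:P * (lf B 0 ^+ (N - j) * lf B 1 ^+ j).

Lemma hsub_lin N B q (a b : K) : (size q <= N.+1)%N ->
  hsub N.+1 B ((a%:P + b%:P * 'X) * q) = (a%:P * lf B 0 + b%:P * lf B 1) * hsub N B q.
Proof.
move=> sq; rewrite /hsub; set l0 := lf B 0; set l1 := lf B 1.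
have cf j : ((a%:P + b%:P * 'X) * q)`_j = a * q`_j + b * (if j is j'.+1 then q`_j' else 0).
  by rewrite mulrDl coefD coefCM -mulrA coefCM coefXM; case: j.
rewrite (eq_bigr (fun j : 'I_N.+2 => a%:P * ((q`_j)%:P * (l0 ^+ (N.+1 - j) * l1 ^+ j)) +
    b%:P * ((if nat_of_ord j is j'.+1 then q`_j' else 0)%:P * (l0 ^+ (N.+1 - j) * l1 ^+ j)))); last first.
  by move=> j _; rewrite cf !rmorphD !rmorphM /=; ring.
rewrite big_split /= -!mulr_sumr mulrDl; congr (_ + _).
  rewrite big_ord_recr /= nth_default // mul0r addr0 -mulrA; congr (_ * _).
  rewrite mulr_sumr; apply: eq_bigr => j _; rewrite subSn; last by rewrite -ltnS.
  by rewrite exprS; ring.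
rewrite big_ord_recl /= mul0r add0r -mulrA; congr (_ * _).
rewrite mulr_sumr; apply: eq_bigr => j _; rewrite /= /bump leq0n add1n subSS exprS; ring.
Qed.

Lemma lf_mul A B r : lf (A *m B) r = (A r 0)%:P * lf B 0 + (A r 1)%:P * lf B 1.
Proof. by rewrite /lf !mul2E !rmorphD !rmorphM /=; ring. Qed.

Lemma hsub_lfX A B a b : hsub (a + b) B (lf A 0 ^+ a * lf A 1 ^+ b) =
  lf (A *m B) 0 ^+ a * lf (A *m B) 1 ^+ b.
Proof.
elim: a => [|a IH].
  rewrite add0n expr0 !mul1r; elim: b => [|b IH].
    by rewrite !expr0 /hsub big_ord1 coef1 subn0 !expr0 !mulr1.
  rewrite !exprS hsub_lin ?IH ?lf_mul //.
  by have := size_lfX A 0 b; rewrite expr0 mul1r add0n.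
by rewrite addSn exprS -mulrA hsub_lin ?size_lfX // IH lf_mul exprS mulrA.
Qed.

Lemma sym_mul N A B b i : (b <= N)%N ->
  sym N (A *m B) b i = \sum_(j < N.+1) sym N A b j * sym N B j i.
Proof.
move=> bN; rewrite /sym -hsub_lfX (subnK bN) /hsub coef_sum.
by apply: eq_bigr => j _; rewrite coefCM.
Qed.

Lemma sym1 N b i : (b <= N)%N -> sym N 1%:M b i = (b == i)%:R.
Proof.
move=> bN; rewrite /sym /lf !mxE /= mulr1n mulr0n !polyC0 !polyC1 mul0r addr0 add0r mul1r expr1n mul1r.
by rewrite coefXn eq_sym.
Qed.

Lemma det2E M : \det M = M 0 0 * M 1 1 - M 0 1 * M 1 0.
Proof.
rewrite (expand_det_row _ 0) big_ord_recl big_ord1 /cofactor !det_mx11 !mxE /= expr0 expr1 mul1r mulN1r mulrN.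
by congr (_ * M _ _ - M _ _ * M _ _); exact: val_inj.
Qed.

(** The complete homogeneous symmetric polynomial of degree n in two variables. *)
Definition hcs (x y : {poly K}) n : {poly K} := \sum_(b < n.+1) x ^+ (n - b) * y ^+ b.

Lemma hcsSl x y n : hcs x y n.+1 = x * hcs x y n + y ^+ n.+1.
Proof.
rewrite /hcs big_ord_recr /= subnn expr0 mul1r mulr_sumr; congr (_ + _).
apply: eq_bigr => b _; rewrite subSn; last by rewrite -ltnS.
by rewrite exprS mulrA.
Qed.

Lemma hcsSr x y n : hcs x y n.+1 = y * hcs x y n + x ^+ n.+1.
Proof.
rewrite /hcs big_ord_recl /= subn0 expr0 mulr1 mulr_sumr addrC; congr (_ + _).
by apply: eq_bigr => b _; rewrite /= /bump leq0n add1n subSS exprS; ring.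
Qed.

Lemma hcsSS x y n : hcs x y n.+2 = (x + y) * hcs x y n.+1 - x * y * hcs x y n.
Proof.
rewrite hcsSl [in RHS]mulrDl [y * hcs _ _ n.+1]mulrC [hcs x y n.+1 in X in _ + X - _]hcsSl.
by rewrite exprS; ring.
Qed.

Definition trs n M : K := \sum_(b < n.+1) sym n M b b.

(** Once the first form is multiplied by 'X, the diagonal coefficients for all [b] are found in the
    same degree [n]. *)
Lemma trs_hcs n M : trs n M = (hcs ('X * lf M 0) (lf M 1) n)`_n.
Proof.
rewrite /hcs coef_sum; apply: eq_bigr => b _; rewrite exprMn -mulrA coefXnM /sym.
have bn : (b <= n)%N by rewrite -ltnS.
by rewrite ltnNge leq_subr /= subKn.
Qed.

(** The usual recursion for the traces of symmetric powers, obtained by comparing coefficients in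
    the recursions of [hcs]; it needs no eigenvalues, hence holds over any commutative ring. *)
Lemma trsSS n M : trs n.+2 M = (M 0 0 + M 1 1) * trs n.+1 M - \det M * trs n M.
Proof.
rewrite !trs_hcs det2E; set a := M 0 0; set b := M 0 1; set c := M 1 0; set d := M 1 1.
set x := 'X * lf M 0; set y := lf M 1; set H := hcs x y.
have xE : x = a%:P * 'X + b%:P * 'X^2 by rewrite /x /lf -/a -/b expr2; ring.
have yE : y = c%:P + d%:P * 'X by [].
have cX (k : K) (P : {poly K}) i : (k%:P * 'X * P)`_i.+1 = k * P`_i by rewrite -mulrA coefCM coefXM.
have cX2 (k : K) (P : {poly K}) i : (k%:P * 'X^2 * P)`_i.+2 = k * P`_i.
  by rewrite -mulrA coefCM coefXnM /= subn2.
have e1 : (H n.+1)`_n.+2 = a * (H n)`_n.+1 + b * (H n)`_n.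
  rewrite /H hcsSl coefD [X in _ + X]nth_default ?addr0; last first.
    by have := size_lfX M 0 n.+1; rewrite expr0 mul1r add0n.
  by rewrite {1}xE mulrDl coefD cX cX2.
have e2 : (H n.+1)`_n = c * (H n)`_n + d * (H n * 'X)`_n.
  rewrite /H hcsSr coefD [X in _ + X](_ : _ = 0) ?addr0; last by rewrite exprMn coefXnM ltnSn.
  by rewrite {1}yE mulrDl coefD coefCM -mulrA coefCM [_ * 'X]mulrC.
have -> : (H n.+2)`_n.+2 = c * (H n.+1)`_n.+2 + (a + d) * (H n.+1)`_n.+1 + b * (H n.+1)`_n
   - (a * c * (H n)`_n.+1 + (a * d + b * c) * (H n)`_n + b * d * (H n * 'X)`_n).
  rewrite /H hcsSS -/H coefB; congr (_ - _).
    have -> P : (x + y) * P = c%:P * P + (a + d)%:P * 'X * P + b%:P * 'X^2 * P.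
      by rewrite xE yE rmorphD; ring.
    by rewrite !coefD coefCM cX cX2.
  have -> P : x * y * P = (a * c)%:P * 'X * P + (a * d + b * c)%:P * 'X^2 * P +
     (b * d)%:P * 'X^2 * (P * 'X).
    by rewrite xE yE !rmorphD !rmorphM /=; ring.
  by rewrite !coefD cX !cX2.
by rewrite e1 e2; ring.
Qed.

(** The Chebyshev polynomials of the second kind, normalized as U_n(t/2). *)
Fixpoint cheb (t : K) (n : nat) : K :=
  match n with 0 => 1 | 1 => t | (n''.+1 as n').+1 => t * cheb t n' - cheb t n'' end.

Lemma chebSS t n : cheb t n.+2 = t * cheb t n.+1 - cheb t n. Proof. by []. Qed.

Lemma trs_cheb n M : exists r, trs n M = cheb (M 0 0 + M 1 1) n + (\det M - 1) * r.
Proof.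
have [[r h] _] : (exists r, trs n M = cheb (M 0 0 + M 1 1) n + (\det M - 1) * r) /\
  (exists r, trs n.+1 M = cheb (M 0 0 + M 1 1) n.+1 + (\det M - 1) * r); last by exists r.
elim: n => [|n [[r1 h1] [r2 h2]]].
  split; exists 0; rewrite mulr0 addr0 /trs; first by rewrite big_ord1 /sym /= !expr0 mulr1 coef1.
  rewrite big_ord_recl big_ord1 /sym /= !expr0 !expr1 mulr1 mul1r /lf.
  by rewrite !coefD !coefC !coefCM !coefX /= mulr0 mulr1 addr0 add0r.
split; first by exists r2.
exists ((M 0 0 + M 1 1) * r2 - cheb (M 0 0 + M 1 1) n - \det M * r1).
by rewrite trsSS h1 h2 chebSS; ring.
Qed.

Definition cheb_sum t s : K := \sum_(b < s.+1) (2 * b).+1%:R * cheb t (2 * b).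

Lemma cheb_sumE t s : (t ^+ 2 - 4%:R) * cheb_sum t s =
  (2 * s).+1%:R * cheb t (2 * s).+2 - (2 * s).+3%:R * cheb t (2 * s).
Proof.
elim: s => [|s IH]; first by rewrite /cheb_sum big_ord1 muln0 !chebSS /=; ring.
rewrite /cheb_sum big_ord_recr mulrDr -/(cheb_sum t s) IH.
have -> : (2 * (@ord_max s.+1) = (2 * s).+2)%N by rewrite /=; lia.
rewrite !chebSS; move: (cheb t (2 * s)) (cheb t (2 * s).+1) => x y.
have e k : (k + 2 * s)%:R = k%:R + (2 * s)%:R :> K by rewrite natrD.
by rewrite (e 1) (e 3) (e 5); ring.
Qed.

End SymmetricPowers.

Section ChebyshevModp.
Variables (p : nat) (p_pr : prime p).
Variable K : comNzRingType.
Hypothesis pK : p \in [pchar K].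

(** With [J] a matrix square root of t^2 - 4, X = t + J stands for twice an eigenvalue of trace [t]
    and determinant 1, so its powers are given by [cheb]. The coefficient of [J] in X^p = t^p + J^p,
    which is Frobenius, is the claim. *)
Lemma cheb_char (t : K) k : p = (2 * k).+1 -> 2 ^+ (2 * k) * cheb t (2 * k) = (t ^+ 2 - 4%:R) ^+ k.
Proof.
move=> pk; have k0 : (0 < k)%N by case: (k) pk p_pr => [->|].
pose J : 'M[K]_2 := \matrix_(i, j) if i == 0 then (if j == 0 then 0 else t ^+ 2 - 4%:R)
  else (if j == 0 then 1 else 0).
have JJ : J * J = (t ^+ 2 - 4%:R)%:M.
  by apply/matrixP => i j; rewrite [LHS]mul2E !mxE; case: i j => [[|[|]]] // ? [[|[|]]] // ?; rewrite /= ?mulr1n ?mulr0n; ring.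
pose X : 'M[K]_2 := t%:M + J.
have cJ (a : K) : GRing.comm a%:M J by apply/esym; exact: scalar_mxC.
have sM (a b : K) : (a * b)%:M = a%:M * b%:M :> 'M_2 by rewrite scalar_mxM.
have X2 : X * X = (2 * t)%:M * X - 4%:R%:M.
  have -> : (2 * t)%:M = t%:M + t%:M :> 'M[K]_2 by rewrite -raddfD; congr (_%:M); ring.
  rewrite /X mulrDr !mulrDl JJ -(cJ t) expr2 raddfB /= sM.
  move: (t%:M : 'M_2) => T; rewrite mulrDr.
  by rewrite !addrA; congr (_ - _); rewrite -!addrA; congr (_ + (_ + _)); rewrite addrC.
have Xn n : X ^+ n.+2 = (2 ^+ n.+1 * cheb t n.+1)%:M * X - (2 ^+ n.+2 * cheb t n)%:M.
  elim: n => [|n IH].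
    by rewrite !expr2 X2 /= mulr1 expr1; congr (_ - _%:M); ring.
  rewrite exprSr IH mulrBl -mulrA X2 mulrBr mulrA -!sM.
  have -> : 2 ^+ n.+2 * cheb t n.+2 = 2 ^+ n.+1 * cheb t n.+1 * (2 * t) - 2 ^+ n.+2 * cheb t n.
    by rewrite chebSS !exprS; ring.
  rewrite raddfB mulrBl -!addrA; congr (_ + _); rewrite addrC; congr (_ - _%:M).
  by rewrite !exprS; ring.
have pX : p \in [pchar 'M[K]_2].
  rewrite inE p_pr /=; apply/eqP.
  have -> : p%:R = (p%:R)%:M :> 'M[K]_2 by rewrite raddfMn.
  by rewrite (pcharf0 pK) raddf0.
have /(congr1 (fun M : 'M_2 => M 1 0)) : X ^+ p = t%:M ^+ p + J ^+ p.
  by have := pFrobenius_autD_comm pX (cJ t); rewrite !pFrobenius_autE.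
have sX (a : K) l : a%:M ^+ l = (a ^+ l)%:M :> 'M[K]_2.
  by elim: l => [|l IH]; rewrite ?expr0 // !exprS IH sM.
have Jp : J ^+ p = ((t ^+ 2 - 4%:R) ^+ k)%:M * J.
  by rewrite pk exprSr exprM expr2 JJ sX.
have e : p = (2 * k).-1.+2 by lia.
rewrite Jp sX [in X ^+ _]e Xn prednK; last by lia.
have sJ (a : K) (M : 'M[K]_2) i j : (a%:M * M) i j = a * M i j by rewrite [_ * M]mul_scalar_mx mxE.
have aD (A B : 'M[K]_2) i j : (A + B) i j = A i j + B i j by rewrite mxE.
have aB (A B : 'M[K]_2) i j : (A - B) i j = A i j - B i j by rewrite !mxE.
have s0 (a : K) : (a%:M : 'M[K]_2) 1 0 = 0 by rewrite mxE mulr0n.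
have J1 : J 1 0 = 1 by rewrite mxE.
by rewrite aB !aD !sJ aD !s0 J1 !add0r subr0 !mulr1.
Qed.

End ChebyshevModp.

Section ChebyshevMorphism.
Variables (K L : comNzRingType) (f : {rmorphism K -> L}).

Lemma rmorph_cheb t n : f (cheb t n) = cheb (f t) n.
Proof.
have [] // : f (cheb t n) = cheb (f t) n /\ f (cheb t n.+1) = cheb (f t) n.+1.
elim: n => [|n [IH1 IH2]]; first by rewrite /= rmorph1.
by split=> //; rewrite !chebSS rmorphB rmorphM IH1 IH2.
Qed.

Lemma rmorph_cheb_sum t s : f (cheb_sum t s) = cheb_sum (f t) s.
Proof.
rewrite rmorph_sum; apply: eq_bigr => b _.
by rewrite rmorphM rmorph_nat rmorph_cheb.
Qed.

End ChebyshevMorphism.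

Section ChebyshevSum.
Variables (p s : nat) (p_pr : prime p) (pE : p = (2 * s).+3).

(** In [cheb_sumE] one coefficient is 2s + 3 = p = 0 and the other 2s + 1 = -2; [cheb_char] makes
    the remaining term a power of X^2 - 4, which is then cancelled. *)
Lemma cheb_sum_Fp : cheb_sum ('X : {poly 'F_p}) s = - 2%:R * ('X ^+ 2 - 4%:R) ^+ s.
Proof.
have nz : 'X ^+ 2 - 4%:R != 0 :> {poly 'F_p}.
  apply/eqP => /(congr1 (fun q : {poly 'F_p} => q`_2)).
  rewrite coefB coefXn -polyC_natr coefC subr0 coef0 => /eqP; apply/negP; exact: oner_neq0.
apply: (mulfI nz); rewrite cheb_sumE.
have pP : p \in [pchar {poly 'F_p}].
  by rewrite inE p_pr /= -polyC_natr (pcharf0 (pchar_Fp p_pr)) polyC0.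
have e : (2 * s.+1 = (2 * s).+2)%N by lia.
have := @cheb_char p p_pr {poly 'F_p} pP 'X s.+1; rewrite e -pE => /(_ erefl).
have -> : 2 ^+ (2 * s).+2 = 1 :> {poly 'F_p}.
  have -> : 2 = (2%:R : 'F_p)%:P :> {poly 'F_p} by rewrite polyC_natr.
  rewrite -rmorphXn /=; have -> : (2 * s).+2 = p.-1 by rewrite pE.
  have p2 : (2%:R : 'F_p) != 0.
    by rewrite -(dvdn_pcharf (pchar_Fp p_pr)) gtnNdvd // pE.
  apply/eqP; rewrite -(inj_eq (mulfI (_ : (2%:R : 'F_p)%:P != 0))) ?polyC_eq0 // mulr1 -polyCM -exprS prednK ?prime_gt0 //.
  by rewrite -(pFrobenius_autE (pchar_Fp p_pr)) pFrobenius_aut_nat.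
rewrite mul1r => ->; rewrite (pcharf0 pP) mul0r subr0.
have -> : (2 * s).+1%:R = - 2%:R :> {poly 'F_p}.
  by apply/eqP; rewrite -subr_eq0 opprK -natrD addn2 -pE (pcharf0 pP).
by rewrite exprS mulrCA.
Qed.

(** The identity over F_p, lifted to integral polynomials and specialized at [t]. *)
Lemma cheb_sum_mod (K : comNzRingType) (t : K) :
  exists r, cheb_sum t s = - 2%:R * (t ^+ 2 - 4%:R) ^+ s + p%:R * r.
Proof.
pose q : {poly int} := cheb_sum 'X s + 2%:R * ('X ^+ 2 - 4%:R) ^+ s.
have q0 : map_poly (intr : int -> 'F_p) q = 0.
  pose ev : {rmorphism {poly int} -> {poly 'F_p}} := map_poly (intr : int -> 'F_p).
  have evX : ev 'X = 'X by exact: map_polyX.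
  rewrite -[LHS]/(ev q) rmorphD rmorph_cheb_sum rmorphM rmorphXn rmorphB rmorphXn !rmorph_nat evX cheb_sum_Fp.
  by rewrite mulNr addNr.
pose r : {poly int} := \poly_(i < size q) (q`_i %/ p%:Z)%Z.
have qr : q = p%:R * r.
  apply/polyP => i; rewrite -polyC_natr coefCM coef_poly.
  case: ltnP => h; last by rewrite mulr0 nth_default.
  have := congr1 (fun u : {poly 'F_p} => u`_i) q0; rewrite coef_map coef0 /= => qi.
  rewrite mulrC natz divzK // (dvdz_pcharf (pchar_Fp p_pr)); exact/eqP.
exists ((map_poly (intr : int -> K) r).[t]).
pose ev : {rmorphism {poly int} -> K} := horner_eval t \o map_poly (intr : int -> K).
have evX : ev 'X = t by rewrite /ev /= map_polyX /horner_eval hornerX.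
have : ev q = ev (p%:R * r) by rewrite qr.
rewrite [ev (p%:R * _)]rmorphM /q rmorphD rmorph_cheb_sum rmorphM rmorphXn rmorphB rmorphXn !rmorph_nat evX => e.
by rewrite -[(map_poly _ r).[t]]/(ev r) -e mulNr addrC addrK.
Qed.

End ChebyshevSum.

(** * Functionals on polynomials in three variables per relator *)

Section BlockFunctional.
Variables (K : comNzRingType) (m : nat).
Local Notation mon := 'X_{1..m * 3}.
Local Notation S := {mpoly K[m * 3]}.
Implicit Types (P Q : S) (B : {set 'I_m}) (j : 'I_m).

Definition bv j (a : 'I_3) : 'I_(m * 3) := mxvec_index j a.

Lemma bv_inj j j' a a' : (bv j a == bv j' a') = (j == j') && (a == a').
Proof.
have [f fK _] := @curry_mxvec_bij m 3.
have inj : injective (uncurry (@mxvec_index m 3)).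
  by move=> x y e; rewrite -[x]fK ?inE // e fK ?inE.
by apply/eqP/andP => [e|[/eqP-> /eqP->]] //; have [-> ->] := inj (j, a) (j', a') e.
Qed.

Definition i0 : 'I_3 := 0.
Definition i1 : 'I_3 := 1.
Definition i2 : 'I_3 := 2.

(** A weighted degree in the variables of relator [j]: the weights 1, 1, 1 give the total degree,
    and 1, -1, 0 the excess of raising over lowering. *)
Definition bg (c0 c1 c2 : int) j (u : mon) : int :=
  c0 * (u (bv j i0))%:Z + c1 * (u (bv j i1))%:Z + c2 * (u (bv j i2))%:Z.

Lemma bgD c0 c1 c2 j u u' : bg c0 c1 c2 j (u + u')%MM = bg c0 c1 c2 j u + bg c0 c1 c2 j u'.
Proof. by rewrite /bg !mnmDE !PoszD; ring. Qed.

Lemma bg0 c0 c1 c2 j : bg c0 c1 c2 j 0%MM = 0.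
Proof. by rewrite /bg !mnm0E !mulr0. Qed.

Definition cvec (c0 c1 c2 : int) (a : 'I_3) : int :=
  if a == i0 then c0 else if a == i1 then c1 else c2.

Lemma bgU c0 c1 c2 j j' a : bg c0 c1 c2 j U_(bv j' a)%MM = if j' == j then cvec c0 c1 c2 a else 0.
Proof.
rewrite /bg !mnm1E !bv_inj /cvec; case: (j' == j) => /=; last by rewrite !mulr0.
by case: a => [[|[|[]]]] //= ?; rewrite !mulr0 !mulr1 ?add0r ?addr0.
Qed.

Definition graded c0 c1 c2 j d P := forall u, u \in msupp P -> bg c0 c1 c2 j u = d.

Section Graded.
Variables (c0 c1 c2 : int) (j : 'I_m).
Local Notation gr := (graded c0 c1 c2 j).

Lemma gr0 d : gr d 0. Proof. by move=> u; rewrite msupp0. Qed.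

Lemma grC c : gr 0 c%:MP.
Proof.
by move=> u; rewrite msuppC; case: eqP => // _; rewrite inE => /eqP->; rewrite bg0.
Qed.

Lemma gr1 : gr 0 1. Proof. by rewrite -mpolyC1; exact: grC. Qed.

Lemma grD d P Q : gr d P -> gr d Q -> gr d (P + Q).
Proof.
by move=> hP hQ u /msuppD_le; rewrite mem_cat => /orP[/hP|/hQ].
Qed.

Lemma gr_sum d (I : Type) (r : seq I) (A : pred I) (F : I -> S) :
  (forall i, A i -> gr d (F i)) -> gr d (\sum_(i <- r | A i) F i).
Proof. by move=> h; elim/big_ind: _ => //; [exact: gr0 | exact: grD]. Qed.

Lemma grM d e P Q : gr d P -> gr e Q -> gr (d + e) (P * Q).
Proof.
move=> hP hQ u /msuppM_le /allpairsP[[u1 u2] /= [h1 h2 ->]].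
by rewrite bgD hP ?hQ.
Qed.

Lemma grMl P d Q : gr 0 P -> gr d Q -> gr d (P * Q).
Proof. by move=> hP hQ; rewrite -[d]add0r; exact: grM. Qed.

Lemma grX d P k : gr d P -> gr (d * k%:Z) (P ^+ k).
Proof.
move=> hP; elim: k => [|k IH]; first by rewrite mulr0; exact: gr1.
by rewrite exprS -addn1 PoszD mulrDr mulr1 addrC; exact: grM.
Qed.

Lemma gr_prod (I : Type) (r : seq I) (A : pred I) (F : I -> S) (d : I -> int) :
  (forall i, A i -> gr (d i) (F i)) -> gr (\sum_(i <- r | A i) d i) (\prod_(i <- r | A i) F i).
Proof. by move=> h; elim/big_rec2: _ => [|i d' P Ai]; [exact: gr1 | apply: grM; exact: h]. Qed.

Lemma gr_prod0 (I : Type) (r : seq I) (A : pred I) (F : I -> S) :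
  (forall i, A i -> gr 0 (F i)) -> gr 0 (\prod_(i <- r | A i) F i).
Proof. by move=> h; have := @gr_prod I r A F (fun=> 0) h; rewrite big1. Qed.

Lemma grZ d c P : gr d P -> gr d (c *: P).
Proof. by move=> hP u /msuppZ_le; exact: hP. Qed.

Lemma grN d P : gr d P -> gr d (- P).
Proof. by move=> hP; rewrite -scaleN1r; exact: grZ. Qed.

Lemma grU j' a : gr (if j' == j then cvec c0 c1 c2 a else 0) 'X_(bv j' a).
Proof. by move=> u; rewrite msuppX inE => /eqP->; exact: bgU. Qed.

End Graded.

Definition avoids j P := graded 1 1 1 j 0 P.

Lemma avoidsP j P u a : avoids j P -> u \in msupp P -> u (bv j a) = 0%N.
Proof.
move=> h /h; rewrite /bg !mul1r => e.
have : (u (bv j i0) + u (bv j i1) + u (bv j i2) = 0)%N by lia.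
case: a => [[|[|[|//]]]] ha.
- by rewrite (_ : Ordinal ha = i0); [lia | exact: val_inj].
- by rewrite (_ : Ordinal ha = i1); [lia | exact: val_inj].
- by rewrite (_ : Ordinal ha = i2); [lia | exact: val_inj].
Qed.

Variable c1 : nat -> nat -> nat -> K.

Definition cblk (u : mon) j := c1 (u (bv j i0)) (u (bv j i1)) (u (bv j i2)).

Definition cmon B u := \prod_(j in B) cblk u j.

(* The monomials in the three variables of relator [j] are evaluated by the moments [c1],
   independently for the relators [j] in [B]; the variables outside [B] are set to 1. *)
Definition lext B P := \sum_(u <- msupp P) P@_u * cmon B u.

Lemma lextE B k P : (msize P <= k)%N ->
  lext B P = \sum_(u : 'X_{1..(m * 3)%N < k}) P@_u * cmon B u.
Proof.
move=> le; rewrite (bigID (fun u : 'X_{1..(m * 3)%N < k} => (u : mon) \in msupp P)) /=.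
rewrite [X in _ = _ + X]big1 ?addr0 => [|u /memN_msupp_eq0->]; last by rewrite mul0r.
rewrite -(big_map (@bmnm _ _) (fun u => u \in msupp P) (fun u => P@_u * cmon B u)) -big_filter.
apply: perm_big; apply: uniq_perm; rewrite ?msupp_uniq ?filter_uniq //.
  by rewrite map_inj_uniq ?index_enum_uniq //; exact: val_inj.
move=> u; rewrite mem_filter; case: (boolP (u \in msupp P)) => //= uP.
have uk : (mdeg u < k)%N by exact: leq_trans (msize_mdeg_lt uP) le.
by apply/esym/mapP; exists (BMultinom uk); rewrite ?mem_index_enum.
Qed.

Lemma lextD B P Q : lext B (P + Q) = lext B P + lext B Q.
Proof.
pose k := maxn (msize (P + Q)) (maxn (msize P) (msize Q)).
rewrite !(@lextE B k) ?leq_max ?leqnn ?orbT // -big_split /=.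
by apply: eq_bigr => u _; rewrite mcoeffD mulrDl.
Qed.

Lemma lextZ B c P : lext B (c *: P) = c * lext B P.
Proof.
pose k := maxn (msize (c *: P)) (msize P).
rewrite !(@lextE B k) ?leq_max ?leqnn ?orbT // mulr_sumr.
by apply: eq_bigr => u _; rewrite mcoeffZ mulrA.
Qed.

Lemma lext0 B : lext B 0 = 0. Proof. by rewrite /lext msupp0 big_nil. Qed.

Lemma lext_sum B (I : Type) (r : seq I) (A : pred I) (F : I -> S) :
  lext B (\sum_(i <- r | A i) F i) = \sum_(i <- r | A i) lext B (F i).
Proof. by apply: (big_morph _ _ (lext0 B)); exact: lextD. Qed.

Lemma lextX B u : lext B 'X_[u] = cmon B u.
Proof. by rewrite /lext msuppX big_seq1 mcoeffX eqxx mul1r. Qed.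

Lemma lext_mon B P : lext B P = \sum_(u <- msupp P) P@_u * lext B 'X_[u].
Proof. by apply: eq_bigr => u _; rewrite lextX. Qed.

Lemma lextMC B c P : lext B (c%:MP * P) = c * lext B P.
Proof. by rewrite mul_mpolyC lextZ. Qed.

Lemma lext_natl B k P : lext B (k%:R * P) = k%:R * lext B P.
Proof. by rewrite -[k%:R : S]mpolyC_nat lextMC. Qed.

Lemma lext_indep j B P Q : j \notin B -> (forall j', j' != j -> avoids j' P) ->
  (forall j', j' \notin B -> avoids j' Q) ->
  lext (j |: B) (P * Q) = lext [set j] P * lext B Q.
Proof.
move=> jB hP hQ.
rewrite [P in P * Q]mpolyE mulr_suml lext_sum [X in _ = X * _]lext_mon mulr_suml.
rewrite big_seq [RHS]big_seq; apply: eq_bigr => u uP.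
rewrite -scalerAl lextZ -mulrA; congr (_ * _).
rewrite [Q in _ * Q]mpolyE mulr_sumr lext_sum [X in _ = _ * X]lext_mon mulr_sumr.
rewrite big_seq [RHS]big_seq; apply: eq_bigr => u' uQ.
rewrite -scalerAr lextZ mulrCA; congr (_ * _).
rewrite -mpolyXD !lextX /cmon big_setU1 //= big_set1; congr (_ * _).
  by rewrite /cblk !mnmDE !(avoidsP _ (hQ _ jB) uQ) !addn0.
apply: eq_bigr => j' j'B; rewrite /cblk !mnmDE.
have nj : j' != j by apply: contraNneq jB => <-.
by rewrite !(avoidsP _ (hP _ nj) uP) !add0n.
Qed.

End BlockFunctional.

(** * Gaussian moments and Wick's formula *)

Section Wick.
Variables (K : fieldType) (m : nat).
Local Notation S := {mpoly K[m * 3]}.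
Local Notation bv := (@bv m).
Implicit Types (P Q M : S) (j k l : 'I_m).

Hypothesis two_neq0 : 2%:R != 0 :> K.

(* The moments of a centered Gaussian triple (e, f, u) with E(e f) = 1, E(u^2) = 1/8 and all
   other covariances 0. *)
Definition wick (a b c : nat) : K :=
  if (a == b) && ~~ odd c then a`!%:R * \prod_(i < c./2) ((2 * i).+1%:R / 8%:R) else 0.

Definition wext := lext wick [set: 'I_m].

(** Gaussian integration by parts, reduced to a recursion for the moments of a single block. *)
Lemma wext_parts (a0 a1 : 'I_3) (t : K) k P :
  (forall u : 'X_{1..m * 3}, cblk wick (U_(bv k a0) + u)%MM k =
      t * ((u (bv k a1))%:R * cblk wick (u - U_(bv k a1))%MM k)) ->
  wext ('X_(bv k a0) * P) = t * wext (P^`M(bv k a1)).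
Proof.
move=> h; rewrite [in LHS](mpolyE P) [in RHS](mpolyE P) mulr_sumr.
have -> : (\sum_(u <- msupp P) P@_u *: 'X_[u])^`M(bv k a1) =
   \sum_(u <- msupp P) (P@_u *: 'X_[u])^`M(bv k a1) by rewrite raddf_sum.
rewrite /wext !lext_sum mulr_sumr.
apply: eq_bigr => u _; rewrite -scalerAr mderivZ !lextZ mulrCA; congr (_ * _).
rewrite -mpolyXD mderivX lextZ !lextX /cmon (bigD1 k) ?inE //= h.
rewrite [in RHS](bigD1 k) ?inE //= !mulrA; congr (_ * _).
apply: eq_bigr => j /andP[_ jk]; rewrite /cblk !mnmDE !mnmBE !mnm1E !bv_inj.
by rewrite [k == j]eq_sym (negbTE jk) /= !add0n !subn0.
Qed.

Lemma wext_parts0 k P : wext ('X_(bv k i0) * P) = wext (P^`M(bv k i1)).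
Proof.
rewrite -[RHS]mul1r; apply: wext_parts => u; rewrite mul1r /cblk !mnmDE !mnmBE !mnm1E !bv_inj !eqxx /=.
rewrite add1n !add0n !subn0 subn1 /wick; case: (u (bv k i1)) => [|b] /=; first by rewrite mul0r.
rewrite eqSS; case: eqP => [->|_] /=; last by rewrite mulr0.
by case: ifP; rewrite ?mulr0 // factS natrM mulrA.
Qed.

Lemma wext_parts1 k P : wext ('X_(bv k i1) * P) = wext (P^`M(bv k i0)).
Proof.
rewrite -[RHS]mul1r; apply: wext_parts => u; rewrite mul1r /cblk !mnmDE !mnmBE !mnm1E !bv_inj !eqxx /=.
rewrite add1n !add0n !subn0 subn1 /wick; case: (u (bv k i0)) => [|b] /=; first by rewrite mul0r.
rewrite eqSS; case: eqP => [_|_] /=; last by rewrite mulr0.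
by case: ifP; rewrite ?mulr0 // factS natrM mulrA.
Qed.

Lemma wext_parts2 k P : wext ('X_(bv k i2) * P) = 8%:R^-1 * wext (P^`M(bv k i2)).
Proof.
apply: wext_parts => u; rewrite /cblk !mnmDE !mnmBE !mnm1E !bv_inj !eqxx /=.
rewrite add1n !add0n !subn0 subn1 /wick; case: (u (bv k i2)) => [|c] /=.
  by rewrite andbF mul0r mulr0.
rewrite negbK; case: (_ == _); rewrite /= ?mulr0 //; case: ifP => oc; rewrite ?mulr0 //.
have e : (2 * c./2 = c)%N by rewrite mul2n -[RHS](odd_double_half c) (negbTE oc).
by rewrite big_ord_recr /= e; ring.
Qed.

Lemma wextD P Q : wext (P + Q) = wext P + wext Q. Proof. exact: lextD. Qed.
Lemma wextZ c P : wext (c *: P) = c * wext P. Proof. exact: lextZ. Qed.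

(** The polarization of the quadratic form 4u^2 + e f of sl_2, at the vectors of the relators [k]
    and [l]. *)
Definition gram k l : S := 4%:R *: ('X_(bv k i2) * 'X_(bv l i2)) +
  2%:R^-1 *: ('X_(bv k i0) * 'X_(bv l i1) + 'X_(bv k i1) * 'X_(bv l i0)).

Lemma gramC k l : gram k l = gram l k.
Proof. by rewrite /gram; congr (_ *: _ + _ *: _); ring. Qed.

(* The derivation replacing the vector variable [k] by [l]. *)
Definition polar l k P : S := 'X_(bv l i0) * P^`M(bv k i0) + 'X_(bv l i1) * P^`M(bv k i1) +
  'X_(bv l i2) * P^`M(bv k i2).

Lemma polarM l k P Q : polar l k (P * Q) = polar l k P * Q + P * polar l k Q.
Proof. by rewrite /polar !mderivM; ring. Qed.

Lemma mderivXv (i j : 'I_(m * 3)) : ('X_i : S)^`M(j) = (i == j)%:R.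
Proof.
rewrite mderivX mnm1E; case: eqP => [->|_]; last by rewrite scale0r.
rewrite scale1r; have -> : (U_(j) - U_(j) = 0 :> 'X_{1..m * 3})%MM.
  by apply/mnmP => i'; rewrite mnmBE mnm0E subnn.
by rewrite mpolyX0.
Qed.

Lemma polarX l k j a : polar l k 'X_(bv j a) = if j == k then 'X_(bv l a) else 0.
Proof.
rewrite /polar !mderivXv !bv_inj; case: (j == k) => /=; last by rewrite !mulr0 !addr0.
case: a => [[|[|[|//]]]] ha /=; rewrite ?mulr0 ?mulr1 ?addr0 ?add0r;
  by congr ('X_(bv _ _)); apply: val_inj.
Qed.

Lemma polarZ l k c P : polar l k (c *: P) = c *: polar l k P.
Proof. by rewrite /polar !mderivZ -!scalerAr !scalerDr. Qed.

Lemma polarD l k P Q : polar l k (P + Q) = polar l k P + polar l k Q.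
Proof. by rewrite /polar !mderivD; ring. Qed.

Lemma polar_gram l k a b : polar l k (gram a b) =
  (if a == k then gram l b else 0) + (if b == k then gram a l else 0).
Proof.
rewrite {1}/gram polarD !polarZ polarD !polarM !polarX.
by case: (a == k); case: (b == k); rewrite /gram ?mul0r ?mulr0 ?addr0 ?add0r ?scaler0 ?addr0 //;
  rewrite !scalerDr; ring.
Qed.

(** Integration by parts in the variables of [k]. The covariances of [wick] turn every coefficient
    of [gram] into 1/2, and 3 is the dimension of sl_2. *)
Lemma wick_rec k l M : wext (gram k l * M) = 2%:R^-1 * ((3 * (k == l))%:R * wext M + wext (polar l k M)).
Proof.
have e a : 'X_(bv l a) ^`M(bv k a) = (k == l)%:R :> S by rewrite mderivXv bv_inj eqxx andbT eq_sym.
have e8 : 4%:R * 8%:R^-1 = 2%:R^-1 :> K.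
  have -> : 8%:R = 4%:R * 2%:R :> K by rewrite -natrM.
  by rewrite invfM mulrA divff ?mul1r // (_ : 4%:R = 2%:R * 2%:R) -?natrM // natrM mulf_neq0.
rewrite /gram mulrDl -!scalerAl mulrDl -!mulrA wextD !wextZ wextD wext_parts0 wext_parts1 wext_parts2.
rewrite mulrA e8 -mulrDr !mderivM !e; congr (_ * _); rewrite /polar !wextD.
have en : wext ((k == l)%:R * M) = (k == l)%:R * wext M by exact: lext_natl.
by rewrite !en natrM; ring.
Qed.

Definition gprod (L : seq ('I_m * 'I_m)) : S := \prod_(q <- L) gram q.1 q.2.

Fixpoint repl l k (L : seq ('I_m * 'I_m)) : seq (seq ('I_m * 'I_m)) :=
  if L is (a, b) :: L' then
    (if a == k then [:: (l, b) :: L'] else [::]) ++ (if b == k then [:: (a, l) :: L'] else [::]) ++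
    map (cons (a, b)) (repl l k L')
  else [::].

Definition cnt j (L : seq ('I_m * 'I_m)) : nat := \sum_(q <- L) ((q.1 == j) + (q.2 == j)).

Lemma polar_gprod l k L : polar l k (gprod L) = \sum_(L' <- repl l k L) gprod L'.
Proof.
elim: L => [|[a b] L IH] /=.
  rewrite /gprod !big_nil /polar -mpolyC1 !mderivC; ring.
have gc q L' : gprod (q :: L') = gram q.1 q.2 * gprod L' by rewrite /gprod big_cons.
rewrite gc polarM IH polar_gram mulrDl !big_cat /= big_map -addrA; congr (_ + (_ + _)).
- by case: (a == k); rewrite ?big_seq1 ?gc ?big_nil ?mul0r.
- by case: (b == k); rewrite ?big_seq1 ?gc ?big_nil ?mul0r.
- by rewrite mulr_sumr; apply: eq_bigr => L' _; rewrite gc.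
Qed.

Lemma cnt_cons j q L : cnt j (q :: L) = ((q.1 == j) + (q.2 == j) + cnt j L)%N.
Proof. by rewrite /cnt big_cons. Qed.

Lemma repl_size l k L L' : L' \in repl l k L -> size L' = size L.
Proof.
elim: L L' => [//|[a b] L IH] L' /=; rewrite !mem_cat => /or3P[].
- by case: ifP => // _; rewrite inE => /eqP->.
- by case: ifP => // _; rewrite inE => /eqP->.
- by move=> /mapP[L1 /IH e ->] /=; rewrite e.
Qed.

Lemma repl_cnt j l k L L' : L' \in repl l k L -> (cnt j L' + (k == j) = cnt j L + (l == j))%N.
Proof.
elim: L L' => [//|[a b] L IH] L' /=; rewrite !mem_cat => /or3P[].
- by case: eqP => // -> ; rewrite inE => /eqP->; rewrite !cnt_cons /=; lia.
- by case: eqP => // -> ; rewrite inE => /eqP->; rewrite !cnt_cons /=; lia.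
- by move=> /mapP[L1 /IH e ->]; rewrite !cnt_cons /=; lia.
Qed.

Lemma repl_id k L : \sum_(L' <- repl k k L) gprod L' = (cnt k L)%:R * gprod L.
Proof.
rewrite -polar_gprod /gprod /cnt; elim: L => [|q L IH].
  by rewrite !big_nil /polar -mpolyC1 !mderivC; ring.
rewrite !big_cons polarM IH polar_gram !natrD.
by case: eqP => [->|_]; case: eqP => [->|_] /=; ring.
Qed.

Variable s : nat.
Hypothesis sK : (2 * s + 3)%:R = 0 :> K.

(** Contracting a vector other than [j] removes a factor and keeps the number of occurrences of [j].
    What remains is to contract a factor [gram j j]: the dimension 3 and the 2s other occurrences of
    [j] add up to 2s + 3, which is 0 in [K]. *)
Lemma wick_gram0 j L : cnt j L = (2 * s).+2 -> wext (gprod L) = 0.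
Proof.
move: {2}(size L) (erefl (size L)) => r; elim: r L => [|r IH] [//|[a b] L] //=.
  by move=> _; rewrite /cnt big_nil.
move=> [szL]; rewrite cnt_cons /= => cL.
have step k l : (k, l) = (a, b) \/ (k, l) = (b, a) -> k != j -> wext (gram k l * gprod L) = 0.
  move=> kl kj; have e : ((k == j) + (l == j) = (a == j) + (b == j))%N.
    by case: kl => -[-> ->] //; rewrite addnC.
  rewrite wick_rec polar_gprod /wext lext_sum big_seq big1 => [|L' h]; last first.
    apply: IH; first by rewrite (repl_size h).
    by have := repl_cnt j h; rewrite (negbTE kj) in e *; lia.
  rewrite addr0; case: eqP => [kle|_]; last by rewrite mul0r mulr0.
  rewrite -/wext IH ?mulr0 //; move: e; rewrite -kle (negbTE kj); lia.
have -> : gprod ((a, b) :: L) = gram a b * gprod L by rewrite /gprod big_cons.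
have [aj|aj] := eqVneq a j; last by apply: step => //; left.
have [bj|bj] := eqVneq b j; last by rewrite gramC; apply: step => //; right.
rewrite aj bj wick_rec polar_gprod repl_id eqxx muln1 /wext lext_natl -/wext -mulrDl -natrD.
have -> : (3 + cnt j L = 2 * s + 3)%N by move: cL; rewrite aj bj eqxx; lia.
by rewrite sK mul0r mulr0.
Qed.

Lemma wick_row j i L : i != j -> cnt j L = (2 * s).+1 -> wext (polar i j (gprod L)) = 0.
Proof.
(* One more factor [gram j i] raises the number of occurrences of [j] to 2s + 2, and contracting it
   gives half of the polarization. *)
move=> ij cL; have := @wick_gram0 j ((j, i) :: L); rewrite cnt_cons /= eqxx (negbTE ij) cL => /(_ erefl).
have -> : gprod ((j, i) :: L) = gram j i * gprod L by rewrite /gprod big_cons.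
rewrite wick_rec eq_sym (negbTE ij) muln0 mul0r add0r => /eqP; rewrite mulf_eq0 invr_eq0 (negbTE two_neq0).
by move/eqP.
Qed.

End Wick.

(** * Forms invariant under row operations *)

Section RowInvariant.
Variables (p : nat) (K : fieldType) (n d : nat) (Pos : finType).
Variables (kap : Pos -> 'I_n) (c : {ffun Pos -> 'I_n} -> K).
Hypothesis pK : p \in [pchar K].
Hypothesis d_lt : (d < p)%N.
Hypothesis d_even : ~~ odd d.
Hypothesis kap_cnt : forall i, #|[pred u | kap u == i]| = d.
Hypothesis c_cnt : forall phi i, c phi != 0 -> #|[pred u | phi u == i]| = d.
Hypothesis c_row : forall i j (phi : {ffun Pos -> 'I_n}), i != j ->
  \sum_(u | phi u == j) c (upd phi u i) = 0.
Implicit Types (A B L U : 'M[K]_n) (i j : 'I_n).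

(** A form of degree [d] in every row and every column: the position [u] reads the column [kap u]
    and the row [phi u]. The hypothesis [c_row] is the infinitesimal version of invariance under row
    additions. *)
Definition rowform A : K := \sum_(phi : {ffun Pos -> 'I_n}) c phi * \prod_u A (phi u) (kap u).

Definition rowadd i j t A : 'M[K]_n := \matrix_(a, b) (A a b + (a == i)%:R * (t * A j b)).

Lemma deriv_prod (I : finType) (F : I -> {poly K}) :
  (\prod_i F i)^`() = \sum_i (F i)^`() * \prod_(j | j != i) F j.
Proof.
suff h (r : seq I) : uniq r -> (\prod_(i <- r) F i)^`() =
    \sum_(i <- r) (F i)^`() * \prod_(j <- r | j != i) F j.
  by rewrite h ?index_enum_uniq.
elim: r => [|i r IH] /=; first by rewrite !big_nil derivC.
move=> /andP[ir ur]; rewrite !big_cons derivM IH // eqxx /=; congr (_ * _ + _).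
  rewrite big_seq [RHS]big_seq_cond; apply: eq_bigl => j; case: (boolP (j \in r)) => //= jr.
  by apply/esym/eqP => ji; rewrite -ji jr in ir.
rewrite mulr_sumr big_seq [RHS]big_seq; apply: eq_bigr => j jr.
rewrite big_cons; case: eqP => [ij|_]; first by rewrite ij jr in ir.
by rewrite mulrCA.
Qed.

Lemma poly_deriv0 (P : {poly K}) : (size P <= p)%N -> P^`() = 0 -> P = (P`_0)%:P.
Proof.
move=> szP dP; apply/polyP => -[|k]; rewrite coefC //=.
have [kp|kp] := ltnP k.+1 p; last by rewrite nth_default // (leq_trans szP).
have /eqP : P^`()`_k = 0 by rewrite dP coef0.
rewrite coef_deriv -mulr_natr mulf_eq0 => /orP[/eqP//|].
by rewrite -(dvdn_pcharf pK) gtnNdvd.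
Qed.

(** As a polynomial in [t] the form has degree at most d < p and, by [c_row], derivative 0; so it is
    constant even in characteristic p. *)
Lemma rowform_rowadd i j t A : i != j -> rowform (rowadd i j t A) = rowform A.
Proof.
move=> ij.
pose F a b : {poly K} := (A a b)%:P + (a == i)%:R * ((A j b)%:P * 'X).
pose P := \sum_(phi : {ffun Pos -> 'I_n}) (c phi)%:P * \prod_u F (phi u) (kap u).
have Pt x : P.[x] = rowform (rowadd i j x A).
  rewrite horner_sum; apply: eq_bigr => phi _; rewrite hornerCM horner_prod; congr (_ * _).
  apply: eq_bigr => u _; rewrite mxE /F hornerD hornerC; congr (_ + _).
  by case: (_ == i); rewrite ?mul0r ?mul1r ?horner0 // hornerCM hornerX mulrC.
have -> : rowform A = P.[0].
  rewrite Pt; congr rowform; apply/matrixP => a b; rewrite mxE mul0r mulr0 addr0 //.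
have dF a b : (F a b)^`() = (a == i)%:R * (A j b)%:P.
  rewrite /F derivD derivC add0r; case: (_ == i); last by rewrite !mul0r derivC.
  by rewrite !mul1r derivM derivC derivX mul0r add0r mulr1.
have szF a b : (size (F a b) <= (a == i).+1)%N.
  rewrite /F; case: (a == i); last by rewrite mul0r addr0 size_polyC_leq1.
  rewrite mul1r (leq_trans (size_polyD _ _)) // geq_max (leq_trans (size_polyC_leq1 _)) //=.
  rewrite (leq_trans (size_polyMleq _ _)) // size_polyX addn2 /=.
  by rewrite ltnS size_polyC_leq1.
have szP : (size P <= p)%N.
  apply: (leq_trans (size_sum _ _ _)); apply/bigmax_leqP => phi _.
  have [->|c0] := eqVneq (c phi) 0; first by rewrite polyC0 mul0r size_poly0.
  rewrite mul_polyC (leq_trans (size_scale_leq _ _)) // (leq_trans (size_poly_prod_leq _ _)) //.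
  have : (\sum_u size (F (phi u) (kap u)) <= \sum_u (phi u == i).+1)%N by exact: leq_sum.
  have -> : (\sum_u (phi u == i).+1 = #|Pos| + d)%N.
    rewrite -(c_cnt i c0) -sum1_card -[in RHS]sum1_card [in X in (_ + X)%N]big_mkcond -big_split /=.
    by apply: eq_bigr => u _; rewrite inE; case: (_ == i).
  have -> : #|(xpredT : pred Pos)| = #|Pos| by exact: eq_card.
  move=> le; rewrite leq_subLR; apply: leq_ltn_trans le _.
  by rewrite ltn_add2l.
have dP : P^`() = 0.
  have -> : P^`() = \sum_(phi : {ffun Pos -> 'I_n}) (c phi)%:P * \sum_(u | phi u == i)
     ((A j (kap u))%:P * \prod_(u' | u' != u) F (phi u') (kap u')).
    rewrite raddf_sum; apply: eq_bigr => phi _; rewrite /= derivM derivC mul0r add0r deriv_prod.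
    congr (_ * _); rewrite [RHS]big_mkcond; apply: eq_bigr => u _; rewrite dF.
    by case: (_ == i); rewrite ?mul0r ?mul1r.
  under eq_bigr => phi _ do rewrite mulr_sumr.
  rewrite (exchange_big_dep xpredT) //=.
  transitivity (\sum_u \sum_(psi : {ffun Pos -> 'I_n} | psi u == j)
     ((c (upd psi u i))%:P * \prod_u' F (psi u') (kap u'))).
    apply: eq_bigr => u _.
    rewrite (reindex_onto (fun psi : {ffun Pos -> 'I_n} => upd psi u i) (fun phi => upd phi u j)) /=.
      apply: eq_big => psi.
        rewrite upd_same eqxx upd_upd /=; apply/eqP/eqP => [<-|<-]; first by rewrite upd_same.
        by rewrite upd_id.
      move=> /andP[_ /eqP psiu]; congr (_ * _); rewrite [RHS](bigD1 u) //=.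
      have -> : psi u = j by rewrite -psiu upd_same.
      rewrite {2}/F eq_sym (negbTE ij) mul0r addr0; congr (_ * _).
      by apply: eq_bigr => u' nu; rewrite upd_neq.
    by move=> phi /eqP pu; rewrite upd_upd -pu upd_id.
  rewrite (exchange_big_dep xpredT) //= big1 // => psi _.
  by rewrite -mulr_suml -rmorph_sum c_row // mul0r.
have e := poly_deriv0 szP dP.
by rewrite -(Pt t) e !hornerC.
Qed.

Definition scalerow i t A : 'M[K]_n := \matrix_(a, b) ((if a == i then t else 1) * A a b).

Lemma rowform_scale i t A : rowform (scalerow i t A) = t ^+ d * rowform A.
Proof.
rewrite /rowform mulr_sumr; apply: eq_bigr => phi _.
have [->|c0] := eqVneq (c phi) 0; first by rewrite !mul0r mulr0.
rewrite mulrCA; congr (_ * _); under eq_bigr => u _ do rewrite mxE.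
rewrite big_split /=; congr (_ * _); rewrite -big_mkcond /= prodr_const.
by congr (_ ^+ _); rewrite -(c_cnt i c0); apply: eq_card.
Qed.

Lemma rowform_xrow i j A : rowform (xrow i j A) = rowform A.
Proof.
have [->|ij] := eqVneq i j.
  by rewrite /xrow tperm1 row_perm1.
have ji : j != i by rewrite eq_sym.
(* An exchange of rows is three row additions and a change of sign, which is harmless as [d] is
   even. *)
have -> : xrow i j A = scalerow j (-1) (rowadd i j 1 (rowadd j i (-1) (rowadd i j 1 A))).
  apply/matrixP => a b; rewrite !mxE.
  case: tpermP => [->|->|/eqP ai /eqP aj]; rewrite ?eqxx ?(negbTE ij) ?(negbTE ji) ?(negbTE ai) ?(negbTE aj). all: rewrite ?mulr1n ?mulr0n ?mul0r ?mul1r ?addr0 /=. 1: ring. 1: ring. 1: ring.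
rewrite rowform_scale !rowform_rowadd // -signr_odd (negbTE d_even) expr0 mul1r //.
Qed.

Lemma rowform_perm (sg : {perm 'I_n}) A : rowform (row_perm sg A) = rowform A.
Proof.
have [ts -> _] := prod_tpermP sg; elim: ts => [|t ts IH]; first by rewrite big_nil row_perm1.
rewrite big_cons row_permM -[row_perm (tperm _ _) _]/(xrow _ _ _).
by rewrite rowform_xrow.
Qed.

Lemma rowform_adds r (w : 'I_n -> K) (js : seq 'I_n) A : r \notin js ->
  rowform (\matrix_(a, b) (A a b + (a == r)%:R * \sum_(j <- js) w j * A j b)) = rowform A.
Proof.
elim: js => [|j js IH] /=.
  by move=> _; congr rowform; apply/matrixP => a b; rewrite mxE big_nil mulr0 addr0.
rewrite inE negb_or => /andP[rj rjs]; rewrite -[RHS](IH rjs) -[RHS](rowform_rowadd (w j) _ rj).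
congr rowform; apply/matrixP => a b; rewrite !mxE big_cons.
by rewrite [j == r]eq_sym (negbTE rj) mulr0n mul0r addr0; ring.
Qed.

(** The rows are changed from the last to the first, so that each change only uses rows above it
    that are still those of [B]. *)
Lemma rowform_lower L B : (forall i j : 'I_n, (i <= j)%N -> L i j = (i == j)%:R) ->
  rowform (L *m B) = rowform B.
Proof.
move=> hL.
pose C r : 'M[K]_n := \matrix_(a, b) if (a < r)%N then B a b else (L *m B) a b.
have -> : L *m B = C 0%N by apply/matrixP => a b; rewrite [RHS]mxE ltn0.
have -> : B = C n by apply/matrixP => a b; rewrite [RHS]mxE ltn_ord.
suff h r : (r <= n)%N -> rowform (C (n - r)%N) = rowform (C n) by have := h n (leqnn n); rewrite subnn.
elim: r => [|r IH] rn; first by rewrite subn0.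
rewrite -IH; last by exact: ltnW.
have lt : (n - r.+1 < n)%N by lia.
pose q := Ordinal lt; have -> : (n - r = q.+1)%N by rewrite /=; lia.
rewrite -[(n - r.+1)%N]/(q : nat) -[RHS](@rowform_adds q (L q) [seq j : 'I_n <- enum 'I_n | (j < q)%N]).
  congr rowform; apply/matrixP => a b; rewrite !mxE ltnS.
  have [->|aq] := eqVneq a q; last first.
    rewrite mulr0n mul0r addr0 [in RHS]leq_eqVlt; case: eqP => // /val_inj e.
    by rewrite e eqxx in aq.
  rewrite ltnn leqnn mul1r (bigID (fun j : 'I_n => (j < q)%N)) [LHS]addrC; congr (_ + _).
    rewrite (bigD1 q) ?ltnn // hL // eqxx mul1r big1; first exact: addr0.
    move=> j /andP[h jq].
    have qj : (q <= j)%N by rewrite leqNgt.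
    by rewrite (hL _ _ qj) [q == j]eq_sym (negbTE jq) mul0r.
  rewrite big_filter big_enum_cond; apply: eq_bigr => j jq; rewrite mxE.
  by have -> : (j < q.+1)%N by exact: ltnW.
by rewrite mem_filter ltnn.
Qed.

(** A nonzero term has [phi u <= kap u] for all [u]; since [phi] and [kap] both take every value [d]
    times, their sums agree and phi = kap. *)
Lemma rowform_upper U : (forall i j : 'I_n, (j < i)%N -> U i j = 0) ->
  rowform U = rowform 1%:M * (\prod_i U i i) ^+ d.
Proof.
move=> hU.
have main (V : 'M[K]_n) : (forall i j : 'I_n, (j < i)%N -> V i j = 0) ->
   rowform V = c [ffun u => kap u] * (\prod_i V i i) ^+ d.
  move=> hV; rewrite /rowform (bigD1 [ffun u => kap u]) //= [X in _ + X]big1 ?addr0 => [|phi nphi].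
    congr (_ * _); under eq_bigr => u _ do rewrite ffunE.
    rewrite (partition_big kap xpredT) //= -prodrXl; apply: eq_bigr => i _.
    rewrite (eq_bigr (fun=> V i i)) => [|u /eqP-> //].
    by rewrite prodr_const; congr (_ ^+ _); rewrite -(kap_cnt i); apply: eq_card.
  have [->|c0] := eqVneq (c phi) 0; first by rewrite mul0r.
  have [/forallP le|] := boolP [forall u, (phi u <= kap u)%N]; last first.
    by rewrite negb_forall => /existsP[u]; rewrite -ltnNge => lt; rewrite (bigD1 u) //= hV // mul0r mulr0.
  have sumE (psi : Pos -> 'I_n) : (forall i, #|[pred u | psi u == i]| = d) ->
      (\sum_u psi u = \sum_(i < n) d * i)%N.
    move=> h; rewrite (partition_big psi xpredT) //=; apply: eq_bigr => i _.
    rewrite (eq_bigr (fun=> i : nat)) => [|u /eqP-> //].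
    by rewrite sum_nat_const; congr (_ * _)%N; rewrite -(h i); apply: eq_card.
  have e : (\sum_u phi u = \sum_u kap u)%N by rewrite !sumE // => i; exact: c_cnt.
  suff ee : phi = [ffun u => kap u] by rewrite ee eqxx in nphi.
  apply/ffunP => u; rewrite ffunE; apply: val_inj => /=.
  have [_] := leqif_sum (fun u (_ : true) => leqif_eq (le u)).
  by rewrite e eqxx => /esym/forallP/(_ u)/eqP.
rewrite main // [rowform 1%:M]main => [|i j ji]; last by rewrite mxE -val_eqE /= gtn_eqF.
by rewrite [X in _ * X ^+ _ * _]big1 ?expr1n ?mulr1 // => i _; rewrite mxE eqxx.
Qed.

Lemma rowform_det A : rowform A = rowform 1%:M * \det A ^+ d.
Proof.
have sq (b : bool) : ((-1) ^+ b) ^+ d = 1 :> K.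
  by rewrite -exprM mulnC exprM -(signr_odd _ d) (negbTE d_even) expr0 expr1n.
have [[[P L] U] /= [hP hPA hL hLt hUt]] : exists T : 'M[K]_n * 'M[K]_n * 'M[K]_n,
   [/\ is_perm_mx T.1.1, T.1.1 *m A = T.1.2 *m T.2, \det T.1.2 = 1,
    forall i j : 'I_n, (i <= j)%N -> T.1.2 i j = (i == j)%:R & forall i j : 'I_n, (j < i)%N -> T.2 i j = 0].
  case: (n) A => [|n'] B.
    exists (1%:M, 1%:M, B); split; [exact: is_perm_mx1 | by [] | exact: det1 | by case | by case].
  exists (cormen_lup B); split.
  - exact: cormen_lup_perm.
  - by have := cormen_lup_correct B; case: (cormen_lup B) => -[P L] U.
  - exact: cormen_lup_detL.
  - by move=> i j; exact: cormen_lup_lower.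
  - by move=> i j; exact: cormen_lup_upper.
have /is_perm_mxP[sg Psg] := hP.
have e1 : rowform A = rowform U.
  by rewrite -(rowform_perm sg) row_permE -Psg hPA rowform_lower.
have dU : \det U = \prod_i U i i.
  rewrite -det_tr det_trig; first by apply: eq_bigr => i _; rewrite mxE.
  by apply/is_trig_mxP => i j ij; rewrite mxE hUt.
have e2 : \det A ^+ d = \det U ^+ d.
  by have := congr1 (fun M => \det M ^+ d) hPA; rewrite /= !det_mulmx hL mul1r Psg det_perm exprMn sq mul1r.
by rewrite e1 rowform_upper // e2 dU.
Qed.

End RowInvariant.

(** * Power sums over the weights mod p *)

Section Moments.
Variables (p s : nat).
Hypothesis p_pr : prime p.
Hypothesis p_ge5 : (5 <= p)%N.
Hypothesis pE : p = (2 * s).+3.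
Local Notation K := ('F_p).

Lemma natF_neq0 k : (0 < k < p)%N -> k%:R != 0 :> K.
Proof. by move=> h; rewrite -(dvdn_pcharf (pchar_Fp p_pr)) gtnNdvd //; case/andP: h. Qed.

Lemma natF_p : p%:R = 0 :> K. Proof. exact: pcharf0 (pchar_Fp p_pr). Qed.

Lemma power_sum k : (k < p.-1)%N -> \sum_(i < p) i%:R ^+ k = 0 :> K.
Proof.
elim/ltn_ind: k => k IH kp.
have tel : \sum_(i < p) ((i%:R + 1) ^+ k.+1 - i%:R ^+ k.+1) = 0 :> K.
  rewrite -(big_mkord xpredT (fun i => (i%:R + 1) ^+ k.+1 - i%:R ^+ k.+1 : K)).
  rewrite (eq_bigr (fun i => i.+1%:R ^+ k.+1 - i%:R ^+ k.+1)) => [|i _]; last by rewrite natr1.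
  by rewrite telescope_sumr // natF_p expr0n subrr.
have : \sum_(i < p) (k.+1%:R * i%:R ^+ k) = 0 :> K.
  rewrite -[RHS]tel; under [RHS]eq_bigr => i _ do
    rewrite exprDn big_ord_recl /= subn0 bin0 expr1n mulr1 mulr1n addrAC subrr add0r.
  rewrite [RHS]exchange_big /= big_ord_recl /=.
  rewrite [X in _ = _ + X]big1 ?addr0; last first.
    move=> l _; under eq_bigr => i _ do rewrite expr1n mulr1 -mulr_natl.
    rewrite -mulr_sumr IH ?mulr0 //; rewrite /bump; move: (ltn_ord l) kp; lia.
  apply: eq_bigr => i _; rewrite expr1n mulr1 -mulr_natl /bump /= add1n bin1.
  by rewrite subSS subn0 mulr1 mulr_natl.
rewrite -mulr_sumr => /eqP; rewrite mulf_eq0 (negbTE (natF_neq0 _)) //=; last by lia.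
by move/eqP.
Qed.

Definition ox (z : nat) : K := (2 * z).+1%:R.

(** For an even exponent below p - 1 this is half of the sum over all residues, hence 0; for
    exponent p - 1 all (p-1)/2 terms are 1. *)
Lemma odd_power_sum q : (0 < q)%N -> (2 * q <= p.-1)%N ->
  \sum_(z < s.+1) ox z ^+ (2 * q) = if (2 * q == p.-1)%N then - 2%:R^-1 else 0.
Proof.
move=> q0 qp.
have two : 2%:R != 0 :> K by apply: natF_neq0; lia.
case: eqP => [e|ne].
  rewrite (eq_bigr (fun=> 1)) => [|z _]; last first.
    have nz : ox z != 0 by apply: natF_neq0; have := ltn_ord z; lia.
    apply: (mulfI nz); rewrite mulr1 -exprS e prednK ?prime_gt0 //.
    by rewrite /ox -(pFrobenius_autE (pchar_Fp p_pr)) pFrobenius_aut_nat.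
  rewrite sumr_const card_ord; apply: (mulfI two); rewrite mulrN divff // -[LHS]natrM.
  by apply/eqP; rewrite -addr_eq0 natr1 (_ : (2 * s.+1).+1 = p) ?natF_p //; lia.
have := @power_sum (2 * q); rewrite ltn_neqAle qp andbT (introN eqP ne) => /(_ isT).
have F (a b : int) : (a = b %[mod p%:Z])%Z -> a%:~R ^+ (2 * q) = b%:~R ^+ (2 * q) :> K.
  move=> /eqP; rewrite eqz_mod_dvd (dvdz_pcharf (pchar_Fp p_pr)) rmorphB subr_eq0 => /eqP e.
  by rewrite e.
have := sum_odd p_pr p_ge5 F; rewrite expr0n muln_eq0 /= (gtn_eqF q0) subr0 => <-.
have -> : (p.-1)./2 = s.+1 by lia.
rewrite (eq_bigr (fun z : 'I_s.+1 => 2%:R * ox z ^+ (2 * q))) => [|z _]; last first.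
  by rewrite rmorphN !exprM sqrrN -pmulrn /ox -exprM; ring.
rewrite -mulr_sumr => /eqP; rewrite mulf_eq0 (negbTE two) /=; exact/eqP.
Qed.

(* The points u of the weights of the module of dimension [2 z + 1]. *)
Definition ou (z i : nat) : K := (2 * z)%:R - (2 * i)%:R.

Definition mom (c e : nat) : K := \sum_(z < s.+1) ox z ^+ e.+1 * \sum_(i < (2 * z).+1) ou z i ^+ c.

Lemma ou_rev c z : \sum_(i < (2 * z).+1) ou z i ^+ c = (-1) ^+ c * \sum_(i < (2 * z).+1) ou z i ^+ c.
Proof.
rewrite [LHS](reindex_inj rev_ord_inj) /= mulr_sumr; apply: eq_bigr => i _.
have iz := ltn_ord i.
rewrite -exprMn; congr (_ ^+ _); rewrite mulN1r /ou opprB subSS.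
rewrite mulnBr natrB; last by lia.
by rewrite !natrM; ring.
Qed.

Lemma mom_odd c e : odd c -> mom c e = 0.
Proof.
move=> oc; have two : 2%:R != 0 :> K by apply: natF_neq0; lia.
rewrite /mom big1 // => z _; have := ou_rev c z; rewrite -signr_odd oc expr1 mulN1r => /eqP.
by rewrite -addr_eq0 -mulr2n -mulr_natl mulf_eq0 (negbTE two) /= => /eqP->; rewrite mulr0.
Qed.

Lemma ou_tele k z : \sum_(i < (2 * z).+1) ((ou z i + 1) ^+ k - (ou z i - 1) ^+ k) = ox z ^+ k - (- ox z) ^+ k.
Proof.
rewrite -(big_mkord xpredT (fun i => (ou z i + 1) ^+ k - (ou z i - 1) ^+ k)).
rewrite (eq_bigr (fun i => (- (ou z i.+1 + 1) ^+ k) - - (ou z i + 1) ^+ k)) => [|i _]; last first.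
  rewrite opprK [RHS]addrC; congr (_ - _ ^+ _).
  by rewrite /ou mulnS natrD; ring.
rewrite telescope_sumr // opprK [LHS]addrC; congr (_ ^+ _ - _ ^+ _).
  by rewrite /ou muln0 subr0 natr1.
by rewrite /ou /ox mulnS natrD -?natr1 ?natrM; ring.
Qed.

(** By [ou_tele] and the binomial theorem, x^(c+1) is a combination of the sums of u^c, u^(c-2), and
    so on. All but the first drop out by induction, having smaller degree, and the power sum of x
    that is left is nonzero only in degree p - 1. *)
Lemma mom_top c e : ~~ odd c -> ~~ odd e -> (c + e <= 2 * s)%N ->
  mom c e = if (c + e == 2 * s)%N then - 2%:R^-1 / c.+1%:R else 0.
Proof.
have two : 2%:R != 0 :> K by apply: natF_neq0; lia.
elim/ltn_ind: c => c IH oc oe ce.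
have c1 : c.+1%:R != 0 :> K by apply: natF_neq0; lia.
have key : 2%:R * (c.+1%:R * mom c e) = 2%:R * \sum_(z < s.+1) ox z ^+ (c + e).+2.
  transitivity (\sum_(z < s.+1) ox z ^+ e.+1 * (ox z ^+ c.+1 - (- ox z) ^+ c.+1)); last first.
    rewrite mulr_sumr; apply: eq_bigr => z _.
    rewrite exprNn -signr_odd /= oc expr1 mulN1r opprK mulrDr -exprD.
    have -> : (e.+1 + c.+1 = (c + e).+2)%N by lia.
    by ring.
  under [RHS]eq_bigr => z _ do rewrite -ou_tele.
  have bin (u : K) : (u + 1) ^+ c.+1 - (u - 1) ^+ c.+1 =
     \sum_(k < c.+2) (1 - (-1) ^+ k) * 'C(c.+1, k)%:R * u ^+ (c.+1 - k).
    rewrite exprBn exprDn -sumrB; apply: eq_bigr => k _.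
    by rewrite !expr1n !mulr1 -mulrnAr -mulr_natl; ring.
  transitivity (\sum_(k < c.+2) (1 - (-1) ^+ k) * 'C(c.+1, k)%:R * mom (c.+1 - k) e); last first.
    rewrite /mom; under [LHS]eq_bigr => k _ do rewrite mulr_sumr.
    rewrite [LHS]exchange_big /=; apply: eq_bigr => z _.
    rewrite [in RHS](eq_bigr _ (fun i _ => bin _)).
    rewrite [in RHS]exchange_big /= mulr_sumr; apply: eq_bigr => k _.
    by rewrite mulrCA; congr (_ * _); rewrite mulr_sumr.
  rewrite big_ord_recl big_ord_recl /= expr0 subrr !mul0r add0r bin1 subSS subn0.
  rewrite big1 ?addr0 => [|k _]; first by rewrite expr1 opprK mulrA.
  rewrite /bump /= !add1n !subSS; set l := (c - k.+1)%N.
  have [ok|ok] := boolP (odd k); last by rewrite -signr_odd /= negbK (negbTE ok) expr0 subrr !mul0r.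
  have kc : (k < c)%N by have := ltn_ord k; lia.
  have ol : ~~ odd l by rewrite /l oddB //= (negbTE oc) ok.
  have lt : (l + e < 2 * s)%N by rewrite /l; lia.
  by rewrite IH ?(ltn_eqF lt) ?mulr0 // /l; lia.
move/(mulfI two): key; have -> : (c + e).+2 = (2 * ((c + e)./2).+1)%N by have := odd_double_half (c + e); rewrite oddD (negbTE oc) (negbTE oe); lia.
rewrite odd_power_sum; last 2 first.
- by [].
- by have := odd_double_half (c + e); rewrite oddD (negbTE oc) (negbTE oe); lia.
have -> : (2 * ((c + e)./2).+1 == p.-1)%N = (c + e == 2 * s)%N.
  by have := odd_double_half (c + e); rewrite oddD (negbTE oc) (negbTE oe); lia.
by move=> e1; apply: (mulfI c1); rewrite e1; case: ifP => _; rewrite ?mulr0 // mulrCA divff ?mulr1.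
Qed.

(* The weighted number of points; 4 * mu ^ 2 = u ^ 2. *)
Definition ptmom (a b c : nat) : K :=
  if a == b then \sum_(z < s.+1) ox z * \sum_(i < (2 * z).+1)
    ((ox z ^+ 2 - ou z i ^+ 2) ^+ a * (ou z i / 2%:R) ^+ c) else 0.

Lemma ptmom_mom a c : 2%:R ^+ c * ptmom a a c = \sum_(i < a.+1) 'C(a, i)%:R * (-1) ^+ i * mom (c + 2 * i) (2 * (a - i)).
Proof.
have two : 2%:R != 0 :> K by apply: natF_neq0; lia.
rewrite /ptmom eqxx /mom; under [RHS]eq_bigr => i _ do rewrite mulr_sumr.
rewrite [RHS]exchange_big /= mulr_sumr; apply: eq_bigr => z _.
under [RHS]eq_bigr => i _ do rewrite mulrA mulr_sumr.
rewrite [RHS]exchange_big /= mulrA mulr_sumr; apply: eq_bigr => j _.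
rewrite exprBn mulr_suml !mulr_sumr; apply: eq_bigr => i _.
rewrite expr_div_n -[_ *+ 'C(a, i)]mulr_natl -!exprM [ox z ^+ _.+1]exprS [ou z j ^+ (_ + _)]exprD.
have e : 2%:R ^+ c / 2%:R ^+ c = 1 :> K by rewrite divff // expf_neq0.
transitivity (2%:R ^+ c / 2%:R ^+ c * ('C(a, i)%:R * (-1) ^+ i * (ox z * ox z ^+ (2 * (a - i))) * (ou z j ^+ c * ou z j ^+ (2 * i)))).
  by ring.
by rewrite e mul1r.
Qed.

Lemma ptmom_low a b c : (a + b + c < 2 * s)%N -> ptmom a b c = 0.
Proof.
move=> h; have [ab|nab] := eqVneq a b; last by rewrite /ptmom (negbTE nab).
rewrite -ab in h *; have two : 2%:R != 0 :> K by apply: natF_neq0; lia.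
apply: (mulfI (expf_neq0 c two)); rewrite mulr0 ptmom_mom big1 // => i _.
have ia : (i <= a)%N by rewrite -ltnS.
have [oc|oc] := boolP (odd c); first by rewrite mom_odd ?mulr0 // oddD oc oddM.
by rewrite mom_top ?ltn_eqF ?mulr0 ?oddD ?oddM ?(negbTE oc) //; lia.
Qed.

(** The beta integral of (1 - t^2)^a t^c over the unit interval, expanded into a sum that makes
    sense mod p; [jnum_rec] is integration by parts. *)
Definition jnum (a c : nat) : K := \sum_(i < a.+1) 'C(a, i)%:R * (-1) ^+ i / (c + 2 * i).+1%:R.

Lemma ptmom_jnum a c : ~~ odd c -> (2 * a + c = 2 * s)%N ->
  2%:R ^+ c * ptmom a a c = - 2%:R^-1 * jnum a c.
Proof.
move=> oc h; rewrite ptmom_mom /jnum mulr_sumr; apply: eq_bigr => i _.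
have ia : (i <= a)%N by rewrite -ltnS.
have e : (c + 2 * i + 2 * (a - i) = 2 * s)%N by lia.
have e1 : ~~ odd (c + 2 * i) by rewrite oddD oddM /= (negbTE oc).
have e2 : ~~ odd (2 * (a - i)) by rewrite oddM.
by rewrite (mom_top e1 e2) ?e ?eqxx //; ring.
Qed.

Lemma jnum_rec a c : (2 * a.+1 + c <= 2 * s)%N ->
  c.+1%:R * jnum a.+1 c = 2%:R * a.+1%:R * jnum a c.+2.
Proof.
move=> h; rewrite /jnum.
have nz i : (i <= a.+1)%N -> (c + 2 * i).+1%:R != 0 :> K by move=> ia; apply: natF_neq0; lia.
transitivity (\sum_(i < a.+2) 'C(a.+1, i)%:R * (-1) ^+ i * (1 - (2 * i)%:R / (c + 2 * i).+1%:R) : K).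
  rewrite mulr_sumr; apply: eq_bigr => i _; rewrite mulrCA; congr (_ * _).
  have ni : (c + 2 * i).+1%:R != 0 :> K by apply: nz; rewrite -ltnS.
  apply: (mulIf ni); rewrite mulfVK // mulrBl mul1r mulfVK //.
  by rewrite -addSn natrD addrK.
under eq_bigr => i _ do rewrite mulrBr mulr1.
rewrite sumrB.
have -> : \sum_(i < a.+2) 'C(a.+1, i)%:R * (-1) ^+ i = 0 :> K.
  transitivity ((1 - 1) ^+ a.+1 : K); last by rewrite subrr expr0n.
  by rewrite exprBn; apply: eq_bigr => i _; rewrite !expr1n !mulr1 mulr_natl.
rewrite sub0r big_ord_recl /= muln0 mul0r mulr0 add0r mulr_sumr -sumrN.
apply: eq_bigr => i _; rewrite /bump /= add1n exprS.
have -> : (c + 2 * i.+1 = c.+2 + 2 * i)%N by lia.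
have /(congr1 (fun k => k%:R : K)) := mul_bin_diag a.+1 i; rewrite !natrM /= => e.
transitivity (2%:R * (i.+1%:R * 'C(a.+1, i.+1)%:R) * (-1) ^+ i / (c.+2 + 2 * i).+1%:R : K).
  by ring.
by rewrite -e; ring.
Qed.

(** The Gaussian moment [wick] at (a, a, c), multiplied by 2^c. *)
Definition gnum (a c : nat) : K := a`!%:R * \prod_(i < c./2) ((2 * i).+1%:R / 2%:R).

(** Along 2a + c = 2s both sides obey the same recursion in [a], and the constant is fixed at a =
    0. *)
Lemma gnum_jnum a c : ~~ odd c -> (2 * a + c = 2 * s)%N ->
  gnum a c = gnum 0 (2 * s) * (2 * s).+1%:R * jnum a c.
Proof.
elim: a c => [|a IH] c oc h.
  have -> : c = (2 * s)%N by lia.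
  rewrite /jnum big_ord1 /= bin0 expr0 muln0 addn0 !mul1r mulfK //.
  by apply: natF_neq0; lia.
have c1 : c.+1%:R != 0 :> K by apply: natF_neq0; lia.
have two : 2%:R != 0 :> K by apply: natF_neq0; lia.
apply: (mulfI c1); rewrite [RHS]mulrCA jnum_rec; last by lia.
transitivity (2%:R * a.+1%:R * gnum a c.+2).
  rewrite /gnum factS natrM /= big_ord_recr /= (_ : (2 * c./2 = c)%N); last first.
    by rewrite mul2n -[RHS](odd_double_half c) (negbTE oc).
  move: (\prod_(i < c./2) _) => w; rewrite -natr1 /= in c1 *; move: c1 two; generalize (c%:R : K) => x.
  by move=> ? two'; field.
by rewrite IH //=; [ring | rewrite negbK | lia].
Qed.

Definition kappa : K := - 2%:R^-1 / (gnum 0 (2 * s) * (2 * s).+1%:R).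

(** As for the uniform measure on a sphere, the moments of one fixed degree are proportional to
    Gaussian ones; here the degree is p - 3, the lowest one that is not killed by [ptmom_low]. *)
Lemma ptmom_wick a b c : (a + b + c = 2 * s)%N -> ptmom a b c = kappa * wick K a b c.
Proof.
move=> h; have two : 2%:R != 0 :> K by apply: natF_neq0; lia.
have [ab|nab] := eqVneq a b; last by rewrite /ptmom /wick (negbTE nab) mulr0.
rewrite -ab in h *; apply: (mulfI (expf_neq0 c two)).
have oc : ~~ odd c by have -> : c = (2 * (s - a))%N; [lia | rewrite oddM].
rewrite ptmom_jnum //; last by lia.
have g0 : gnum 0 (2 * s) * (2 * s).+1%:R != 0.
  rewrite mulf_neq0 //; last by apply: natF_neq0; lia.
  rewrite /gnum fact0 mul1r; apply/prodf_neq0 => i _.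
  by rewrite mulf_neq0 ?invr_eq0 // natF_neq0 //; have := ltn_ord i; lia.
have -> : 2%:R ^+ c * (kappa * wick K a a c) = kappa * gnum a c.
  rewrite mulrCA; congr (_ * _); rewrite /wick eqxx oc /= mulrCA /gnum; congr (_ * _).
  have -> : 2%:R ^+ c = 4%:R ^+ c./2 :> K.
    rewrite -[in LHS](odd_double_half c) (negbTE oc) add0n -mul2n exprM; congr (_ ^+ _).
    by rewrite -natrX.
  rewrite -[in 4%:R ^+ _](card_ord c./2) -prodr_const -big_split /=; apply: eq_bigr => i _.
  have -> : 8%:R = 4%:R * 2%:R :> K by rewrite -natrM.
  have four : 4%:R != 0 :> K by rewrite (_ : 4%:R = 2%:R * 2%:R) ?mulf_neq0 // -natrM.
  by rewrite mulrCA; congr (_ * _); rewrite invfM mulrA divff // mul1r.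
by rewrite gnum_jnum //; last lia; rewrite /kappa mulrA; congr (_ * _); rewrite divfK.
Qed.

End Moments.

(** * The determinant *)

Section PairProduct.
Variables (R : comNzRingType) (I T : finType) (g : I -> I -> R).
Implicit Types (phi : {ffun (T * bool)%type -> I}) (t : T) (i : I).

Definition pairprod phi : R := \prod_t g (phi (t, false)) (phi (t, true)).

Definition pairprod' t phi : R := \prod_(t' | t' != t) g (phi (t', false)) (phi (t', true)).

Lemma pairprod'_upd t b phi i : pairprod' t (upd phi (t, b) i) = pairprod' t phi.
Proof. by apply: eq_bigr => t' nt; rewrite !upd_neq // xpair_eqE (negbTE nt). Qed.

Lemma pairprodD t phi : pairprod phi = g (phi (t, false)) (phi (t, true)) * pairprod' t phi.
Proof. by rewrite /pairprod (bigD1 t). Qed.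

Lemma pairprod_upd0 t phi i : pairprod (upd phi (t, false) i) = g i (phi (t, true)) * pairprod' t phi.
Proof. by rewrite (pairprodD t) pairprod'_upd upd_same upd_neq // xpair_eqE eqxx. Qed.

Lemma pairprod_upd1 t phi i : pairprod (upd phi (t, true) i) = g (phi (t, false)) i * pairprod' t phi.
Proof. by rewrite (pairprodD t) pairprod'_upd upd_same upd_neq // xpair_eqE eqxx. Qed.

Lemma pair_distr (F : T -> I -> I -> R) : \prod_t \sum_a \sum_b F t a b =
  \sum_(phi : {ffun (T * bool)%type -> I}) \prod_t F t (phi (t, false)) (phi (t, true)).
Proof.
under eq_bigr => t _ do rewrite pair_bigA.
rewrite bigA_distr_bigA /=.
pose h phi : {ffun T -> I * I} := [ffun t => (phi (t, false), phi (t, true))].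
pose h' (f : {ffun T -> I * I}) : {ffun (T * bool)%type -> I} :=
  [ffun u : T * bool => if u.2 then (f u.1).2 else (f u.1).1].
rewrite (reindex h) /=; last first.
  exists h' => [phi _|f _]; apply/ffunP => u; rewrite !ffunE /=; last by case: (f u).
  by case: u => t [].
by apply: eq_bigr => phi _; apply: eq_bigr => t _; rewrite !ffunE.
Qed.

End PairProduct.

Section GramDeterminant.
Variables (p s n : nat).
Hypothesis p_pr : prime p.
Hypothesis p_ge5 : (5 <= p)%N.
Hypothesis pE : p = (2 * s).+3.
Local Notation K := ('F_p).
Local Notation S := {mpoly K[n * 3]}.
Local Notation Pos := (('I_n * 'I_s) * bool)%type.
Local Notation gram := (@gram K n).
Implicit Types (phi : {ffun Pos -> 'I_n}) (A : 'M[K]_n).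

Definition kap (u : Pos) : 'I_n := u.1.1.

Definition pf phi : S := pairprod gram phi.

Definition npos phi j := #|[pred u | phi u == j]|.

Definition pcoef phi : K := lext (ptmom p s) [set: 'I_n] (pf phi).

Lemma big_pos (R : Type) (idx : R) (op : Monoid.com_law idx) (F : Pos -> R) :
  \big[op/idx]_u F u = \big[op/idx]_t op (F (t, false)) (F (t, true)).
Proof.
rewrite (eq_bigr (fun u => F (u.1, u.2))) => [|[]//].
rewrite -(pair_bigA _ (fun t b => F (t, b))) /=; apply: eq_bigr => t _.
by rewrite big_bool Monoid.mulmC.
Qed.

Lemma sum_pos (V : nmodType) (F : Pos -> V) : \sum_u F u = \sum_t (F (t, false) + F (t, true)).
Proof. exact: big_pos. Qed.

Lemma npos_sum phi j : npos phi j = (\sum_t ((phi (t, false) == j) + (phi (t, true) == j)))%N.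
Proof.
rewrite /npos -sum1_card big_mkcond big_pos; apply: eq_bigr => t _.
by rewrite !inE; case: eqP; case: eqP.
Qed.

Lemma gr_gram j k l : graded 1 1 1 j ((k == j) + (l == j))%N%:Z (gram k l).
Proof.
have g k' a : graded 1 1 1 j (k' == j)%N%:Z ('X_(bv k' a) : S).
  have := @grU K n 1 1 1 j k' a; case: (k' == j) => //.
  by have -> : cvec 1 1 1 a = 1 by rewrite /cvec; case: ifP => // _; case: ifP.
by rewrite PoszD; apply: grD; [apply: grZ; exact: grM | apply: grZ; apply: grD; exact: grM].
Qed.

Lemma gr_pf phi j : graded 1 1 1 j (npos phi j)%:Z (pf phi).
Proof.
rewrite npos_sum; have -> : (\sum_t ((phi (t, false) == j) + (phi (t, true) == j)))%N%:Z =
  \sum_t ((phi (t, false) == j) + (phi (t, true) == j))%N%:Z by rewrite (big_morph Posz PoszD (erefl _)).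
by rewrite /pf /pairprod; apply: gr_prod => t _; exact: gr_gram.
Qed.

Lemma npos_total phi : (\sum_j npos phi j = \sum_(j < n) 2 * s)%N.
Proof.
rewrite sum_nat_const card_ord; under eq_bigr => j _ do rewrite /npos -sum1_card.
rewrite (exchange_big_dep xpredT) //= (eq_bigr (fun=> 1)) => [|u _].
  by rewrite sum1_card !card_prod !card_ord card_bool; lia.
by rewrite (bigD1 (phi u)) ?inE ?eqxx //= big1 // => j; rewrite inE => /andP[/eqP->]; rewrite eqxx.
Qed.

(** By [ptmom_low] every relator must occur at least 2s times in a nonvanishing term, and there are
    only 2s n positions in all. *)
Lemma pcoef_cnt phi j : pcoef phi != 0 -> npos phi j = (2 * s)%N.
Proof.
move=> c0; have ge i : (2 * s <= npos phi i)%N.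
  rewrite leqNgt; apply: contra_neqN c0 => lt.
  rewrite /pcoef /lext big_seq big1 // => u /(gr_pf i); rewrite /bg !mul1r => h.
  by rewrite /cmon (bigD1 i) ?inE //= /cblk ptmom_low ?mul0r ?mulr0 //; lia.
have [_] := leqif_sum (fun i (_ : true) => leqif_eq (ge i)).
by rewrite npos_total eqxx => /esym/forallP/(_ j)/eqP.
Qed.

Lemma pcoef_wick phi : (forall j, npos phi j = (2 * s)%N) -> pcoef phi = kappa p s ^+ n * wext (pf phi).
Proof.
move=> h; rewrite /pcoef /wext /lext mulr_sumr big_seq [RHS]big_seq; apply: eq_bigr => u us.
rewrite mulrCA; congr (_ * _); rewrite /cmon -[in _ ^+ n](card_ord n) -cardsT -prodr_const -big_split /=.
apply: eq_bigr => j _; rewrite /cblk ptmom_wick //.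
by have := gr_pf j us; rewrite /bg !mul1r h; lia.
Qed.

Lemma polar_prod (I : finType) (F : I -> S) l k :
  polar l k (\prod_i F i) = \sum_i polar l k (F i) * \prod_(j | j != i) F j.
Proof.
suff h (r : seq I) : uniq r -> polar l k (\prod_(i <- r) F i) =
    \sum_(i <- r) polar l k (F i) * \prod_(j <- r | j != i) F j.
  by rewrite h ?index_enum_uniq.
elim: r => [|i r IH] /=.
  by rewrite !big_nil /polar -mpolyC1 !mderivC; rewrite !mulr0 !addr0.
move=> /andP[ir ur]; rewrite !big_cons polarM IH // eqxx /=; congr (_ * _ + _).
  rewrite big_seq [RHS]big_seq_cond; apply: eq_bigl => j; case: (boolP (j \in r)) => //= jr.
  by apply/esym/eqP => ji; rewrite -ji jr in ir.
rewrite mulr_sumr big_seq [RHS]big_seq; apply: eq_bigr => j jr.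
rewrite big_cons; case: eqP => [ij|_]; first by rewrite ij jr in ir.
by rewrite mulrCA.
Qed.

Lemma polar_pf i j phi : polar i j (pf phi) = \sum_(u | phi u == j) pf (upd phi u i).
Proof.
rewrite polar_prod [RHS]big_mkcond sum_pos; apply: eq_bigr => t _.
rewrite /pf pairprod_upd0 pairprod_upd1 -/(pairprod' gram t phi).
rewrite polar_gram mulrDl; move: (pairprod' gram t phi) => w.
by case: (phi (t, false) == j); case: (phi (t, true) == j); rewrite ?mul0r.
Qed.

Lemma npos_upd phi u i j : phi u = j -> i != j ->
  [/\ npos (upd phi u i) j = (npos phi j).-1, npos (upd phi u i) i = (npos phi i).+1 &
    forall l, l != i -> l != j -> npos (upd phi u i) l = npos phi l].
Proof.
move=> pu ij; have step l : (npos (upd phi u i) l + (j == l) = npos phi l + (i == l))%N.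
  have e psi : npos psi l = (\sum_(u' | u' != u) (psi u' == l) + (psi u == l))%N.
    rewrite /npos -sum1_card big_mkcond (bigD1 u) //= addnC inE.
    have -> : (if psi u == l then 1 else 0)%N = (psi u == l) by case: eqP.
    by congr (_ + _)%N; apply: eq_bigr => u' _; rewrite inE; case: eqP.
  rewrite !e upd_same pu addnAC; congr (_ + _ + _)%N.
  by apply: eq_bigr => u' nu; rewrite upd_neq.
split=> [||l li lj].
- by have := step j; rewrite eqxx (negbTE ij); lia.
- by have := step i; rewrite eqxx [j == i]eq_sym (negbTE ij); lia.
- by have := step l; rewrite ![_ == l]eq_sym (negbTE li) (negbTE lj); lia.
Qed.

Lemma pf_gprod phi : pf phi = gprod K [seq (phi (t, false), phi (t, true)) | t <- index_enum _].
Proof. by rewrite /gprod big_map. Qed.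

(** Unless [j] occurs 2s + 1 times, [i] 2s - 1 times and every other vector 2s times, all terms
    vanish by [pcoef_cnt]. In that case the moments are Gaussian and [wick_row] applies. *)
Lemma pcoef_row i j phi : i != j -> \sum_(u | phi u == j) pcoef (upd phi u i) = 0.
Proof.
move=> ij; have two : 2%:R != 0 :> K by apply: natF_neq0 => //; lia.
have [c1|c1] := boolP ((npos phi j == (2 * s).+1) && [forall l, (l != i) && (l != j) ==> (npos phi l == (2 * s)%N)]); last first.
  rewrite big1 // => u /eqP pu; apply: contraNeq c1 => c0.
  have [e1 e2 e3] := npos_upd pu ij.
  have npj : (0 < npos phi j)%N by apply/card_gt0P; exists u; rewrite inE pu.
  apply/andP; split; first by have := pcoef_cnt j c0; rewrite e1; lia.
  by apply/forallP => l; apply/implyP => /andP[li lj]; rewrite -e3 // (pcoef_cnt l c0).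
have [/eqP cj /forallP cl] := andP c1.
have ci : ((npos phi i).+1 = 2 * s)%N.
  have := npos_total phi; rewrite (bigD1 i) //= (bigD1 j) 1?eq_sym //= [in RHS](bigD1 i) //= [in RHS](bigD1 j) 1?eq_sym //=.
  rewrite cj (eq_bigr (fun=> 2 * s)%N) => [|l /andP[li lj]]; first by lia.
  by have := cl l; rewrite li lj => /eqP.
rewrite (eq_bigr (fun u => kappa p s ^+ n * wext (pf (upd phi u i)))) => [|u /eqP pu]; last first.
  apply: pcoef_wick => l; have [e1 e2 e3] := npos_upd pu ij.
  have [->|li] := eqVneq l i; first by rewrite e2.
  have [->|lj] := eqVneq l j; first by rewrite e1 cj.
  by rewrite e3 //; have := cl l; rewrite li lj => /eqP.
have sK : (2 * s + 3)%:R = 0 :> K by rewrite (_ : 2 * s + 3 = p)%N ?natF_p //; lia.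
have cL : cnt j [seq (phi (t, false), phi (t, true)) | t <- index_enum _] = (2 * s).+1.
  by rewrite /cnt big_map -cj npos_sum.
have := wick_row two sK ij cL; rewrite -pf_gprod polar_pf /wext lext_sum => h.
by rewrite -mulr_sumr h mulr0.
Qed.

(** The quadratic form of sl_2 at the combination of the relator vectors given by column [k] of
    [A]. *)
Definition qform A k : S := \sum_a \sum_b (A a k * A b k) *: gram a b.

Lemma qform_expand A : \prod_k qform A k ^+ s =
  \sum_(phi : {ffun Pos -> 'I_n}) (\prod_u A (phi u) (kap u)) *: pf phi.
Proof.
have -> : \prod_k qform A k ^+ s = \prod_(t : 'I_n * 'I_s) qform A t.1.
  rewrite -(pair_bigA _ (fun k (r : 'I_s) => qform A k)) /=; apply: eq_bigr => k _.
  by rewrite prodr_const card_ord.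
rewrite pair_distr; apply: eq_bigr => phi _.
by rewrite scaler_prod big_pos.
Qed.

Lemma gram_det A : lext (ptmom p s) [set: 'I_n] (\prod_k qform A k ^+ s) =
  lext (ptmom p s) [set: 'I_n] (\prod_k qform 1%:M k ^+ s) * \det A ^+ (2 * s).
Proof.
have e B : lext (ptmom p s) [set: 'I_n] (\prod_k qform B k ^+ s) = rowform kap pcoef B.
  rewrite qform_expand lext_sum; apply: eq_bigr => phi _.
  by rewrite lextZ mulrC.
rewrite !e; apply: (@rowform_det p) => //.
- exact: pchar_Fp.
- by lia.
- by rewrite oddM.
- move=> i; rewrite -sum1_card big_mkcond big_pos /=.
  rewrite (eq_bigr (fun t : 'I_n * 'I_s => 2 * (t.1 == i)))%N => [|t _]; last first.
    by rewrite !inE /kap /=; case: (t.1 == i).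
  rewrite -big_distrr /= -(pair_bigA _ (fun (k : 'I_n) (r : 'I_s) => (k == i) : nat)) /=.
  rewrite (bigD1 i) //= [X in (_ + X)%N]big1 => [|k ki]; last by rewrite big1 // => r _; rewrite (negbTE ki).
  by rewrite addn0 eqxx sum_nat_const card_ord muln1.
- by move=> phi i; exact: pcoef_cnt.
- by move=> i j phi ij; exact: pcoef_row.
Qed.

End GramDeterminant.

(** * Normalization at the identity matrix *)

Section IdentityValue.
Variables (p s n : nat).
Hypothesis p_pr : prime p.
Hypothesis p_ge5 : (5 <= p)%N.
Hypothesis pE : p = (2 * s).+3.
Local Notation K := ('F_p).
Local Notation S := {mpoly K[n * 3]}.

Lemma lext_blocks (R : comNzRingType) (m : nat) (c1 : nat -> nat -> nat -> R) (P : 'I_m -> {mpoly R[m * 3]}) :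
  (forall j j', j' != j -> avoids j' (P j)) ->
  lext c1 [set: 'I_m] (\prod_j P j) = \prod_j lext c1 [set j] (P j).
Proof.
move=> hP.
have h (r : seq 'I_m) : uniq r ->
   lext c1 [set j in r] (\prod_(j <- r) P j) = \prod_(j <- r) lext c1 [set j] (P j).
  elim: r => [_|j r IH /= /andP[jr ur]].
    rewrite !big_nil -mpolyC1 /lext msuppC oner_eq0 big_seq1 mcoeffC eqxx mulr1 mul1r.
    by rewrite /cmon big1 // => j; rewrite inE.
  rewrite !big_cons set_cons lext_indep ?IH ?inE // => j' nj'.
    exact: hP.
  rewrite /avoids big_seq; apply: gr_prod0 => i ir; apply: hP; apply: contraNneq nj' => ->.
  by rewrite inE.
rewrite -h ?index_enum_uniq //; congr (lext _ _ _).
by apply/setP => j; rewrite !inE mem_index_enum.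
Qed.

(** At every point the form takes the Casimir value u^2 + (x^2 - u^2) = x^2, so the sum over the 2z
    + 1 points leaves the power sum of x^(2s+2) = x^(p-1), which is -1/2. *)
Lemma lext_gram (k : 'I_n) : lext (ptmom p s) [set k] (gram K k k ^+ s) = - 2%:R^-1.
Proof.
have two : 2%:R != 0 :> K by apply: natF_neq0 => //; lia.
have -> : gram K k k = 4%:R *: 'X_[(U_(bv k i2) + U_(bv k i2))%MM] + 'X_[(U_(bv k i0) + U_(bv k i1))%MM] :> S.
  rewrite /gram !mpolyXD; congr (_ + _).
  by rewrite [X in _ + X]mulrC -mulr2n -scaler_nat scalerA mulVf // scale1r.
rewrite exprDn lext_sum.
transitivity (\sum_(i < s.+1) 'C(s, i)%:R * 4%:R ^+ (s - i) * ptmom p s i i (2 * (s - i))).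
  apply: eq_bigr => i _; rewrite exprZn !mpolyXn -scalerAl -scaler_nat !lextZ -mpolyXD lextX mulrA.
  rewrite /cmon big_set1 /cblk; congr (_ * ptmom _ _ _ _ _);
    rewrite !mnmDE !mulmnE !mnmDE !mnm1E !bv_inj !eqxx /=; lia.
have four : 4%:R = 2%:R ^+ 2 :> K by rewrite -natrX.
transitivity (\sum_(z < s.+1) ox p z ^+ (2 * s.+1)); last first.
  by rewrite odd_power_sum //; [rewrite (_ : 2 * s.+1 == p.-1)%N //; lia | lia].
under eq_bigr => i _ do rewrite /ptmom eqxx mulr_sumr.
rewrite exchange_big /=; apply: eq_bigr => z _.
transitivity (ox p z * \sum_(j < (2 * z).+1) (4%:R * (ou p z j / 2%:R) ^+ 2 + (ox p z ^+ 2 - ou p z j ^+ 2)) ^+ s).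
  under eq_bigr => i _ do rewrite mulrCA.
  rewrite -mulr_sumr; congr (_ * _); under eq_bigr => i _ do rewrite mulr_sumr.
  rewrite exchange_big /=; apply: eq_bigr => j _.
  move: (ox p z ^+ 2 - ou p z j ^+ 2) (ou p z j / 2%:R) => b a.
  rewrite exprDn; apply: eq_bigr => i _; rewrite exprMn -exprM -[RHS]mulr_natl; ring.
rewrite (eq_bigr (fun=> ox p z ^+ (2 * s))) => [|j _]; last first.
  by rewrite expr_div_n mulrCA four divff ?expf_neq0 // mulr1 addrC subrK exprM.
rewrite sumr_const card_ord -mulr_natl -/(ox p z) mulrA -expr2 -exprD.
by congr (_ ^+ _); lia.
Qed.

Lemma gram_identity : lext (ptmom p s) [set: 'I_n] (\prod_k @qform p n 1%:M k ^+ s) = (- 2%:R^-1 : K) ^+ n.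
Proof.
have e k : @qform p n 1%:M k = gram K k k :> S.
  rewrite /qform (bigD1 k) //= [X in _ + X]big1 ?addr0 => [|a ak]; last first.
    by rewrite big1 // => b _; rewrite mxE (negbTE ak) mul0r scale0r.
  rewrite (bigD1 k) //= [X in _ + X]big1 ?addr0 => [|b bk]; last first.
    by rewrite !mxE (negbTE bk) mulr0 scale0r.
  by rewrite !mxE eqxx mulr1 scale1r.
under eq_bigr => k _ do rewrite e.
rewrite lext_blocks => [|j j' nj].
  by under eq_bigr => k _ do rewrite lext_gram; rewrite prodr_const card_ord.
have g : graded 1 1 1 j' 0 (gram K j j) by have := @gr_gram p n j' j j; rewrite eq_sym (negbTE nj).
by have := @grX _ _ _ _ _ _ _ _ s g; rewrite mul0r.
Qed.

End IdentityValue.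

(** * Classical limit of the relator strands *)

Section TriangularPowers.
Variable K : comNzRingType.

Lemma sym_lower (N : nat) (M : 'M[K]_2) b i : M 0 1 = 0 -> (b <= N)%N ->
  sym N M b i = if (i <= b)%N then M 0 0 ^+ (N - b) * (M 1 0 ^+ (b - i) * M 1 1 ^+ i *+ 'C(b, i)) else 0.
Proof.
move=> M01 bN; rewrite /sym /lf M01 polyC0 mul0r addr0 -rmorphXn coefCM exprDn coef_sum.
have [ib|ib] := leqP i b; last first.
  rewrite big1 ?mulr0 // => j _; rewrite exprMn -!rmorphXn mulrA -rmorphM coefMn coefCM coefXn.
  by rewrite gtn_eqF ?mulr0 ?mul0rn //; have := ltn_ord j; lia.
rewrite (bigD1 (inord i)) //= big1 ?addr0 => [|j ji].
  by rewrite inordK // exprMn -!rmorphXn mulrA -rmorphM coefMn coefCM coefXn eqxx mulr1.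
rewrite exprMn -!rmorphXn mulrA -rmorphM coefMn coefCM coefXn.
case: eqP => [e|_]; last by rewrite mulr0 mul0rn.
by case/eqP: ji; apply: val_inj; rewrite /= inordK.
Qed.

Lemma sym_upper (N : nat) (M : 'M[K]_2) b i : M 1 0 = 0 -> (b <= N)%N -> (i <= N)%N ->
  sym N M b i = if (b <= i)%N then M 1 1 ^+ b * (M 0 0 ^+ (N - i) * M 0 1 ^+ (i - b) *+ 'C(N - b, i - b)) else 0.
Proof.
move=> M10 bN iN; rewrite /sym /lf M10 polyC0 add0r exprMn -rmorphXn mulrCA coefCM coefMXn.
case: ltnP => bi; first by rewrite mulr0.
congr (_ * _); rewrite exprDn coef_sum.
rewrite (bigD1 (inord (i - b))) //= big1 ?addr0 => [|j ji].
  rewrite inordK ?ltnS ?leq_sub2r // exprMn -!rmorphXn mulrA -rmorphM coefMn coefCM coefXn eqxx mulr1.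
  by rewrite subnBA // subnK.
rewrite exprMn -!rmorphXn mulrA -rmorphM coefMn coefCM coefXn.
case: eqP => [e|_]; last by rewrite mulr0 mul0rn.
by case/eqP: ji; apply: val_inj; rewrite /= inordK -?e ?ltnS ?leq_sub2r // e leq_sub2r.
Qed.

End TriangularPowers.

Section SiteProducts.
Variables (p n : nat).
Hypothesis p_pr : prime p.
Hypothesis p_ge5 : (5 <= p)%N.
Variable K : comNzRingType.
Local Notation gst := {ffun 'I_n -> bvec p}.
Implicit Types (M N : 'M[K]_2) (x y : bvec p) (g : gst).

(** The indices are transposed, so composition of kernels reverses the order of the matrices
    ([symb_mul]). *)
Definition symb M x y : K := if tag y == tag x then sym (2 * tag x) M (bidx y) (bidx x) else 0.

Lemma symb_mul M N x y : \sum_u symb M x u * symb N u y = symb (N *m M) x y.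
Proof.
rewrite (@sum_bvec p K (tag x) _ (fun j => if tag y == tag x then
    sym (2 * tag x) N (bidx y) j * sym (2 * tag x) M j (bidx x) else 0)).
- rewrite /symb; case: eqP => [e|_]; last by rewrite big1.
  by rewrite sym_mul // -e bidx_le.
- by move=> u tu; rewrite /symb tu eqxx; case: ifP => _; rewrite ?mulr0 // mulrC.
- by move=> u /negbTE tu; rewrite /symb tu mul0r.
Qed.

Lemma symb1 x y : symb 1%:M x y = (x == y)%:R.
Proof.
rewrite /symb bvec_eq eq_sym; case: eqP => [e|//] /=.
by rewrite sym1 ?e ?bidx_le // eq_sym.
Qed.

Definition symprod (M : 'I_n -> 'M[K]_2) g g' : K := \prod_k symb (M k) (g k) (g' k).

Lemma symprod_mul (M N : 'I_n -> 'M[K]_2) g g' :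
  \sum_(u : gst) symprod M g u * symprod N u g' = symprod (fun k => N k *m M k) g g'.
Proof.
rewrite /symprod; under [RHS]eq_bigr => k _ do rewrite -symb_mul.
by rewrite bigA_distr_bigA /=; apply: eq_bigr => u _; rewrite big_split.
Qed.

Lemma symprod1 g g' : symprod (fun=> 1%:M) g g' = (g == g')%:R.
Proof.
rewrite /symprod; under eq_bigr => k _ do rewrite symb1.
have [->|ne] := eqVneq g g'; first by rewrite big1 // => k _; rewrite eqxx.
have /existsP[k gk] : [exists k, g k != g' k].
  by rewrite -negb_forall; apply: contraNN ne => /forallP h; apply/eqP/ffunP => k; exact/eqP.
by rewrite (bigD1 k) //= (negbTE gk) mul0r.
Qed.

Lemma symprod_trace (M : 'I_n -> 'M[K]_2) : \sum_(g : gst) (\prod_k (2 * tag (g k)).+1%:R) * symprod M g g =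
  \prod_k \sum_(z < (sp p).+1) (2 * z).+1%:R * trs (2 * z) (M k).
Proof.
have e k : \sum_(z < (sp p).+1) (2 * z).+1%:R * trs (2 * z) (M k) =
    \sum_(x : bvec p) (2 * tag x).+1%:R * symb (M k) x x.
  rewrite (eq_bigr (fun x : bvec p => (2 * tag x).+1%:R * sym (2 * tag x) (M k) (bidx x) (bidx x))) => [|x _].
    rewrite (sum_bvec2 p_pr p_ge5 (fun z i : nat => (2 * z).+1%:R * sym (2 * z) (M k) i i)).
    by apply: eq_bigr => z _; rewrite /trs mulr_sumr.
  by rewrite /symb eqxx.
under [RHS]eq_bigr => k _ do rewrite e.
by rewrite bigA_distr_bigA /=; apply: eq_bigr => g _; rewrite -big_split.
Qed.

Definition letterM (k : 'I_n) M : 'I_n -> 'M[K]_2 := fun i => if k == i then M else 1%:M.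

Lemma symprod_letter k M (N : 'I_n -> 'M[K]_2) g g' :
  \sum_y symb M (g k) y * symprod N (upd g k y) g' = symprod (fun i => N i *m letterM k M i) g g'.
Proof.
rewrite [RHS]/symprod (bigD1 k) //= /letterM eqxx -symb_mul mulr_suml.
apply: eq_bigr => y _; rewrite /symprod (bigD1 k) //= upd_same mulrA; congr (_ * _).
by apply: eq_bigr => i ik; rewrite upd_neq // eq_sym (negbTE ik) mulmx1.
Qed.

End SiteProducts.

Section SiteMatrices.
Variable K : comNzRingType.

Definition mx2 (a b c d : K) : 'M[K]_2 :=
  \matrix_(i, j) if i == 0 then (if j == 0 then a else b) else (if j == 0 then c else d).

(* The classical limit of a crossing of the traveling strand with the strand [k], as a matrix
   acting on the vector representation of the strand [k]; [W] is the exponential of the weight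
   of the traveling strand, [Wi] its inverse, and [e], [f] are its raising and lowering operators. *)
Definition sitem (c : bool * bool) (W Wi e f : K) : 'M[K]_2 :=
  if c.1 then (if c.2 then mx2 W (W * f) 0 Wi else mx2 Wi (- (W * f)) 0 W)
  else (if c.2 then mx2 W 0 (Wi * e) Wi else mx2 Wi 0 (- (Wi * e)) W).

Definition site n (cs : seq ((bool * bool) * 'I_n)) (W Wi e f : K) (k : 'I_n) : 'M[K]_2 :=
  foldr (fun c M => M *m letterM c.2 (sitem c.1 W Wi e f) k) 1%:M cs.

Lemma mx2E (a b c d : K) : [/\ mx2 a b c d 0 0 = a, mx2 a b c d 0 1 = b, mx2 a b c d 1 0 = c & mx2 a b c d 1 1 = d].
Proof. by split; rewrite mxE. Qed.

End SiteMatrices.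

(** * Coefficients of the relator strands modulo h *)

Section Symbols.
Variables (R : comNzRingType) (h : R) (p n : nat) (vz : int -> R) (qbin : nat -> nat -> R).
Hypothesis p_pr : prime p.
Hypothesis p_ge5 : (5 <= p)%N.
Hypothesis vz0 : vz 0 = 1.
Hypothesis vzD : forall a b, vz (a + b) = vz a * vz b.
Hypothesis vz_1 : forall k, exists r, vz k = 1 + h * r.
Hypothesis qbin_bin : forall a b, exists r, qbin a b = 'C(a, b)%:R + h * r.
Local Notation inA := (inA vz).
Local Notation congA := (congA h vz).
Local Notation Ver := (Ver vz qbin).
Local Notation vco := (@vco R p vz qbin).
Local Notation gst := {ffun 'I_n -> bvec p}.
Implicit Types (f g : int -> int -> R) (x y : bvec p) (z mu : int).

Definition ac f g := [/\ inA f, inA g & congA f g].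

Lemma ac_refl f : inA f -> ac f f. Proof. by move=> hf; split=> //; exact: congA_refl. Qed.

Lemma ac_eq f g f' g' : ac f g -> (forall z mu, f z mu = f' z mu) -> (forall z mu, g z mu = g' z mu) -> ac f' g'.
Proof.
move=> [hf hg hfg] ef eg.
have <- : f = f' by apply: funext => z; apply: funext => mu.
by have <- : g = g' by apply: funext => z; apply: funext => mu.
Qed.

Lemma ac_mul f g f' g' : ac f g -> ac f' g' -> ac (fun z mu => f z mu * f' z mu) (fun z mu => g z mu * g' z mu).
Proof. by move=> [? ? ?] [? ? ?]; split; [exact: inA_mul | exact: inA_mul | exact: congA_mul]. Qed.

Lemma ac_trans f g k : ac f g -> ac g k -> ac f k.
Proof. by move=> [? ? c1] [? ? c2]; split=> //; exact: congA_trans c1 c2. Qed.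

Lemma ac_cst (a b r : R) : a = b + h * r -> ac (fun _ _ => a) (fun _ _ => b).
Proof.
move=> e; split; try exact: inA_cst.
by exists (fun _ _ => r); [exact: inA_cst | move=> z mu].
Qed.

Lemma ac_sum (I : Type) (r : seq I) (F G : I -> int -> int -> R) : (forall i, ac (F i) (G i)) ->
  ac (fun z mu => \sum_(i <- r) F i z mu) (fun z mu => \sum_(i <- r) G i z mu).
Proof.
move=> hF; split; try by apply: inA_sum => i _; case: (hF i).
by apply: congA_sum => i; case: (hF i).
Qed.

Lemma ac_prod (I : Type) (r : seq I) (F G : I -> int -> int -> R) : (forall i, ac (F i) (G i)) ->
  ac (fun z mu => \prod_(i <- r) F i z mu) (fun z mu => \prod_(i <- r) G i z mu).
Proof.
move=> hF; elim: r => [|i r IH].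
  apply: ac_eq (ac_refl (inA_cst vz0 1)) _ _ => z mu; by rewrite big_nil.
by apply: ac_eq (ac_mul (hF i) IH) _ _ => z mu; rewrite big_cons.
Qed.

Lemma ac_vz a : ac (fun _ _ => vz a) (fun _ _ => 1).
Proof. by have [r hr] := vz_1 a; exact: ac_cst hr. Qed.

(** Modulo [h] the weight of the traveling strand may be treated as constant along its way. *)
Lemma ac_shift e f : inA f -> ac (fun z mu => f z (mu + e)) f.
Proof.
move=> hf; split=> //; first exact: inA_shift.
elim: hf => [|c a b|f1 f2 _ h1 _ h2]; first exact: congA_refl.
  have [r hr] := vz_1 (2 * b * e).
  exists (fun z mu => c * r * Xx vz (2 * z + 1) ^+ a * vz (2 * b * mu)); first exact: InAmon.
  by move=> z mu; rewrite mulrDr vzD hr; ring.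
exact: congA_add h1 h2.
Qed.

(** The limit of the raising coefficient in the Verma basis; for the actual ring it is divisible by
    h^2 ([epsbE]). *)
Definition epsz z mu : R := Xx vz (2 * z + 1) - vz (2 * mu) - vz (- (2 * mu)).

Lemma ac_Ehat k : ac (Ehat vz k) (fun z mu => epsz z mu ^+ k).
Proof.
have := @ac_prod _ (index_enum 'I_k) (fun j z mu => qdif vz (z - mu - j%:Z) * qdif vz (z + mu + 1 + j%:Z)) (fun _ => epsz).
move=> H; apply: ac_eq (H _) _ _ => [j|z mu|z mu] //; last by rewrite prodr_const card_ord.
have dd z mu : qdif vz (z - mu - j%:Z) * qdif vz (z + mu + 1 + j%:Z) =
   Xx vz (2 * z + 1) - vz (2 * mu) * vz (2 * j%:Z + 1) - vz (- (2 * mu)) * vz (- (2 * j%:Z + 1)).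
  rewrite /qdif /Xx mulrBr !mulrBl -!vzD.
  have e1 : z - mu - j%:Z + (z + mu + 1 + j%:Z) = 2 * z + 1 by ring.
  have e2 : - (z - mu - j%:Z) + (z + mu + 1 + j%:Z) = 2 * mu + (2 * j%:Z + 1) by ring.
  have e3 : z - mu - j%:Z + - (z + mu + 1 + j%:Z) = - (2 * mu) + - (2 * j%:Z + 1) by ring.
  have e4 : - (z - mu - j%:Z) + - (z + mu + 1 + j%:Z) = - (2 * z + 1) by ring.
  by rewrite e1 e2 e3 e4; ring.
have V1 : ac (fun z mu => vz (2 * mu) * vz (2 * j%:Z + 1)) (fun z mu => vz (2 * mu)).
  apply: ac_eq (ac_mul (ac_refl (inA_V vz 1)) (ac_vz (2 * j%:Z + 1))) _ _ => z mu; by rewrite !mulr1.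
have V2 : ac (fun z mu => vz (- (2 * mu)) * vz (- (2 * j%:Z + 1))) (fun z mu => vz (- (2 * mu))).
  apply: ac_eq (ac_mul (ac_refl (inA_V vz (-1))) (ac_vz (- (2 * j%:Z + 1)))) _ _ => z mu;
    by rewrite ?mulr1 mulrN1 mulNr.
have add f g f' g' : ac f g -> ac f' g' -> ac (fun z mu => f z mu + f' z mu) (fun z mu => g z mu + g' z mu).
  by move=> [? ? ?] [? ? ?]; split; [exact: InAadd | exact: InAadd | exact: congA_add].
have neg f g : ac f g -> ac (fun z mu => - f z mu) (fun z mu => - g z mu).
  move=> hfg; apply: ac_eq (ac_mul (ac_refl (inA_cst vz0 (-1))) hfg) _ _ => z mu; by rewrite mulN1r.
have := add _ _ _ _ (add _ _ _ _ (ac_refl (inA_X vz0)) (neg _ _ V1)) (neg _ _ V2).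
by move=> H1; apply: ac_eq H1 _ _ => z mu //=; rewrite dd.
Qed.

(** The last argument, the lowering operator, is 1 because of the Verma basis. *)
Definition atpt (K : Type) (F : R -> R -> R -> R -> K) z mu : K :=
  F (vz mu) (vz (- mu)) (epsz z mu) 1.

Lemma vz_expn a k : vz a ^+ k = vz (a * k%:Z).
Proof.
elim: k => [|k IH]; first by rewrite mulr0 vz0 expr0.
by rewrite exprS IH -vzD; congr vz; rewrite -addn1 PoszD; ring.
Qed.

Lemma tri0 (a b c : R) k : a * (b * c *+ k) = a * b * c * k%:R.
Proof. by rewrite -mulr_natr; ring. Qed.

Lemma tri (a b c s : R) k : a * (b * (s * c) *+ k) = a * b * c * s * k%:R.
Proof. by rewrite -mulr_natr; ring. Qed.

Lemma tri2 (a b c d : R) k : a * (b * d * c *+ k) = a * b * c * (k%:R * d).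
Proof. by rewrite -mulr_natr; ring. Qed.

Lemma tri3 (a b c d s : R) k : a * (s * (b * d) * c *+ k) = a * b * c * s * (k%:R * d).
Proof. by rewrite -mulr_natr; ring. Qed.

(** The crossing matrices are triangular, so the entries of their symmetric powers are binomials
    times monomials. Modulo [h] these are the entries of [vco]: q-binomials become binomials, and
    powers of v with constant exponent become 1. *)
Lemma ac_vco c x y : ac (vco c x y) (fun z mu => symb (atpt (sitem c) z mu) x y).
Proof.
rewrite /vco /symb; case: eqP => [t|nt] /=; last by apply: ac_refl; exact: InA0.
have bx := bidx_le x; have by_ := bidx_le y; rewrite -t in bx *.
have hx : hwt x = (tag y)%:Z - (bidx x)%:Z by rewrite hwtE t.
have hy : hwt y = (tag y)%:Z - (bidx y)%:Z by [].
set N := (2 * tag y)%N in bx by_ *.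
set e := hwt x - hwt y; set k := `|e|%N.
have eb : e = (bidx y)%:Z - (bidx x)%:Z by rewrite /e hx hy; ring.
have HA : ac (fun z mu => if c.2 then vz (2 * (mu + e) * hwt y) * vz 'C(k, 2)%:Z
     else vz (- (2 * mu * hwt x)) * ((-1) ^+ k * vz (- 'C(k, 2)%:Z)))
   (fun z mu => if c.2 then vz (2 * hwt y * mu) else vz (2 * - hwt x * mu) * (-1) ^+ k).
  case: (c.2).
    apply: ac_eq (ac_mul (ac_refl (inA_V vz (hwt y))) (ac_mul (ac_vz (2 * hwt y * e)) (ac_vz 'C(k, 2)%:Z))) _ _ => z mu.
      by rewrite mulrA -vzD; congr (vz _ * _); ring.
    by rewrite !mulr1.
  apply: ac_eq (ac_mul (ac_refl (inA_V vz (- hwt x))) (ac_mul (ac_refl (inA_cst vz0 ((-1) ^+ k))) (ac_vz (- 'C(k, 2)%:Z)))) _ _ => z mu.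
    by congr (vz _ * _); ring.
  by rewrite !mulr1.
have HB : ac (fun z mu => if c.1 then qbin (N - bidx y)%N k else qbin (bidx y) k * Ehat vz k z mu)
   (fun z mu => if c.1 then 'C(N - bidx y, k)%:R else 'C(bidx y, k)%:R * epsz z mu ^+ k).
  case: (c.1); first by have [r hr] := qbin_bin (N - bidx y) k; exact: ac_cst hr.
  have [r hr] := qbin_bin (bidx y) k.
  exact: ac_mul (ac_cst hr) (ac_Ehat k).
have H := ac_mul HA HB.
case ce: (if c.1 then e <= 0 else 0 <= e); last first.
  apply: ac_eq (ac_refl (@InA0 R vz)) _ _ => z mu //. rewrite /atpt /sitem.
  move: ce; case: (c.1) => ce.
    rewrite sym_upper //; last by case: (c.2); rewrite mxE.
    by case: leqP => // le; move: ce; lia.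
  rewrite sym_lower //; last by case: (c.2); rewrite mxE.
  by case: leqP => // le; move: ce; lia.
apply: ac_eq H _ _ => z mu //; rewrite /atpt /sitem.
move: ce; case: (c.1) => ce.
  rewrite sym_upper //; last by case: (c.2); rewrite mxE.
  have le : (bidx y <= bidx x)%N by lia.
  have kE : (bidx x - bidx y = k)%N by rewrite /k; lia.
  have kZ : k%:Z = (bidx x)%:Z - (bidx y)%:Z by rewrite -kE; lia.
  have NZ : (N - bidx x)%N%:Z = 2 * (tag y)%:Z - (bidx x)%:Z by rewrite /N; lia.
  rewrite le kE; case: (c.2); rewrite !mxE /= mulr1.
    rewrite !vz_expn tri0 -!vzD; congr (vz _ * _).
    by rewrite hy NZ kZ; ring.
  rewrite (exprNn (vz mu)) !vz_expn tri -!vzD; congr (vz _ * _ * _).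
  by rewrite hx NZ kZ; ring.
rewrite sym_lower //; last by case: (c.2); rewrite mxE.
have le : (bidx x <= bidx y)%N by lia.
have kE : (bidx y - bidx x = k)%N by rewrite /k; lia.
have kZ : k%:Z = (bidx y)%:Z - (bidx x)%:Z by rewrite -kE; lia.
have NZ : (N - bidx y)%N%:Z = 2 * (tag y)%:Z - (bidx y)%:Z by rewrite /N; lia.
have Ck : 'C(bidx y, bidx x) = 'C(bidx y, k) by rewrite -kE bin_sub.
rewrite le kE Ck; case: (c.2); rewrite !mxE /= ?(exprNn (vz (- mu) * _)) (exprMn k (vz (- mu))) !vz_expn.
  rewrite tri2 -!vzD; congr (vz _ * _).
  by rewrite hy NZ kZ; ring.
rewrite tri3 -!vzD; congr (vz _ * _ * _).
by rewrite hx NZ kZ; ring.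
Qed.

Lemma ac_Ver cs (g g' : gst) : ac (Ver cs g g') (fun z mu => symprod (atpt (site cs) z mu) g g').
Proof.
elim: cs g => [|c cs IH] g /=.
  have := ac_refl (inA_cst vz0 ((g == g')%:R : R)); move=> H; apply: ac_eq H _ _ => z mu //.
  by rewrite -symprod1.
have step y : ac (fun z mu => vco c.1 (g c.2) y z mu * Ver cs (upd g c.2 y) g' z (mu + (hwt (g c.2) - hwt y)))
   (fun z mu => symb (atpt (sitem c.1) z mu) (g c.2) y * symprod (atpt (site cs) z mu) (upd g c.2 y) g').
  apply: ac_mul (ac_vco _ _ _) _; have H := IH (upd g c.2 y); apply: ac_trans H.
  by case: (IH (upd g c.2 y)) => hA _ _; exact: ac_shift.
apply: ac_eq (ac_sum _ step) _ _ => z mu //.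
by rewrite symprod_letter.
Qed.

End Symbols.

Section SymMorphism.
Variables (K L : comNzRingType) (f : {rmorphism K -> L}).

Lemma map_lf (M : 'M[K]_2) r : map_poly f (lf M r) = lf (map_mx f M) r.
Proof. by rewrite /lf rmorphD rmorphM /= !map_polyC map_polyX /= !mxE. Qed.

Lemma rmorph_sym N (M : 'M[K]_2) b i : f (sym N M b i) = sym N (map_mx f M) b i.
Proof. by rewrite /sym -coef_map rmorphM !rmorphXn /= !map_lf. Qed.

Lemma rmorph_symprod p n (M : 'I_n -> 'M[K]_2) (g g' : {ffun 'I_n -> bvec p}) :
  f (symprod M g g') = symprod (fun k => map_mx f (M k)) g g'.
Proof.
rewrite rmorph_prod; apply: eq_bigr => k _; rewrite /symb.
by case: ifP => _; [exact: rmorph_sym | rewrite rmorph0].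
Qed.

Lemma map_mx2 (a b c d : K) : map_mx f (mx2 a b c d) = mx2 (f a) (f b) (f c) (f d).
Proof. by apply/matrixP => i j; rewrite !mxE; case: (i == 0); case: (j == 0). Qed.

Lemma map_site n (cs : seq ((bool * bool) * 'I_n)) (W Wi e f' : K) k :
  map_mx f (site cs W Wi e f' k) = site cs (f W) (f Wi) (f e) (f f') k.
Proof.
elim: cs => [|c cs IH] /=; first by rewrite map_mx1.
rewrite map_mxM IH; congr (_ *m _); rewrite /letterM; case: ifP => _; last by rewrite map_mx1.
by rewrite /sitem; case: (c.1) => [[] []]; rewrite map_mx2 ?rmorphN ?rmorphM ?rmorph0.
Qed.
End SymMorphism.

(** * Balancing the raising and the lowering operator *)

Section Conjugation.
Variables (K : comNzRingType) (p n : nat) (h : K).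
Hypothesis h_inj : forall k, injective ( *%R (h ^+ k)).
Implicit Types (g : {ffun 'I_n -> bvec p}).

Lemma mul_mx2 (a b c d a' b' c' d' : K) : mx2 a b c d *m mx2 a' b' c' d' =
  mx2 (a * a' + b * c') (a * b' + b * d') (c * a' + d * c') (c * b' + d * d').
Proof.
apply/matrixP => i j; rewrite mul2E !mxE.
by case: (i == 0); case: (j == 0).
Qed.

(** Conjugation by this matrix moves a factor [h] from [f] to [e], so that e = h^2 e', f = 1 may be
    replaced by h e' and [h], both small. *)
Definition dmx : 'M[K]_2 := mx2 1 0 0 h.

Lemma mx2_1 : 1%:M = mx2 1 0 0 1 :> 'M[K]_2.
Proof. by apply/matrixP => -[[|[|//]] i] [[|[|//]] j]; rewrite !mxE. Qed.

Lemma sitem_conj c W Wi e f : dmx *m sitem c W Wi e (h * f) = sitem c W Wi (h * e) f *m dmx.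
Proof. by case: c => [[] []]; rewrite /dmx !mul_mx2; congr mx2; ring. Qed.

Lemma site_conj (cs : seq ((bool * bool) * 'I_n)) W Wi e f k :
  dmx *m site cs W Wi e (h * f) k = site cs W Wi (h * e) f k *m dmx.
Proof.
elim: cs => [|c cs IH] /=; first by rewrite mulmx1 mul1mx.
rewrite mulmxA IH -!mulmxA; congr (_ *m _); rewrite /letterM.
by case: ifP => _; [exact: sitem_conj | rewrite mulmx1 mul1mx].
Qed.

Lemma symb_dmx (x y : bvec p) : symb dmx x y = (x == y)%:R * h ^+ bidx x.
Proof.
rewrite /symb bvec_eq eq_sym; case: eqP => [e|_] /=; last by rewrite mul0r.
have [E00 E01 E10 E11] := mx2E (1 : K) 0 0 h.
rewrite e /dmx sym_lower ?bidx_le // E00 E10 E11 expr1n mul1r.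
case: ltngtP => [lt|gt|->]; rewrite ?mul0r //.
  by rewrite expr0n subn_eq0 leqNgt lt mul0r mul0rn.
by rewrite subnn expr0 binn !mulr1n !mul1r.
Qed.

Definition btot g : nat := \sum_k bidx (g k).

Lemma symprod_dmx g g' : symprod (fun=> dmx) g g' = (g == g')%:R * h ^+ btot g.
Proof.
rewrite /symprod; under eq_bigr => k _ do rewrite symb_dmx.
rewrite big_split /= -[\prod_i h ^+ _](expr_sum); congr (_ * _).
by rewrite -symprod1; apply: eq_bigr => k _; rewrite symb1.
Qed.

(** On the states the conjugation is scaling by [h] to the total index. That index agrees for states
    of equal labels and equal weight, and coefficients between different labels vanish. *)
Lemma symprod_conj (M M' : 'I_n -> 'M[K]_2) g g' : Wt g' = Wt g ->
  (forall k, dmx *m M' k = M k *m dmx) -> symprod M' g g' = symprod M g g'.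
Proof.
move=> W e.
have [/forallP tg|] := boolP [forall k, tag (g' k) == tag (g k)]; last first.
  rewrite negb_forall => /existsP[k nk].
  by rewrite /symprod (bigD1 k) //= [RHS](bigD1 k) //= /symb (negbTE nk) !mul0r.
have eb : btot g = btot g'.
  have hb g0 : (btot g0)%:Z = \sum_k (tag (g0 k))%:Z - Wt g0.
    rewrite /btot /Wt (big_morph Posz PoszD (erefl _)) -sumrB; apply: eq_bigr => k _.
    by rewrite hwtE; ring.
  suff : (btot g)%:Z = (btot g')%:Z by case.
  rewrite !hb W; congr (_ - _); apply: eq_bigr => k _.
  by rewrite (eqP (tg k)).
apply: (@h_inj (btot g)).
have : symprod (fun k => dmx *m M' k) g g' = symprod (fun k => M k *m dmx) g g'.
  by congr symprod; apply: funext.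
rewrite -!symprod_mul.
rewrite (bigD1 g') //= [X in _ + X]big1 ?addr0 => [|u nu]; last first.
  by rewrite symprod_dmx (negbTE nu) mul0r mulr0.
rewrite [RHS](bigD1 g) //= [X in _ = _ + X]big1 ?addr0 => [|u nu]; last first.
  by rewrite symprod_dmx eq_sym (negbTE nu) !mul0r.
by rewrite !symprod_dmx !eqxx !mul1r -eb => <-; rewrite mulrC.
Qed.

End Conjugation.

Section GradedMatrices.
Variables (K : comNzRingType) (m p n : nat) (c0 c1 c2 : int) (j : 'I_m).
Local Notation S := {mpoly K[m * 3]}.
Local Notation gr := (@graded K m c0 c1 c2 j).
Variable t : int.

Definition grmx (M : 'M[S]_2) := forall r c : 'I_2, gr (t * ((r : nat)%:Z - (c : nat)%:Z)) (M r c).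

Lemma grmx_mul A B : grmx A -> grmx B -> grmx (A *m B).
Proof.
move=> hA hB r c; rewrite mul2E; apply: grD.
  have := grM (hA r 0) (hB 0 c); congr graded; rewrite /=; ring.
have := grM (hA r 1) (hB 1 c); congr graded; rewrite /=; ring.
Qed.

Lemma grmx2 a b c d : gr 0 a -> gr (- t) b -> gr t c -> gr 0 d -> grmx (mx2 a b c d).
Proof.
move=> ha hb hc hd [[|[|//]] i] [[|[|//]] i']; rewrite mxE /=.
- by rewrite subrr mulr0.
- by rewrite sub0r mulrN mulr1.
- by rewrite subr0 mulr1.
- by rewrite subrr mulr0.
Qed.

Lemma grmx1 : grmx 1%:M.
Proof. by rewrite mx2_1; apply: grmx2; [exact: gr1 | exact: gr0 | exact: gr0 | exact: gr1]. Qed.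

Lemma grmx_site (cs : seq ((bool * bool) * 'I_n)) W Wi e f k : gr 0 W -> gr 0 Wi -> gr t e -> gr (- t) f ->
  grmx (site cs W Wi e f k).
Proof.
move=> hW hWi he hf; elim: cs => [|c cs IH] /=; first exact: grmx1.
apply: grmx_mul IH _; rewrite /letterM; case: ifP => _; last exact: grmx1.
by rewrite /sitem; case: (c.1) => [[] []]; apply: grmx2 => //; rewrite ?opprK;
  first [exact: gr0 | exact: grMl | apply: grN; exact: grMl].
Qed.

Definition grpoly d (P : {poly S}) := forall i, gr (t * (d - i%:Z)) P`_i.

Lemma grpolyM d e P Q : grpoly d P -> grpoly e Q -> grpoly (d + e) (P * Q).
Proof.
move=> hP hQ i; rewrite coefM; apply: gr_sum => l _.
have := grM (hP l) (hQ (i - l)%N); congr graded.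
have li : (l <= i)%N by rewrite -ltnS.
by rewrite -subzn //; ring.
Qed.

Lemma grpolyX d P k : grpoly d P -> grpoly (d * k%:Z) (P ^+ k).
Proof.
move=> hP; elim: k => [|k IH].
  move=> i; rewrite coef1 mulr0; case: eqP => [->|_]; last exact: gr0.
  by rewrite subrr mulr0; exact: gr1.
by rewrite exprS -addn1 PoszD mulrDr mulr1 addrC; exact: grpolyM.
Qed.

Lemma gr_sym N M b i : grmx M -> gr (t * (b%:Z - i%:Z)) (sym N M b i).
Proof.
move=> hM.
have hl (r : 'I_2) : grpoly (r : nat)%:Z (lf M r).
  move=> l; rewrite /lf coefD coefC coefCM coefX.
  case: l => [|[|l]] /=.
  - by have := hM r 0; rewrite mulr0 !addr0.
  - by rewrite mulr1 add0r; exact: (hM r 1).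
  - by rewrite mulr0 !addr0; exact: gr0.
have := grpolyM (grpolyX (k := (N - b)%N) (hl 0)) (grpolyX (k := b) (hl 1)).
by move/(_ i); rewrite /= mul0r mul1r add0r.
Qed.

Lemma gr_symprod (M : 'I_n -> 'M[S]_2) (g g' : {ffun 'I_n -> bvec p}) : (forall k, grmx (M k)) ->
  gr (t * (Wt g - Wt g')) (symprod M g g').
Proof.
move=> hM; rewrite /Wt -sumrB mulr_sumr; apply: gr_prod => k _.
rewrite /symb; case: eqP => [e|_]; last exact: gr0.
have := @gr_sym (2 * tag (g k))%N (M k) (bidx (g' k)) (bidx (g k)) (hM k); congr graded.
by rewrite !hwtE e; ring.
Qed.

End GradedMatrices.

(** * Weight sums as a functional on formal variables *)

Section FormalTransfer.
Variables (R : comNzRingType) (h : R) (p m n : nat) (vz : int -> R) (qint : nat -> R).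
Hypothesis p_gt0 : (0 < p)%N.
Hypothesis vz0 : vz 0 = 1.
Hypothesis vzD : forall a b, vz (a + b) = vz a * vz b.
Hypothesis vz_p : forall a, vz (a * p%:Z) = 1.
Hypothesis h_inj : forall k, injective ( *%R (h ^+ k)).
Variables (eb : int -> int -> R) (wb : int -> R).
Hypothesis ebE : forall z mu, h * (h * eb z mu) = epsz vz z mu.
Hypothesis wbE : forall mu, 1 + h * wb mu = vz mu.
Local Notation S := {mpoly R[m * 3]}.
Local Notation vlam := (lam p vz qint).
Implicit Types (j : 'I_m) (cs : seq ((bool * bool) * 'I_n)).

(** Only monomials balanced in raising and lowering contribute to coefficients that preserve the
    weight of the generator strands; each pair e f counts as one factor [eb]. *)
Definition pmom (a b c : nat) : R := if a == b then vlam (fun z mu => eb z mu ^+ a * wb mu ^+ c) else 0.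

Lemma lam_sum (I : eqType) (r : seq I) (a : I -> R) (F : I -> int -> int -> R) :
  vlam (fun z mu => \sum_(i <- r) a i * F i z mu) = \sum_(i <- r) a i * vlam (F i).
Proof.
rewrite /lam; under [RHS]eq_bigr => i _ do rewrite mulr_sumr.
rewrite [RHS]exchange_big /=; apply: eq_bigr => z _.
under [RHS]eq_bigr => i _ do rewrite mulrCA mulr_sumr.
rewrite -mulr_sumr; congr (_ * _); rewrite [RHS]exchange_big /=; apply: eq_bigr => l _.
by rewrite mulr_sumr; apply: eq_bigr => i _; rewrite mulrCA.
Qed.

Definition blockpt j (e w : R) (i : 'I_(m * 3)) : R :=
  (if i == bv j i0 then e else 1) * (if i == bv j i2 then w else 1).

Lemma blockpt_mon j e w (u : 'X_{1..m * 3}) : mmap1 (blockpt j e w) u = e ^+ u (bv j i0) * w ^+ u (bv j i2).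
Proof.
rewrite /mmap1 /blockpt; under eq_bigr => i _ do rewrite exprMn.
have one k (x : R) : \prod_(i < m * 3) (if i == bv j k then x else 1) ^+ u i = x ^+ u (bv j k).
  rewrite (bigD1 (bv j k)) //= eqxx big1 ?mulr1 // => i /negbTE->; exact: expr1n.
by rewrite big_split /= !one.
Qed.

Lemma lext_unbal j d (P : S) : graded 1 (-1) 0 j d P -> d != 0 -> lext pmom [set j] P = 0.
Proof.
move=> hP d0; rewrite /lext big_seq big1 // => u /hP; rewrite /bg => e.
rewrite /cmon big_set1 /cblk /pmom; case: eqP => [ab|_]; last by rewrite mulr0.
by case/eqP: d0; rewrite -e ab; ring.
Qed.

Lemma lext_bal j (P : S) : graded 1 (-1) 0 j 0 P ->
  lext pmom [set j] P = vlam (fun z mu => P.@[blockpt j (eb z mu) (wb mu)]).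
Proof.
move=> hP.
have -> : (fun z mu => P.@[blockpt j (eb z mu) (wb mu)]) =
  (fun z mu => \sum_(u <- msupp P) P@_u * (eb z mu ^+ u (bv j i0) * wb mu ^+ u (bv j i2))).
  apply: funext => z; apply: funext => mu; rewrite /meval /mmap; apply: eq_bigr => u _.
  by rewrite blockpt_mon.
rewrite lam_sum /lext big_seq [RHS]big_seq; apply: eq_bigr => u /hP; rewrite /bg => e.
congr (_ * _); rewrite /cmon big_set1 /cblk /pmom.
by have -> : u (bv j i0) == u (bv j i1); [apply/eqP; lia|].
Qed.

Definition Wform j : S := 1 + h *: 'X_(bv j i2).

(** The inverse of v^mu is its power p - 1; written this way the entries stay polynomial in the
    formal variables. *)
Definition formsite j cs : 'I_n -> 'M[S]_2 :=
  site cs (Wform j) (Wform j ^+ p.-1) (h *: 'X_(bv j i0)) (h *: 'X_(bv j i1)).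

Lemma Wform_gr c0 c1 j k : graded c0 c1 0 k 0 (Wform j).
Proof.
apply: grD; first exact: gr1.
apply: grZ; have := @grU R m c0 c1 0 k j i2; rewrite /cvec /=.
by case: ifP.
Qed.

Lemma formsite_bal j cs k : grmx 1 (-1) 0 j 1 (formsite j cs k).
Proof.
apply: grmx_site; first exact: Wform_gr.
- by have := @grX R m 1 (-1) 0 j 0 _ p.-1 (@Wform_gr _ _ _ _); rewrite mul0r; apply.
- by apply: grZ; have := @grU R m 1 (-1) 0 j j i0; rewrite eqxx.
- by apply: grZ; have := @grU R m 1 (-1) 0 j j i1; rewrite eqxx.
Qed.

Lemma formsite_avoids j j' cs k : j' != j -> grmx 1 1 1 j' 0 (formsite j cs k).
Proof.
move=> nj; have gU a : graded 1 1 1 j' 0 ('X_(bv j a) : S).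
  by have := @grU R m 1 1 1 j' j a; rewrite eq_sym (negbTE nj).
have gW : graded 1 1 1 j' 0 (Wform j) by apply: grD; [exact: gr1 | apply: grZ; exact: gU].
apply: grmx_site => //; rewrite ?oppr0.
- by have := grX (k := p.-1) gW; rewrite mul0r.
- by apply: grZ; exact: gU.
- by apply: grZ; exact: gU.
Qed.

Lemma vz_pred mu : vz mu ^+ p.-1 = vz (- mu).
Proof.
rewrite (vz_expn vz0 vzD); have -> : - mu = mu * p.-1%:Z + (-mu) * p%:Z.
  by rewrite -[in p%:Z](prednK p_gt0) -addn1 PoszD; ring.
by rewrite vzD vz_p mulr1.
Qed.

(** The excess of raising over lowering in a coefficient is the weight gained by the generator
    strands. So the functional vanishes when their weight changes; otherwise the variables may be
    evaluated at a point, up to the conjugation by [dmx]. *)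
Lemma lext_formsite j cs (g g' : {ffun 'I_n -> bvec p}) :
  lext pmom [set j] (symprod (formsite j cs) g g') =
  if Wt g' == Wt g then vlam (fun z mu => symprod (atpt vz (site cs) z mu) g g') else 0.
Proof.
have bal := gr_symprod (g := g) (g' := g') (fun k => @formsite_bal j cs k); rewrite mul1r in bal.
case: eqP => [e|ne]; last first.
  by apply: lext_unbal bal _; rewrite subr_eq0 eq_sym; exact/eqP.
rewrite lext_bal; last by move: bal; rewrite e subrr.
congr lam; apply: funext => z; apply: funext => mu.
pose ev : {rmorphism S -> R} := meval (blockpt j (eb z mu) (wb mu)).
rewrite -[LHS]/(ev _) (rmorph_symprod ev); apply: (symprod_conj h_inj e) => k.
rewrite /formsite map_site.
have evX a : ev 'X_(bv j a) = blockpt j (eb z mu) (wb mu) (bv j a) by exact: mevalXU.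
have evZ c P : ev (c *: P) = c * ev P by exact: mevalZ.
have -> : ev (Wform j) = vz mu.
  by rewrite /Wform rmorphD rmorph1 evZ evX /blockpt !bv_inj !eqxx /= mul1r wbE.
have -> : ev (Wform j ^+ p.-1) = vz (- mu).
  rewrite rmorphXn /Wform rmorphD rmorph1 evZ evX /blockpt !bv_inj !eqxx /= mul1r wbE.
  exact: vz_pred.
rewrite !evZ !evX /blockpt !bv_inj !eqxx /= !mulr1.
by rewrite -[X in site _ _ _ _ X k](mulr1 h) site_conj ebE.
Qed.

End FormalTransfer.

(** * First order expansion of the classical limit *)

Section FirstOrder.
Variables (K : comNzRingType) (h : K) (p s : nat).
Hypothesis p_pr : prime p.
Hypothesis pE : p = (2 * s).+3.
Hypothesis s_gt0 : (0 < s)%N.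
Variable pu : K.
Hypothesis puE : p%:R = h ^+ p.-1 * pu.
Local Notation dvh := (dvh h).
Implicit Types (M N : 'M[K]_2).

Definition mxlin M N := forall i j : 'I_2, dvh 2 (M i j - (i == j)%:R - h * N i j).

Lemma mxlin1 : mxlin 1%:M 0.
Proof. by move=> i j; rewrite !mxE mulr0 subr0 subrr; exact: dvh0. Qed.

Lemma mxlin_mul M M' N N' : mxlin M N -> mxlin M' N' -> mxlin (M *m M') (N + N').
Proof.
move=> hM hM' i j; rewrite mul2E.
have [a ha] := hM i 0; have [b hb] := hM i 1; have [a' ha'] := hM' 0 j; have [b' hb'] := hM' 1 j.
have ea : M i 0 = (i == 0)%:R + h * N i 0 + h ^+ 2 * a by rewrite -ha; ring.
have eb : M i 1 = (i == 1)%:R + h * N i 1 + h ^+ 2 * b by rewrite -hb; ring.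
have ea' : M' 0 j = (0 == j)%:R + h * N' 0 j + h ^+ 2 * a' by rewrite -ha'; ring.
have eb' : M' 1 j = (1 == j)%:R + h * N' 1 j + h ^+ 2 * b' by rewrite -hb'; ring.
rewrite ea eb ea' eb' mxE.
have o0 : (0 == 0 :> 'I_2) = true by []. have o1 : (1 == 1 :> 'I_2) = true by [].
have o2 : (0 == 1 :> 'I_2) = false by []. have o3 : (1 == 0 :> 'I_2) = false by [].
have [->|->] : i = 0 \/ i = 1.
- by case: i {ha hb ea eb hM} => -[|[|//]] i; [left|right]; exact: val_inj.
- have [->|->] : j = 0 \/ j = 1.
  + by case: j {ha' hb' ea' eb' hM'} => -[|[|//]] j; [left|right]; exact: val_inj.
  + rewrite o0 o3 /=.
    exists (a + a' + N 0 0 * N' 0 0 + N 0 1 * N' 1 0 + h * (a * N' 0 0 + N 0 0 * a' + b * N' 1 0 + N 0 1 * b') + h ^+ 2 * (a * a' + b * b')).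
    ring.
  + rewrite o0 o1 o2 /=.
    exists (b + b' * 0 + a' + N 0 0 * N' 0 1 + N 0 1 * N' 1 1 + h * (a * N' 0 1 + N 0 0 * a' + b * N' 1 1 + N 0 1 * b') + h ^+ 2 * (a * a' + b * b')).
    ring.
- have [->|->] : j = 0 \/ j = 1.
  + by case: j {ha' hb' ea' eb' hM'} => -[|[|//]] j; [left|right]; exact: val_inj.
  + rewrite o0 o1 o3 /=.
    exists (a + b' + N 1 0 * N' 0 0 + N 1 1 * N' 1 0 + h * (a * N' 0 0 + N 1 0 * a' + b * N' 1 0 + N 1 1 * b') + h ^+ 2 * (a * a' + b * b')).
    ring.
  + rewrite o1 o2 /=.
    exists (b + b' + N 1 0 * N' 0 1 + N 1 1 * N' 1 1 + h * (a * N' 0 1 + N 1 0 * a' + b * N' 1 1 + N 1 1 * b') + h ^+ 2 * (a * a' + b * b')).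
    ring.
Qed.

Lemma p_dvh : dvh (2 * s).+2 p%:R.
Proof. by exists pu; rewrite puE pE. Qed.

Lemma onePX w k : exists r, (1 + h * w) ^+ k = 1 + k%:R * (h * w) + h ^+ 2 * r.
Proof.
elim: k => [|k [r IH]]; first by exists 0; rewrite expr0; ring.
exists (k%:R * w ^+ 2 + r * (1 + h * w)); rewrite exprS IH -natr1; ring.
Qed.

(** The exponent p - 1 acts as -1 to first order, because h^2 divides [p]. *)
Lemma inv_lin w : dvh 2 ((1 + h * w) ^+ p.-1 - 1 + h * w).
Proof.
have [r ->] := onePX w p.-1.
have [q hq] := p_dvh; exists (h ^+ (2 * s).+1 * q * w + r).
have -> : p.-1%:R = p%:R - 1 :> K by rewrite -[in p%:R](prednK (prime_gt0 p_pr)) -natr1; ring.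
by rewrite hq !exprS; ring.
Qed.

Definition nlow (w e f : K) : 'M[K]_2 := mx2 w 0 e (- w).
Definition nup (w e f : K) : 'M[K]_2 := mx2 w f 0 (- w).

Definition nmat (c : bool * bool) w e f : 'M[K]_2 :=
  (if c.2 then 1 else -1) *: (if c.1 then nup w e f else nlow w e f).

Lemma mxlin2 a b c d a' b' c' d' : dvh 2 (a - 1 - h * a') -> dvh 2 (b - h * b') -> dvh 2 (c - h * c') ->
  dvh 2 (d - 1 - h * d') -> mxlin (mx2 a b c d) (mx2 a' b' c' d').
Proof.
move=> ha hb hc hd [[|[|//]] i] [[|[|//]] j]; rewrite !mxE /=.
- exact: ha.
- by rewrite subr0.
- by rewrite subr0.
- exact: hd.
Qed.

Lemma scale_mx2 (t a b c d : K) : t *: mx2 a b c d = mx2 (t * a) (t * b) (t * c) (t * d).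
Proof. by apply/matrixP => i j; rewrite !mxE; case: (i == 0); case: (j == 0). Qed.

Lemma sitem_lin c w e f :
  mxlin (sitem c (1 + h * w) ((1 + h * w) ^+ p.-1) (h * e) (h * f)) (nmat c w e f).
Proof.
have [r hr] := inv_lin w.
have hi : (1 + h * w) ^+ p.-1 = 1 - h * w + h ^+ 2 * r by rewrite -hr; ring.
case: c => [[] []]; rewrite /sitem /nmat /nup /nlow /= scale_mx2 hi; apply: mxlin2.
all: try by exists 0; ring.
all: try by exists r; ring.
- by exists (w * f); ring.
- by exists (- (w * f)); ring.
- by exists (- (w * e) + h * r * e); ring.
- by exists (w * e - h * r * e); ring.
Qed.

Definition nsite n (cs : seq ((bool * bool) * 'I_n)) w e f (k : 'I_n) : 'M[K]_2 :=
  \sum_(c <- cs | c.2 == k) nmat c.1 w e f.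

Lemma site_lin n (cs : seq ((bool * bool) * 'I_n)) w e f k :
  mxlin (site cs (1 + h * w) ((1 + h * w) ^+ p.-1) (h * e) (h * f) k) (nsite cs w e f k).
Proof.
rewrite /nsite; elim: cs => [|c cs IH] /=; first by rewrite big_nil; exact: mxlin1.
rewrite big_cons /letterM; case: ifP => _; last by rewrite mulmx1.
by rewrite [X in mxlin _ X]addrC; apply: mxlin_mul IH _; exact: sitem_lin.
Qed.

(** The crossing matrices have determinant (1 + h w)^p, which is not exactly 1 but 1 up to h^(2s+1)
    ([onep_dvh]). *)
Definition det1h M := dvh (2 * s).+1 (\det M - 1).

Lemma det1h_mul M M' : det1h M -> det1h M' -> det1h (M *m M').
Proof.
move=> [r hr] [r' hr']; rewrite /det1h det_mulmx; exists (r * \det M' + r').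
have -> : \det M = 1 + h ^+ (2 * s).+1 * r by rewrite -hr; ring.
have -> : \det M' = 1 + h ^+ (2 * s).+1 * r' by rewrite -hr'; ring.
ring.
Qed.

Lemma det1h_1 : det1h 1%:M.
Proof. by rewrite /det1h det1 subrr; exact: dvh0. Qed.

Lemma onep_dvh w : dvh (2 * s).+1 ((1 + h * w) ^+ p - 1).
Proof.
rewrite exprDn big_ord_recl subn0 bin0 expr1n expr0 mulr1 mulr1n addrAC subrr add0r.
apply: dvh_sum => i _; rewrite expr1n mul1r lift0 -mulr_natl.
have [ip|ip] := eqVneq (i.+1 : nat) p.
  apply: (@dvh_le _ _ _ p); first by lia.
  by exists (w ^+ p); rewrite ip binn mul1r exprMn.
have /dvdnP[q ->] : (p %| 'C(p, i.+1))%N by apply: prime_dvd_bin => //; have := ltn_ord i; lia.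
have [a ha] := p_dvh; apply: (@dvh_le _ _ _ (2 * s).+2) => //.
by exists (q%:R * a * (h * w) ^+ i.+1); rewrite natrM ha; ring.
Qed.

Lemma det_mx2 a b c d : \det (mx2 a b c d) = a * d - b * c :> K.
Proof. by rewrite det2E !mxE. Qed.

Lemma site_det n (cs : seq ((bool * bool) * 'I_n)) w e f k :
  det1h (site cs (1 + h * w) ((1 + h * w) ^+ p.-1) (h * e) (h * f) k).
Proof.
elim: cs => [|c cs IH] /=; first exact: det1h_1.
apply: det1h_mul IH _; rewrite /letterM; case: ifP => _; last exact: det1h_1.
have [r hr] := onep_dvh w.
have eW : (1 + h * w) * (1 + h * w) ^+ p.-1 = 1 + h ^+ (2 * s).+1 * r.
  by rewrite -exprS prednK ?prime_gt0 // -hr; ring.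
by rewrite /det1h /sitem; case: (c.1) => [[] []] /=; rewrite det_mx2 ?mulr0 ?mul0r ?subr0 ?[_ ^+ _ * (1 + _)]mulrC eW; exists r; ring.
Qed.

Definition theta M : K := \sum_(z < s.+1) (2 * z).+1%:R * trs (2 * z) M.

(** The discriminant tr^2 - 4 det of the characteristic polynomial. *)
Definition disc N : K := (N 0 0 - N 1 1) ^+ 2 + 4%:R * (N 0 1 * N 1 0).

Lemma theta_cheb M : det1h M -> dvh (2 * s).+1 (theta M - cheb_sum (M 0 0 + M 1 1) s).
Proof.
move=> [r hr]; rewrite /theta /cheb_sum -sumrB; apply: dvh_sum => z _.
have [q ->] := trs_cheb (2 * z) M; rewrite hr.
by exists ((2 * z).+1%:R * (r * q)); rewrite -mulrBr addrAC subrr add0r; ring.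
Qed.

(** Up to h^(2s+1) the sum is -2(tr^2 - 4)^s. As the determinant is nearly 1, tr^2 - 4 is nearly the
    discriminant of [M], which starts with h^2 times that of [N]. *)
Lemma theta_lin M N : det1h M -> mxlin M N ->
  dvh (2 * s).+1 (theta M - h ^+ (2 * s) * (- 2%:R * disc N ^+ s)).
Proof.
move=> dM hM; have h1 := theta_cheb dM.
have [q hq] := @cheb_sum_mod p s p_pr pE K (M 0 0 + M 1 1).
have h2 : dvh (2 * s).+1 (cheb_sum (M 0 0 + M 1 1) s + 2%:R * ((M 0 0 + M 1 1) ^+ 2 - 4%:R) ^+ s).
  have [a ha] := p_dvh; apply: (@dvh_le _ _ _ (2 * s).+2) => //; exists (a * q).
  by rewrite hq ha; ring.
have [r hr] := dM; rewrite det2E in hr.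
have [a ha] := hM 0 0; have [b hb] := hM 0 1; have [c hc] := hM 1 0; have [d hd] := hM 1 1.
have o0 : (0 == 0 :> 'I_2) = true by []. have o1 : (1 == 1 :> 'I_2) = true by [].
have o2 : (0 == 1 :> 'I_2) = false by []. have o3 : (1 == 0 :> 'I_2) = false by [].
have ea : M 0 0 = 1 + h * N 0 0 + h ^+ 2 * a by rewrite -ha o0 /=; ring.
have eb : M 0 1 = h * N 0 1 + h ^+ 2 * b by rewrite -hb o2 /=; ring.
have ec : M 1 0 = h * N 1 0 + h ^+ 2 * c by rewrite -hc o3 /=; ring.
have ed : M 1 1 = 1 + h * N 1 1 + h ^+ 2 * d by rewrite -hd o1 /=; ring.
have [y hy] : exists y, (M 0 0 + M 1 1) ^+ 2 - 4%:R = h ^+ 2 * (disc N + h * y).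
  have -> : (M 0 0 + M 1 1) ^+ 2 - 4%:R = (M 0 0 - M 1 1) ^+ 2 + 4%:R * (M 0 1 * M 1 0) +
     4%:R * (M 0 0 * M 1 1 - M 0 1 * M 1 0 - 1) by ring.
  rewrite hr ea eb ec ed /disc.
  (* As s > 0, the error of the determinant is divisible by h^3. *)
  have -> : h ^+ (2 * s).+1 = h ^+ 2 * (h * h ^+ (2 * s - 2)).
    by rewrite -exprS -exprD; congr (h ^+ _); lia.
  set u := h ^+ (2 * s - 2).
  exists (2%:R * (N 0 0 - N 1 1) * (a - d) + h * (a - d) ^+ 2 +
     4%:R * (N 0 1 * c + b * N 1 0 + h * b * c) + 4%:R * u * r).
  by ring.
have [x hx] : exists x, (disc N + h * y) ^+ s = disc N ^+ s + h * x.
  rewrite exprDn big_ord_recl subn0 bin0 expr0 mulr1 mulr1n.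
  have [x hx] : dvh 1 (\sum_(i < s) disc N ^+ (s - lift ord0 i) * (h * y) ^+ lift ord0 i *+ 'C(s, lift ord0 i)).
    apply: dvh_sum => i _; rewrite lift0 -mulr_natl.
    by exists ('C(s, i.+1)%:R * disc N ^+ (s - i.+1) * y * (h * y) ^+ i); rewrite [(h * y) ^+ i.+1]exprS; ring.
  by exists x; rewrite hx expr1.
rewrite hy exprMn hx -exprM in h2.
have [q1 e1] := h1; have [q2 e2] := h2.
exists (q1 + q2 - 2%:R * x).
have -> : theta M = (theta M - cheb_sum (M 0 0 + M 1 1) s) + cheb_sum (M 0 0 + M 1 1) s by ring.
have -> : cheb_sum (M 0 0 + M 1 1) s = h ^+ (2 * s).+1 * q2 - 2%:R * (h ^+ (2 * s) * (disc N ^+ s + h * x)).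
  by rewrite -e2; ring.
rewrite (_ : theta M - _ = h ^+ (2 * s).+1 * q1); last first.
  by rewrite -e1 -[cheb_sum (M 0 0 + M 1 1) s in RHS](addrK (2%:R * (h ^+ (2 * s) * (disc N ^+ s + h * x)))) e2.
by rewrite exprS; ring.
Qed.

End FirstOrder.

(** * The value of the link *)

Section Kernels.
Variables (R : comNzRingType) (h : R) (X J : finType).
Local Notation dvh := (dvh h).
Implicit Types (T U : X -> X -> R) (f : X -> R).

Definition kop T f : X -> R := fun g => \sum_g' T g g' * f g'.

Lemma kop_dvh N (T : J -> X -> X -> R) (js : seq J) f g : (forall j g g', dvh N (T j g g')) ->
  dvh (N * size js) (foldr (fun j f => kop (T j) f) f js g).
Proof.
move=> hT; elim: js g => [|j js IH] g /=; first by exists (f g); rewrite muln0 expr0 mul1r.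
by apply: dvh_sum => g' _; rewrite mulnS; apply: dvhM.
Qed.

(** Operators are exchanged one at a time; all the others still contribute their power of [h], and
    the exchanged one gains one more. *)
Lemma kop_cong N (T U : J -> X -> X -> R) (js : seq J) f g :
  (forall j g g', dvh N (T j g g')) -> (forall j g g', dvh N (U j g g')) ->
  (forall j g g', dvh N.+1 (T j g g' - U j g g')) ->
  dvh (N * size js).+1 (foldr (fun j f => kop (T j) f) f js g - foldr (fun j f => kop (U j) f) f js g).
Proof.
move=> hT hU hTU; elim: js g => [|j js IH] g /=; first by rewrite subrr; exact: dvh0.
rewrite /kop -sumrB; apply: dvh_sum => g' _.
set F := foldr _ _ js; set G := foldr _ _ js.
have -> : T j g g' * F g' - U j g g' * G g' = (T j g g' - U j g g') * F g' + U j g g' * (F g' - G g') by ring.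
apply: dvhD; rewrite mulnS.
  by rewrite -addSn; apply: dvhM => //; exact: kop_dvh.
by rewrite -addnS; apply: dvhM => //; exact: IH.
Qed.

End Kernels.

Section Assembly.
Variables (R : comNzRingType) (h : R) (p m n : nat) (vz : int -> R) (qint : nat -> R) (qbin : nat -> nat -> R).
Hypothesis p_pr : prime p.
Hypothesis p_ge5 : (5 <= p)%N.
Local Notation s := (sp p).
Hypothesis vz0 : vz 0 = 1.
Hypothesis vzD : forall a b, vz (a + b) = vz a * vz b.
Hypothesis vz_p : forall a, vz (a * p%:Z) = 1.
Hypothesis h_inj : forall k, injective ( *%R (h ^+ k)).
Variable pu : R.
Hypothesis puE : p%:R = h ^+ p.-1 * pu.
Hypothesis lamD : forall f, inA vz f -> dvh h (2 * s) (lam p vz qint f).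
Hypothesis lamC : forall f g, congA h vz f g ->
  exists r, lam p vz qint f = lam p vz qint g + h ^+ (2 * s).+1 * r.
Hypothesis vz_1 : forall k, exists r, vz k = 1 + h * r.
Hypothesis qbin_bin : forall a b, exists r, qbin a b = 'C(a, b)%:R + h * r.
Variables (eb : int -> int -> R) (wb : int -> R).
Hypothesis ebE : forall z mu, h * (h * eb z mu) = epsz vz z mu.
Hypothesis wbE : forall mu, 1 + h * wb mu = vz mu.
Variable wgt : bvec p -> R.
Hypothesis wgtE : forall x, exists r, wgt x = (2 * tag x).+1%:R + h * r.
Variable cs : 'I_m -> seq ((bool * bool) * 'I_n).
Local Notation S := {mpoly R[m * 3]}.
Local Notation gst := {ffun 'I_n -> bvec p}.
Local Notation pmom := (pmom p vz qint eb wb).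
Local Notation formsite := (@formsite R h p m n).
Local Notation dvh := (dvh h).

Definition Tver j (g g' : gst) : R := if Wt g' == Wt g then lam p vz qint (Ver vz qbin (cs j) g g') else 0.

Definition Tsym j (g g' : gst) : R :=
  if Wt g' == Wt g then lam p vz qint (fun z mu => symprod (atpt vz (site (cs j)) z mu) g g') else 0.

Lemma Tver_dvh j g g' : dvh (2 * s) (Tver j g g').
Proof.
rewrite /Tver; case: ifP => _; last exact: dvh0.
by apply: lamD; case: (ac_Ver p_pr p_ge5 vz0 vzD vz_1 qbin_bin (cs j) g g').
Qed.

Lemma Tsym_dvh j g g' : dvh (2 * s) (Tsym j g g').
Proof.
rewrite /Tsym; case: ifP => _; last exact: dvh0.
by apply: lamD; case: (ac_Ver p_pr p_ge5 vz0 vzD vz_1 qbin_bin (cs j) g g').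
Qed.

Lemma Tver_Tsym j g g' : dvh (2 * s).+1 (Tver j g g' - Tsym j g g').
Proof.
rewrite /Tver /Tsym; case: ifP => _; last by rewrite subrr; exact: dvh0.
have [_ _ /lamC[r ->]] := ac_Ver p_pr p_ge5 vz0 vzD vz_1 qbin_bin (cs j) g g'.
by exists r; rewrite addrAC subrr add0r.
Qed.

Definition Mtot (js : seq 'I_m) k : 'M[S]_2 := foldr (fun j M => M *m formsite j (cs j) k) 1%:M js.

(** The functional is multiplicative over distinct relators, so the composite of the operators of
    the relators is one functional applied to a product of matrices. *)
Lemma lext_foldr (js : seq 'I_m) (g g0 : gst) : uniq js ->
  lext pmom [set j in js] (symprod (Mtot js) g g0) =
  foldr (fun j f => kop (Tsym j) f) (delta R g0) js g.
Proof.
elim: js g => [|j js IH] g /=.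
  move=> _; rewrite symprod1 /delta.
  have -> : (g == g0)%:R = ((g == g0)%:R : R)%:MP :> S by rewrite rmorph_nat.
  by rewrite -[_%:MP]mulr1 lextMC -mpolyC1 /lext msuppC oner_eq0 big_seq1 mcoeffC eqxx mulr1 mul1r /cmon big1 ?mulr1 // => i; rewrite inE.
move=> /andP[jjs ujs]; rewrite -symprod_mul lext_sum; apply: eq_bigr => g' _.
have av j1 j2 g1 g2 : j2 != j1 -> avoids j2 (symprod (formsite j1 (cs j1)) g1 g2).
  move=> nj; have := gr_symprod (g := g1) (g' := g2) (fun k => @formsite_avoids R h p m n j1 j2 (cs j1) k nj).
  by rewrite mul0r.
rewrite set_cons lext_indep ?inE //; last 2 first.
- by move=> j' nj; exact: av.
- move=> j'; rewrite inE => nj'.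
  have hM k : grmx 1 1 1 j' 0 (Mtot js k).
    rewrite /Mtot; elim: (js) nj' => [|j1 l IHl] /=; first by move=> _; exact: grmx1.
    rewrite inE negb_or => /andP[n1 n2]; apply: grmx_mul; first exact: IHl.
    exact: formsite_avoids.
  by have := gr_symprod (g := g') (g' := g0) hM; rewrite mul0r.
rewrite IH //; congr (_ * _).
exact: (@lext_formsite R h p m n vz qint (prime_gt0 p_pr) vz0 vzD vz_p h_inj eb wb ebE wbE).
Qed.

Definition Zker : R := \sum_(g : gst) (\prod_k wgt (g k)) *
  foldr (fun j f => kop (Tver j) f) (delta R g) (enum 'I_m) g.

Lemma Zker_dvh : dvh (2 * s * m) Zker.
Proof.
apply: dvh_sum => g _; apply: dvhMl.
have := @kop_dvh R h _ _ (2 * s) Tver (enum 'I_m) (delta R g) g Tver_dvh.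
by rewrite size_enum_ord.
Qed.

Lemma Zker_lext : dvh (2 * s * m).+1
  (Zker - lext pmom [set: 'I_m] (\prod_k theta s (Mtot (enum 'I_m) k))).
Proof.
have -> : \prod_k theta s (Mtot (enum 'I_m) k) =
   \sum_(g : gst) (\prod_k (2 * tag (g k)).+1%:R) * symprod (Mtot (enum 'I_m)) g g.
  by rewrite (symprod_trace p_pr p_ge5).
rewrite lext_sum -sumrB; apply: dvh_sum => g _.
have -> : \prod_k (2 * tag (g k)).+1%:R = ((\prod_k (2 * tag (g k)).+1%:R : R))%:MP :> S.
  by rewrite rmorph_prod; apply: eq_bigr => k _; rewrite rmorph_nat.
have eS : [set: 'I_m] = [set j in enum 'I_m] by apply/setP => j; rewrite !inE mem_enum.
rewrite lextMC eS lext_foldr ?enum_uniq //.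
set F := foldr _ _ _ g; set G := foldr _ _ _ g.
have hF : dvh (2 * s * m) F.
  by have := @kop_dvh R h _ _ (2 * s) Tver (enum 'I_m) (delta R g) g Tver_dvh; rewrite size_enum_ord.
have hFG : dvh (2 * s * m).+1 (F - G).
  have := @kop_cong R h _ _ (2 * s) Tver Tsym (enum 'I_m) (delta R g) g Tver_dvh Tsym_dvh Tver_Tsym.
  by rewrite size_enum_ord.
have [r hr] : exists r, \prod_k wgt (g k) = \prod_k (2 * tag (g k)).+1%:R + h * r.
  apply: (big_ind2 (fun x y => exists r, x = y + h * r)) => [|x1 x2 y1 y2 [r1 ->] [r2 ->]|k _]; last exact: wgtE.
    by exists 0; rewrite mulr0 addr0.
  by exists (x2 * r2 + r1 * y2 + h * r1 * r2); ring.
rewrite hr mulrDl -addrA [_ - _]addrC addrA -mulrBr.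
apply: dvhD; first exact: dvhMl.
rewrite -mulrA -add1n; apply: dvhM; first by exists 1; rewrite expr1 mulr1.
exact: dvhMl.
Qed.

End Assembly.

Section ThetaProduct.
Variables (R : comNzRingType) (h : R) (p s m n : nat).
Hypothesis p_pr : prime p.
Hypothesis pE : p = (2 * s).+3.
Hypothesis s_gt0 : (0 < s)%N.
Variable pu : R.
Hypothesis puE : p%:R = h ^+ p.-1 * pu.
Variable wd : 'I_m -> seq ('I_n * bool).
Local Notation S := {mpoly R[m * 3]}.
Local Notation H := (h%:MP : S).
Local Notation Mtot := (@Mtot R h p m n (fun j => flat (wd j))).

Definition Nblk (K : comNzRingType) (j : 'I_m) k : 'M[{mpoly K[m * 3]}]_2 :=
  nsite (flat (wd j)) 'X_(bv j i2) 'X_(bv j i0) 'X_(bv j i1) k.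

Definition Ntot (K : comNzRingType) k := \sum_j Nblk K j k.

Lemma puS : p%:R = H ^+ p.-1 * pu%:MP :> S.
Proof. by rewrite -rmorphXn -rmorphM /= -puE rmorph_nat. Qed.

Lemma formsiteE j cs k : @formsite R h p m n j cs k =
  site cs (1 + H * 'X_(bv j i2)) ((1 + H * 'X_(bv j i2)) ^+ p.-1) (H * 'X_(bv j i0)) (H * 'X_(bv j i1)) k.
Proof. by rewrite /formsite /Wform !mul_mpolyC. Qed.

Lemma Mtot_lin k : mxlin H (Mtot (enum 'I_m) k) (Ntot R k).
Proof.
rewrite /Ntot -big_enum /=; elim: (enum _) => [|j js IH] /=; first by rewrite big_nil; exact: mxlin1.
rewrite big_cons [X in mxlin _ _ X]addrC; apply: mxlin_mul IH _; rewrite formsiteE.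
exact: (site_lin p_pr pE puS).
Qed.

Lemma Mtot_det k : det1h H s (Mtot (enum 'I_m) k).
Proof.
elim: (enum _) => [|j js IH] /=; first exact: det1h_1.
by apply: det1h_mul IH _; rewrite formsiteE; exact: (site_det p_pr pE s_gt0 puS).
Qed.

Lemma theta_prod : exists Q : S, \prod_k theta s (Mtot (enum 'I_m) k) =
  H ^+ (2 * s * n) * (\prod_k (- 2%:R * disc (Ntot R k) ^+ s) + H * Q).
Proof.
have e k : exists r, theta s (Mtot (enum 'I_m) k) = H ^+ (2 * s) * (- 2%:R * disc (Ntot R k) ^+ s + H * r).
  have [r hr] := theta_lin p_pr pE s_gt0 puS (Mtot_det k) (Mtot_lin k); exists r.
  by rewrite -[LHS](subrK (H ^+ (2 * s) * (- 2%:R * disc (Ntot R k) ^+ s))) hr exprSr; ring.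
have /fin_all_exists[r hr] := e.
rewrite (eq_bigr _ (fun k _ => hr k)) big_split /= prodr_const card_ord -exprM.
have [Q hQ] : exists Q, \prod_k (- 2%:R * disc (Ntot R k) ^+ s + H * r k) =
   \prod_k (- 2%:R * disc (Ntot R k) ^+ s) + H * Q.
  apply: (big_ind2 (fun x y => exists Q, x = y + H * Q)) => [|x1 x2 y1 y2 [r1 ->] [r2 ->]|k _].
  - by exists 0; rewrite mulr0 addr0.
  - by exists (x2 * r2 + r1 * y2 + H * r1 * r2); ring.
  - by exists (r k).
by exists Q; rewrite hQ.
Qed.

End ThetaProduct.

Section LextMorphism.
Variables (K L : comNzRingType) (f : {rmorphism K -> L}) (m : nat) (c1 : nat -> nat -> nat -> K).

Lemma rmorph_lext B (P : {mpoly K[m * 3]}) :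
  f (lext c1 B P) = lext (fun a b c => f (c1 a b c)) B (map_mpoly f P).
Proof.
have -> : map_mpoly f P = \sum_(u <- msupp P) f P@_u *: 'X_[u].
  rewrite [in LHS](mpolyE P) raddf_sum; apply: eq_bigr => u _.
  by rewrite /= map_mpolyZ map_mpolyX.
rewrite lext_sum [in LHS]/lext rmorph_sum; apply: eq_bigr => u _.
by rewrite lextZ lextX rmorphM rmorph_prod.
Qed.

End LextMorphism.

Section Discriminant.
Variables (n m : nat) (wd : 'I_m -> seq ('I_n * bool)).

Definition expsum (E : finType) (w : seq (E * bool)) (e : E) : int := \sum_(l <- w | l.1 == e) (-1) ^+ l.2.

Lemma nsite_cat (K : comNzRingType) (c1 c2 : seq ((bool * bool) * 'I_n)) (w e f : K) k :
  nsite (c1 ++ c2) w e f k = nsite c1 w e f k + nsite c2 w e f k.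
Proof. by rewrite /nsite big_cat. Qed.

(** To first order, the passages over the lower strands cancel with the way back. The two crossings
    of the clasp add a lower and an upper triangular matrix to a traceless one with doubled
    diagonal. *)
Lemma nsite_flat (K : comNzRingType) (v : seq ('I_n * bool)) (w e f : K) k :
  nsite (flat v) w e f k = - (expsum v k)%:~R *: mx2 (2%:R * w) f e (- (2%:R * w)).
Proof.
rewrite /expsum; elim: v => [|l v IH].
  by rewrite /nsite !big_nil oppr0 scale0r.
rewrite /flat /= nsite_cat -/(flat v) IH big_cons.
have -> : nsite (flat1 l) w e f k = if l.1 == k then - ((-1) ^+ l.2)%:~R *: mx2 (2%:R * w) f e (- (2%:R * w)) else 0.
  rewrite /flat1 !nsite_cat addrCA.
  have -> : nsite [seq (false, false, i) | i <- low n l.1] w e f k +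
     nsite [seq (false, true, i) | i <- rev (low n l.1)] w e f k = 0.
    rewrite map_rev /nsite [X in _ + X](perm_big [seq (false, true, i) | i <- low n l.1]) /=; last first.
      by rewrite perm_rev.
    rewrite !big_map /=.
    rewrite -big_split big1 //= => i _; rewrite /nmat /= scaleN1r scale1r addNr //.
  rewrite addr0; case: l => [k' b] /=.
  rewrite /nsite; case: b; rewrite !big_cons big_nil /=; case: (k' == k); rewrite ?addr0 //;
    rewrite /nmat /nlow /nup /= !scale_mx2; apply/matrixP => i j; rewrite !mxE;
    by case: (i == 0); case: (j == 0); rewrite ?rmorphN ?rmorph1 /=; ring.
by case: ifP => _; rewrite ?add0r // rmorphD opprD scalerDl.
Qed.

End Discriminant.

Section DiscriminantModp.
Variables (p n : nat) (wd : 'I_n -> seq ('I_n * bool)).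
Hypothesis p_pr : prime p.
Hypothesis p_ge5 : (5 <= p)%N.
Local Notation K := ('F_p).
Local Notation S := {mpoly K[n * 3]}.

Definition emx : 'M[K]_n := \matrix_(j, k) (expsum (wd j) k)%:~R.

Lemma disc_qform k : disc (Ntot wd K k) = 4%:R * qform emx k :> S.
Proof.
pose z j : S := (expsum (wd j) k)%:~R.
have zE j P : emx j k *: P = z j * P by rewrite mxE scaler_int /z mulrzl.
pose L a : S := \sum_j z j * 'X_(bv j a).
have nt i j : Ntot wd K k i j = mx2 (- (2%:R * L i2)) (- L i1) (- L i0) (2%:R * L i2) i j.
  rewrite /Ntot /L summxE !mxE.
  under eq_bigr => j0 _ do rewrite /Nblk nsite_flat mxE -/(z j0) mxE.
  by case: (i == 0); case: (j == 0); rewrite ?mulr_sumr -?sumrN; apply: eq_bigr => j0 _; ring.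
rewrite /disc !nt !mxE /=.
have qe : qform emx k = 4%:R * (L i2 * L i2) + L i0 * L i1.
  have two : 2%:R != 0 :> K by apply: natF_neq0 => //; lia.
  have LL a b : \sum_j \sum_l (z j * z l) * ('X_(bv j a) * 'X_(bv l b)) = L a * L b.
    rewrite /L mulr_suml; apply: eq_bigr => j _; rewrite mulr_sumr; apply: eq_bigr => l _.
    by rewrite mulrACA.
  have h2 : (2%:R^-1)%:MP * 2%:R = 1 :> S.
    by rewrite -(rmorph_nat (@mpolyC _ _)) -rmorphM /= mulVf // mpolyC1.
  transitivity (4%:R * (L i2 * L i2) + (2%:R^-1)%:MP * (L i0 * L i1 + L i1 * L i0)); last first.
    rewrite [L i1 * _]mulrC; congr (_ + _).
    have -> : L i0 * L i1 + L i0 * L i1 = 2%:R * (L i0 * L i1) by ring.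
    by rewrite !mulrA h2 mul1r.
  rewrite -!LL -big_split /= !mulr_sumr -big_split /=; apply: eq_bigr => j _.
  rewrite -big_split /= !mulr_sumr -big_split /=; apply: eq_bigr => l _.
  rewrite /gram -scalerA zE -[emx l k *: _]/(_ *: _) zE scalerDr -!mul_mpolyC.
  by ring.
by rewrite qe; ring.
Qed.

End DiscriminantModp.

Section CongruenceModulo.
Variables (R : comNzRingType) (h : R).

Definition fo (x y : R) := exists r, x = y + h * r.

Lemma fo_refl x : fo x x. Proof. by exists 0; rewrite mulr0 addr0. Qed.

Lemma foD x1 x2 y1 y2 : fo x1 x2 -> fo y1 y2 -> fo (x1 + y1) (x2 + y2).
Proof. by move=> [r ->] [q ->]; exists (r + q); rewrite mulrDr addrACA. Qed.

Lemma foM x1 x2 y1 y2 : fo x1 x2 -> fo y1 y2 -> fo (x1 * y1) (x2 * y2).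
Proof. by move=> [r ->] [q ->]; exists (x2 * q + r * y2 + h * r * q); ring. Qed.

Lemma inverse_first_order (x y r q : R) : (forall z, h * z = 0 -> z = 0) -> x * y = 1 ->
  x = 1 + h * r -> y = 1 + h * q -> r + q = - (h * (r * q)).
Proof.
move=> reg xy ex ey; apply/eqP; rewrite -subr_eq0 opprK; apply/eqP/reg.
by transitivity (x * y - 1); [rewrite ex ey; ring | rewrite xy subrr].
Qed.

End CongruenceModulo.

(** * Specialization to the root of unity *)

Section LinkValue.
Variable p : nat.
Hypothesis p_pr : prime p.
Hypothesis p_ge5 : (5 <= p)%N.
Local Notation R := (Rp p).
Local Notation h := (hv p).
Local Notation s := (sp p).
Local Notation vz := (Defs.vz p).
Local Notation phim := (phim p_pr).
Local Notation fo := (fo h).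

Lemma vz_first_order k : fo (vz k) 1.
Proof. by exists (cyc p `|(k %% p%:Z)%Z|); rewrite -cycE /Defs.vz addrC subrK. Qed.

Lemma qint_first_order k : fo (qint p k) k%:R.
Proof.
have -> : k%:R = \sum_(i < k) 1 :> R by rewrite sumr_const card_ord.
rewrite /qint; apply: (big_ind2 fo) => [|x1 x2 y1 y2|i _]; first exact: fo_refl.
- exact: foD.
- exact: vz_first_order.
Qed.

Lemma qbin_first_order a b : fo (qbin p a b) 'C(a, b)%:R.
Proof.
elim: a b => [|a IH] [|b]; try exact: fo_refl.
rewrite qbinSSE binS natrD -['C(a, b.+1)%:R]mul1r -['C(a, b)%:R]mul1r.
by apply: foD; apply: foM; [exact: vz_first_order | exact: IH | exact: vz_first_order | exact: IH].
Qed.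

Lemma wgt_first_order (x : bvec p) : fo (wgt x) (2 * tag x).+1%:R.
Proof.
rewrite /wgt -[(2 * tag x).+1%:R]mulr1; apply: foM; last exact: vz_first_order.
exact: qint_first_order.
Qed.

(** The quotient (v^k - 1)/h, which mod p is [k] itself ([phim_vlog]). *)
Definition vlog (k : int) : R := cyc p `|(k %% p%:Z)%Z|.

Lemma vlogE k : 1 + h * vlog k = vz k.
Proof. by rewrite -cycE /Defs.vz addrC subrK. Qed.

Lemma phim_vlog k : phim (vlog k) = k%:~R.
Proof.
have p0 : p%:Z != 0 by rewrite -lt0n prime_gt0.
rewrite /vlog phim_cyc pmulrn gez0_abs ?modz_ge0 //; apply/eqP.
rewrite -subr_eq0 -rmorphB -(dvdz_pcharf (pchar_Fp p_pr)) -eqz_mod_dvd; apply/eqP.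
by rewrite modz_mod.
Qed.

(** The quotient of [epsz] by h^2: since v^k v^-k = 1, the sum v^k + v^-k is 2 - h^2 times
    [vlog k * vlog (- k)]. *)
Definition epsb (z mu : int) : R := vlog (2 * mu) * vlog (- (2 * mu)) - vlog (2 * z + 1) * vlog (- (2 * z + 1)).

Lemma epsbE z mu : h * (h * epsb z mu) = epsz vz z mu.
Proof.
have e k : vz k + vz (- k) = 1 + 1 - h * (h * (vlog k * vlog (- k))).
  have := inverse_first_order (fun z => @hv_regular p p_pr z) (vzN p_pr k) (esym (vlogE k)) (esym (vlogE (- k))).
  move=> e1; rewrite -!vlogE addrACA -mulrDr e1; congr (_ + _).
  exact: mulrN.
rewrite /epsz /Xx e -addrA -opprD e /epsb mulrBr mulrBr.
move: (h * (h * _)) (h * (h * _)) (1 + 1) => a b c.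
by rewrite opprD opprK addrACA subrr add0r addrC.
Qed.

Lemma phim_epsb z mu : phim (epsb z mu) = (2 * z + 1)%:~R ^+ 2 - (2 * mu)%:~R ^+ 2.
Proof. by rewrite rmorphB !rmorphM !phim_vlog !rmorphN; ring. Qed.

(** With x = 2z + 1 and u = 2mu, [epsb] becomes x^2 - u^2 and [vlog] at mu becomes u/2. *)
Lemma phim_pmom a b c : phim (pmom p vz (qint p) epsb vlog a b c) = ptmom p s a b c.
Proof.
have two : 2%:R != 0 :> 'F_p by apply: natF_neq0 => //; move: p_ge5; lia.
rewrite /pmom /ptmom; case: eqP => _; last by rewrite rmorph0.
rewrite /lam rmorph_sum; apply: eq_bigr => z _; rewrite rmorphM phim_qint; congr (_ * _).
rewrite rmorph_sum; apply: eq_bigr => i _; rewrite rmorphM phim_vz mul1r rmorphM !rmorphXn phim_epsb phim_vlog.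
have e2 : (2 * (z%:Z - i%:Z))%:~R = ou p z i.
  have -> : 2 * (z%:Z - i%:Z) = (2 * z)%N%:Z - (2 * i)%N%:Z by lia.
  by rewrite rmorphB /= -!pmulrn.
have e1 : (2 * z%:Z + 1)%:~R = ox p z.
  have -> : 2 * z%:Z + 1 = (2 * z).+1%:Z by lia.
  by rewrite -pmulrn.
have e3 : (z%:Z - i%:Z)%:~R = ou p z i / 2%:R.
  by apply: (mulIf two); rewrite divfK // -e2 rmorphM /= mulrC.
by rewrite e1 e2 e3.
Qed.

Lemma lam_dvhE f : inA vz f -> dvh h (2 * s) (lam p vz (qint p) f).
Proof.
apply: (@lam_dvh R h p vz p_pr p_ge5 (vzDE p_pr) (vz_p p_pr) _ (pu p) (natr_p_hv p_pr p_ge5) (vdif p)) => //.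
- by move=> k; exact: hvX_inj.
- exact: vdif_unit.
- exact: sum_all_v.
- by move=> n; exact: qint_vdif.
Qed.

Lemma lam_congE f g : congA h vz f g ->
  exists r, lam p vz (qint p) f = lam p vz (qint p) g + h ^+ (2 * s).+1 * r.
Proof.
apply: (@lam_cong R h p vz p_pr p_ge5 (vzDE p_pr) (vz_p p_pr) _ (pu p) (natr_p_hv p_pr p_ge5) (vdif p)) => //.
- by move=> k; exact: hvX_inj.
- exact: vdif_unit.
- exact: sum_all_v.
- by move=> n; exact: qint_vdif.
Qed.

Definition krK (c : bool * bool) : bvec p -> bvec p -> bvec p -> bvec p -> R :=
  if c.1 then (if c.2 then KunV (@braidingV p) else Kun (@braiding p))
  else (if c.2 then KovV (@braidingV p) else Kov (@braiding p)).

Lemma krKE c x y x' y' : krK c x y x' y' = kr vz (vfact p) (qbin p) c x y x' y'.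
Proof.
rewrite /krK /kr; case: c => [[] []] /=.
- by rewrite andbC; exact: overVE.
- by rewrite andbC; exact: overE.
- exact: overVE.
- exact: overE.
Qed.

Lemma vfact_inj i (x y : R) : (i < p)%N -> vfact p i * x = vfact p i * y -> x = y.
Proof.
elim: i x y => [|i IH] x y ip; first by rewrite vfact0E !mul1r.
rewrite vfactSE -!mulrA => e0; have := IH _ _ (ltnW ip) e0.
have [u] := @vdif_unit p p_pr p_ge5 i.+1 ip; rewrite -[vdif p i.+1]/(qdif vz i.+1%:Z) => -> uu.
rewrite -!mulrA => e; apply: (unit_mulI uu); apply: (hvX_inj p_pr (k := 1)).
by rewrite expr1.
Qed.

Variable P : presentation.
Local Notation n := (pgen P).
Local Notation m := (prel P).
Local Notation cs := (fun j : 'I_m => flat (relator j)).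

Lemma Zlink_Zker : Zlink p (link P) = @Zker R p m n vz (qint p) (qbin p) (@wgt p) cs.
Proof.
rewrite Zlink_trace //; apply: eq_bigr => g _; congr (_ * _).
congr (_ g); elim: (enum _) => [//|j js IH] /=; rewrite IH.
apply: funext => g0; rewrite (@relT_Ver R p n vz (vfact p) (qbin p) p_pr p_ge5 vfact_inj krK _ (qint p)) //.
move=> c x y x' y'; rewrite krKE.
apply: (@kr_gauge R p vz (qint p) (qfact p) (vfact p) (qbin p)) => //.
- exact: qint_unit.
- exact: qfact0E.
- by move=> k; exact: qfactSE.
- exact: qbin_fact.
- exact: vfact0E.
- by move=> k; exact: vfactSE.
- exact: qint_difE.
Qed.

End LinkValue.

Section DiscriminantMorphism.
Variables (K L : comNzRingType) (f : {rmorphism K -> L}).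

Lemma rmorph_disc (N : 'M[K]_2) : f (disc N) = disc (map_mx f N).
Proof. by rewrite /disc rmorphD rmorphXn rmorphB !rmorphM rmorph_nat !mxE. Qed.

Lemma rmorph_discX s (N : 'M[K]_2) : f (- 2%:R * disc N ^+ s) = - 2%:R * disc (map_mx f N) ^+ s.
Proof. by rewrite rmorphM rmorphN rmorph_nat rmorphXn rmorph_disc. Qed.

Lemma rmorph_disc_prod s n (N : 'I_n -> 'M[K]_2) :
  f (\prod_k (- 2%:R * disc (N k) ^+ s)) = \prod_k (- 2%:R * disc (map_mx f (N k)) ^+ s).
Proof. by rewrite rmorph_prod; apply: eq_bigr => k _; exact: rmorph_discX. Qed.

Lemma map_nmat c (w e f' : K) : map_mx f (nmat c w e f') = nmat c (f w) (f e) (f f').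
Proof.
rewrite /nmat map_mxZ; congr (_ *: _); first by case: (c.2); rewrite ?rmorphN rmorph1.
by case: (c.1); rewrite map_mx2 rmorphN ?rmorph0.
Qed.

Lemma map_nsite n (cs : seq ((bool * bool) * 'I_n)) (w e f' : K) k :
  map_mx f (nsite cs w e f' k) = nsite cs (f w) (f e) (f f') k.
Proof. by rewrite /nsite map_mx_sum; apply: eq_bigr => c _; exact: map_nmat. Qed.

End DiscriminantMorphism.

Section PowerExtraction.
Variables (R : comNzRingType) (h : R).

Lemma expr_extract (r : R) N a b : (0 < N)%N -> (a < b)%N ->
  h ^+ (N * b) * r = h ^+ (N * a) * (h * (h ^+ (N * (b - a)).-1 * r)).
Proof.
move=> N0 ab; rewrite [h * _]mulrA -exprS [RHS]mulrA -exprD.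
have e : (0 < N * (b - a))%N by rewrite muln_gt0 N0 subn_gt0.
by rewrite prednK // -mulnDr subnKC // ltnW.
Qed.

Lemma expr_collect (z l t q r : R) N : z - l = h ^+ N.+1 * r -> l = h ^+ N * (t + h * q) ->
  z = h ^+ N * (t + h * (q + r)).
Proof. by move=> zl e; rewrite -[LHS](subrK l) zl e exprS; ring. Qed.

Lemma scaled_power (c d q : R) N : d = 4%:R * q -> c * d ^+ N = c * 4%:R ^+ N * q ^+ N.
Proof. by move=> ->; rewrite exprMn mulrA. Qed.

End PowerExtraction.

Section PresentationValue.
Variable p : nat.
Hypothesis p_pr : prime p.
Hypothesis p_ge5 : (5 <= p)%N.
Local Notation R := (Rp p).
Local Notation h := (hv p).
Local Notation s := (sp p).
Local Notation phim := (phim p_pr).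

Lemma sp_gt0 : (0 < s)%N.
Proof. by have := spE p_pr p_ge5; move: p_ge5; lia. Qed.

Lemma X02_inv : exists e y : R, [/\ X02 p = h ^+ (2 * s) * e, e * y = 1 & phim y = 4%:R].
Proof.
have [e [-> [y ey] e4]] := X02_hv p_pr p_ge5; exists e, y; split=> //.
have := congr1 phim ey; rewrite rmorphM rmorph1 => e1.
transitivity (4%:R * (phim e * phim y)); first by rewrite mulrA e4 mul1r.
by rewrite e1 mulr1.
Qed.

(** The unit part of X_0^2 reduces to 1/4, hence the factor 4 for each generator. *)
Lemma ZQ_intro (P : presentation) (r : R) (a : 'F_p) :
  Zlink p (link P) = h ^+ (2 * s * pgen P) * r -> 4%:R ^+ pgen P * phim r = a -> pres_ZQ P a.
Proof.
move=> Zr <-; have [e [w [eX ew w4]]] := X02_inv.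
exists (w ^+ pgen P * r); last by rewrite -(phimE p_pr) rmorphM rmorphXn w4.
rewrite Zr eX exprMn -exprM -mulrA; congr (_ * _).
by rewrite mulrA -exprMn ew expr1n mul1r.
Qed.

Lemma pres_ZQ_lt (P : presentation) : (pgen P < prel P)%N -> pres_ZQ P (0 : 'F_p).
Proof.
move=> lt; have := @Zker_dvh R h p (prel P) (pgen P) (Defs.vz p) (qint p) (qbin p) p_pr p_ge5 (vz0E p_pr) (vzDE p_pr)
  (lam_dvhE p_pr p_ge5) (@vz_first_order p) (@qbin_first_order p) (@wgt p) (fun j => flat (relator j)).
rewrite -Zlink_Zker // => -[r Zr].
apply: (@ZQ_intro P (h * (h ^+ (2 * s * (prel P - pgen P)).-1 * r))).
  rewrite Zr; apply: expr_extract => //.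
  by rewrite muln_gt0 /= sp_gt0.
by rewrite rmorphM phim_hv mul0r mulr0.
Qed.

Lemma pres_ZQ_eq n (rel : 'I_n -> seq ('I_n * bool)) :
  pres_ZQ (Presentation rel) (\det (emx p rel) ^+ (2 * s)).
Proof.
have sp0 := sp_gt0.
have := @Zker_lext R h p n n (Defs.vz p) (qint p) (qbin p) p_pr p_ge5 (vz0E p_pr) (vzDE p_pr) (vz_p p_pr)
  (fun k => @hvX_inj p p_pr k) (lam_dvhE p_pr p_ge5) (lam_congE p_pr p_ge5) (@vz_first_order p) (@qbin_first_order p)
  (@epsb p) (@vlog p) (epsbE p_pr) (@vlogE p) (@wgt p) (@wgt_first_order p) (fun j => flat (rel j)).
have := @Zlink_Zker p p_pr p_ge5 (Presentation rel); rewrite [pgen _]/= [prel _]/= => <- [r Zr].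
have [Q tQ] := @theta_prod R h p s n n p_pr (spE p_pr p_ge5) sp0 (pu p) (natr_p_hv p_pr p_ge5) rel.
set L := lext _ _ in Zr; rewrite tQ in Zr.
pose T : {mpoly R[n * 3]} := \prod_k (- 2%:R * disc (Ntot rel R k) ^+ s).
have LE : L (h%:MP ^+ (2 * s * n) * (T + h%:MP * Q)) = h ^+ (2 * s * n) * (L T + h * L Q).
  by rewrite -rmorphXn /L lextMC lextD lextMC.
apply: (@ZQ_intro _ (L T + h * (L Q + r))).
  exact: expr_collect Zr LE.
rewrite rmorphD rmorphM phim_hv mul0r addr0 /= /L.
have -> : phim (lext (pmom p (Defs.vz p) (qint p) (@epsb p) (@vlog p)) [set: 'I_n] T) =
   lext (ptmom p s) [set: 'I_n] (map_mpoly phim T).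
  rewrite rmorph_lext; congr (lext _ _ _).
  by apply: funext => a; apply: funext => b; apply: funext => c; exact: phim_pmom.
(* Mod p every discriminant is 4 times the quadratic form at a column of exponent sums. *)
have -> : map_mpoly phim T = ((- 2%:R * 4%:R ^+ s) ^+ n)%:MP * \prod_k qform (emx p rel) k ^+ s.
  pose fm : {rmorphism {mpoly R[n * 3]} -> {mpoly 'F_p[n * 3]}} := map_mpoly phim.
  have eN k : map_mx fm (Ntot rel R k) = Ntot rel 'F_p k.
    rewrite /Ntot map_mx_sum; apply: eq_bigr => j _; rewrite /Nblk map_nsite.
    by rewrite /fm /= !map_mpolyX.
  transitivity (\prod_k (- 2%:R * disc (map_mx fm (Ntot rel R k)) ^+ s)); first exact: rmorph_disc_prod.
  have cE : (- 2%:R * 4%:R ^+ s : 'F_p)%:MP = - 2%:R * 4%:R ^+ s :> {mpoly 'F_p[n * 3]}.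
    by rewrite rmorphM rmorphN rmorphXn !rmorph_nat.
  rewrite rmorphXn /= cE -[n in _ ^+ n](card_ord n) -prodr_const -big_split /=.
  apply: eq_bigr => k _; apply: scaled_power.
  by transitivity (disc (Ntot rel 'F_p k)); [congr disc; exact: eN | exact: disc_qform].
rewrite lextMC (gram_det p_pr p_ge5 (spE p_pr p_ge5)) (gram_identity n p_pr p_ge5 (spE p_pr p_ge5)).
(* Per generator the constants are 4, -2 times 4^s, and -1/2, with product 4^(s+1) = 2^(p-1) = 1. *)
rewrite !mulrA -[RHS]mul1r; congr (_ * _); rewrite -!exprMn.
have two : 2%:R != 0 :> 'F_p by apply: natF_neq0 => //; move: p_ge5; lia.
rewrite -[RHS](expr1n _ n); congr (_ ^+ n).
transitivity (4%:R ^+ s.+1 * (2%:R / 2%:R) : 'F_p); first by rewrite exprS; ring.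
have four : 4%:R = 2%:R ^+ 2 :> 'F_p by rewrite -natrX.
rewrite divff // mulr1 four -exprM.
have -> : (2 * s.+1 = p.-1)%N by have := spE p_pr p_ge5; lia.
apply: (mulfI two); rewrite mulr1 -exprS prednK ?prime_gt0 //.
by rewrite -(pFrobenius_autE (pchar_Fp p_pr)) pFrobenius_aut_nat.
Qed.

End PresentationValue.

(** * Homology and 2-deformations *)

Section ChainEquivalence.
Local Open Scope classical_set_scope.

Definition bundle (V W : zmodType) (f : V -> W) (h : zmod_morphism f) : {additive V -> W} :=
  HB.pack f (GRing.isZmodMorphism.Build V W f h).

Definition kerset (V W : zmodType) (d : V -> W) : set V := [set c | d c = 0].

Definition istors (V W : zmodType) (d : V -> W) (c : W) := exists k : nat, (0 < k)%N /\ range d (c *+ k).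

Definition torset (V W : zmodType) (d : V -> W) : set (set W) :=
  [set [set c' | range d (c' - c)] | c in [set c | istors d c]].

Lemma has_rank_sub (V V' : zmodType) (G : set V) (G' : set V') (f : {additive V -> V'}) (g : {additive V' -> V}) r :
  (forall x, G x -> G' (f x) /\ g (f x) = x) -> (forall x, G' x -> G (g x) /\ f (g x) = x) ->
  has_rank G r -> has_rank G' r.
Proof.
move=> hf hg [[c [cG cf]] mx]; split.
  exists (f \o c); split=> [i|a e]; first by case: (hf _ (cG i)).
  apply: cf; transitivity (g (\sum_i (f \o c) i *~ a i)); last by rewrite e raddf0.
  by rewrite raddf_sum; apply: eq_bigr => i _; rewrite raddfMz /=; case: (hf _ (cG i)) => _ ->.
move=> q b bG bf; apply: (mx q (g \o b)) => [i|a e]; first by case: (hg _ (bG i)).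
apply: bf; transitivity (f (\sum_i (g \o b) i *~ a i)); last by rewrite e raddf0.
by rewrite raddf_sum; apply: eq_bigr => i _; rewrite raddfMz /=; case: (hg _ (bG i)) => _ ->.
Qed.

(** Weaker than a chain homotopy equivalence: only cycles and the torsion of the cokernel are
    compared. An expansion by a free edge adds a free summand to the cokernel of [d2], so the last
    two conditions can be asked on torsion only. *)
Definition zequiv (V W V' W' : zmodType) (d : V -> W) (d' : V' -> W') :=
  exists (f : {additive V -> V'}) (g : {additive V' -> V}) (F : {additive W -> W'}) (G : {additive W' -> W}),
    [/\ (forall x, d' (f x) = F (d x)), (forall x, d (g x) = G (d' x)),
        (forall x, d x = 0 -> g (f x) = x) /\ (forall x, d' x = 0 -> f (g x) = x),
        (forall w, istors d w -> range d (G (F w) - w)) &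
        (forall w, istors d' w -> range d' (F (G w) - w))].

Lemma zequiv_sym (V W V' W' : zmodType) (d : V -> W) (d' : V' -> W') : zequiv d d' -> zequiv d' d.
Proof. by move=> [f [g [F [G [h1 h2 [h3 h4] h5 h6]]]]]; exists g, f, G, F. Qed.

Lemma zequiv_rank (V W V' W' : zmodType) (d : V -> W) (d' : V' -> W') r :
  zequiv d d' -> has_rank (kerset d) r -> has_rank (kerset d') r.
Proof.
move=> [f [g [F [G [h1 h2 [h3 h4] _ _]]]]]; apply: (@has_rank_sub _ _ _ _ f g) => x dx.
  by split; [rewrite /kerset /= h1 dx raddf0 | exact: h3].
by split; [rewrite /kerset /= h2 dx raddf0 | exact: h4].
Qed.

Lemma zequiv_torset_le (V W V' W' : zmodType) (d : {additive V -> W}) (d' : {additive V' -> W'}) :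
  zequiv d d' -> (torset d #<= torset d')%card.
Proof.
move=> [f [g [F [G [h1 h2 _ h5 _]]]]].
have FI w : range d w -> range d' (F w) by move=> [x _ <-]; exists (f x).
have GI w : range d' w -> range d (G w) by move=> [x _ <-]; exists (g x).
have rD (A B : zmodType) (e : {additive A -> B}) x y : range e x -> range e y -> range e (x + y).
  by move=> [a _ <-] [b _ <-]; exists (a + b) => //; rewrite raddfD.
have rN (A B : zmodType) (e : {additive A -> B}) x : range e x -> range e (- x).
  by move=> [a _ <-]; exists (- a) => //; rewrite raddfN.
pose h (C : set W) : set W' := [set w' | exists2 w, C w & range d' (w' - F w)].
have hE c : h [set c' | range d (c' - c)] = [set w' | range d' (w' - F c)].
  apply/seteqP; split=> w' /=.
    move=> [w wc ww]; have -> : w' - F c = (w' - F w) + F (w - c) by rewrite raddfB /= addrA subrK.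
    by apply: (rD) => //; exact: FI.
  by move=> ww; exists c => //; exists 0 => //; rewrite raddf0 subrr.
have inj : {in torset d &, injective h}.
  move=> C1 C2; rewrite !inE => -[c1 t1 <-] [c2 t2 <-]; rewrite !hE => e.
  have : [set w' | range d' (w' - F c2)] (F c1).
    by rewrite -e /=; exists 0 => //; rewrite raddf0 subrr.
  move=> /= /GI; rewrite !raddfB /= => r12.
  have c12 : range d (c1 - c2).
    have -> : c1 - c2 = (G (F c1) - G (F c2)) - (G (F c1) - c1) + (G (F c2) - c2).
      by rewrite opprB [_ - _ + _]addrC !subrKA.
    by apply: (rD); [apply: (rD) => //; apply: (rN); exact: h5 | exact: h5].
  apply/seteqP; split=> w /= wr.
    by have -> : w - c2 = (w - c1) + (c1 - c2); [rewrite addrA subrK | exact: (rD)].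
  by have -> : w - c1 = (w - c2) - (c1 - c2); [rewrite opprB addrA subrK | apply: (rD) => //; exact: (rN)].
have := inj_card_eq inj; rewrite card_eq_sym => /card_eqPle[le _].
apply: card_le_trans le _; apply: subset_card_le => D [C [c [k [k0 kc]] <-] <-].
exists (F c); last by rewrite hE.
by exists k; split=> //; rewrite -raddfMn; exact: FI.
Qed.

Lemma zequiv_torset (V W V' W' : zmodType) (d : {additive V -> W}) (d' : {additive V' -> W'}) :
  zequiv d d' -> (torset d #= torset d')%card.
Proof. by move=> e; apply/card_eqPle; split; apply: zequiv_torset_le => //; exact: zequiv_sym. Qed.

End ChainEquivalence.

Section BoundaryMaps.
Variable X : complex2.

Lemma d2E (c : {ffun face X -> int}) e : d2 c e = \sum_f c f * expsum (attach f).2 e.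
Proof. by rewrite ffunE. Qed.

Lemma d2_zmod : zmod_morphism (@d2 X).
Proof.
move=> x y; apply/ffunP => e; rewrite !ffunE -sumrB; apply: eq_bigr => f _.
by rewrite !ffunE mulrBl.
Qed.

Definition dd2 : {additive {ffun face X -> int} -> {ffun edge X -> int}} := bundle d2_zmod.

Lemma expsum_walk (u u' v : vert X) (w : seq (edge X * bool)) : walk (@src X) (@tgt X) u w u' ->
  \sum_e expsum w e * ((tgt e == v)%:R - (src e == v)%:R) = (u' == v)%:R - (u == v)%:R.
Proof.
elim: w u => [|l w IH] u /=.
  move=> /eqP->; rewrite subrr big1 // => e _; by rewrite /expsum big_nil mul0r.
move=> /andP[/eqP su /IH h].
have -> : \sum_e expsum (l :: w) e * ((tgt e == v)%:R - (src e == v)%:R) =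
   (-1) ^+ l.2 * ((tgt l.1 == v)%:R - (src l.1 == v)%:R) + \sum_e expsum w e * ((tgt e == v)%:R - (src e == v)%:R).
  rewrite (bigD1 l.1) //= [in RHS](bigD1 l.1) //= addrA; congr (_ + _).
    by rewrite /expsum big_cons eqxx mulrDl.
  by apply: eq_bigr => e el; rewrite /expsum big_cons eq_sym (negbTE el).
rewrite h -su /letter_src /letter_tgt; case: (l.2); rewrite ?expr1 ?expr0; ring.
Qed.

Lemma d1d2 (c : {ffun face X -> int}) : d1 (d2 c) = 0.
Proof.
apply/ffunP => v; rewrite !ffunE; under eq_bigr => e _ do rewrite d2E mulr_suml.
rewrite exchange_big big1 // => f _.
under eq_bigr => e _ do rewrite -mulrA.
by rewrite -mulr_sumr (expsum_walk v (attachP f)) subrr mulr0.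
Qed.

Local Open Scope classical_set_scope.

(** A chain with a multiple that is a boundary is itself a cycle, because 0-chains have no torsion;
    so [d1] can be forgotten. *)
Lemma H1_torsionE : H1_torsion X = torset dd2.
Proof.
rewrite /H1_torsion /torset; congr (image _ _); apply/seteqP; split=> c /=; first by case.
move=> [k [k0 [x _ dx]]]; split; last by exists k; split=> //; exists x.
have e : d1 c *+ k = 0.
  rewrite -(d1d2 x) (_ : d2 x = c *+ k) //; apply/ffunP => v; rewrite ffunMnE !ffunE -sumrMnl.
  by apply: eq_bigr => e _; rewrite ffunMnE mulrnAl.
apply/ffunP => v; have := congr1 (fun t : {ffun vert X -> int} => t v) e.
rewrite ffunMnE !ffunE => /eqP; rewrite mulrn_eq0 => /orP[/eqP k0'|/eqP//].
by rewrite k0' in k0.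
Qed.

Lemma H2E : H2 X = kerset dd2. Proof. by []. Qed.

End BoundaryMaps.

Lemma big_option (R : Type) (idx : R) (op : Monoid.com_law idx) (I : finType) (h : option I -> R) :
  \big[op/idx]_x h x = op (h None) (\big[op/idx]_i h (Some i)).
Proof.
rewrite (bigD1 None) //=; congr (op _ _).
rewrite (reindex_omap Some id) => [|[] //].
by apply: eq_bigl => i; rewrite /= eqxx.
Qed.

Section WordBoundary.

Lemma expsum_nil (E : finType) (e : E) : expsum [::] e = 0.
Proof. by rewrite /expsum big_nil. Qed.

Lemma expsum_cons (E : finType) (l : E * bool) w e : expsum (l :: w) e = (if l.1 == e then (-1) ^+ l.2 else 0) + expsum w e.
Proof. by rewrite /expsum big_cons; case: (l.1 == e); rewrite ?add0r. Qed.

Lemma expsum_cat (E : finType) (w w' : seq (E * bool)) e : expsum (w ++ w') e = expsum w e + expsum w' e.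
Proof. by rewrite /expsum big_cat. Qed.

Lemma expsum_winv (E : finType) (w : seq (E * bool)) e : expsum (winv w) e = - expsum w e.
Proof.
elim: w => [|l w IH]; first by rewrite /winv /= !expsum_nil oppr0.
rewrite /winv /= rev_cons -cats1 expsum_cat -[rev _]/(winv w) IH !expsum_cons expsum_nil addr0 /= opprD addrC.
by congr (_ + _); case: (l.1 == e); rewrite ?oppr0 //; case: (l.2); rewrite ?expr0 ?expr1 ?opprK.
Qed.

Lemma expsum_map_word (E E' : finType) (h : E -> E') (w : seq (E * bool)) e :
  injective h -> expsum (map_word h w) (h e) = expsum w e.
Proof. by move=> hI; rewrite /expsum /map_word big_map /=; apply: eq_bigl => l; rewrite (inj_eq hI). Qed.

Lemma expsum_map_word0 (E E' : finType) (h : E -> E') (w : seq (E * bool)) y :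
  (forall e, h e != y) -> expsum (map_word h w) y = 0.
Proof. by move=> hy; rewrite /expsum /map_word big_map /= big_pred0 // => l; apply: negbTE. Qed.

End WordBoundary.

Section Moves.
Local Open Scope classical_set_scope.

Lemma zequiv_iso (V W V' W' : zmodType) (d : {additive V -> W}) (d' : {additive V' -> W'})
    (f : {additive V -> V'}) (g : {additive V' -> V}) (F : {additive W -> W'}) (G : {additive W' -> W}) :
  cancel f g -> cancel g f -> cancel F G -> cancel G F -> (forall x, d' (f x) = F (d x)) -> zequiv d d'.
Proof.
move=> fK gK FK GK h; exists f, g, F, G; split=> // [x|w _|w _].
- by rewrite -[in RHS](gK x) h FK.
- by exists 0 => //; rewrite FK subrr raddf0.
- by exists 0 => //; rewrite GK subrr raddf0.
Qed.

Lemma cell_iso_zequiv (X Y : complex2) : cell_iso X Y -> zequiv (dd2 X) (dd2 Y).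
Proof.
move=> [fv [fe [ff [oe [fo [[_ [[fe' feK fe'K] [ff' ffK ff'K]]] _ _ hat]]]]]].
pose f (c : {ffun face X -> int}) : {ffun face Y -> int} := [ffun y => (-1) ^+ fo (ff' y) * c (ff' y)].
pose F (c : {ffun edge X -> int}) : {ffun edge Y -> int} := [ffun y => (-1) ^+ oe (fe' y) * c (fe' y)].
pose g (c : {ffun face Y -> int}) : {ffun face X -> int} := [ffun y => (-1) ^+ fo y * c (ff y)].
pose G (c : {ffun edge Y -> int}) : {ffun edge X -> int} := [ffun y => (-1) ^+ oe y * c (fe y)].
have fz : zmod_morphism f by move=> x y; apply/ffunP => e; rewrite !ffunE mulrBr.
have Fz : zmod_morphism F by move=> x y; apply/ffunP => e; rewrite !ffunE mulrBr.
have gz : zmod_morphism g by move=> x y; apply/ffunP => e; rewrite !ffunE mulrBr.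
have Gz : zmod_morphism G by move=> x y; apply/ffunP => e; rewrite !ffunE mulrBr.
have sgn (b : bool) : (-1) ^+ b * (-1) ^+ b = 1 :> int by case: b; rewrite ?mulr1 // expr1 mulrNN mulr1.
apply: (zequiv_iso (f := bundle fz) (g := bundle gz) (F := bundle Fz) (G := bundle Gz)) => c; apply/ffunP => y.
- by rewrite !ffunE ffK mulrA sgn mul1r.
- by rewrite !ffunE ff'K mulrA sgn mul1r.
- by rewrite !ffunE feK mulrA sgn mul1r.
- by rewrite !ffunE fe'K mulrA sgn mul1r.
rewrite -[dd2 Y _]/(d2 (f c)) -[bundle Fz _]/(F (d2 c)) d2E ffunE d2E mulr_sumr.
rewrite (reindex ff) /=; last by exists ff' => x _.
apply: eq_bigr => x _; rewrite ffunE ffK hat /=.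
set w := map _ _.
have wE : expsum w y = (-1) ^+ oe (fe' y) * expsum (attach x).2 (fe' y).
  rewrite /w; elim: (attach x).2 => [|l u IH] /=; first by rewrite !expsum_nil mulr0.
  rewrite !expsum_cons IH mulrDr /=; congr (_ + _).
  rewrite -{1}(fe'K y) (can_eq feK); case: eqP => [->|_]; last by rewrite mulr0.
  by rewrite addbC signr_addb.
rewrite (_ : expsum (if fo x then winv w else w) y = (-1) ^+ fo x * expsum w y).
  by rewrite wE mulrACA sgn mul1r mulrCA.
by case: (fo x); rewrite ?expsum_winv ?expr1 ?expr0 ?mul1r ?mulN1r.
Qed.

Lemma expansion1_zequiv (X Y : complex2) : expansion1 X Y -> zequiv (dd2 X) (dd2 Y).
Proof.
move=> [fv [fe [ff [u [[_ [[fe' feK fe'K] [ff' ffK ff'K]]] _ _ hat]]]]].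
have feI : injective (fe \o Some) by move=> a b /= /(can_inj feK) [].
have feN e : (fe \o Some) e != fe None by apply/eqP => /(can_inj feK).
pose f (c : {ffun face X -> int}) : {ffun face Y -> int} := [ffun y => c (ff' y)].
pose F (c : {ffun edge X -> int}) : {ffun edge Y -> int} := [ffun y => if fe' y is Some e then c e else 0].
pose g (c : {ffun face Y -> int}) : {ffun face X -> int} := [ffun x => c (ff x)].
pose G (c : {ffun edge Y -> int}) : {ffun edge X -> int} := [ffun e => c (fe (Some e))].
have fz : zmod_morphism f by move=> x y; apply/ffunP => e; rewrite !ffunE.
have Fz : zmod_morphism F.
  by move=> x y; apply/ffunP => e; rewrite !ffunE; case: (fe' e) => [z|]; rewrite ?ffunE ?subrr.
have gz : zmod_morphism g by move=> x y; apply/ffunP => e; rewrite !ffunE.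
have Gz : zmod_morphism G by move=> x y; apply/ffunP => e; rewrite !ffunE.
have dY (c : {ffun face Y -> int}) y : d2 c y = \sum_x c (ff x) * expsum (map_word (fe \o Some) (attach x).2) y.
  rewrite d2E (reindex ff) /=; last by exists ff' => x _.
  by apply: eq_bigr => x _; rewrite hat.
have dN (c : {ffun face Y -> int}) : d2 c (fe None) = 0.
  by rewrite dY big1 // => x _; rewrite expsum_map_word0 ?mulr0.
have dS (c : {ffun face Y -> int}) e : d2 c (fe (Some e)) = d2 (g c) e.
  by rewrite dY d2E; apply: eq_bigr => x _; rewrite ffunE -[fe _]/((fe \o Some) e) expsum_map_word.
have gfK c : g (f c) = c by apply/ffunP => x; rewrite !ffunE ffK.
exists (bundle fz), (bundle gz), (bundle Fz), (bundle Gz); split.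
- move=> c; apply/ffunP => y; rewrite -[dd2 Y _]/(d2 (f c)) -[bundle Fz _]/(F (d2 c)) [RHS]ffunE -(fe'K y) feK.
  by case: (fe' y) => [e|]; rewrite ?dN // dS gfK.
- move=> c; apply/ffunP => e; rewrite -[dd2 X _]/(d2 (g c)) -[bundle Gz _]/(G (d2 c)) [RHS]ffunE.
  by rewrite dS.
- by split=> c _; [exact: gfK | apply/ffunP => y; rewrite !ffunE ff'K].
- move=> w _; exists 0 => //; rewrite raddf0; apply/esym/eqP; rewrite subr_eq0; apply/eqP/ffunP => e.
  by rewrite !ffunE feK.
- move=> w [k [k0 [c _ dc]]]; exists 0 => //; rewrite raddf0; apply/esym/eqP; rewrite subr_eq0; apply/eqP/ffunP => y.
  rewrite !ffunE -(fe'K y) feK; case: (fe' y) => [e|]; first by rewrite ffunE.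
  have := dN c; rewrite -[d2 c]/(dd2 Y c) dc ffunMnE => /eqP; rewrite mulrn_eq0 eqn0Ngt k0 /= => /eqP //.
Qed.

Lemma expansion2_zequiv (X Y : complex2) : expansion2 X Y -> zequiv (dd2 X) (dd2 Y).
Proof.
move=> [fv [fe [ff [u [u' [w [[_ [[fe' feK fe'K] [ff' ffK ff'K]]] _ _ hat hatN]]]]]]].
have feI : injective (fe \o Some) by move=> a b /= /(can_inj feK) [].
have feN e : (fe \o Some) e != fe None by apply/eqP => /(can_inj feK).
pose f (c : {ffun face X -> int}) : {ffun face Y -> int} := [ffun y => if ff' y is Some x then c x else 0].
pose F (c : {ffun edge X -> int}) : {ffun edge Y -> int} := [ffun y => if fe' y is Some e then c e else 0].
pose g (c : {ffun face Y -> int}) : {ffun face X -> int} := [ffun x => c (ff (Some x))].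
pose G (c : {ffun edge Y -> int}) : {ffun edge X -> int} :=
  [ffun e => c (fe (Some e)) + c (fe None) * expsum w e].
have fz : zmod_morphism f.
  by move=> x y; apply/ffunP => e; rewrite !ffunE; case: (ff' e) => [z|]; rewrite ?ffunE ?subrr.
have Fz : zmod_morphism F.
  by move=> x y; apply/ffunP => e; rewrite !ffunE; case: (fe' e) => [z|]; rewrite ?ffunE ?subrr.
have gz : zmod_morphism g by move=> x y; apply/ffunP => e; rewrite !ffunE.
have Gz : zmod_morphism G.
  by move=> x y; apply/ffunP => e; rewrite !ffunE mulrBl addrACA -opprD.
have dY (c : {ffun face Y -> int}) y : d2 c y =
    c (ff None) * ((if fe None == y then 1 else 0) - expsum (map_word (fe \o Some) w) y) +
    \sum_x c (ff (Some x)) * expsum (map_word (fe \o Some) (attach x).2) y.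
  rewrite d2E (reindex ff) /=; last by exists ff' => x _.
  rewrite big_option /= hatN /= expsum_cons expsum_winv /= expr0; congr (_ + _).
  by apply: eq_bigr => x _; rewrite hat.
have dN (c : {ffun face Y -> int}) : d2 c (fe None) = c (ff None).
  by rewrite dY eqxx expsum_map_word0 // subr0 mulr1 big1 ?addr0 // => x _; rewrite expsum_map_word0 ?mulr0.
have dS (c : {ffun face Y -> int}) e : d2 c (fe (Some e)) = d2 (g c) e - c (ff None) * expsum w e.
  rewrite dY (can_eq feK) /= -[fe _]/((fe \o Some) e) expsum_map_word // sub0r mulrN addrC; congr (_ - _).
  by rewrite d2E; apply: eq_bigr => x _; rewrite ffunE expsum_map_word.
have gfK c : g (f c) = c by apply/ffunP => x; rewrite !ffunE ffK.
exists (bundle fz), (bundle gz), (bundle Fz), (bundle Gz); split.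
- move=> c; apply/ffunP => y; rewrite -[dd2 Y _]/(d2 (f c)) -[bundle Fz _]/(F (d2 c)) [RHS]ffunE -(fe'K y) feK.
  by case: (fe' y) => [e|]; rewrite ?dN ?dS ?gfK [f c _]ffunE ffK // mul0r subr0.
- move=> c; apply/ffunP => e; rewrite -[dd2 X _]/(d2 (g c)) -[bundle Gz _]/(G (d2 c)) [RHS]ffunE.
  by rewrite dS dN subrK.
- split=> c c0; first exact: gfK.
  have cN : c (ff None) = 0 by rewrite -dN -[d2 c]/(dd2 Y c) c0 ffunE.
  by apply/ffunP => y; rewrite !ffunE -(ff'K y) ffK; case: (ff' y) => [x|]; rewrite ?ffunE.
- move=> c _; exists 0 => //; rewrite raddf0; apply/esym/eqP; rewrite subr_eq0; apply/eqP/ffunP => e.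
  by rewrite !ffunE !feK mul0r addr0.
(* The new 2-cell, with the coefficient of the new edge, bounds the difference made by replacing
   that edge by [w]. *)
- move=> c _; pose D : {ffun face Y -> int} := [ffun y => if y == ff None then - c (fe None) else 0].
  have DN : D (ff None) = - c (fe None) by rewrite ffunE eqxx.
  have gD : g D = 0 by apply/ffunP => x; rewrite !ffunE (can_eq ffK).
  exists D => //; apply/ffunP => y.
  rewrite -[dd2 Y _]/(d2 _) -(fe'K y) [RHS]ffunE [(- c) _]ffunE -[bundle Fz _]/(F (G c)) [F _ _]ffunE feK.
  case: (fe' y) => [e|]; last by rewrite dN DN add0r.
  rewrite dS [G c e]ffunE DN gD mulNr opprK [c _ + _]addrC addrK.
  by rewrite -[d2 0]/(dd2 X 0) raddf0 ffunE add0r.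
Qed.

(** The homotopy avoids the 2-cell [f], so the boundary of [f] changes by boundaries of the other
    cells only; the condition [a f = 0] makes the induced change of 2-chains invertible. *)
Lemma loop_homotopic_expsum (X : complex2) (f : face X) l l' : loop_homotopic f l l' ->
  exists2 a : face X -> int, a f = 0 & forall e, expsum l'.2 e = expsum l.2 e + \sum_g a g * expsum (attach g).2 e.
Proof.
elim=> {l l'} [l l' [_ _ []]|l|l l' _ [a af aE]|l1 l2 l3 _ [a af aE] _ [b bf bE]].
- move=> u l0 w; exists (fun=> 0) => [//|e]; rewrite big1 ?addr0 => [|g _]; last by rewrite mul0r.
  by rewrite /= -cats1 expsum_cat !expsum_cons expsum_nil addr0 addrC.
- move=> u w1 l0 w2; exists (fun=> 0) => [//|e]; rewrite big1 ?addr0 => [|g _]; last by rewrite mul0r.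
  rewrite /= !expsum_cat !expsum_cons /=; congr (_ + _); rewrite addrA -[LHS]add0r; congr (_ + _).
  by case: (_ == e); rewrite ?addr0 //; case: (l0.2); rewrite ?expr0 ?expr1 ?addNr ?subrr.
- move=> u w1 g w2 gf; exists (fun h => if h == g then -1 else 0) => [|e]; first by rewrite eq_sym (negbTE gf).
  rewrite (bigD1 g) //= eqxx big1 ?addr0 => [|h /negbTE->]; last by rewrite mul0r.
  by rewrite !expsum_cat /= mulN1r addrCA addrAC subrr add0r.
- by exists (fun=> 0) => [//|e]; rewrite big1 ?addr0 // => g _; rewrite mul0r.
- exists (fun g => - a g) => [|e]; first by rewrite af oppr0.
  rewrite aE -addrA -big_split /= big1 ?addr0 // => g _; by rewrite mulNr subrr.
- exists (fun g => a g + b g) => [|e]; first by rewrite af bf addr0.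
  by rewrite bE aE -addrA -big_split; congr (_ + _); apply: eq_bigr => g _; rewrite mulrDl.
Qed.

Lemma slide_zequiv (X Y : complex2) : slide X Y -> zequiv (dd2 X) (dd2 Y).
Proof.
move=> [fv [fe [ff [s [l [[_ [[fe' feK fe'K] [ff' ffK ff'K]]] _ /loop_homotopic_expsum[a as0 aE] hat]]]]]].
pose f (c : {ffun face X -> int}) : {ffun face Y -> int} := [ffun y => c (ff' y) - c s * a (ff' y)].
pose F (c : {ffun edge X -> int}) : {ffun edge Y -> int} := [ffun y => c (fe' y)].
pose g (c : {ffun face Y -> int}) : {ffun face X -> int} := [ffun x => c (ff x) + c (ff s) * a x].
pose G (c : {ffun edge Y -> int}) : {ffun edge X -> int} := [ffun e => c (fe e)].
have fz : zmod_morphism f.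
  by move=> x y; apply/ffunP => e; rewrite !ffunE; ring.
have Fz : zmod_morphism F by move=> x y; apply/ffunP => e; rewrite !ffunE.
have gz : zmod_morphism g.
  by move=> x y; apply/ffunP => e; rewrite !ffunE; ring.
have Gz : zmod_morphism G by move=> x y; apply/ffunP => e; rewrite !ffunE.
apply: zequiv_sym; apply: (zequiv_iso (f := bundle gz) (g := bundle fz) (F := bundle Gz) (G := bundle Fz)) => c; apply/ffunP => y.
- by rewrite !ffunE ff'K as0; ring.
- by rewrite !ffunE !ffK as0; ring.
- by rewrite !ffunE fe'K.
- by rewrite !ffunE feK.
rewrite -[dd2 X _]/(d2 (g c)) -[bundle Gz _]/(G (d2 c)) [RHS]ffunE !d2E.
rewrite [RHS](reindex ff) /=; last by exists ff' => x _.
rewrite [RHS](bigD1 s) //= hat eqxx /= expsum_map_word; last exact: can_inj feK.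
rewrite aE mulrDr (bigD1 s) //= [g c s]ffunE as0 mulr0 addr0 -addrA; congr (_ + _).
rewrite [in RHS](bigD1 s) //= as0 mul0r add0r mulr_sumr -big_split /=; apply: eq_bigr => x xs.
rewrite ffunE hat (negbTE xs) /= expsum_map_word; last exact: can_inj feK.
by rewrite mulrDl -mulrA addrC.
Qed.

Lemma deformation_zequiv (X Y : complex2) : deformation X Y ->
  [/\ euler_char X = euler_char Y,
      forall r, has_rank (H2 X) r <-> has_rank (H2 Y) r &
      (H1_torsion X #= H1_torsion Y)%card].
Proof.
elim=> {X Y} [X Y step|X|X Y _ [e r t]|X Y Z _ [e1 r1 t1] _ [e2 r2 t2]]; last first.
- split; [by rewrite e1 | by move=> n; split=> [/r1/r2|/r2/r1] | exact: card_eq_trans t1 t2].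
- by split; [rewrite e | move=> n; split=> /r | rewrite card_eq_sym].
- by split.
have zq : zequiv (dd2 X) (dd2 Y).
  case: step => [|[|[|]]];
    [exact: cell_iso_zequiv|exact: expansion1_zequiv|exact: expansion2_zequiv|exact: slide_zequiv].
split; last by rewrite !H1_torsionE; exact: zequiv_torset.
- rewrite /euler_char; case: step => [|[|[|]]].
  + by move=> [fv [fe [ff [_ [_ [[/bij_eq_card-> [/bij_eq_card-> /bij_eq_card->]] _ _ _]]]]]].
  + move=> [fv [fe [ff [_ [[/bij_eq_card<- [/bij_eq_card<- /bij_eq_card->]] _ _ _]]]]].
    by rewrite !card_option; lia.
  + move=> [fv [fe [ff [_ [_ [_ [[/bij_eq_card-> [/bij_eq_card<- /bij_eq_card<-]] _ _ _ _]]]]]]].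
    by rewrite !card_option; lia.
  + by move=> [fv [fe [ff [_ [_ [[/bij_eq_card-> [/bij_eq_card-> /bij_eq_card->]] _ _ _]]]]]].
- by move=> r; rewrite !H2E; split; apply: zequiv_rank => //; exact: zequiv_sym.
Qed.

End Moves.

(** * Homology of a presentation complex *)

Section TorsionCount.
Local Open Scope classical_set_scope.

(** The torsion classes are counted by a complete invariant [h] with values in a finite type. *)
Lemma torset_card (V W : zmodType) (d : {additive V -> W}) (T : finType) (h : W -> T) :
  (forall w, istors d w) -> (forall t, exists w, h w = t) -> (forall w w', range d (w' - w) <-> h w' = h w) ->
  (torset d #= `I_#|T|)%card.
Proof.
move=> dt /choice[s sK] hE.
pose q (i : 'I_#|T|) : set W := [set w' | range d (w' - s (enum_val i))].
have qI : {in [set: 'I_#|T|] &, injective q}.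
  move=> i j _ _ e; apply: enum_val_inj.
  have : q j (s (enum_val i)) by rewrite -e /q /=; apply/hE.
  by move=> /= /hE; rewrite !sK.
suff -> : torset d = [set q x | x in [set: 'I_#|T|]].
  by apply: card_eq_trans (inj_card_eq qI) _; rewrite card_eq_sym; exact: card_II.
apply/seteqP; split=> _ [w _ <-]; last by exists (s (enum_val w)) => //; exact: dt.
exists (enum_rank (h w)) => //; rewrite /q enum_rankK.
by apply/seteqP; split=> w' /= /hE e; apply/hE; rewrite e sK.
Qed.

Lemma resid_subproof (N : nat) (N0 : (0 < N)%N) (x : int) : (`|(x %% N)%Z| < N)%N.
Proof. by have := modz_ge0 x (d := N%:Z); have := ltz_pmod x (d := N%:Z); lia. Qed.

Definition resid (N : nat) (N0 : (0 < N)%N) (x : int) : 'I_N := Ordinal (resid_subproof N0 x).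

Lemma resid_eq (N : nat) (N0 : (0 < N)%N) x y : (resid N0 x = resid N0 y) <-> (N %| x - y)%Z.
Proof.
rewrite -eqz_mod_dvd; split=> [/(congr1 val) /= e|/eqP e]; last by apply/val_inj; rewrite /= e.
have hx := modz_ge0 x (d := N%:Z); have hy := modz_ge0 y (d := N%:Z); apply/eqP; lia.
Qed.

Lemma resid_nat (N : nat) (N0 : (0 < N)%N) (i : 'I_N) : resid N0 i = i.
Proof. by apply/val_inj; rewrite /= modz_nat absz_nat modn_small. Qed.

(** Smith normal form makes the cokernel a product of cyclic groups of orders |e_k|, and the
    residues modulo the e_k are a complete invariant of the classes. *)
Lemma torset_det (n : nat) (A : 'M[int]_n) (d : {additive {ffun 'I_n -> int} -> {ffun 'I_n -> int}}) :
  (forall c k, d c k = \sum_j c j * A j k) -> \det A != 0 -> (torset d #= `I_(`|\det A|%N))%card.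
Proof.
move=> dE detA; pose row (c : {ffun 'I_n -> int}) : 'rV[int]_n := \row_k c k.
have rangeE w : range d w <-> exists x, x *m A = row w.
  split=> [[c _ <-]|[x e]].
    by exists (row c); apply/rowP => k; rewrite !mxE dE; apply: eq_bigr => j _; rewrite !mxE.
  exists [ffun j => x 0 j] => //; apply/ffunP => k; have := congr1 (fun y : 'rV_n => y 0 k) e.
  by rewrite !mxE dE => <-; apply: eq_bigr => j _; rewrite ffunE.
(* The adjugate shows that the determinant annihilates the cokernel, so that every class is
   torsion. *)
have tors w : istors d w.
  exists `|\det A|%N; split; first by rewrite absz_gt0.
  apply/rangeE; exists ((Num.sg (\det A)) *: (row w *m \adj A)).
  rewrite -scalemxAl -mulmxA mul_adj_mx mul_mx_scalar scalerA -normrEsg.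
  by apply/rowP => k; rewrite !mxE ffunMnE -mulr_natl natz abszE.
have [L uL [R uR [s _ AE]]] := int_Smith_normal_form A.
pose e (k : 'I_n) : int := s`_k; pose D : 'rV[int]_n := \row_k e k.
have {}AE : A = L *m diag_mx D *m R.
  rewrite AE; congr (_ *m _ *m _); apply/matrixP => i j; rewrite !mxE.
  by congr (_ *+ _); rewrite -val_eqE.
have du (M : 'M[int]_n) : M \in unitmx -> `|\det M|%N = 1%N.
  move=> uM; apply/eqP; have : (`|\det M| * `|\det (invmx M)|)%N == 1%N.
    by rewrite -abszM -det_mulmx mulmxV // det1.
  by rewrite muln_eq1 => /andP[].
have detE : `|\det A|%N = (\prod_k `|e k|)%N.
  rewrite AE !det_mulmx det_diag !abszM !du // mul1n muln1.
  under eq_bigr do rewrite mxE.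
  by rewrite (big_morph absz abszM (erefl : `|1|%N = 1%N)).
have D0 k : (0 < `|e k|)%N.
  by move: detA; rewrite -absz_gt0 detE (bigD1 k) //= muln_gt0 => /andP[].
pose h (w : {ffun 'I_n -> int}) : {dffun forall k : 'I_n, 'I_(`|e k|)} :=
  [ffun k => resid (D0 k) ((row w *m invmx R) 0 k)].
have cE : `|\det A|%N = #|{dffun forall k : 'I_n, 'I_(`|e k|)}|.
  rewrite card_dep_ffun foldrE big_map big_enum detE /=.
  by apply: eq_bigr => k _; rewrite card_ord.
rewrite cE; apply: (torset_card (h := h)) => // [t|w w'].
  pose x : 'rV[int]_n := \row_k (t k : nat)%:Z.
  exists [ffun k => (x *m R) 0 k]; apply/ffunP => k; rewrite ffunE.
  have -> : row [ffun k => (x *m R) 0 k] = x *m R by apply/rowP => j; rewrite !mxE ffunE mxE.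
  by rewrite mulmxK // mxE resid_nat.
have rB : row (w' - w) = row w' - row w by apply/rowP => k; rewrite !mxE !ffunE.
rewrite rangeE rB; split=> [[x xE]|we].
  apply/ffunP => k; rewrite !ffunE; apply/resid_eq.
  have : (x *m L) *m diag_mx D = row w' *m invmx R - row w *m invmx R.
    by rewrite -mulmxBl -xE AE !mulmxA mulmxK.
  move=> /(congr1 (fun y : 'rV_n => y 0 k)); rewrite mul_mx_diag [RHS]mxE [X in _ + X]mxE => <-.
  by rewrite mxE [D _ _]mxE dvdzE absz_nat -dvdzE dvdz_mull.
have {}we k : (e k %| (row w' *m invmx R) 0%R k - (row w *m invmx R) 0%R k)%Z.
  have := congr1 (fun t : {dffun forall k : 'I_n, 'I_(`|e k|)} => t k) we; rewrite !ffunE => /resid_eq.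
  by rewrite dvdzE absz_nat -dvdzE.
pose y : 'rV[int]_n := \row_k (((row w' *m invmx R) 0%R k - (row w *m invmx R) 0%R k) %/ e k)%Z.
exists (y *m invmx L); rewrite AE !mulmxA mulmxKV //.
suff -> : y *m diag_mx D = (row w' - row w) *m invmx R by rewrite mulmxKV.
by apply/rowP => k; rewrite mul_mx_diag mxE [y _ _]mxE [D _ _]mxE divzK // mulmxBl [RHS]mxE [X in _ = _ + X]mxE.
Qed.

End TorsionCount.

Section PresentationHomology.
Local Open Scope classical_set_scope.

Lemma det_col0 (R : comNzRingType) n (A : 'M[R]_n) (k : 'I_n) : (forall j, A j k = 0) -> \det A = 0.
Proof. by move=> A0; rewrite (expand_det_col _ k) big1 // => i _; rewrite A0 mul0r. Qed.

(** Zero columns complete the matrix to a square one of determinant 0. *)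
Lemma int_kernel (n m : nat) (A : 'I_m -> 'I_n -> int) : (n < m)%N ->
  exists2 c : 'I_m -> int, (exists j, c j != 0) & forall k, \sum_j c j * A j k = 0.
Proof.
move=> nm; pose M : 'M[int]_m := \matrix_(j, k) (if insub (k : nat) is Some k' then A j k' else 0).
have : \det M == 0 by apply/eqP/(det_col0 (k := Ordinal nm)) => j; rewrite mxE insubF //= ltnn.
move=> /det0P[v v0 vM]; exists (fun j => v 0 j); first by apply/rV0Pn.
move=> k; have := congr1 (fun x : 'rV_m => x 0 (widen_ord (ltnW nm) k)) vM; rewrite !mxE => e.
by rewrite -[RHS]e; apply: eq_bigr => j _; rewrite mxE valK.
Qed.

Lemma rank_pos (I : finType) (K : set {ffun I -> int}) (c : {ffun I -> int}) r :
  K c -> c != 0 -> has_rank K r -> (0 < r)%N.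
Proof.
move=> Kc c0 [_ mx]; apply: (mx 1%N (fun=> c)) => // a; rewrite big_ord1 => e i; rewrite ord1.
apply/eqP/negPn/negP => a0; case/eqP: c0; apply/ffunP => j; apply/eqP.
have /eqP := congr1 (fun t : {ffun I -> int} => t j) e.
by rewrite ffunMzE !ffunE mulrz_eq0 (negbTE a0).
Qed.

Lemma rank_witness (I : finType) (K : set {ffun I -> int}) r :
  (0 < r)%N -> has_rank K r -> exists2 c, K c & c != 0.
Proof.
case: r => // r _ [[c [Kc cf]] _]; exists (c ord0) => //; apply/eqP => c0.
have := cf (fun i => (i == ord0)%:Z); rewrite (bigD1 ord0) //= c0 mul0rz add0r big1; last first.
  by move=> i /negbTE->; rewrite mulr0z.
by move=> /(_ (erefl _) ord0).
Qed.

Lemma euler_pres (P : presentation) : euler_char (pres_complex P) = 1 - (pgen P)%:Z + (prel P)%:Z.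
Proof. by rewrite /euler_char /= card_unit !card_ord. Qed.

Lemma d2_pres (P : presentation) c k : d2 (X := pres_complex P) c k = \sum_j c j * expsum (relator j) k.
Proof. by rewrite ffunE. Qed.

Lemma pres_rank_pos (P : presentation) r :
  (pgen P < prel P)%N -> has_rank (H2 (pres_complex P)) r -> (0 < r)%N.
Proof.
move=> nm; have [c [j cj] ck] := int_kernel (fun j k => expsum (relator j) k) nm.
apply: (rank_pos (c := [ffun j => c j])); last by apply: contraNneq cj => /ffunP/(_ j); rewrite !ffunE => ->.
by apply/ffunP => k; rewrite d2_pres [RHS]ffunE -[RHS](ck k); apply: eq_bigr => i _; rewrite ffunE.
Qed.

Section Square.
Variables (n : nat) (rel : 'I_n -> seq ('I_n * bool)).
Let X := pres_complex (Presentation rel).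
Let A : 'M[int]_n := \matrix_(j, k) expsum (rel j) k.

Lemma pres_rank_det r : has_rank (H2 X) r -> (0 < r)%N = (\det A == 0).
Proof.
move=> rk; apply/idP/idP => [r0|/det0P[v v0 vA]].
  have [c Kc c0] := rank_witness r0 rk.
  apply/det0P; exists (\row_j c j).
    by apply: contraNneq c0 => /rowP c0; apply/eqP/ffunP => j; have := c0 j; rewrite !mxE ffunE.
  apply/rowP => k; have := d2_pres (P := Presentation rel) c k.
  rewrite (Kc : d2 c = 0) ffunE => e; rewrite [RHS]mxE e mxE.
  by apply: eq_bigr => j _; rewrite !mxE.
apply: (rank_pos (c := [ffun j => v 0 j]) _ _ rk).
  apply/ffunP => k; rewrite d2_pres [RHS]ffunE; have /rowP/(_ k) := vA; rewrite !mxE => e.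
  by rewrite -[RHS]e; apply: eq_bigr => j _; rewrite ffunE mxE.
apply: contraNneq v0 => /ffunP v0; apply/eqP/rowP => j; have := v0 j; by rewrite !mxE !ffunE.
Qed.

Lemma pres_torsion_det : \det A != 0 -> (H1_torsion X #= `I_(`|\det A|%N))%card.
Proof.
move=> detA; rewrite H1_torsionE; apply: torset_det => // c k.
rewrite (d2_pres (P := Presentation rel) c k : dd2 X c k = _).
by apply: eq_bigr => j _; rewrite mxE.
Qed.

End Square.

End PresentationHomology.

Lemma emx_det p n (rel : 'I_n -> seq ('I_n * bool)) :
  \det (emx p rel) = (\det (\matrix_(j, k) expsum (rel j) k))%:~R.
Proof. by rewrite -det_map_mx; congr (\det _); apply/matrixP => j k; rewrite !mxE. Qed.

(** The homology knows the determinant only up to sign, which the even exponent p - 3 ignores. *)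
Lemma intr_absz_sqr (R : pzRingType) (z : int) : (z%:~R : R) ^+ 2 = `|z|%N%:R ^+ 2.
Proof. by case: z => n //; rewrite NegzE rmorphN sqrrN /= -pmulrn. Qed.

Lemma pres_ZQ_square p (p_pr : prime p) (p_ge5 : (5 <= p)%N) n (rel : 'I_n -> seq ('I_n * bool)) b2 t1 :
  has_rank (H2 (pres_complex (Presentation rel))) b2 ->
  (H1_torsion (pres_complex (Presentation rel)) #= `I_t1)%card ->
  pres_ZQ (Presentation rel) (if (0 < b2)%N || (p %| t1)%N then 0 else t1%:R ^- 2 : 'F_p).
Proof.
move=> rk t1P; have := pres_ZQ_eq p_pr p_ge5 rel; rewrite emx_det exprM intr_absz_sqr.
have sgt0 := sp_gt0 p_pr p_ge5; have sE := spE p_pr p_ge5.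
rewrite (pres_rank_det rk); set D := \det _; have [D0|D0] /= := eqVneq D 0.
  by rewrite D0 expr0n mulr0n expr0n /= eqn0Ngt sgt0.
have tD := card_eq_trans (etrans (card_eq_sym _ _) (pres_torsion_det D0)) t1P.
have {tD}/card_eq_II <- := tD.
rewrite -exprM (dvdn_pcharf (pchar_Fp p_pr)); set t : 'F_p := _%:R; have [->|t0] := eqVneq t 0.
  by rewrite expr0n muln_eq0 [sp p == _]eqn0Ngt sgt0.
(* By Fermat t^p = t, so t^(p-3) is the inverse of t^2. *)
suff -> : t ^+ (2 * sp p) = t ^- 2 by [].
apply: (mulIf (expf_neq0 2 t0)); rewrite mulVf ?expf_neq0 // -exprD.
apply: (mulIf t0); rewrite mul1r -exprSr -[RHS]expf_card card_Fp //.
by congr (_ ^+ _); rewrite [RHS]sE; lia.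
Qed.

Theorem proposition1p3 (p : nat) (p_prime : prime p) (p_ge5 : (5 <= p)%N)
    (X : complex2) (X_connected : connected2 X) (X_chi : 1 <= euler_char X)
    (b2 t1 : nat) (b2P : has_rank (H2 X) b2) (t1P : (H1_torsion X #= `I_t1)%card) :
  is_ZQ X (if (0 < b2)%N || (p %| t1)%N then 0 else t1%:R ^- 2 : 'F_p).
Proof.
move=> P /deformation_zequiv[chiE /(_ b2)[/(_ b2P) rk _] tE].
(* The Euler characteristic of the presentation complex is 1 - n + m, so the assumption gives at
   least as many relators as generators. *)
have nm : (pgen P <= prel P)%N by move: X_chi; rewrite chiE euler_pres; lia.
have [lt|ge] := ltnP (pgen P) (prel P).
  (* With more relators than generators there is a nonzero 2-cycle, so both sides are 0. *)
  by rewrite (pres_rank_pos lt rk); exact: pres_ZQ_lt.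
rewrite card_eq_sym in tE; have {t1P tE}t1P := card_eq_trans tE t1P.
have nmE : prel P = pgen P by apply/eqP; rewrite eqn_leq ge.
case: P nmE rk t1P {chiE nm ge} => n m rel /= nmE; subst m.
exact: pres_ZQ_square.
Qed.
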